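(* Let $\mathbb K$ be an algebraically closed field of characteristic $p\neq 2$. Let $\mathfrak g=\mathfrak{ag}(2)$ over $\mathbb K$ be given by its first Cartan matrix $$A=\begin{pmatrix}0&1&0\\-1&2&-3\\0&-1&2\end{pmatrix}$$ and equipped with the $\mathbb Z$-grading $r=(1,0,0)$, so that $\mathfrak g=\bigoplus_{|i|\le 2}\mathfrak g_i$. Let $\mathfrak g_-=\mathfrak g_{-2}\oplus\mathfrak g_{-1}$. (1) If $p=0$ or $p>3$, the Cartan--Tanaka--Shchepochkina (CTS) prolong $(\mathfrak g_-,\mathfrak g_0)_{*}$ (for $p>3$: $(\mathfrak g_-,\mathfrak g_0)_{*,N}$ for every integer $N\ge 1$) is isomorphic to $\mathfrak{ag}(2)$. (2) If $p=3$, let $\widetilde{\mathfrak g}_0=\mathfrak{psl}(3)\oplus\mathfrak z\subset\mathfrak g_0$ be the subalgebra described in the context. Then: (a) for every integer $N\ge 1$, the CTS prolong $\mathrm{Bj}(1;N|7):=(\mathfrak g_-,\widetilde{\mathfrak g}_0)_{*,N}$ is a simple Lie superalgebra; (b) the degree-$1$ component of $\mathrm{Bj}(1;N|7)$ is, as a $\widetilde{\mathfrak g}_0$-module, the direct sum of an irreducible submodule of superdimension $0|1$ and an irreducible submodule $\mathfrak g_1''$ of superdimension $0|7$; the partial CTS prolong $\mathrm{bj}:=(\mathfrak g_-,\widetilde{\mathfrak g}_0,\mathfrak g_1'')_*$ is a simple Lie superalgebra, and it is exceptional, in the sense that it does not depend on $N$.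
   Context: **The Lie superalgebra $\mathfrak{ag}(2)$.** Over $\mathbb C$, $\mathfrak{ag}(2)$ is the simple exceptional Lie superalgebra $\mathfrak g(A)$ of superdimension $17|14$. It has Chevalley generators $E_i^\pm$ and $H_i$ ($i=1,2,3$), where $E_1^\pm$ are odd and $E_2^\pm,E_3^\pm$ are even. The relations are $[E_i^+,E_j^-]=\delta_{ij}H_i$, $[H_i,H_j]=0$, $[H_i,E_j^\pm]=\pm a_{ij}E_j^\pm$, together with the generators of the maximal ideal having zero intersection with $\mathrm{Span}(H_i)$. It has a basis with integer structure constants. Over $\mathbb K$, $\mathfrak{ag}(2)$ denotes the algebra obtained from this integer form by reducing the structure constants to $\mathbb K$. The grading $r=(1,0,0)$ is defined by $\deg E_1^\pm=\pm1$, $\deg E_2^\pm=\deg E_3^\pm=0$. In this grading $\mathfrak g_0=\mathfrak g(2)\oplus\mathfrak z$, where $\mathfrak g(2)$ is the (reduction to $\mathbb K$ of the) 14-dimensional exceptional Lie algebra $G_2$ and $\mathfrak z$ is the 1-dimensional center of $\mathfrak g_0$. The center acts on $\mathfrak g_i$ as a multiple of the grading operator $x\mapsto i\,x$. Further, $\mathfrak g_{-1}$ is purely odd of superdimension $0|7$ (the 7-dimensional fundamental $\mathfrak g(2)$-module), $\mathfrak g_{-2}$ is even of dimension $1$, and $[x,y]=B(x,y)z$ for $x,y\in\mathfrak g_{-1}$, where $\mathfrak g_{-2}=\mathbb K z$ and $B$ is a nondegenerate $\mathfrak g(2)$-invariant symmetric bilinear form. **Explicit description for $p=3$.** The space $\mathfrak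 g_{-1}$ has a basis of odd vectors $u,v_1,v_3,v_4,w_1,w_3,w_4$ with $B(v_i,w_i)=B(w_i,v_i)=1$, $B(u,u)=1$, and all other values zero ($B$ being determined up to a nonzero scalar factor). For $a,b\in\mathfrak g_{-1}$ let $R_{a,b}(c)=B(b,c)a-B(a,c)b$. These operators act on $\mathfrak g_-$ by degree-preserving derivations that vanish on $\mathfrak g_{-2}$. Inside $\mathfrak g(2)$ one has the elements $$X_1^+=-R_{v_4,w_3}-R_{u,v_1},\quad X_2^+=R_{v_3,w_1},\quad X_1^-=-R_{v_3,w_4}-R_{u,w_1},\quad X_2^-=R_{v_1,w_3}.$$ Put $X_3^\pm=[X_1^\pm,X_2^\pm]$, $X_4^\pm=[X_1^\pm,X_3^\pm]$, $H_1=[X_1^+,X_1^-]$. The span of $X_1^\pm,X_3^\pm,X_4^\pm,H_1$ is a 7-dimensional simple Lie algebra isomorphic to $\mathfrak{psl}(3)$, generated by $X_1^\pm$ and $X_3^\pm$. Set $\widetilde{\mathfrak g}_0=\mathfrak{psl}(3)\oplus\mathfrak z$, where $\mathfrak z$ is spanned by the grading derivation (acting as $-1$ on $\mathfrak g_{-1}$ and $-2$ on $\mathfrak g_{-2}$). **Divided powers and vector fields.** For $p>0$ and an integer $N\ge1$, let $\mathcal O(1;N|7)$ be the supercommutative algebra over $\mathbb K$ with basis $t^{(r)}\xi_{a_1}\cdots\xi_{a_s}$, $0\le r<p^N$, $1\le a_1<\dots<a_s\le 7$. Here the $\xi_a$ are odd generators of a Grassmann algebra, and $t^{(r)}t^{(s)}=\binom{r+s}{r}t^{(r+s)}$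 (zero when $r+s\ge p^N$). Let $\mathfrak{vect}(1;N|7)$ be the Lie superalgebra of special derivations $f\partial_t+\sum_a f_a\partial_{\xi_a}$ with $f,f_a\in\mathcal O(1;N|7)$, where $\partial_t t^{(r)}=t^{(r-1)}$ and $\partial_{\xi_a}\xi_b=\delta_{ab}$. It is graded by $\deg t^{(r)}=2r$, $\deg\xi_a=1$. For $p=0$ one uses ordinary polynomials in $t$ and there is no parameter $N$. **CTS prolong.** Choose a basis $e_1,\dots,e_7$ of $\mathfrak g_{-1}$ and put $B_{ab}=B(e_a,e_b)$. Embed $\mathfrak g_-$ into the graded algebra of vector fields by $z\mapsto\partial_t$, $e_a\mapsto\partial_{\xi_a}+\tfrac12\sum_b B_{ab}\xi_b\partial_t$. Let $\mathfrak h_0$ be a Lie algebra of degree-preserving derivations of $\mathfrak g_-$ (here $\mathfrak h_0=\mathfrak g_0$ or $\widetilde{\mathfrak g}_0$). It embeds uniquely into the vector fields of degree $0$ so that brackets with $\mathfrak g_-$ are the given action. The CTS prolong $(\mathfrak g_-,\mathfrak h_0)_{*,N}=\bigoplus_{k\ge-2}\mathfrak h_k$ (written $(\mathfrak g_-,\mathfrak h_0)_*$ when $p=0$) is the maximal graded subalgebra of the algebra of vector fields with the given non-positive part. That is, $\mathfrak h_{k}=\mathfrak g_k$ for $k=-1,-2$, and for $k\ge1$, $\mathfrak h_k$ is the set of vector fields $D$ of degree $k$ with $[D,\mathfrak g_{-1}]\subset\mathfrak h_{k-1}$. **Partial CTS prolong.** Given an $\mathfrak h_0$-submodule $\mathfrak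 m\subset\mathfrak h_1$, the partial prolong $(\mathfrak g_-,\mathfrak h_0,\mathfrak m)_*$ is $\mathfrak g_-\oplus\mathfrak h_0\oplus\mathfrak m\oplus\bigoplus_{k\ge2}\mathfrak m_k$, where $\mathfrak m_1=\mathfrak m$ and $\mathfrak m_k=\{D\in\mathfrak h_k\mid[D,\mathfrak g_{-1}]\subset\mathfrak m_{k-1}\}$ for $k\ge2$. *)

(* Defs.v *)
From HB Require Import structures.
From mathcomp Require Import all_boot all_order all_algebra.
From mathcomp Require Import reals.
From mathcomp Require Import complex.
Set Implicit Arguments.
Unset Strict Implicit.
Unset Printing Implicit Defensive.
Import Order.TTheory GRing.Theory Num.Theory.
Local Open Scope ring_scope.

Section LinearAlgebra.
Variables (F : fieldType) (V : lmodType F).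

Definition subspace (U : V -> Prop) : Prop :=
  U 0 /\ forall (a : F) x y, U x -> U y -> U (a *: x + y).

Definition span_of n (b : 'I_n -> V) (x : V) : Prop :=
  exists a : 'I_n -> F, x = \sum_i a i *: b i.

Definition lin_indep n (b : 'I_n -> V) : Prop :=
  forall a : 'I_n -> F, \sum_i a i *: b i = 0 -> forall i, a i = 0.

Definition is_basis (U : V -> Prop) n (b : 'I_n -> V) : Prop :=
  (forall x, U x <-> span_of b x) /\ lin_indep b.

End LinearAlgebra.

(* A vector space with an even part [par false], an odd part [par true] and a
   product.  No law is built in: [is_lie_superalgebra] below states the axioms
   for a subset of the carrier, so that subalgebras are predicates. *)
Record superAlg (F : fieldType) := SuperAlg {
  sa_car :> lmodType F;
  par : bool -> sa_car -> Prop;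
  br : sa_car -> sa_car -> sa_car
}.

Section LieSuperalgebras.
Variables (F : fieldType) (V : superAlg F).
Implicit Types (U I W : V -> Prop).

Definition full : V -> Prop := fun _ => True.

Definition subsuperspace U : Prop :=
  subspace U /\
  forall x, U x -> exists x0 x1,
    [/\ U x0, U x1, par false x0, par true x1 & x = x0 + x1].

(* [lie_odd_cube] follows from the Jacobi identity unless the characteristic
   is 3.  In characteristic 2 further structure (a squaring) is needed. *)
Record is_lie_superalgebra U : Prop := IsLieSuperalgebra {
  lie_par : forall s, subspace (par (s := V) s);
  lie_par_disj : forall x : V, par false x -> par true x -> x = 0;
  lie_sub : subsuperspace U;
  lie_closed : forall x y, U x -> U y -> U (br x y);
  lie_linl : forall (a : F) x y w, U x -> U y -> U w ->
    br (a *: x + y) w = a *: br x w + br y w;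
  lie_linr : forall (a : F) x y w, U x -> U y -> U w ->
    br w (a *: x + y) = a *: br w x + br w y;
  lie_br_par : forall s t x y, U x -> U y -> par s x -> par t y ->
    par (s (+) t) (br x y);
  lie_skew : forall s t x y, U x -> U y -> par s x -> par t y ->
    br x y = - ((-1) ^+ (s && t) *: br y x);
  lie_jacobi : forall s t x y w, U x -> U y -> U w -> par s x -> par t y ->
    br x (br y w) = br (br x y) w + (-1) ^+ (s && t) *: br y (br x w);
  lie_odd_cube : forall x, U x -> par true x -> br x (br x x) = 0
}.

(* [W] is a sub-superspace stable under the bracket with [U]. *)
Definition submodule U W : Prop :=
  subsuperspace W /\ forall x y, U x -> W y -> W (br x y).

Definition irreducible U W : Prop :=
  [/\ submodule U W,
      exists x, W x /\ x <> 0 &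
      forall W', submodule U W' -> (forall x, W' x -> W x) ->
        (forall x, W' x -> x = 0) \/ (forall x, W x -> W' x)].

Definition ideal U I : Prop :=
  (forall x, I x -> U x) /\ submodule U I.

Definition is_simple U : Prop :=
  [/\ is_lie_superalgebra U,
      exists x y, [/\ U x, U y & br x y <> 0] &
      forall I, ideal U I ->
        (forall x, I x -> x = 0) \/ (forall x, U x -> I x)].

Definition superdim U (m n : nat) : Prop :=
  [/\ subsuperspace U,
      exists b : 'I_m -> V, is_basis (fun x => U x /\ par false x) b &
      exists b : 'I_n -> V, is_basis (fun x => U x /\ par true x) b].

Definition direct_sum U W1 W2 : Prop :=
  (forall x, U x <-> exists x1 x2, [/\ W1 x1, W2 x2 & x = x1 + x2]) /\
  (forall x, W1 x -> W2 x -> x = 0).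

End LieSuperalgebras.

Record is_iso (F : fieldType) (V V' : superAlg F)
    (U : V -> Prop) (U' : V' -> Prop) (f : V -> V') : Prop := IsIso {
  iso_lin : forall (a : F) x y, U x -> U y -> f (a *: x + y) = a *: f x + f y;
  iso_par : forall s x, U x -> par s x -> par s (f x);
  iso_br : forall x y, U x -> U y -> f (br x y) = br (f x) (f y);
  iso_inj : forall x y, U x -> U y -> f x = f y -> x = y;
  iso_im : forall y, U' y <-> exists2 x, U x & f x = y
}.

Definition isomorphic (F : fieldType) (V V' : superAlg F)
    (U : V -> Prop) (U' : V' -> Prop) : Prop :=
  exists f : V -> V', is_iso U U' f.

Section CartanMatrix.
Variables (F : fieldType) (n : nat) (A : 'M[int]_n) (odd_node : 'I_n -> bool).
Variables (L : superAlg F) (Ep Em H : 'I_n -> L).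

(* [L] is g(A), for a nondegenerate matrix A: the quotient of the Lie
   superalgebra with generators E_i^+, E_i^-, H_i and relations [gA_EE] to
   [gA_HEm] by its maximal ideal meeting Span(H_i) in zero.  That [L] is this
   quotient is expressed by [gA_gen], [gA_indep] and [gA_max]. *)
Record is_gA : Prop := IsGA {
  gA_lie : is_lie_superalgebra (full (V := L));
  gA_parEp : forall i, par (odd_node i) (Ep i);
  gA_parEm : forall i, par (odd_node i) (Em i);
  gA_parH : forall i, par false (H i);
  gA_EE : forall i j, br (Ep i) (Em j) = if i == j then H i else 0;
  gA_HH : forall i j, br (H i) (H j) = 0;
  gA_HEp : forall i j, br (H i) (Ep j) = (A i j)%:~R *: Ep j;
  gA_HEm : forall i j, br (H i) (Em j) = - ((A i j)%:~R *: Em j);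
  gA_gen : forall U : L -> Prop, subspace U ->
    (forall x y, U x -> U y -> U (br x y)) ->
    (forall i, [/\ U (Ep i), U (Em i) & U (H i)]) -> forall x, U x;
  gA_indep : lin_indep H;
  gA_max : forall I : L -> Prop, ideal (full (V := L)) I ->
    (forall x, I x -> span_of H x -> x = 0) -> forall x, I x -> x = 0
}.

(* The Z-grading of g(A) with deg E_i^+ = r i and deg E_i^- = - r i. *)
Inductive rgrade (r : 'I_n -> int) : int -> L -> Prop :=
| rgrade_Ep i : rgrade r (r i) (Ep i)
| rgrade_Em i : rgrade r (- r i) (Em i)
| rgrade_H i : rgrade r 0 (H i)
| rgrade_0 k : rgrade r k 0
| rgrade_lin k (a : F) x y :
    rgrade r k x -> rgrade r k y -> rgrade r k (a *: x + y)
| rgrade_br k l x y :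
    rgrade r k x -> rgrade r l y -> rgrade r (k + l) (br x y).

(* Chevalley's integer form: the smallest subgroup containing the generators
   and closed under the bracket and under the divided powers
   (ad E_i^+)^k / k! and (ad E_i^-)^k / k! for the even nodes i. *)
Inductive zform : L -> Prop :=
| zform_Ep i : zform (Ep i)
| zform_Em i : zform (Em i)
| zform_H i : zform (H i)
| zform_0 : zform 0
| zform_sub x y : zform x -> zform y -> zform (x - y)
| zform_br x y : zform x -> zform y -> zform (br x y)
| zform_divp i k x y : ~~ odd_node i -> zform x ->
    k`!%:R *: y = iter k (br (Ep i)) x -> zform y
| zform_divm i k x y : ~~ odd_node i -> zform x ->
    k`!%:R *: y = iter k (br (Em i)) x -> zform y.

(* [b] is a basis of [L], and a Z-basis of the integer form, homogeneous for
   the parity (given by [q]) and for the grading [r] (degrees [d]), with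
   integer structure constants [c]. *)
Record is_integral_basis (r : 'I_n -> int) m (b : 'I_m -> L)
    (q : 'I_m -> bool) (d : 'I_m -> int) (c : 'I_m -> 'I_m -> 'I_m -> int)
    : Prop := IsIntegralBasis {
  ib_basis : is_basis (full (V := L)) b;
  ib_zform : forall x, zform x <->
    exists a : 'I_m -> int, x = \sum_i (a i)%:~R *: b i;
  ib_par : forall i, par (q i) (b i);
  ib_deg : forall i, rgrade r (d i) (b i);
  ib_br : forall i j, br (b i) (b j) = \sum_k (c i j k)%:~R *: b k
}.

End CartanMatrix.

Definition ag2_cartan : 'M[int]_3 :=
  \matrix_(i < 3, j < 3)
    nth 0 (nth [::] [:: [:: 0; 1; 0]; [:: -1; 2; -3]; [:: 0; -1; 2]] i) j.

Definition ag2_odd (i : 'I_3) : bool := i == ord0.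

Definition ag2_r (i : 'I_3) : int := (i == ord0)%:R.

Section Reduction.
Variables (K : fieldType) (m : nat) (q : 'I_m -> bool) (d : 'I_m -> int).
Variable (c : 'I_m -> 'I_m -> 'I_m -> int).

Definition reduction : superAlg K :=
  @SuperAlg K 'rV[K]_m
    (fun s x => forall i, x 0 i != 0 -> q i = s)
    (fun x y => \row_k \sum_i \sum_j (c i j k)%:~R * x 0 i * y 0 j).

Definition red_deg (k : int) (x : reduction) : Prop :=
  forall i, (x : 'rV[K]_m) 0 i != 0 -> d i = k.

(* [z] and [e] are bases of the components of degree -2 and -1, and [B] is the
   Gram matrix of the bracket on the latter. *)
Record is_frame (z : reduction) (e : 'I_7 -> reduction) (B : 'M[K]_7)
    : Prop := IsFrame {
  frame_z : is_basis (red_deg (-2)) (fun _ : 'I_1 => z);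
  frame_e : is_basis (red_deg (-1)) e;
  frame_B : forall a b, br (e a) (e b) = B a b *: z
}.

End Reduction.

(* The algebra of functions of the even variable t: its product, the derivative
   with respect to t, and the coefficient of t^r, resp. of t^(r). *)
Record tAlg (K : fieldType) := TAlg {
  t_car :> lmodType K;
  t_one : t_car;
  t_mul : t_car -> t_car -> t_car;
  t_der : t_car -> t_car;
  t_coef : nat -> t_car -> K
}.

Definition poly_tAlg (K : fieldType) : tAlg K :=
  @TAlg K {poly K} 1 (fun f g => f * g) (fun f => f^`()) (fun r f => f`_r).

(* The divided powers t^(r) with r < h, where h = p ^ N. *)
Section DividedPowers.
Variables (K : fieldType) (h : nat).

Definition dp_coef (r : nat) (f : 'rV[K]_h) : K :=
  oapp (fun k : 'I_h => f 0 k) 0 (insub r).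

Definition dp_tAlg : tAlg K :=
  @TAlg K 'rV[K]_h
    (\row_(k < h) (k == 0%N :> nat)%:R)
    (fun f g => \row_(k < h) \sum_(i < h) \sum_(j < h | (i + j)%N == k)
       'C(i + j, i)%:R * f 0 i * g 0 j)
    (fun f => \row_(k < h) dp_coef k.+1 f)
    dp_coef.

End DividedPowers.

Section VectorFields.
Variables (K : fieldType) (T : tAlg K).

(* [f S] is the coefficient of the product of the xi_a, a in S, taken in
   increasing order. *)
Definition O := {ffun {set 'I_7} -> T}.

(* The number of transpositions needed to sort xi_S xi_S'. *)
Definition inversions (S S' : {set 'I_7}) : nat :=
  #|[set ab : 'I_7 * 'I_7 | [&& ab.1 \in S, ab.2 \in S' & (ab.2 < ab.1)%N]]|.

Definition o_mul (f g : O) : O :=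
  [ffun S : {set 'I_7} => \sum_(S' : {set 'I_7} | S' \subset S)
    (-1) ^+ inversions S' (S :\: S') *: t_mul (f S') (g (S :\: S'))].

Definition o_one : O := [ffun S : {set 'I_7} => if S == set0 then t_one T else 0].

Definition o_xi (a : 'I_7) : O :=
  [ffun S : {set 'I_7} => if S == [set a] then t_one T else 0].

(* The index [None] stands for t, and [Some a] for xi_a. *)
Definition o_der (i : option 'I_7) (f : O) : O :=
  match i with
  | None => [ffun S => t_der (f S)]
  | Some a => [ffun S : {set 'I_7} =>
      if a \in S then 0
      else (-1) ^+ #|[set b in S | (b < a)%N]| *: f (a |: S)]
  end.

(* The field with coefficients D is D None d_t + \sum_a D (Some a) d_{xi_a}. *)
Definition vect := {ffun option 'I_7 -> O}.

Definition v_parity (i : option 'I_7) (S : {set 'I_7}) : bool :=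
  odd #|S| (+) isSome i.

Definition v_part (s : bool) (D : vect) : vect :=
  [ffun i => [ffun S => if v_parity i S == s then D i S else 0]].

Definition v_act (D : vect) (f : O) : O := \sum_i o_mul (D i) (o_der i f).

Definition v_br (D D' : vect) : vect :=
  \sum_(s : bool) \sum_(s' : bool)
    [ffun i => v_act (v_part s D) (v_part s' D' i)
               - (-1) ^+ (s && s') *: v_act (v_part s' D') (v_part s D i)].

Definition vect_alg : superAlg K :=
  @SuperAlg K vect
    (fun s D => forall i S, D i S != 0 -> v_parity i S = s)
    v_br.

Definition v_deg (k : int) (D : vect) : Prop :=
  forall i S r, t_coef r (D i S) != 0 ->
    (2 * r + #|S|)%:Z - (if i is Some _ then 1 else 2) = k.

Definition v_dt : vect := [ffun i => if i is None then o_one else 0].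

Definition v_e (B : 'M[K]_7) (a : 'I_7) : vect :=
  [ffun i => match i with
             | None => \sum_b (B a b / 2%:R) *: o_xi b
             | Some b => if b == a then o_one else 0
             end].

End VectorFields.

Section Prolong.
Variables (K : fieldType) (T : tAlg K).
Variables (g : superAlg K) (z : g) (e : 'I_7 -> g) (B : 'M[K]_7).
(* the subalgebra of the degree-0 component of [g] to be prolonged *)
Variable (s : g -> Prop).

Definition h_m2 : vect_alg T -> Prop := span_of (fun _ : 'I_1 => v_dt T).
Definition h_m1 : vect_alg T -> Prop := span_of (v_e T B).

(* The fields of degree 0 whose brackets with the images of [z] and [e] are
   given by the adjoint action of an element [x] of [s]. *)
Definition h_0 (D : vect_alg T) : Prop :=
  v_deg 0 D /\
  exists (x : g) (l : K) (M : 'M[K]_7),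
    [/\ s x, br x z = l *: z, forall a, br x (e a) = \sum_b M b a *: e b,
        v_br D (v_dt T) = l *: v_dt T &
        forall a, v_br D (v_e T B a) = \sum_b M b a *: v_e T B b].

Fixpoint h_comp (k : nat) (D : vect_alg T) : Prop :=
  match k with
  | 0 => h_0 D
  | k'.+1 => v_deg k D /\ forall y, h_m1 y -> h_comp k' (br D y)
  end.

Fixpoint m_comp (m1 : vect_alg T -> Prop) (k : nat) (D : vect_alg T) : Prop :=
  match k with
  | 0 => h_0 D
  | 1 => m1 D
  | k'.+1 => h_comp k D /\ forall y, h_m1 y -> m_comp m1 k' (br D y)
  end.

Definition with_negative_part (h : nat -> vect_alg T -> Prop)
    (D : vect_alg T) : Prop :=
  exists (D2 D1 : vect_alg T) (n : nat) (D' : 'I_n -> vect_alg T),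
    [/\ h_m2 D2, h_m1 D1, forall k : 'I_n, h k (D' k) &
        D = D2 + D1 + \sum_k D' k].

Definition cts_prolong : vect_alg T -> Prop := with_negative_part h_comp.

Definition partial_prolong (m1 : vect_alg T -> Prop) : vect_alg T -> Prop :=
  with_negative_part (m_comp m1).

(* The degree-1 component is the direct sum of [m'] and [m'']. *)
Definition degree1_splits (m' m'' : vect_alg T -> Prop) : Prop :=
  [/\ direct_sum (h_comp 1) m' m'',
      irreducible h_0 m', superdim m' 0 1,
      irreducible h_0 m'' & superdim m'' 0 7].

End Prolong.

(* The natural embedding, t^(r) to t^(r), of the vector fields over divided
   powers of height h into those of height h', when h <= h'. *)
Definition v_incl (K : fieldType) (h h' : nat)
    (D : vect_alg (dp_tAlg K h)) : vect_alg (dp_tAlg K h') :=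
  [ffun i => [ffun S => \row_(r < h') dp_coef r (D i S)]].

Section CharacteristicThree.
Variable (K : fieldType).

(* The basis of g_{-1} is ordered as u, v_1, v_3, v_4, w_1, w_3, w_4. *)
Definition iu : 'I_7 := inord 0.
Definition iv1 : 'I_7 := inord 1.
Definition iv3 : 'I_7 := inord 2.
Definition iv4 : 'I_7 := inord 3.
Definition iw1 : 'I_7 := inord 4.
Definition iw3 : 'I_7 := inord 5.
Definition iw4 : 'I_7 := inord 6.

Definition gram3 : 'M[K]_7 :=
  \matrix_(a, b) ([|| (a == iu) && (b == iu),
    (a, b) \in [:: (iv1, iw1); (iv3, iw3); (iv4, iw4)] |
    (b, a) \in [:: (iv1, iw1); (iv3, iw3); (iv4, iw4)]])%:R.

Variables (g : superAlg K) (z : g) (e : 'I_7 -> g).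

(* The value of R_{e_a, e_b} on the basis vector e_k. *)
Definition R_op (a b k : 'I_7) : g :=
  gram3 b k *: e a - gram3 a k *: e b.

Definition acts_as (x : g) (M : 'I_7 -> g) : Prop :=
  br x z = 0 /\ forall k, br x (e k) = M k.

Record is_g0_tilde (g0 : g -> Prop) (X1p X2p X1m X2m Z : g) : Prop :=
  IsG0Tilde {
  g0t_in : [/\ g0 X1p, g0 X2p, g0 X1m, g0 X2m & g0 Z];
  g0t_X1p : acts_as X1p (fun k => - R_op iv4 iw3 k - R_op iu iv1 k);
  g0t_X2p : acts_as X2p (R_op iv3 iw1);
  g0t_X1m : acts_as X1m (fun k => - R_op iv3 iw4 k - R_op iu iw1 k);
  g0t_X2m : acts_as X2m (R_op iv1 iw3);
  g0t_Z : br Z z = - (2%:R *: z) /\ forall k, br Z (e k) = - e k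
}.

Definition g0_tilde (X1p X2p X1m X2m Z : g) : g -> Prop :=
  let X3p := br X1p X2p in let X3m := br X1m X2m in
  let X4p := br X1p X3p in let X4m := br X1m X3m in
  let H1 := br X1p X1m in
  span_of (fun i : 'I_8 =>
    nth 0 [:: X1p; X1m; X3p; X3m; X4p; X4m; H1; Z] i).

End CharacteristicThree.

(* Submission.v *)
(* A field of degree k in the prolong is determined by a contact potential: the
   two commuting frames [ee (+- 1/2) a] on functions identify the fields that
   commute suitably with g_- with functions f, and the field with potential f
   lies in the prolong of h_0 iff iterated frame derivatives of f lead back to
   the potentials of h_0.

   Characteristic 3: the potentials of each degree k form an explicit
   8-dimensional space, the levels in t of four families A, B_i, C_i, W of
   elements of the Grassmann algebra.  That these families exhaust the prolong
   is linear algebra over the integers with pivots prime to 3; the ideal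
   generated by any nonzero element is found by differentiating it down to
   g_{-1}.  The submodule g_1'' is spanned by the B_i, and the prolong it
   generates stops in degree 2, whence its independence of N.

   Other characteristics: if H^1(g_-; g) vanishes in nonnegative degrees, the
   prolong of g_0 is g itself.  This vanishing is checked on the table [brT] of
   integer structure constants, with pivots dividing a power of 6.  The table
   describes the reduction of ag(2) for every integral basis of Chevalley's
   form: in the product of g(A) and the algebra of the table over the complex
   numbers, the subalgebra generated by the pairs of corresponding Chevalley
   generators is the graph of an isomorphism, since by triangular decomposition
   its intersections with both factors meet the Cartan subalgebras in zero; this
   isomorphism identifies the two integer forms. *)

Require Import Defs.
From Stdlib Require Import ZArith.
From mathcomp Require Import all_boot all_order all_algebra.
From mathcomp Require Import reals.
From mathcomp Require Import complex.
From mathcomp Require Import boolp ring zify ssrZ.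
Set Implicit Arguments.
Unset Strict Implicit.
Unset Printing Implicit Defensive.
Import Order.TTheory GRing.Theory Num.Theory.
Delimit Scope Z_scope with Z.
Local Open Scope ring_scope.

(** * Sparse elimination over the integers *)

Section SparseElimination.
Variable K : fieldType.

Definition zK (c : Z) : K := (int_of_Z c)%:~R.

Lemma zKD a b : zK (a + b)%Z = zK a + zK b.
Proof. by rewrite /zK -[(a + b)%Z]/(a + b)%R rmorphD /= intrD. Qed.
Lemma zKM a b : zK (a * b)%Z = zK a * zK b.
Proof. by rewrite /zK -[(a * b)%Z]/(a * b)%R rmorphM /= intrM. Qed.
Lemma zKN a : zK (- a)%Z = - zK a.
Proof. by rewrite /zK -[(- a)%Z]/(- a)%R rmorphN /= mulrNz. Qed.
Lemma zK0 : zK 0%Z = 0. Proof. by []. Qed.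
Lemma zK1 : zK 1%Z = 1. Proof. by []. Qed.

(* A row is a linear form in the unknowns y 0, y 1, and so on. *)
Definition lrow := seq (nat * Z).
Definition rowval (y : nat -> K) (r : lrow) : K := \sum_(x <- r) zK x.2 * y x.1.

Variable red : Z -> Z.
Hypothesis red_zK : forall c, zK (red c) = zK c.

Fixpoint row_add (r1 r2 : lrow) {struct r1} : lrow :=
  let fix aux r2 {struct r2} :=
    match r1, r2 with
    | [::], _ => r2
    | _, [::] => r1
    | (n1, c1) :: s1, (n2, c2) :: s2 =>
      match Nat.compare n1 n2 with
      | Lt => (n1, c1) :: row_add s1 r2
      | Gt => (n2, c2) :: aux s2
      | Eq => let c := red (c1 + c2)%Z in
              if Z.eqb c 0 then row_add s1 s2 else (n1, c) :: row_add s1 s2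
      end
    end in aux r2.

Definition row_scale (c : Z) (r : lrow) : lrow :=
  [seq (x.1, red (c * x.2)%Z) | x <- r].

Lemma rowval_add y r1 r2 : rowval y (row_add r1 r2) = rowval y r1 + rowval y r2.
Proof.
rewrite /rowval; elim: r1 r2 => [|[n1 c1] s1 IH1]; elim=> [|[n2 c2] s2 IH2] /=;
  rewrite ?big_nil ?add0r ?addr0 //.
case: (Nat.compare_spec n1 n2) => [<-|_|_].
- case: Z.eqb_spec => c0; rewrite ?big_cons IH1 /=; last first.
    by rewrite red_zK zKD mulrDl addrACA.
  have -> : zK c1 * y n1 + \sum_(x <- s1) zK x.2 * y x.1 +
     (zK c2 * y n1 + \sum_(x <- s2) zK x.2 * y x.1) = (zK (c1 + c2)%Z) * y n1 +
     (\sum_(x <- s1) zK x.2 * y x.1 + \sum_(x <- s2) zK x.2 * y x.1).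
    by rewrite zKD mulrDl addrACA.
  by rewrite -red_zK c0 zK0 mul0r add0r.
- by rewrite big_cons IH1 !big_cons addrA.
- rewrite big_cons IH2 !big_cons /= addrCA; congr (_ + _).
Qed.

Lemma rowval_scale y c r : rowval y (row_scale c r) = zK c * rowval y r.
Proof.
rewrite /rowval big_map mulr_sumr; apply: eq_bigr => x _ /=.
by rewrite red_zK zKM mulrA.
Qed.

Definition row_nz (r : lrow) : lrow := [seq x <- r | ~~ Z.eqb (red x.2) 0].

Lemma rowval_nz y r : rowval y (row_nz r) = rowval y r.
Proof.
rewrite /rowval big_filter [RHS](bigID (fun x => ~~ Z.eqb (red x.2) 0)) /= [X in _ + X]big1 ?addr0 //.
by move=> x; rewrite negbK => /Z.eqb_spec c0; rewrite -red_zK c0 mul0r.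
Qed.

Fixpoint row_coef (n : nat) (r : lrow) : Z :=
  match r with
  | [::] => 0%Z
  | (m, c) :: s => if Nat.eqb m n then c else row_coef n s
  end.

Definition row_elim (n : nat) (p r : lrow) : lrow :=
  let d := row_coef n r in
  if Z.eqb d 0 then r else
  let c := row_coef n p in let g := Z.gcd c d in
  row_add (row_scale (Z.div c g) r) (row_scale (- Z.div d g)%Z p).

Lemma row_elimP y n p r : rowval y p = 0 -> rowval y r = 0 -> rowval y (row_elim n p r) = 0.
Proof.
by move=> p0 r0; rewrite /row_elim; case: Z.eqb => //; rewrite rowval_add !rowval_scale p0 r0 !mulr0 addr0.
Qed.

Variable good : Z -> bool.

Definition pivot (r : lrow) : option (nat * Z) :=
  foldl (fun o x => if good x.2 then
      match o with
      | Some z => if Z.ltb (Z.abs x.2) (Z.abs z.2) then Some x else o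
      | None => Some x
      end else o) None r.

Fixpoint shortest (best : lrow) (acc todo : seq lrow) : lrow * seq lrow :=
  match todo with
  | [::] => (best, acc)
  | r :: s => if (if pivot r then Nat.ltb (size r) (size best) else false)
              then shortest r (best :: acc) s else shortest best (r :: acc) s
  end.

Definition nonnil (rs : seq lrow) := [seq r <- rs | if r is [::] then false else true].

Fixpoint gauss (fuel : nat) (ps rs : seq lrow) : seq lrow :=
  match fuel, rs with
  | S k, r0 :: s0 =>
    let '(p, s) := shortest r0 [::] s0 in
    match pivot p with
    | Some (n, _) => gauss k (p :: map (row_elim n p) ps) (nonnil (map (row_elim n p) s))
    | None => gauss k (p :: ps) s
    end
  | _, _ => ps
  end.

Definition vanishes y (rs : seq lrow) := forall r, r \in rs -> rowval y r = 0.

Lemma vanishes_map y n p rs : rowval y p = 0 -> vanishes y rs -> vanishes y (map (row_elim n p) rs).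
Proof. by move=> p0 v _ /mapP[r /v r0 ->]; apply: row_elimP. Qed.

Lemma shortestP y best acc todo : rowval y best = 0 -> vanishes y acc -> vanishes y todo ->
  rowval y (shortest best acc todo).1 = 0 /\ vanishes y (shortest best acc todo).2.
Proof.
elim: todo best acc => [//|r s IH] best acc b0 a0 t0 /=.
have r0 : rowval y r = 0 by apply: t0; rewrite mem_head.
have s0 : vanishes y s by move=> x xs; apply: t0; rewrite inE xs orbT.
case: ifP => _; apply: IH => //.
  by move=> x; rewrite inE => /orP[/eqP->|/a0].
by move=> x; rewrite inE => /orP[/eqP->|/a0].
Qed.

Lemma gaussP y fuel ps rs : vanishes y ps -> vanishes y rs -> vanishes y (gauss fuel ps rs).
Proof.
elim: fuel ps rs => [//|k IH] ps [//|r0 s0] vp vr /=.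
have r00 : rowval y r0 = 0 by apply: vr; rewrite mem_head.
have s00 : vanishes y s0 by move=> x xs; apply: vr; rewrite inE xs orbT.
have := shortestP (best := r0) (acc := [::]) r00 (fun _ => ltac:(by [])) s00.
case: shortest => p s /= [p0 vs].
have cons0 qs : vanishes y qs -> vanishes y (p :: qs).
  by move=> vq x; rewrite inE => /orP[/eqP->|/vq].
case: pivot => [[n c]|]; apply: IH => //; try exact: cons0.
  exact/cons0/vanishes_map.
by move=> x; rewrite mem_filter => /andP[_]; apply: vanishes_map.
Qed.

Definition solves (ns : seq nat) (rs : seq lrow) : bool :=
  let g := gauss (size rs) [::] rs in
  all (fun n => has (fun r => if r is [:: (m, c)] then Nat.eqb m n && good c else false) g) ns.

Hypothesis good_neq0 : forall c, good c -> zK c != 0.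

Lemma solvesP ns rs y : solves ns rs -> vanishes y rs -> forall n, n \in ns -> y n = 0.
Proof.
move=> /allP sol vr n /sol /hasP[r rg]; case: r rg => [//|[m c] [|//]] rg /andP[/Nat.eqb_spec <- gc].
have v0 : vanishes y [::] by [].
have := gaussP (fuel := size rs) v0 vr rg.
rewrite /rowval big_seq1 => /eqP; rewrite mulf_eq0 (negPf (good_neq0 gc)) /=.
by move/eqP.
Qed.

End SparseElimination.

(** * Algebras of functions of t *)

Record tlaws (K : fieldType) (T : tAlg K) (ok : pred nat) (tau : nat -> T) :=
  TLaws {
  tmul_lin : forall (a : K) (x y w : T), t_mul (a *: x + y) w = a *: t_mul x w + t_mul y w;
  tmulC : forall x y : T, t_mul x y = t_mul y x;
  tmulA : forall x y w : T, t_mul x (t_mul y w) = t_mul (t_mul x y) w;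
  tmul1 : forall x : T, t_mul (t_one T) x = x;
  tder_lin : forall (a : K) (x y : T), t_der (a *: x + y) = a *: t_der x + t_der y;
  tderM : forall x y : T, t_der (t_mul x y) = t_mul (t_der x) y + t_mul x (t_der y);
  tcoef_lin : forall r (a : K) (x y : T), t_coef r (a *: x + y) = a * t_coef r x + t_coef r y;
  tcoef_ext : forall x : T, (forall r, t_coef r x = 0) -> x = 0;
  tcoef_der : forall r (x : T), t_coef r (t_der x) = 0 <-> t_coef r.+1 x = 0;
  tcoef_mul : forall r (x y : T),
    (forall i, (i <= r)%N -> t_coef i x = 0 \/ t_coef (r - i)%N y = 0) ->
    t_coef r (t_mul x y) = 0;
  tcoef_fin : forall x : T, exists n, forall r, (n <= r)%N -> t_coef r x = 0;
  tau0 : tau 0%N = t_one T;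
  tder_tau : forall r, ok r.+1 -> t_der (tau r.+1) = tau r;
  tau_ok : forall r, ~~ ok r -> tau r = 0;
  tcoef_tau : forall r s, r != s -> t_coef r (tau s) = 0;
  tcoef_tau_neq0 : forall r, ok r -> t_coef r (tau r) != 0;
  tcoef_ok : forall r (x : T), ~~ ok r -> t_coef r x = 0;
  ok_down : forall r, ok r.+1 -> ok r;
  ok2 : ok 2 }.

Section TLawsTheory.
Variables (K : fieldType) (T : tAlg K) (ok : pred nat) (tau : nat -> T).
Hypothesis tl : tlaws ok tau.

Lemma ok0 : ok 0. Proof. exact/(ok_down tl)/(ok_down tl)/(ok2 tl). Qed.
Lemma ok1 : ok 1. Proof. exact/(ok_down tl)/(ok2 tl). Qed.

Lemma tmul0l (x : T) : t_mul 0 x = 0.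
Proof. by have := tmul_lin tl (-1) 0 0 x; rewrite scaler0 addr0 scaleN1r addNr. Qed.
Lemma tmul0r (x : T) : t_mul x 0 = 0.
Proof. by rewrite (tmulC tl) tmul0l. Qed.
Lemma tmulZl (a : K) (x w : T) : t_mul (a *: x) w = a *: t_mul x w.
Proof. by have := tmul_lin tl a x 0 w; rewrite !addr0 tmul0l addr0. Qed.
Lemma tmulZr (a : K) (x w : T) : t_mul w (a *: x) = a *: t_mul w x.
Proof. by rewrite !(tmulC tl w) tmulZl. Qed.
Lemma tmulDl (x y w : T) : t_mul (x + y) w = t_mul x w + t_mul y w.
Proof. by have := tmul_lin tl 1 x y w; rewrite !scale1r. Qed.
Lemma tmulDr (x y w : T) : t_mul w (x + y) = t_mul w x + t_mul w y.
Proof. by rewrite !(tmulC tl w) tmulDl. Qed.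
Lemma tmul_suml (I : Type) (r : seq I) (P : pred I) (F : I -> T) w :
  t_mul (\sum_(i <- r | P i) F i) w = \sum_(i <- r | P i) t_mul (F i) w.
Proof. by apply: (big_morph (fun x => t_mul x w)) => [x y|]; rewrite ?tmul0l ?tmulDl. Qed.
Lemma tmul_sumr (I : Type) (r : seq I) (P : pred I) (F : I -> T) w :
  t_mul w (\sum_(i <- r | P i) F i) = \sum_(i <- r | P i) t_mul w (F i).
Proof. by apply: (big_morph (t_mul w)) => [x y|]; rewrite ?tmul0r ?tmulDr. Qed.
Lemma tder0 : t_der (0 : T) = 0.
Proof. by have := tder_lin tl (-1) 0 0; rewrite scaler0 addr0 scaleN1r addNr. Qed.
Lemma tderZ (a : K) (x : T) : t_der (a *: x) = a *: t_der x.
Proof. by have := tder_lin tl a x 0; rewrite !addr0 tder0 addr0. Qed.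
Lemma tderD (x y : T) : t_der (x + y) = t_der x + t_der y.
Proof. by have := tder_lin tl 1 x y; rewrite !scale1r. Qed.
Lemma tder_sum (I : Type) (r : seq I) (P : pred I) (F : I -> T) :
  t_der (\sum_(i <- r | P i) F i) = \sum_(i <- r | P i) t_der (F i).
Proof. by apply: (big_morph (@t_der K T)) => [x y|]; rewrite ?tder0 ?tderD. Qed.
Lemma tder1 : t_der (t_one T) = 0.
Proof.
have := tderM tl (t_one T) (t_one T); rewrite (tmul1 tl) (tmulC tl _ (t_one T)).
by rewrite (tmul1 tl) => /eqP; rewrite -subr_eq subrr eq_sym => /eqP.
Qed.
Lemma tcoef0 r : t_coef r (0 : T) = 0.
Proof. by have := tcoef_lin tl r (-1) 0 0; rewrite scaler0 addr0 mulN1r addNr. Qed.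
Lemma tcoefZ r (a : K) (x : T) : t_coef r (a *: x) = a * t_coef r x.
Proof. by have := tcoef_lin tl r a x 0; rewrite !addr0 tcoef0 addr0. Qed.
Lemma tcoefD r (x y : T) : t_coef r (x + y) = t_coef r x + t_coef r y.
Proof. by have := tcoef_lin tl r 1 x y; rewrite !scale1r mul1r. Qed.
Lemma tcoef_sum s (I : Type) (r : seq I) (P : pred I) (F : I -> T) :
  t_coef s (\sum_(i <- r | P i) F i) = \sum_(i <- r | P i) t_coef s (F i).
Proof. by apply: (big_morph (t_coef s)) => [x y|]; rewrite ?tcoef0 ?tcoefD. Qed.

Lemma tau_span r (x : T) : (forall s, s != r -> t_coef s x = 0) ->
  exists a, x = a *: tau r.
Proof.
move=> hx; case okr: (ok r); last first.
  exists 0; rewrite scale0r; apply: (tcoef_ext tl) => s.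
  by have [->|/hx//] := eqVneq s r; rewrite (tcoef_ok tl) ?okr.
exists (t_coef r x / t_coef r (tau r)); apply/eqP; rewrite -subr_eq0; apply/eqP.
apply: (tcoef_ext tl) => s; rewrite -scaleN1r tcoefD !tcoefZ.
have [->|sr] := eqVneq s r.
  by rewrite divfK ?mulN1r ?subrr // (tcoef_tau_neq0 tl).
by rewrite hx // (tcoef_tau tl sr) !mulr0 addr0.
Qed.

End TLawsTheory.

Lemma poly_tlaws (K : fieldType) : [pchar K] =i pred0 ->
  tlaws (T := poly_tAlg K) predT (fun r => (r`!%:R)^-1 *: 'X^r).
Proof.
move=> /pcharf0P K0; split => //=.
- by move=> a x y w; rewrite mulrDl scalerAl.
- exact: mulrC.
- exact: mulrA.
- exact: mul1r.
- by move=> a x y; rewrite derivD derivZ.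
- by move=> x y; rewrite derivM.
- by move=> r a x y; rewrite coefD coefZ.
- by move=> x hx; apply/polyP => r; rewrite hx coef0.
- move=> r x; rewrite coef_deriv; split=> [/eqP|->]; last by rewrite mul0rn.
  by rewrite -mulr_natr mulf_eq0 K0 orbF => /eqP.
- move=> r x y xy; rewrite coefM big1 // => i _.
  by case: (xy i) => [|->|->]; rewrite ?mul0r ?mulr0 // -ltnS.
- by move=> x; exists (size x) => r hr; rewrite nth_default.
- by rewrite fact0 invr1 scale1r expr0.
- move=> r _; rewrite derivZ derivXn /= -scaler_nat scalerA; congr (_ *: _).
  rewrite factS natrM invfM mulrC mulrA divff ?mul1r //.
  by rewrite K0.
- by move=> r s rs; rewrite coefZ coefXn (negPf rs) mulr0.
- by move=> r _; rewrite coefZ coefXn eqxx mulr1 invr_eq0 K0 -lt0n fact_gt0.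
Qed.

Section BinomialConvolution.
Variable K : fieldType.
Implicit Types u v w : nat -> K.

Definition bconv u v k : K := \sum_(i < k.+1) 'C(k, i)%:R * u i * v (k - i)%N.
Definition shift u k : K := u k.+1.

Lemma bconv0 u v : bconv u v 0 = u 0%N * v 0%N.
Proof. by rewrite /bconv big_ord1 bin0 mul1r subn0. Qed.

Lemma bconv_ext u u' v v' k : (forall i, (i <= k)%N -> u i = u' i) ->
  (forall i, (i <= k)%N -> v i = v' i) -> bconv u v k = bconv u' v' k.
Proof.
move=> hu hv; apply: eq_bigr => i _; have ik := ltn_ord i.
by rewrite hu // hv // leq_subr.
Qed.

Lemma bconvC u v k : bconv u v k = bconv v u k.
Proof.
rewrite /bconv (reindex_inj rev_ord_inj) /=; apply: eq_bigr => i _.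
have ik : (i <= k)%N by rewrite -ltnS.
by rewrite subSS bin_sub // subKn // mulrAC.
Qed.

Lemma bconvD u u' v k : bconv (fun i => u i + u' i) v k = bconv u v k + bconv u' v k.
Proof.
by rewrite /bconv -big_split; apply: eq_bigr => i _ /=; rewrite mulrDr mulrDl.
Qed.

Lemma bconvDr u v v' k : bconv u (fun i => v i + v' i) k = bconv u v k + bconv u v' k.
Proof. by rewrite bconvC bconvD !(bconvC u). Qed.

Lemma bconvS u v k : bconv u v k.+1 = bconv (shift u) v k + bconv u (shift v) k.
Proof.
rewrite /bconv big_ord_recl /= bin0 mul1r subn0.
rewrite (eq_bigr (fun i : 'I_k.+1 => 'C(k, i)%:R * shift u i * v (k - i)%N +
    'C(k, i.+1)%:R * u i.+1 * v (k.+1 - i.+1)%N)); last first.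
  by move=> i _; rewrite /bump /= add1n binS natrD !mulrDl subSS addrC.
rewrite big_split /= addrCA; congr (_ + _).
rewrite [in RHS]big_ord_recl bin0 mul1r /shift subn0; congr (_ + _).
rewrite big_ord_recr /= bin_small // !mul0r addr0; apply: eq_bigr => i _.
by rewrite /bump /= add1n subSS subnSK.
Qed.

Lemma bconvA u v w k : bconv u (bconv v w) k = bconv (bconv u v) w k.
Proof.
elim: k u v w => [|k IH] u v w; first by rewrite !bconv0 mulrA.
rewrite !bconvS.
rewrite (@bconv_ext u u (shift (bconv v w))
  (fun i => bconv (shift v) w i + bconv v (shift w) i)) //; last by move=> i _; apply: bconvS.
rewrite (@bconv_ext (shift (bconv u v))
  (fun i => bconv (shift u) v i + bconv u (shift v) i) w w) //; last by move=> i _; apply: bconvS.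
by rewrite bconvDr bconvD !IH addrA.
Qed.

End BinomialConvolution.

Section DividedPowerLaws.
Variables (K : fieldType) (h : nat).
Hypothesis h2 : (2 < h)%N.
Hypothesis hbin : forall i, (0 < i < h)%N -> 'C(h, i)%:R = 0 :> K.
Implicit Types f g : dp_tAlg K h.

Lemma dp_coefE f (i : 'I_h) : dp_coef i f = (f : 'rV__) 0 i.
Proof. by rewrite /dp_coef valK. Qed.

Lemma dp_coef_row (c : nat -> K) k :
  dp_coef k (\row_(i < h) c i) = if (k < h)%N then c k else 0.
Proof.
rewrite /dp_coef; case: insubP => [i -> <-|/negPf->] //=.
by rewrite mxE.
Qed.

Lemma dp_coef_ge k f : (h <= k)%N -> dp_coef k f = 0.
Proof. by rewrite /dp_coef => hk; rewrite insubF // ltnNge hk. Qed.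

Lemma dp_coef_mul k f g : dp_coef k (t_mul f g) =
  if (k < h)%N then bconv (fun i => dp_coef i f) (fun i => dp_coef i g) k else 0.
Proof.
rewrite /= /dp_coef; case: insubP => [m -> <- /=|/negPf->//]; rewrite mxE.
rewrite /bconv (big_ord_widen h (fun i => 'C(m, i)%:R * dp_coef i f * dp_coef (m - i)%N g) (ltn_ord m)).
rewrite [RHS]big_mkcond; apply: eq_bigr => i _ /=; case: ltnP => im.
  have jh : (m - i < h)%N by apply: leq_ltn_trans (leq_subr _ _) (ltn_ord m).
  rewrite (big_pred1 (Ordinal jh)) /= => [|j].
    by rewrite subnKC // dp_coefE -(dp_coefE g (Ordinal jh)).
  by rewrite /= -val_eqE /= -{1}(subnKC (im : (i <= m)%N)) eqn_add2l.
rewrite big_pred0 // => j; apply/negbTE; rewrite neq_ltn; apply/orP; right.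
exact: leq_trans im (leq_addr _ _).
Qed.

Lemma dp_ext f g : (forall k, dp_coef k f = dp_coef k g) -> f = g.
Proof. by move=> fg; apply/rowP => i; rewrite -!dp_coefE fg. Qed.

Lemma dp_coefD k (a : K) f g : dp_coef k (a *: f + g) = a * dp_coef k f + dp_coef k g.
Proof.
case: (ltnP k h) => kh; last by rewrite !dp_coef_ge // mulr0 addr0.
by rewrite -[k]/(val (Ordinal kh)) !dp_coefE !mxE.
Qed.

Lemma dp_coef_add k f g : dp_coef k (f + g) = dp_coef k f + dp_coef k g.
Proof. by rewrite -{1}[f]scale1r dp_coefD mul1r. Qed.

Lemma dp_coef_0 k : dp_coef k (0 : dp_tAlg K h) = 0.
Proof. by rewrite /dp_coef; case: insub => //= i; rewrite mxE. Qed.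

Lemma dp_coef_der k f : dp_coef k (t_der f) = dp_coef k.+1 f.
Proof.
rewrite [LHS](dp_coef_row (fun k => dp_coef k.+1 f)); case: ltnP => // hk.
by rewrite dp_coef_ge // leqW.
Qed.

Definition dp_tau r : dp_tAlg K h := \row_(k < h) ((k : nat) == r)%:R.

Lemma dp_coef_tau k r : dp_coef k (dp_tau r) = if (k < h)%N then (k == r)%:R else 0.
Proof. exact: (dp_coef_row (fun k => (k == r)%:R)). Qed.

Lemma dp_one : t_one (dp_tAlg K h) = dp_tau 0. Proof. by []. Qed.

Lemma dp_tlaws : tlaws (fun r => (r < h)%N) dp_tau.
Proof.
split.
- move=> a x y w; apply: dp_ext => k; rewrite dp_coefD !dp_coef_mul.
  case: ifP => // _; last by rewrite mulr0 addr0.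
  rewrite (bconv_ext (u' := fun i => a * dp_coef i x + dp_coef i y)
     (v' := fun i => dp_coef i w)) // => [|i _]; last exact: dp_coefD.
  rewrite bconvD; congr (_ + _); rewrite /bconv mulr_sumr.
  by apply: eq_bigr => i _; rewrite !mulrA [a * _]mulrC.
- move=> x y; apply: dp_ext => k; rewrite !dp_coef_mul.
  by case: ifP => // _; apply: bconvC.
- move=> x y w; apply: dp_ext => k; rewrite !dp_coef_mul; case: ifP => // kh.
  rewrite (bconv_ext (u' := fun i => dp_coef i x) (v' := bconv (fun i => dp_coef i y) (fun i => dp_coef i w))) //
    => [|i ik]; last by rewrite dp_coef_mul (leq_ltn_trans ik kh).
  rewrite bconvA; apply: bconv_ext => // i ik.
  by rewrite dp_coef_mul (leq_ltn_trans ik kh).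
- move=> x; apply: dp_ext => k; rewrite dp_coef_mul; case: ifPn => [kh|]; last first.
    by rewrite -leqNgt => hk; rewrite dp_coef_ge.
  rewrite dp_one /bconv big_ord_recl /= bin0 mul1r subn0 big1 => [|i _].
    by rewrite dp_coef_tau (ltn_trans _ h2) // mul1r addr0.
  by rewrite dp_coef_tau /= if_same mulr0 mul0r.
- move=> a x y; apply: dp_ext => k; rewrite dp_coef_der !dp_coefD.
  by rewrite !dp_coef_der.
- move=> x y; apply: dp_ext => k; rewrite dp_coef_add.
  rewrite dp_coef_der !dp_coef_mul.
  have E : bconv (fun i => dp_coef i (t_der x)) (fun i => dp_coef i y) k +
     bconv (fun i => dp_coef i x) (fun i => dp_coef i (t_der y)) k =
     bconv (fun i => dp_coef i x) (fun i => dp_coef i y) k.+1.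
    by rewrite bconvS; congr (_ + _); apply: bconv_ext => // i _; rewrite dp_coef_der.
  case: (ltnP k h) => kh; last by rewrite ltnNge leqW //= addr0.
  rewrite E; case: ltnP => // hk; have {hk}kE : k.+1 = h by apply/eqP; rewrite eqn_leq kh.
  rewrite kE /bconv big1 // => i _.
  have [i0|i0] := posnP i; first by rewrite i0 subn0 (@dp_coef_ge h) // mulr0.
  have [ih|ih] := ltnP i h; first by rewrite hbin ?i0 // !mul0r.
  by rewrite dp_coef_ge // mulr0 mul0r.
- by move=> r a x y; apply: dp_coefD.
- move=> x hx; apply: dp_ext => k; by rewrite [LHS]hx dp_coef_0.
- by move=> r x; rewrite /= dp_coef_der.
- move=> r x y xy; rewrite [LHS]dp_coef_mul; case: ifP => // _.
  rewrite /bconv big1 // => i _.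
  by case: (xy i) => [|/= ->|/= ->]; rewrite ?mulr0 ?mul0r // -ltnS.
- by move=> x; exists h => r; apply: dp_coef_ge.
- by [].
- move=> r rh; apply: dp_ext => k; rewrite dp_coef_der !dp_coef_tau eqSS.
  case: (ltnP k.+1 h) => [/ltnW->//|hk]; case: ifP => // kh.
  by case: eqP => // kr; move: rh; rewrite -kr ltnNge hk.
- move=> r; rewrite -leqNgt => hr; apply: dp_ext => k.
  rewrite dp_coef_tau dp_coef_0.
  by case: ltnP => // kh; rewrite ltn_eqF // (leq_trans kh).
- by move=> r s rs; rewrite /= dp_coef_tau (negPf rs) if_same.
- by move=> r rh; rewrite /= dp_coef_tau rh eqxx oner_neq0.
- by move=> r x; rewrite -leqNgt; apply: dp_coef_ge.
- by move=> r; apply: ltnW.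
- exact: h2.
Qed.

End DividedPowerLaws.

Lemma pchar_binX (K : fieldType) p N i : p \in [pchar K] ->
  (0 < i < p ^ N)%N -> 'C(p ^ N, i)%:R = 0 :> K.
Proof.
move=> pK /andP[i0 ilt]; have pp := pcharf_prime pK.
apply/eqP; rewrite -(dvdn_pcharf pK); apply: contraLR ilt => npC.
rewrite -leqNgt dvdn_leq // -(@Gauss_dvdl _ _ 'C(p ^ N, i)); last first.
  by rewrite coprimeXl // prime_coprime.
by case: i i0 {npC} => // i _; rewrite -mul_bin_diag dvdn_mulr.
Qed.

Lemma dp_tlaws_pchar (K : fieldType) p N : p \in [pchar K] -> (2 < p)%N -> (0 < N)%N ->
  tlaws (fun r => (r < p ^ N)%N) (@dp_tau K (p ^ N)).
Proof.
move=> pK p2 N0; apply: dp_tlaws; last by move=> i; apply: pchar_binX.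
rewrite (leq_trans p2) // -{1}(expn1 p) leq_exp2l //; exact: leq_trans p2.
Qed.

(** * The superalgebra of functions *)

Section Inversions.
Implicit Types A B C : {set 'I_7}.

Lemma inversionsE A B :
  inversions A B = (\sum_(a in A) \sum_(b in B) (b < a)%N)%N.
Proof.
rewrite /inversions -sum1_card pair_big_dep /= big_mkcond [RHS]big_mkcond /=.
apply: eq_bigr => -[a b] _; rewrite inE /=.
by case: (a \in A); case: (b \in B); case: (b < a)%N.
Qed.

Lemma inversionsUl A B C : [disjoint A & B] ->
  inversions (A :|: B) C = (inversions A C + inversions B C)%N.
Proof.
by move=> dAB; rewrite !inversionsE -bigU //=; apply: eq_bigl => i; rewrite inE.
Qed.

Lemma inversionsUr A B C : [disjoint B & C] ->
  inversions A (B :|: C) = (inversions A B + inversions A C)%N.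
Proof.
move=> dBC; rewrite !inversionsE -big_split; apply: eq_bigr => a _.
by rewrite /= -bigU //=; apply: eq_bigl => i; rewrite inE.
Qed.

Lemma inversions_swap A B : [disjoint A & B] ->
  (inversions A B + inversions B A)%N = (#|A| * #|B|)%N.
Proof.
move=> dAB; rewrite !inversionsE [X in (_ + X)%N]exchange_big -big_split /=.
rewrite -sum_nat_const; apply: eq_bigr => a aA.
rewrite -big_split -sum1_card; apply: eq_bigr => b bB /=.
by case: ltngtP => // /val_inj ab; move: (disjointFr dAB aA); rewrite -ab bB.
Qed.

Lemma inversions1l a B : inversions [set a] B = #|[set b in B | (b < a)%N]|.
Proof.
rewrite inversionsE big_set1 -sum1_card [RHS]big_mkcond /= [LHS]big_mkcond.
by apply: eq_bigr => b _; rewrite inE; case: (b \in B); case: (b < a)%N.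
Qed.

Lemma inversions0l A : inversions set0 A = 0%N.
Proof. by rewrite inversionsE big_set0. Qed.

Lemma inversions0r A : inversions A set0 = 0%N.
Proof. by rewrite inversionsE big1 // => a _; rewrite big_set0. Qed.

End Inversions.

Lemma disjointDr (A B : {set 'I_7}) : [disjoint A & B :\: A].
Proof. by rewrite -setI_eq0 setIDA setIC -setIDA setDv setI0. Qed.

Lemma signr_eq (K : fieldType) (m n : nat) : odd m = odd n -> (-1 : K) ^+ m = (-1) ^+ n.
Proof. by move=> mn; rewrite -(signr_odd _ m) mn signr_odd. Qed.

Section Superfunctions.
Variables (K : fieldType) (T : tAlg K) (ok : pred nat) (tau : nat -> T).
Hypothesis tl : tlaws ok tau.
Notation O := (O T).
Implicit Types (f g k : O) (A B C S : {set 'I_7}) (a b : 'I_7).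

Lemma o_mulE f g S : o_mul f g S = \sum_(A : {set 'I_7} | A \subset S)
    (-1) ^+ inversions A (S :\: A) *: t_mul (f A) (g (S :\: A)).
Proof. by rewrite ffunE. Qed.

Lemma o_mul_linl (c : K) f g k : o_mul (c *: f + g) k = c *: o_mul f k + o_mul g k.
Proof.
apply/ffunP => S; rewrite !ffunE scaler_sumr -big_split; apply: eq_bigr => A _ /=.
by rewrite !ffunE (tmulDl tl) (tmulZl tl) scalerDr !scalerA mulrC.
Qed.

Lemma o_mul_linr (c : K) f g k : o_mul k (c *: f + g) = c *: o_mul k f + o_mul k g.
Proof.
apply/ffunP => S; rewrite !ffunE scaler_sumr -big_split; apply: eq_bigr => A _ /=.
by rewrite !ffunE (tmulDr tl) (tmulZr tl) scalerDr !scalerA mulrC.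
Qed.

Lemma o_mulDl f g k : o_mul (f + g) k = o_mul f k + o_mul g k.
Proof. by have := o_mul_linl 1 f g k; rewrite !scale1r. Qed.
Lemma o_mulDr f g k : o_mul k (f + g) = o_mul k f + o_mul k g.
Proof. by have := o_mul_linr 1 f g k; rewrite !scale1r. Qed.
Lemma o_mul0l k : o_mul 0 k = 0.
Proof. by have := o_mul_linl (-1) 0 0 k; rewrite scaler0 addr0 scaleN1r addNr. Qed.
Lemma o_mul0r k : o_mul k 0 = 0.
Proof. by have := o_mul_linr (-1) 0 0 k; rewrite scaler0 addr0 scaleN1r addNr. Qed.
Lemma o_mulZl (c : K) f k : o_mul (c *: f) k = c *: o_mul f k.
Proof. by have := o_mul_linl c f 0 k; rewrite !addr0 o_mul0l addr0. Qed.
Lemma o_mulZr (c : K) f k : o_mul k (c *: f) = c *: o_mul k f.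
Proof. by have := o_mul_linr c f 0 k; rewrite !addr0 o_mul0r addr0. Qed.
Lemma o_mul_suml (I : Type) (r : seq I) (P : pred I) (F : I -> O) k :
  o_mul (\sum_(i <- r | P i) F i) k = \sum_(i <- r | P i) o_mul (F i) k.
Proof. by apply: (big_morph (fun x => o_mul x k)) => [x y|]; rewrite ?o_mul0l ?o_mulDl. Qed.
Lemma o_mul_sumr (I : Type) (r : seq I) (P : pred I) (F : I -> O) k :
  o_mul k (\sum_(i <- r | P i) F i) = \sum_(i <- r | P i) o_mul k (F i).
Proof. by apply: (big_morph (o_mul k)) => [x y|]; rewrite ?o_mul0r ?o_mulDr. Qed.

Lemma o_mulA f g k : o_mul f (o_mul g k) = o_mul (o_mul f g) k.
Proof.
apply/ffunP => S; rewrite !o_mulE.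
transitivity (\sum_(A : {set 'I_7} | A \subset S) \sum_(B : {set 'I_7} | B \subset S :\: A)
   (-1) ^+ (inversions A B + inversions A (S :\: (A :|: B)) + inversions B (S :\: (A :|: B)))
   *: t_mul (f A) (t_mul (g B) (k (S :\: (A :|: B))))).
  apply: eq_bigr => A AS; rewrite o_mulE (tmul_sumr tl) scaler_sumr; apply: eq_bigr => B BS.
  rewrite (tmulZr tl) scalerA -exprD setDDl; congr (_ ^+ _ *: _).
  rewrite -inversionsUr; last first.
    rewrite -setI_eq0; apply/eqP/setP => x; rewrite !inE.
    by case: (x \in B); rewrite ?orbT ?andbF.
  congr (inversions _ _ + _)%N; apply/setP => x; rewrite !inE.
  by have /implyP := subsetP BS x; rewrite !inE; case: (x \in A); case: (x \in B); case: (x \in S).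
transitivity (\sum_(B : {set 'I_7} | B \subset S) \sum_(A : {set 'I_7} | (A \subset S) && (B \subset A))
   (-1) ^+ (inversions A (S :\: A) + inversions B (A :\: B))
   *: t_mul (t_mul (f B) (g (A :\: B))) (k (S :\: A))); last first.
  rewrite (exchange_big_dep (fun A => A \subset S)) /= => [|B A _ /andP[]//].
  apply: eq_bigr => A AS; rewrite o_mulE (tmul_suml tl) scaler_sumr.
  rewrite (eq_bigl (fun B : {set 'I_7} => B \subset A)) => [|B]; last first.
    rewrite AS /=; apply/andP/idP => [[]//|BA]; split=> //; exact: subset_trans AS.
  by apply: eq_bigr => B BA; rewrite (tmulZl tl) scalerA exprD.
apply: eq_bigr => B BS.
rewrite [RHS](reindex_onto (fun C => B :|: C) (fun A => A :\: B)) /=; last first.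
  by move=> A /andP[_ BA]; apply/setP => x; rewrite !inE; have /implyP := subsetP BA x;
    case: (x \in A); case: (x \in B).
apply: eq_big => [C|C CS].
  apply/idP/idP => [CS|/andP[/andP[/subUsetP[_ CS] _]] /eqP E]; last first.
    apply/subsetP => x xC; move: (xC); rewrite -{1}E !inE => /andP[-> _].
    exact: (subsetP CS).
  have dBC x : x \in C -> x \notin B by move/(subsetP CS); rewrite inE => /andP[].
  rewrite subsetUl andbT; apply/andP; split.
    by rewrite subUset BS (subset_trans CS) // subsetDl.
  by apply/eqP/setP => x; rewrite !inE; have /implyP := dBC x; case: (x \in C); case: (x \in B).
have dBC x : x \in C -> x \notin B by move/(subsetP CS); rewrite inE => /andP[].
have -> : (B :|: C) :\: B = C.
  by apply/setP => x; rewrite !inE; have /implyP := dBC x; case: (x \in C); case: (x \in B).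
rewrite inversionsUl; last first.
  by rewrite disjoint_sym disjoints_subset; apply/subsetP => x /dBC; rewrite inE.
by rewrite (tmulA tl) -addnA addnC.
Qed.

Definition osg f : O := [ffun S : {set 'I_7} => (-1) ^+ #|S| *: f S].

Definition o_par (s : bool) f := forall S : {set 'I_7}, f S != 0 -> odd #|S| = s.

Lemma osg_lin (c : K) f g : osg (c *: f + g) = c *: osg f + osg g.
Proof. by apply/ffunP => S; rewrite !ffunE scalerDr !scalerA mulrC. Qed.

Lemma osgK f : osg (osg f) = f.
Proof. by apply/ffunP => S; rewrite !ffunE scalerA -expr2 sqrr_sign scale1r. Qed.

Lemma osg_par s f : o_par s f -> osg f = (-1) ^+ s *: f.
Proof.
move=> fs; apply/ffunP => S; rewrite !ffunE.
by have [->|/fs <-] := eqVneq (f S) 0; rewrite ?scaler0 // signr_odd.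
Qed.

Lemma osgM f g : osg (o_mul f g) = o_mul (osg f) (osg g).
Proof.
apply/ffunP => S; rewrite !ffunE scaler_sumr; apply: eq_bigr => A AS.
rewrite !ffunE (tmulZl tl) (tmulZr tl) !scalerA -!exprD; congr (_ ^+ _ *: _).
by rewrite -(cardsID A S) (setIidPr AS) addnC addnA.
Qed.

Lemma o_mulC s f g : o_par s f -> o_mul f g = o_mul (iter s osg g) f.
Proof.
move=> fs; apply/ffunP => S; rewrite !o_mulE (reindex_onto (fun A => S :\: A) (fun A => S :\: A)) /=; last first.
  by move=> A AS; rewrite setDDr setDv set0U (setIidPr AS).
apply: eq_big => [A|A /andP[_ /eqP]].
  rewrite subsetDl /=; apply/eqP/idP => [<-|AS]; first exact: subsetDl.
  by rewrite setDDr setDv set0U (setIidPr AS).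
move=> E; rewrite E (tmulC tl).
have [->|/fs oA] := eqVneq (f (S :\: A)) 0; first by rewrite !(tmul0r tl) !scaler0.
have -> : iter s osg g A = (-1) ^+ (s * #|A|) *: g A.
  by case: (s); rewrite /= ?ffunE ?mul1n ?mul0n ?scale1r.
rewrite (tmulZl tl) scalerA -exprD; congr (_ *: _); apply: signr_eq.
have dA := disjointDr A S.
have := inversions_swap dA; rewrite oddD oddM => /(congr1 odd); rewrite oddD !oddM oA.
by case: (s); case: (odd (inversions A _)); case: (odd (inversions _ A)); case: (odd #|A|).
Qed.

Lemma o_derE a f S : o_der (Some a) f S =
  if a \in S then 0 else (-1) ^+ inversions [set a] S *: f (a |: S).
Proof. by rewrite ffunE inversions1l. Qed.

Lemma o_der_lin i (c : K) f g : o_der i (c *: f + g) = c *: o_der i f + o_der i g.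
Proof.
apply/ffunP => S; case: i => [a|]; rewrite !ffunE; last exact: (tder_lin tl).
by case: ifP => _; rewrite ?scaler0 ?addr0 // scalerDr !scalerA mulrC.
Qed.

Lemma o_der_osg i f : o_der i (osg f) = (-1) ^+ (isSome i) *: osg (o_der i f).
Proof.
apply/ffunP => S; case: i => [a|] /=; rewrite !ffunE ?expr0 ?scale1r ?(tderZ tl) //.
case: ifPn => aS; first by rewrite !scaler0.
by rewrite !scalerA cardsU1 aS add1n exprS expr1; congr (_ *: _); ring.
Qed.

Lemma o_derM i f g : o_der i (o_mul f g) =
  o_mul (o_der i f) g + o_mul (iter (isSome i) osg f) (o_der i g).
Proof.
case: i => [a|] /=; apply/ffunP => S; last first.
  rewrite !ffunE (tder_sum tl) -big_split; apply: eq_bigr => A _ /=.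
  by rewrite !ffunE (tderZ tl) (tderM tl) scalerDr.
rewrite o_derE [RHS]ffunE !o_mulE.
have dis (A : {set 'I_7}) : a \notin A -> [disjoint [set a] & A].
  by rewrite disjoints1.
rewrite [X in _ = X + _](bigID (fun A : {set 'I_7} => a \in A)) /= [X in _ = X + _ + _]big1 ?add0r; last first.
  by move=> A /andP[_ aA]; rewrite o_derE aA (tmul0l tl) scaler0.
case: ifPn => aS.
  rewrite [X in _ = _ + X](bigID (fun A : {set 'I_7} => a \in A)) /= [X in _ + (_ + X)]big1 ?addr0; last first.
    by move=> A /andP[_ aA]; rewrite o_derE inE aA aS (tmul0r tl) scaler0.
  rewrite [X in _ = _ + X](reindex_onto (fun A => a |: A) (fun A => A :\ a)) /=; last first.
    by move=> A /andP[_ aA]; rewrite setD1K.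
  rewrite [X in _ = _ + X](eq_bigl (fun A : {set 'I_7} => (A \subset S) && (a \notin A))); last first.
    move=> A; rewrite subUset sub1set aS setU11 andbT /=; congr (_ && _).
    apply/eqP/idP => [<-|aA]; first by rewrite !inE eqxx.
    by apply/setP => x; rewrite !inE; have [->|] := eqVneq x a; rewrite ?(negPf aA).
  rewrite -big_split big1 // => A /andP[AS aA] /=.
  rewrite !o_derE (negPf aA) !inE eqxx /= ffunE (tmulZl tl) (tmulZr tl) (tmulZl tl) !scalerA.
  have BE : S :\: A = a |: (S :\: (a |: A)).
    by apply/setP => x; rewrite !inE; have [->|] := eqVneq x a; rewrite ?aS ?(negPf aA).
  have aB : a \notin S :\: (a |: A) by rewrite !inE eqxx.
  rewrite -BE BE -/(setU _ _) inversionsUr ?dis // inversionsUl ?dis // cardsU1 aA.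
  rewrite -!exprD -BE -scalerDl; apply/eqP; rewrite scaler_eq0; apply/orP; left.
  apply/eqP.
  have := inversions_swap (dis _ aA); rewrite cards1 mul1n => /(congr1 odd).
  move: (inversions _ (_ :\: _)) (inversions _ (_ :\: _)) => i j; rewrite oddD => cA.
  rewrite -[X in X + _]signr_odd -[X in _ + X]signr_odd !oddD /= -cA.
  by case: (odd i); case: (odd j); case: (odd (inversions A _)); case: (odd (inversions _ A));
    rewrite /= ?expr0 ?expr1 ?subrr ?addNr.
rewrite [X in _ *: X](bigID (fun A : {set 'I_7} => a \in A)) /= scalerDr; congr (_ + _).
  rewrite (reindex_onto (fun A => a |: A) (fun A => A :\ a)) /=; last first.
    by move=> A /andP[_ aA]; rewrite setD1K.
  rewrite (eq_bigl (fun A : {set 'I_7} => (A \subset S) && (a \notin A))); last first.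
    move=> A; rewrite setU11 andbT subUset sub1set setU11 /=.
    apply/andP/andP => [[AaS /eqP AE]|[AS aA]].
      have aA : a \notin A by rewrite -AE !inE eqxx.
      split=> //; apply/subsetP => x xA; have := subsetP AaS x xA.
      by rewrite !inE => /orP[/eqP xa|//]; move: aA; rewrite -xa xA.
    rewrite (subset_trans AS (subsetUr _ _)); split=> //; apply/eqP/setP => x.
    by rewrite !inE; have [->|] := eqVneq x a; rewrite ?(negPf aA).
  rewrite scaler_sumr; apply: eq_bigr => A /andP[AS aA].
  rewrite o_derE (negPf aA) (tmulZl tl) !scalerA.
  have -> : (a |: S) :\: (a |: A) = S :\: A.
    by apply/setP => x; rewrite !inE; have [->|] := eqVneq x a; rewrite ?(negPf aS) ?andbF.
  rewrite inversionsUl ?dis // -!exprD; congr (_ *: _); apply: signr_eq.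
  have SE : S = A :|: (S :\: A) by apply/setP => x; rewrite !inE; have /implyP := subsetP AS x; case: (x \in A); case: (x \in S).
  rewrite {1}SE inversionsUr ?disjointDr // !oddD.
  by case: (odd _); case: (odd _); case: (odd _).
rewrite (eq_bigl (fun A : {set 'I_7} => A \subset S)); last first.
  move=> A; apply/andP/idP => [[AaS aA]|AS].
    apply/subsetP => x xA; have := subsetP AaS x xA.
    by rewrite !inE => /orP[/eqP xa|//]; move: aA; rewrite -xa xA.
  rewrite (subset_trans AS (subsetUr _ _)); split=> //.
  by apply: contra aS => /(subsetP AS).
rewrite scaler_sumr; apply: eq_bigr => A AS.
have aA : a \notin A by apply: contra aS => /(subsetP AS).
rewrite o_derE inE (negPf aS) andbF ffunE (tmulZl tl) (tmulZr tl) !scalerA.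
have -> : (a |: S) :\: A = a |: (S :\: A).
  by apply/setP => x; rewrite !inE; have [->|] := eqVneq x a; rewrite ?(negPf aA).
rewrite inversionsUr ?dis ?inE ?(negPf aS) ?andbF // -!exprD; congr (_ *: _); apply: signr_eq.
have SE : S = A :|: (S :\: A) by apply/setP => x; rewrite !inE; have /implyP := subsetP AS x; case: (x \in A); case: (x \in S).
rewrite {1}SE inversionsUr ?disjointDr // !oddD.
have := inversions_swap (dis _ aA); rewrite cards1 mul1n => /(congr1 odd); rewrite oddD => <-.
by case: (odd _); case: (odd _); case: (odd _); case: (odd _).
Qed.

End Superfunctions.

Arguments osg {K T} f.
Arguments o_par {K T} s f.

Inductive zexp := ZV of nat | ZO | ZA of zexp & zexp | ZN of zexp.

Section AbelianGroupIdentities.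
Variable V : zmodType.

Fixpoint zeval (s : seq V) (e : zexp) : V :=
  match e with
  | ZV n => nth 0 s n | ZO => 0
  | ZA a b => zeval s a + zeval s b | ZN a => - zeval s a
  end.

Fixpoint zcoef (e : zexp) (n : nat) : int :=
  match e with
  | ZV m => (m == n)%:R | ZO => 0
  | ZA a b => zcoef a n + zcoef b n | ZN a => - zcoef a n
  end.

Lemma zevalE s e : zeval s e = \sum_(i < size s) nth 0 s i *~ zcoef e i.
Proof.
elim: e => [n||a IHa b IHb|a IHa] /=.
- case: (ltnP n (size s)) => [ns|sn].
    rewrite (bigD1 (Ordinal ns)) //= eqxx mulr1z big1 ?addr0 // => i /negPf.
    by rewrite -val_eqE /= eq_sym => ->.
  rewrite nth_default // big1 // => i _; rewrite gtn_eqF ?mulr0z //.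
  exact: leq_trans (ltn_ord i) sn.
- by rewrite big1 // => i _; rewrite mulr0z.
- by rewrite IHa IHb -big_split; apply: eq_bigr => i _; rewrite mulrzDr.
- by rewrite IHa -sumrN; apply: eq_bigr => i _; rewrite mulrNz.
Qed.

Lemma zeval_eq s a b :
  all (fun i => zcoef a i == zcoef b i) (iota 0 (size s)) -> zeval s a = zeval s b.
Proof.
move=> /allP ab; rewrite !zevalE; apply: eq_bigr => i _; congr (_ *~ _).
by apply/eqP/ab; rewrite mem_iota /=.
Qed.

End AbelianGroupIdentities.

Ltac zmem t env := match env with
  | nil => constr:(false)
  | cons ?a _ => let _ := match goal with _ => unify t a end in constr:(true)
  | cons _ ?e => zmem t e end.
Ltac zidx t env := match env with
  | cons ?a _ => let _ := match goal with _ => unify t a end in constr:(0%N)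
  | cons _ ?e => let n := zidx t e in constr:(S n) end.
Ltac zvars t env := lazymatch t with
  | (?a + ?b)%R => let e := zvars a env in zvars b e
  | (- ?a)%R => zvars a env
  | 0%R => env
  | _ => let m := zmem t env in
    lazymatch m with true => env | false => constr:(cons t env) end end.
Ltac zreify t env := lazymatch t with
  | (?a + ?b)%R => let x := zreify a env in let y := zreify b env in constr:(ZA x y)
  | (- ?a)%R => let x := zreify a env in constr:(ZN x)
  | 0%R => constr:(ZO)
  | _ => let n := zidx t env in constr:(ZV n) end.
Ltac zmod := lazymatch goal with |- @eq ?T ?l ?r =>
  let e0 := zvars l (@nil T) in let env := zvars r e0 in
  let x := zreify l env in let y := zreify r env in
  apply: (@zeval_eq _ env x y); vm_compute; reflexivity end.

(** * Vector fields *)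

Section VectorFieldAlgebra.
Variables (K : fieldType) (T : tAlg K) (ok : pred nat) (tau : nat -> T).
Hypothesis tl : tlaws ok tau.
Notation O := (O T).
Notation V := (vect_alg T).
Implicit Types (f g k : O) (A B C S : {set 'I_7}) (a b : 'I_7) (D : V).

Lemma o_derC i j f : o_der i (o_der j f) = (-1) ^+ (isSome i && isSome j) *: o_der j (o_der i f).
Proof.
apply/ffunP => S; case: i j => [a|] [b|] /=; rewrite ?expr0 ?expr1 ?scale1r; last by [].
- rewrite [RHS]ffunE !o_derE !inE.
  case: (boolP (a \in S)) => aS; case: (boolP (b \in S)) => bS /=;
    rewrite ?orbT ?scaler0 //.
  rewrite !orbF [b == a]eq_sym; case: eqVneq => ab; first by rewrite !scaler0.
  rewrite !scalerA setUCA; congr (_ *: _).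
  rewrite !inversionsUr ?disjoints1 // -!exprD -exprS -exprD; apply: signr_eq.
  have dab : [disjoint [set a] & [set b]] by rewrite disjoints1 inE.
  have := inversions_swap dab; rewrite !cards1 muln1 => /(congr1 odd); rewrite !oddD /=.
  by case: (odd _); case: (odd _); case: (odd _); case: (odd _).
- by rewrite !ffunE; case: ifP; rewrite ?(tder0 tl) ?(tderZ tl) // ffunE.
- by rewrite !ffunE; case: ifP; rewrite ?(tder0 tl) ?(tderZ tl) // ffunE.
Qed.

Lemma o_xiE a f S : o_mul (o_xi T a) f S =
  if a \in S then (-1) ^+ inversions [set a] (S :\ a) *: f (S :\ a) else 0.
Proof.
rewrite o_mulE; case: ifPn => aS; last first.
  apply: big1 => A AS; rewrite ffunE; case: eqP => [E|_]; last by rewrite (tmul0l tl) scaler0.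
  by move: aS; rewrite -sub1set -E AS.
rewrite (bigD1 [set a]) ?sub1set //= ffunE eqxx (tmul1 tl) big1 ?addr0 // => A /andP[_ /negPf].
by rewrite ffunE => ->; rewrite (tmul0l tl) scaler0.
Qed.

Lemma o_mul1 f : o_mul (o_one T) f = f.
Proof.
apply/ffunP => S; rewrite o_mulE (bigD1 set0) ?sub0set //= ffunE eqxx (tmul1 tl) inversions0l.
rewrite setD0 scale1r big1 ?addr0 // => A /andP[_ /negPf].
by rewrite ffunE => ->; rewrite (tmul0l tl) scaler0.
Qed.

Lemma o_mulr1 f : o_mul f (o_one T) = f.
Proof.
have p1 : o_par false (o_one T) by move=> S; rewrite ffunE; case: (S =P set0) => [->|_]; rewrite ?cards0 ?eqxx.
by rewrite -[RHS]o_mul1 (o_mulC tl _ p1).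
Qed.

Lemma o_der1 i : o_der i (o_one T) = 0.
Proof.
apply/ffunP => S; case: i => [a|]; rewrite !ffunE; last first.
  by case: ifP; rewrite ?(tder1 tl) ?(tder0 tl).
case: ifP => // _; case: eqP => [/setP/(_ a)|]; last by rewrite scaler0.
by rewrite !inE eqxx.
Qed.

Lemma o_der_xi i a : o_der i (o_xi T a) = if i == Some a then o_one T else 0.
Proof.
apply/ffunP => S; case: i => [b|]; last first.
  by rewrite !ffunE; case: ifP; rewrite ?(tder1 tl) ?(tder0 tl) // ffunE.
rewrite o_derE ffunE; case: (boolP (b \in S)) => bS.
  case: ifP => _; rewrite ffunE //; case: eqP => // S0; by rewrite S0 inE in bS.
rewrite (inj_eq Some_inj); case: (eqVneq b a) => [<-|ba]; last first.
  rewrite ffunE; case: eqP => [/setP/(_ b)|]; last by rewrite scaler0.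
  by rewrite !inE eqxx (negPf ba).
have -> : (b |: S == [set b]) = (S == set0).
  apply/eqP/eqP => [E|->]; last by rewrite setU0.
  apply/setP => x; rewrite inE; apply/negP => xS; move/setP/(_ x): E.
  by rewrite !inE xS orbT => /esym/eqP xb; rewrite -xb xS in bS.
rewrite ffunE; case: eqP => [->|]; last by rewrite scaler0.
by rewrite inversions0r scale1r.
Qed.

Lemma o_par_xi a : o_par true (o_xi T a).
Proof. by move=> S; rewrite ffunE; case: (S =P _) => [->|_]; rewrite ?cards1 ?eqxx. Qed.

Lemma o_par_der i s f : o_par s f -> o_par (s (+) isSome i) (o_der i f).
Proof.
move=> fs S; case: i => [a|]; last first.
  by rewrite ffunE addbF => nz; apply: fs; apply: contraNneq nz => ->; rewrite (tder0 tl) eqxx.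
rewrite o_derE; case: ifPn => aS; first by rewrite eqxx.
rewrite scaler_eq0 negb_or => /andP[_ /fs].
by rewrite cardsU1 aS add1n /= => <-; rewrite addbT negbK.
Qed.

Lemma o_par_lin s (c : K) f g : o_par s f -> o_par s g -> o_par s (c *: f + g).
Proof.
move=> fs gs S; rewrite !ffunE => nz.
have [f0|/fs//] := eqVneq (f S) 0; apply: gs.
by apply: contraNneq nz => ->; rewrite f0 scaler0 addr0.
Qed.

Lemma o_par0 s : o_par s (0 : O).
Proof. by move=> S; rewrite ffunE eqxx. Qed.

Lemma o_par_sum s (I : Type) (r : seq I) (P : pred I) (F : I -> O) :
  (forall i, P i -> o_par s (F i)) -> o_par s (\sum_(i <- r | P i) F i).
Proof.
move=> Fs; apply: (big_ind (fun f => o_par s f)) => //; first exact: o_par0.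
by move=> f g fs gs; rewrite -[f]scale1r; apply: o_par_lin.
Qed.

Lemma o_parM s t f g : o_par s f -> o_par t g -> o_par (s (+) t) (o_mul f g).
Proof.
move=> fs gt S; rewrite o_mulE => nz.
have /existsP[A /and3P[AS fA gA]] : [exists A : {set 'I_7},
    [&& A \subset S, f A != 0 & g (S :\: A) != 0]].
  apply: contraNT nz; rewrite negb_exists => /forallP nA; apply/eqP/big1 => A AS.
  have := nA A; rewrite AS /= negb_and !negbK => /orP[]/eqP->;
  by rewrite ?(tmul0l tl) ?(tmul0r tl) scaler0.
by rewrite -(cardsID A S) (setIidPr AS) oddD (fs _ fA) (gt _ gA).
Qed.

Lemma iter_osg_par (s t : bool) f : o_par t f -> iter s osg f = (-1) ^+ (s && t) *: f.
Proof. by case: s => /= ft; rewrite ?(osg_par ft) ?expr0 ?scale1r. Qed.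

Definition v_par (s : bool) D := forall i, o_par (s (+) isSome i) ((D : vect T) i).

Lemma v_parP s D : par s D <-> v_par s D.
Proof.
split=> Ds i S nz; have := Ds i S nz; rewrite /v_parity;
by case: (odd _); case: (isSome i); case: s {Ds}.
Qed.

Lemma v_act_lin D (c : K) f g : v_act D (c *: f + g) = c *: v_act D f + v_act D g.
Proof.
rewrite /v_act scaler_sumr -big_split; apply: eq_bigr => i _.
by rewrite /= (o_der_lin tl) (o_mul_linr tl).
Qed.
Lemma v_act_linl D D' (c : K) f : v_act (c *: D + D') f = c *: v_act D f + v_act D' f.
Proof.
rewrite /v_act scaler_sumr -big_split; apply: eq_bigr => i _.
by rewrite /= !ffunE (o_mul_linl tl).
Qed.
Lemma v_act0 D : v_act D (0 : O) = 0.
Proof. by have := v_act_lin D (-1) 0 0; rewrite scaler0 addr0 scaleN1r addNr. Qed.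
Lemma v_actZ D (c : K) f : v_act D (c *: f) = c *: v_act D f.
Proof. by have := v_act_lin D c f 0; rewrite !addr0 v_act0 addr0. Qed.
Lemma v_actD D f g : v_act D (f + g) = v_act D f + v_act D g.
Proof. by have := v_act_lin D 1 f g; rewrite !scale1r. Qed.
Lemma v_act_sum D (I : Type) (r : seq I) (P : pred I) (F : I -> O) :
  v_act D (\sum_(i <- r | P i) F i) = \sum_(i <- r | P i) v_act D (F i).
Proof. by apply: (big_morph (v_act D)) => [x y|]; rewrite ?v_act0 ?v_actD. Qed.
Lemma v_act0l f : v_act 0 f = 0.
Proof. by rewrite /v_act big1 // => i _; rewrite ffunE (o_mul0l tl). Qed.

Lemma v_actM s D f g : v_par s D ->
  v_act D (o_mul f g) = o_mul (v_act D f) g + o_mul (iter s osg f) (v_act D g).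
Proof.
move=> Ds; rewrite /v_act (o_mul_suml tl) (o_mul_sumr tl) -big_split; apply: eq_bigr => i _ /=.
rewrite (o_derM tl) (o_mulDr tl) !(o_mulA tl); congr (_ + o_mul _ _).
rewrite (o_mulC tl _ (Ds i)); congr (o_mul _ _).
by case: s (isSome i) {Ds} => [] [] //=; rewrite osgK.
Qed.

Lemma o_par_act s t D f : v_par s D -> o_par t f -> o_par (s (+) t) (v_act D f).
Proof.
move=> Ds ft; apply: o_par_sum => i _; have := o_parM (Ds i) (o_par_der (i := i) ft).
by case: (isSome i); case: s {Ds}; case: t {ft}.
Qed.

Lemma v_part_id s D : v_par s D -> forall t, v_part t D = if t == s then D else 0.
Proof.
move=> /v_parP Ds t; apply/ffunP => i; apply/ffunP => S; rewrite !ffunE.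
have [z|/Ds ->] := eqVneq ((D : vect T) i S) 0.
  rewrite z if_same; case: (t == s) => /=; first by rewrite -/((D : vect T) i S) z.
  by rewrite !ffunE.
by rewrite eq_sym; case: (t == s) => //=; rewrite !ffunE.
Qed.

Lemma v_brE s t D D' i : v_par s D -> v_par t D' ->
  (v_br D D' : vect T) i = v_act D ((D' : vect T) i) - (-1) ^+ (s && t) *: v_act D' ((D : vect T) i).
Proof.
move=> Ds Dt; rewrite /v_br; have zi : (0 : vect T) i = 0 by rewrite ffunE.
pose F u w := [ffun j => v_act (v_part u D) ((v_part w D' : vect T) j)
  - (-1) ^+ (u && w) *: v_act (v_part w D') ((v_part u D : vect T) j)] : vect T.
have F0 u w : (u != s) || (w != t) -> F u w i = 0.
  rewrite ffunE (v_part_id Ds) (v_part_id Dt) => /orP[]/negPf-> /=;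
  by rewrite ?v_act0l zi ?v_act0 ?v_act0l scaler0 subr0.
rewrite sum_ffunE (bigD1 s) //= [X in _ + X]big1 ?addr0 => [|u us]; last first.
  by rewrite sum_ffunE big1 // => w _; rewrite [LHS]F0 ?us.
rewrite sum_ffunE (bigD1 t) //= [X in _ + X]big1 ?addr0 => [|w wt]; last first.
  by rewrite [LHS]F0 ?wt ?orbT.
by rewrite [LHS]ffunE (v_part_id Ds) (v_part_id Dt) !eqxx.
Qed.

Lemma v_par_br s t D D' : v_par s D -> v_par t D' -> v_par (s (+) t) (v_br D D').
Proof.
move=> Ds Dt i; rewrite (v_brE i Ds Dt) addrC -scaleNr.
have p1 := o_par_act Ds (Dt i); have p2 := o_par_act Dt (Ds i).
apply: o_par_lin; first by move: p2; rewrite addbA [t (+) s]addbC.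
by move: p1; rewrite addbA.
Qed.

Lemma v_act_br s t D D' f : v_par s D -> v_par t D' ->
  v_act (v_br D D') f = v_act D (v_act D' f) - (-1) ^+ (s && t) *: v_act D' (v_act D f).
Proof.
move=> Ds Dt.
have expand u w D1 D2 : v_par u D1 -> v_par w D2 -> v_act D1 (v_act D2 f) =
    \sum_i o_mul (v_act D1 ((D2 : vect T) i)) (o_der i f) +
    \sum_i \sum_j (-1) ^+ (u && (w (+) isSome i)) *:
      o_mul (o_mul ((D2 : vect T) i) ((D1 : vect T) j)) (o_der j (o_der i f)).
  move=> D1u D2w; rewrite [v_act D2 f]/v_act v_act_sum -big_split; apply: eq_bigr => i _ /=.
  rewrite (v_actM _ _ D1u); congr (_ + _).
  rewrite /v_act (o_mul_sumr tl); apply: eq_bigr => j _.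
  by rewrite (o_mulA tl) (iter_osg_par _ (D2w i)) !(o_mulZl tl).
rewrite (expand _ _ _ _ Ds Dt) (expand _ _ _ _ Dt Ds) scalerDr opprD addrACA.
rewrite [X in _ + (X - _)]exchange_big [X in _ + X](_ : _ = 0) ?addr0; last first.
  apply/eqP; rewrite subr_eq0; apply/eqP; rewrite scaler_sumr; apply: eq_bigr => j _.
  rewrite scaler_sumr; apply: eq_bigr => i _.
  rewrite (o_mulC tl _ (Dt i)) (iter_osg_par _ (Ds j)) (o_derC j i) !(o_mulZl tl, o_mulZr tl).
  rewrite !scalerA -!exprD; congr (_ *: _); apply: signr_eq; rewrite !oddD !oddb.
  by case: s t (isSome i) (isSome j) {Ds Dt} => [] [] [] [].
rewrite {1}/v_act scaler_sumr -sumrB; apply: eq_bigr => i _.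
by rewrite (v_brE i Ds Dt) -scaleNr addrC (o_mul_linl tl) scaleNr addrC.
Qed.

Definition o_gen (i : option 'I_7) : O :=
  if i is Some a then o_xi T a else [ffun S : {set 'I_7} => if S == set0 then tau 1%N else 0].

Lemma v_act_gen D i : v_act D (o_gen i) = (D : vect T) i.
Proof.
rewrite /v_act (bigD1 i) //= big1 ?addr0 => [|j ji].
  case: i => [a|]; first by rewrite /o_gen o_der_xi eqxx o_mulr1.
  rewrite -[RHS]o_mulr1; congr (o_mul _ _); apply/ffunP => S; rewrite !ffunE.
  case: eqP => _; rewrite ?(tder0 tl) // -(tau0 tl); exact: (tder_tau tl) (ok1 tl).
case: i ji => [a|] ji; first by rewrite /o_gen o_der_xi (negPf ji) (o_mul0r tl).
suff -> : o_der j (o_gen None) = 0 by rewrite (o_mul0r tl).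
case: j ji => // a _; apply/ffunP => S; rewrite o_derE !ffunE; case: ifP => // _.
case: eqP => [/setP/(_ a)|]; last by rewrite scaler0.
by rewrite !inE eqxx.
Qed.

Lemma v_act_inj D D' : (forall f, v_act D f = v_act D' f) -> D = D'.
Proof. by move=> DD; apply/ffunP => i; rewrite -!v_act_gen. Qed.

Lemma v_part_lin s (c : K) D D' : v_part s (c *: D + D') = c *: v_part s D + v_part s D' :> V.
Proof.
apply/ffunP => i; apply/ffunP => S; rewrite !ffunE.
by case: ifP; rewrite ?scaler0 ?addr0.
Qed.

Lemma v_part_par s D : v_par s (v_part s D).
Proof.
apply/v_parP => i S; rewrite !ffunE; case: ifP => [/eqP//|_]; by rewrite eqxx.
Qed.

Lemma v_part_split D : D = v_part false D + v_part true D :> V.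
Proof.
apply/ffunP => i; apply/ffunP => S; rewrite !ffunE.
by case: (v_parity i S); rewrite /= ?addr0 ?add0r.
Qed.

Lemma v_br_linl (c : K) D D' E : v_br (c *: D + D') E = c *: v_br D E + v_br D' E :> V.
Proof.
have linE (A B : vect T) i : (c *: A + B) i = c *: A i + B i by rewrite !ffunE.
rewrite /v_br scaler_sumr -big_split; apply: eq_bigr => s _.
rewrite scaler_sumr -big_split; apply: eq_bigr => t _; apply/ffunP => i.
rewrite [RHS]linE [LHS]ffunE [X in _ = c *: X + _]ffunE [X in _ = _ + X]ffunE.
rewrite v_part_lin linE v_act_linl v_act_lin.
by rewrite !scalerDr !scalerN !scalerA opprD addrACA ![_ * c]mulrC.
Qed.

Lemma v_br_linr (c : K) D D' E : v_br E (c *: D + D') = c *: v_br E D + v_br E D' :> V.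
Proof.
have linE (A B : vect T) i : (c *: A + B) i = c *: A i + B i by rewrite !ffunE.
rewrite /v_br scaler_sumr -big_split; apply: eq_bigr => s _.
rewrite scaler_sumr -big_split; apply: eq_bigr => t _; apply/ffunP => i.
rewrite [RHS]linE [LHS]ffunE [X in _ = c *: X + _]ffunE [X in _ = _ + X]ffunE.
rewrite v_part_lin linE v_act_linl v_act_lin.
by rewrite !scalerDr !scalerN !scalerA opprD addrACA ![_ * c]mulrC.
Qed.

Lemma v_br_skew s t D D' : v_par s D -> v_par t D' ->
  v_br D D' = - ((-1) ^+ (s && t) *: v_br D' D) :> V.
Proof.
move=> Ds Dt; apply/ffunP => i; rewrite (v_brE i Ds Dt) ffunE ffunE (v_brE i Dt Ds).
by rewrite andbC scalerBr opprB scalerA -expr2 sqrr_sign scale1r.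
Qed.

Lemma v_brDr D D' E : v_br E (D + D') = v_br E D + v_br E D' :> V.
Proof. by have := v_br_linr 1 D D' E; rewrite !scale1r. Qed.

Lemma v_br_jacobi s t D D' E : v_par s D -> v_par t D' ->
  v_br D (v_br D' E) = v_br (v_br D D') E + (-1) ^+ (s && t) *: v_br D' (v_br D E) :> V.
Proof.
move=> Ds Dt.
suff homog u F : v_par u F -> v_br D (v_br D' F) =
    v_br (v_br D D') F + (-1) ^+ (s && t) *: v_br D' (v_br D F) :> V.
  rewrite [E]v_part_split !v_brDr scalerDr.
  rewrite (homog false) ?(homog true); [|exact: v_part_par..].
  by rewrite !addrA; congr (_ + _); rewrite addrAC.
move=> Fu; apply: v_act_inj => f.
rewrite (addrC (v_br (v_br D D') F)) v_act_linl.
rewrite (v_act_br _ Ds (v_par_br Dt Fu)) (v_act_br _ Dt (v_par_br Ds Fu)).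
rewrite (v_act_br _ (v_par_br Ds Dt) Fu) !(v_act_br _ Ds Fu) !(v_act_br _ Dt Fu) !(v_act_br _ Ds Dt).
have vB D1 g h : v_act D1 (g - h) = v_act D1 g - v_act D1 h.
  by rewrite addrC -scaleN1r v_act_lin scaleN1r addrC.
rewrite !vB !v_actZ !scalerBr !scalerA.
by case: s t u {Ds Dt Fu} => [] [] []; rewrite /= ?expr0 ?expr1 ?mulr1 ?mul1r ?mulN1r
  ?opprK ?scale1r ?scaleN1r; zmod.
Qed.

Lemma v_br_odd_cube D : v_par true D -> v_br D (v_br D D) = 0 :> V.
Proof.
move=> Do; apply: v_act_inj => f; rewrite v_act0l.
rewrite (v_act_br _ Do (v_par_br Do Do)) /= scale1r !(v_act_br _ Do Do) /=.
rewrite expr1 !scaleN1r !opprK v_actD; exact: subrr.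
Qed.

Lemma vect_lie : is_lie_superalgebra (full (V := V)).
Proof.
have par_lin s : subspace (par (s := V) s).
  split=> [i S|c x y /v_parP xs /v_parP ys]; first by rewrite !ffunE eqxx.
  by apply/v_parP => i; rewrite !ffunE; apply: o_par_lin.
split=> //.
- move=> x x0 x1; apply/ffunP => i; apply/ffunP => S; rewrite !ffunE; apply/eqP.
  by apply/negPn/negP => nz; have := x0 i S nz; rewrite (x1 i S nz).
- split=> // x _; exists (v_part false x), (v_part true x).
  by split=> //; [apply/v_parP/v_part_par..|exact: v_part_split].
- by move=> *; apply: v_br_linl.
- by move=> *; apply: v_br_linr.
- by move=> s t x y _ _ /v_parP xs /v_parP yt; apply/v_parP/v_par_br.
- by move=> s t x y _ _ /v_parP xs /v_parP yt; apply: v_br_skew.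
- by move=> s t x y w _ _ _ /v_parP xs /v_parP yt; apply: v_br_jacobi.
- by move=> x _ /v_parP xo; apply: v_br_odd_cube.
Qed.

End VectorFieldAlgebra.

Arguments o_par_xi {K} T a S _.

(** * Contact potentials *)

Section ContactFields.
Variables (K : fieldType) (T : tAlg K) (ok : pred nat) (tau : nat -> T).
Hypothesis tl : tlaws ok tau.
Variables (B Bi : 'M[K]_7).
Hypothesis two : (2%:R : K) != 0.
Hypothesis Bsym : B^T = B.
Hypothesis BBi : B *m Bi = 1%:M.
Notation O := (O T).
Notation V := (vect_alg T).
Implicit Types (f g k : O) (a b c : 'I_7) (D : V).

Definition xi a f : O := o_mul (o_xi T a) f.
Definition dx a f : O := o_der (Some a) f.
Definition dt f : O := o_der None f.

Lemma xi_lin a (l : K) f g : xi a (l *: f + g) = l *: xi a f + xi a g.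
Proof. exact: o_mul_linr tl _ _ _ _. Qed.
Lemma dx_lin a (l : K) f g : dx a (l *: f + g) = l *: dx a f + dx a g.
Proof. exact: o_der_lin tl _ _ _ _. Qed.
Lemma dt_lin (l : K) f g : dt (l *: f + g) = l *: dt f + dt g.
Proof. exact: o_der_lin tl _ _ _ _. Qed.

Lemma dx_xi a b f : dx a (xi b f) = (a == b)%:R *: f - xi b (dx a f).
Proof.
rewrite /dx /xi (o_derM tl) (o_der_xi tl) (inj_eq Some_inj) /=.
rewrite (osg_par (o_par_xi T b)) (o_mulZl tl) expr1 scaleN1r.
by case: (a == b); rewrite ?(o_mul0l tl) ?(o_mul1 tl) ?scale1r ?scale0r.
Qed.

Lemma xi_xi a b f : xi a (xi b f) = - xi b (xi a f).
Proof.
rewrite /xi !(o_mulA tl) (o_mulC tl _ (o_par_xi T a)) /= (osg_par (o_par_xi T b)).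
by rewrite !(o_mulZl tl) expr1 scaleN1r.
Qed.

Lemma dx_dx a b f : dx a (dx b f) = - dx b (dx a f).
Proof. by rewrite /dx (o_derC tl) expr1 scaleN1r. Qed.

Lemma dt_dx a f : dt (dx a f) = dx a (dt f).
Proof. by rewrite /dt /dx (o_derC tl) expr0 scale1r. Qed.

Lemma dt_xi a f : dt (xi a f) = xi a (dt f).
Proof. by rewrite /dt /xi (o_derM tl) (o_der_xi tl) /= (o_mul0l tl) add0r. Qed.

Lemma linop0 (F : O -> O) : (forall (l : K) f g, F (l *: f + g) = l *: F f + F g) -> F 0 = 0.
Proof. by move=> Fl; have := Fl (-1) 0 0; rewrite scaler0 addr0 scaleN1r addNr. Qed.
Lemma linopZ (F : O -> O) : (forall (l : K) f g, F (l *: f + g) = l *: F f + F g) ->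
  forall (l : K) f, F (l *: f) = l *: F f.
Proof. by move=> Fl l f; have := Fl l f 0; rewrite !addr0 linop0 ?addr0. Qed.
Lemma linopD (F : O -> O) : (forall (l : K) f g, F (l *: f + g) = l *: F f + F g) ->
  forall f g, F (f + g) = F f + F g.
Proof. by move=> Fl f g; have := Fl 1 f g; rewrite !scale1r. Qed.
Lemma linopN (F : O -> O) : (forall (l : K) f g, F (l *: f + g) = l *: F f + F g) ->
  forall f, F (- f) = - F f.
Proof. by move=> Fl f; rewrite -scaleN1r linopZ // scaleN1r. Qed.
Lemma linop_sum (F : O -> O) (I : Type) (r : seq I) (P : pred I) (G : I -> O) :
  (forall (l : K) f g, F (l *: f + g) = l *: F f + F g) ->
  F (\sum_(i <- r | P i) G i) = \sum_(i <- r | P i) F (G i).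
Proof. by move=> Fl; apply: (big_morph F) => [x y|]; rewrite ?linop0 ?linopD. Qed.

Definition yy a f : O := \sum_c B a c *: xi c f.

Lemma yy_lin a (c : K) f g : yy a (c *: f + g) = c *: yy a f + yy a g.
Proof.
rewrite /yy scaler_sumr -big_split; apply: eq_bigr => b _.
by rewrite /= xi_lin scalerDr !scalerA [_ * c]mulrC.
Qed.

Lemma xi_yy a b f : xi a (yy b f) = - yy b (xi a f).
Proof.
rewrite /yy (linop_sum _ _ _ (xi_lin a)) -sumrN; apply: eq_bigr => c _.
by rewrite (linopZ (xi_lin a)) xi_xi scalerN.
Qed.

Lemma yy_yy a b f : yy a (yy b f) = - yy b (yy a f).
Proof.
rewrite {1}/yy; under eq_bigr => c _ do rewrite xi_yy scalerN.
rewrite sumrN [yy a f]/yy (linop_sum _ _ _ (yy_lin b)); congr (- _).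
by apply: eq_bigr => c _; rewrite (linopZ (yy_lin b)).
Qed.

Lemma Bsymm a b : B a b = B b a.
Proof. by rewrite -{1}Bsym mxE. Qed.

Lemma dx_yy a b f : dx a (yy b f) = B a b *: f - yy b (dx a f).
Proof.
rewrite /yy (linop_sum _ _ _ (dx_lin a)).
under eq_bigr => c _ do rewrite (linopZ (dx_lin a)) dx_xi scalerBr scalerA.
rewrite sumrB (bigD1 a) //= eqxx mulr1 big1 ?addr0 ?(Bsymm a) // => c /negPf ca.
by rewrite eq_sym ca mulr0 scale0r.
Qed.

Lemma dt_yy a f : dt (yy a f) = yy a (dt f).
Proof.
rewrite /yy (linop_sum _ _ _ dt_lin); apply: eq_bigr => b _.
by rewrite (linopZ dt_lin) dt_xi.
Qed.

(* The two commuting invariant frames: [ee 2^-1 a] is the action of the image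
   of e_a, and the fields [ee (- 2^-1) b] commute with all of them. *)
Definition ee (l : K) a f : O := dx a f + l *: yy a (dt f).

Lemma ee_lin l a (c : K) f g : ee l a (c *: f + g) = c *: ee l a f + ee l a g.
Proof.
rewrite /ee dx_lin dt_lin yy_lin !scalerDr !scalerA [_ * c]mulrC. zmod.
Qed.

Lemma dt_ee l a f : dt (ee l a f) = ee l a (dt f).
Proof. by rewrite /ee (linopD dt_lin) dt_dx (linopZ dt_lin) dt_yy. Qed.

Lemma ee_xi l a b f : ee l a (xi b f) = (a == b)%:R *: f - xi b (ee l a f).
Proof.
rewrite /ee dx_xi dt_xi (linopD (xi_lin b)) (linopZ (xi_lin b)) xi_yy scalerN; zmod.
Qed.

Lemma ee_ee l m a b f :
  ee l a (ee m b f) + ee m b (ee l a f) = ((l + m) * B a b) *: dt f.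
Proof.
rewrite /ee !(linopD (dx_lin _)) !(linopD dt_lin) !(linopD (yy_lin _)).
rewrite !(linopZ (dx_lin _)) !(linopZ dt_lin) !(linopZ (yy_lin _)) !dx_yy !dt_dx !dt_yy.
rewrite (dx_dx b a) (yy_yy b a) (Bsymm b a) mulrDl scalerDl -!scalerA !scalerBr !scalerDr.
by rewrite !scalerN !scalerA (mulrC m l); zmod.
Qed.

Definition ea := ee 2%:R^-1.
Definition eh := ee (- 2%:R^-1).

Lemma dx_one a : dx a (o_one T) = 0. Proof. exact: o_der1 tl _. Qed.
Lemma dt_one : dt (o_one T) = 0. Proof. exact: o_der1 tl _. Qed.
Lemma ee_one l a : ee l a (o_one T) = 0.
Proof. by rewrite /ee dx_one dt_one (linop0 (yy_lin a)) scaler0 addr0. Qed.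

Lemma ea_lin a (l : K) f g : ea a (l *: f + g) = l *: ea a f + ea a g.
Proof. exact: ee_lin. Qed.
Lemma eh_lin a (l : K) f g : eh a (l *: f + g) = l *: eh a f + eh a g.
Proof. exact: ee_lin. Qed.

Lemma ea_xi a b f : ea a (xi b f) = (a == b)%:R *: f - xi b (ea a f).
Proof. exact: ee_xi. Qed.

Lemma half2 : 2%:R^-1 + 2%:R^-1 = 1 :> K.
Proof. by apply: (mulfI two); rewrite mulrDr mulr1 divff. Qed.

Lemma ea_ea a b f : ea a (ea b f) + ea b (ea a f) = B a b *: dt f.
Proof. by rewrite ee_ee half2 mul1r. Qed.

Lemma ea_eh a b f : ea a (eh b f) = - eh b (ea a f).
Proof. by apply/eqP; rewrite -addr_eq0 ee_ee subrr mul0r scale0r. Qed.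

Lemma osg_ee l a f : osg (ee l a f) = - ee l a (osg f).
Proof.
rewrite /ee addrC osg_lin /dx /yy /dt !(o_der_osg tl) expr1 expr0 scale1r scaleN1r.
rewrite (linop_sum _ _ _ (@osg_lin _ _)) opprD opprK addrC; congr (_ + _).
rewrite -scalerN -sumrN; congr (_ *: _); apply: eq_bigr => b _.
rewrite (linopZ (@osg_lin _ _)) /xi (osgM tl) (osg_par (o_par_xi T b)).
by rewrite (o_mulZl tl) expr1 scaleN1r scalerN.
Qed.

Lemma osg_ea a f : osg (ea a f) = - ea a (osg f).
Proof. exact: osg_ee. Qed.

Definition KFa f a : O := \sum_b Bi a b *: osg (eh b f).
Definition KF f : V :=
  [ffun i => if i is Some a then KFa f a
             else f - 2%:R^-1 *: \sum_c xi c (eh c f)].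

Lemma KFSome f a : (KF f : vect T) (Some a) = KFa f a.
Proof. by rewrite ffunE. Qed.
Lemma KFNone f : (KF f : vect T) None = f - 2%:R^-1 *: \sum_c xi c (eh c f).
Proof. by rewrite ffunE. Qed.

Lemma KFa_lin (l : K) f g a : KFa (l *: f + g) a = l *: KFa f a + KFa g a.
Proof.
rewrite /KFa scaler_sumr -big_split; apply: eq_bigr => b _.
by rewrite /= eh_lin osg_lin scalerDr !scalerA [_ * l]mulrC.
Qed.

Lemma KF_lin (l : K) f g : KF (l *: f + g) = l *: KF f + KF g.
Proof.
have linE (A C : vect T) i : (l *: A + C) i = l *: A i + C i by rewrite !ffunE.
apply/ffunP => -[a|]; rewrite linE ?KFSome ?KFNone; first exact: KFa_lin.
under eq_bigr => c _ do rewrite eh_lin xi_lin.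
rewrite big_split -scaler_sumr /= !scalerDr !scalerN !scalerA [_ * l]mulrC; zmod.
Qed.

Lemma v_act_e a f : v_act (v_e T B a) f = ea a f.
Proof.
rewrite /v_act (bigD1 None) //= (bigD1 (Some a)) //= big1 ?addr0 => [|[b|]//]; last first.
  rewrite andTb ffunE => /negPf ba; rewrite (inj_eq Some_inj) in ba.
  by rewrite ba (o_mul0l tl).
rewrite !ffunE eqxx (o_mul1 tl) addrC; congr (_ + _).
rewrite (o_mul_suml tl) scaler_sumr; apply: eq_bigr => b _.
by rewrite (o_mulZl tl) scalerA mulrC.
Qed.

Lemma o_par1 : o_par false (o_one T).
Proof. by move=> S; rewrite ffunE; case: (S =P set0) => [->|_]; rewrite ?cards0 ?eqxx. Qed.

Lemma v_par_e a : v_par true (v_e T B a).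
Proof.
move=> [b|] /=; rewrite ffunE; first by case: ifP => _; [exact: o_par1|exact: o_par0].
apply: o_par_sum => b _; rewrite -[_ *: _]addr0; apply: o_par_lin; last exact: o_par0.
exact: o_par_xi.
Qed.

Arguments v_par_e : clear implicits.

Lemma v_par_dt : v_par false (v_dt T).
Proof. by move=> [b|] /=; rewrite ffunE //=; [exact: o_par0|exact: o_par1]. Qed.

Lemma v_act_const D (c : K) : v_act D (c *: o_one T) = 0.
Proof.
rewrite /v_act big1 // => i _.
by rewrite (linopZ (o_der_lin tl i)) (o_der1 tl) scaler0 (o_mul0r tl).
Qed.

Lemma v_br_e_Some a s D b : v_par s D ->
  (v_br (v_e T B a) D : vect T) (Some b) = ea a ((D : vect T) (Some b)).
Proof.
move=> Ds; rewrite (v_brE tl _ (v_par_e a) Ds) v_act_e [v_e T B a _]ffunE.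
case: ifP => _; last by rewrite (v_act0 tl) scaler0 subr0.
by rewrite -[o_one T]scale1r v_act_const scaler0 subr0.
Qed.

Lemma v_br_e_None a s D : v_par s D ->
  (v_br (v_e T B a) D : vect T) None =
  ea a ((D : vect T) None) - (-1) ^+ s *: (2%:R^-1 *: \sum_b B a b *: (D : vect T) (Some b)).
Proof.
move=> Ds; rewrite (v_brE tl _ (v_par_e a) Ds) v_act_e [v_e T B a _]ffunE.
congr (_ - _ *: _); rewrite (v_act_sum tl) scaler_sumr; apply: eq_bigr => b _.
rewrite (v_actZ tl) -[o_xi T b]/(o_gen tau (Some b)) (v_act_gen tl) scalerA.
by rewrite mulrC.
Qed.

Lemma v_br_dt s D : v_par s D -> v_br (v_dt T) D = [ffun i => dt ((D : vect T) i)] :> V.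
Proof.
move=> Ds; apply/ffunP => i; rewrite (v_brE tl _ v_par_dt Ds) [RHS]ffunE.
have -> : (v_dt T) i = (if i is None then 1 else 0) *: o_one T.
  by rewrite ffunE; case: i => [b|] /=; rewrite ?scale0r ?scale1r.
rewrite v_act_const scaler0 subr0 /v_act (bigD1 None) //= ffunE (o_mul1 tl).
by rewrite big1 ?addr0 // => -[b|]// _; rewrite ffunE (o_mul0l tl).
Qed.

Lemma o_par_ee l s a f : o_par s f -> o_par (~~ s) (ee l a f).
Proof.
move=> fs; rewrite /ee addrC; apply: o_par_lin; last first.
  by have := o_par_der tl (i := Some a) fs; rewrite /= addbT.
apply: o_par_sum => b _; rewrite -[_ *: _]addr0; apply: o_par_lin; last exact: o_par0.
have := o_parM tl (o_par_xi T b) (o_par_der tl (i := None) fs).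
by rewrite /= addbF.
Qed.

Lemma o_par_osg s f : o_par s f -> o_par s (osg f).
Proof.
by move=> fs; rewrite (osg_par fs) -[_ *: _]addr0; apply: o_par_lin => //; exact: o_par0.
Qed.

Lemma v_par_KF s f : o_par s f -> v_par s (KF f).
Proof.
move=> fs [a|] /=; rewrite ffunE /=.
  rewrite addbT; apply: o_par_sum => b _; rewrite -[_ *: _]addr0.
  by apply: o_par_lin; [apply/o_par_osg/o_par_ee|exact: o_par0].
rewrite addbF addrC -scaleNr; apply: o_par_lin => //.
rewrite -[s]negbK; apply: o_par_sum => b _.
exact: (o_parM tl (o_par_xi T b) (o_par_ee (l := - 2%:R^-1) (a := b) fs)).
Qed.

Lemma BKFa f a : \sum_b B a b *: KFa f b = osg (eh a f).
Proof.
rewrite /KFa; under eq_bigr => b _ do rewrite scaler_sumr.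
rewrite exchange_big (bigD1 a) //= [X in _ + X]big1 ?addr0 => [|c ca].
  under eq_bigr => b _ do rewrite scalerA.
  rewrite -scaler_suml -[RHS]scale1r; congr (_ *: _).
  by have /matrixP/(_ a a) := BBi; rewrite !mxE eqxx => ->.
under eq_bigr => b _ do rewrite scalerA.
rewrite -scaler_suml; have /matrixP/(_ a c) := BBi; rewrite !mxE eq_sym (negPf ca) => ->.
by rewrite scale0r.
Qed.

Lemma o_par_split f : f = [ffun S : {set 'I_7} => if odd #|S| then 0 else f S] +
  [ffun S : {set 'I_7} => if odd #|S| then f S else 0].
Proof. by apply/ffunP => S; rewrite !ffunE; case: ifP; rewrite ?addr0 ?add0r. Qed.

Lemma o_par_ind (P : O -> Prop) : (forall s f, o_par s f -> P f) ->
  (forall f g, P f -> P g -> P (f + g)) -> forall f, P f.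
Proof.
move=> Ph PD f; rewrite (o_par_split f); apply: PD.
  by apply: (Ph false) => S; rewrite ffunE; case: ifP => //; rewrite eqxx.
by apply: (Ph true) => S; rewrite ffunE; case: ifP => //; rewrite eqxx.
Qed.

Lemma KFD f g : KF (f + g) = KF f + KF g.
Proof. by have := KF_lin 1 f g; rewrite !scale1r. Qed.
Lemma KF0 : KF 0 = 0.
Proof. by have := KF_lin (-1) 0 0; rewrite scaler0 addr0 scaleN1r addNr. Qed.
Lemma KFZ (l : K) f : KF (l *: f) = l *: KF f.
Proof. by have := KF_lin l f 0; rewrite !addr0 KF0 addr0. Qed.
Lemma KF_sum (I : Type) (r : seq I) (P : pred I) (G : I -> O) :
  KF (\sum_(i <- r | P i) G i) = \sum_(i <- r | P i) KF (G i).
Proof. by apply: (big_morph KF) => [x y|]; rewrite ?KF0 ?KFD. Qed.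

Lemma v_br_e_KF a f : v_br (v_e T B a) (KF f) = KF (ea a f) :> V.
Proof.
elim/o_par_ind: f => [s f fs|f g IHf IHg]; last first.
  by rewrite KFD (v_brDr tl) IHf IHg (linopD (ea_lin _)) KFD.
apply/ffunP => -[b|].
  rewrite (v_br_e_Some _ _ (v_par_KF fs)) !KFSome /KFa (linop_sum _ _ _ (ea_lin _)).
  apply: eq_bigr => c _; rewrite (linopZ (ea_lin _)); congr (_ *: _).
  by apply: oppr_inj; rewrite -osg_ea ea_eh (linopN (@osg_lin _ _)).
rewrite (v_br_e_None _ (v_par_KF fs)) !KFNone.
under [X in _ - _ *: (_ *: X)]eq_bigr => b _ do rewrite KFSome.
rewrite BKFa (osg_par (o_par_ee (a := a) fs)) -/(eh a).
rewrite (linopD (ea_lin _)) (linopN (ea_lin _)) (linopZ (ea_lin _)).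
rewrite (linop_sum _ _ _ (ea_lin _)).
under [in LHS]eq_bigr => c _ do rewrite ea_xi ea_eh (linopN (xi_lin _)) opprK.
rewrite big_split /= [X in _ *: (X + _)](bigD1 a) //= eqxx scale1r.
rewrite [X in _ *: (_ + X + _)]big1 ?addr0; last first.
  by move=> c /negPf ca; rewrite eq_sym ca scale0r.
rewrite scalerDr !scalerA.
have -> : ((-1) ^+ s * 2%:R^-1 * (-1) ^+ ~~ s)%R = - 2%:R^-1 :> K.
  by case: (s); rewrite /= ?expr0 ?expr1 ?mul1r ?mulr1 ?mulN1r ?mulrN1.
by rewrite scaleNr; zmod.
Qed.

End ContactFields.

Arguments v_par_e {K T} B a i S _.

Section Degrees.
Variables (K : fieldType) (T : tAlg K) (ok : pred nat) (tau : nat -> T).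
Hypothesis tl : tlaws ok tau.
Variables (B Bi : 'M[K]_7).
Hypothesis Bsym : B^T = B.
Hypothesis BBi : B *m Bi = 1%:M.
Notation O := (O T).
Notation V := (vect_alg T).
Implicit Types (f g : O) (a b c : 'I_7) (D : V) (k : int).
Notation xi := (@xi K T).
Notation dx := (@dx K T).
Notation dt := (@dt K T).
Notation yy := (@yy K T B).
Notation ea := (@ea K T B).
Notation KF := (@KF K T B Bi).

Definition o_deg k f := forall (S : {set 'I_7}) r,
  t_coef r (f S) != 0 -> (2 * r + #|S|)%:Z = k.

Lemma o_deg0 k : o_deg k 0.
Proof. by move=> S r; rewrite ffunE (tcoef0 tl) eqxx. Qed.

Lemma o_deg_lin k (l : K) f g : o_deg k f -> o_deg k g -> o_deg k (l *: f + g).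
Proof.
move=> fk gk S r; rewrite !ffunE (tcoefD tl) (tcoefZ tl).
have [z|/fk//] := eqVneq (t_coef r (f S)) 0.
by rewrite z mulr0 add0r; apply: gk.
Qed.

Lemma o_degZ k (l : K) f : o_deg k f -> o_deg k (l *: f).
Proof. by move=> fk; rewrite -[_ *: _]addr0; apply: o_deg_lin => //; apply: o_deg0. Qed.

Lemma o_degD k f g : o_deg k f -> o_deg k g -> o_deg k (f + g).
Proof. by move=> fk gk; rewrite -[f]scale1r; apply: o_deg_lin. Qed.

Lemma o_deg_sum k (I : Type) (r : seq I) (P : pred I) (F : I -> O) :
  (forall i, P i -> o_deg k (F i)) -> o_deg k (\sum_(i <- r | P i) F i).
Proof.
move=> Fs; apply: (big_ind (fun f => o_deg k f)) => //; first exact: o_deg0.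
exact: o_degD.
Qed.

Lemma o_deg_dx k a f : o_deg k f -> o_deg (k - 1) (dx a f).
Proof.
move=> fk S r; rewrite (o_derE); case: ifPn => aS; first by rewrite (tcoef0 tl) eqxx.
rewrite (tcoefZ tl) mulf_eq0 negb_or => /andP[_ /fk <-].
by rewrite cardsU1 aS add1n addnS intS addrC addKr.
Qed.

Lemma o_deg_xi k a f : o_deg k f -> o_deg (k + 1) (xi a f).
Proof.
move=> fk S r; rewrite (o_xiE tl); case: ifPn => aS; last by rewrite (tcoef0 tl) eqxx.
rewrite (tcoefZ tl) mulf_eq0 negb_or => /andP[_ /fk <-].
by rewrite (cardsD1 a S) aS add1n addnS intS addrC.
Qed.

Lemma o_deg_dt k f : o_deg k f -> o_deg (k - 2) (dt f).
Proof.
move=> fk S r nz; have := fk S r.+1; move=> <-; first by lia.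
by apply: contra nz => /eqP z; rewrite ffunE; apply/eqP/(tcoef_der tl).
Qed.

Lemma o_deg_yy k a f : o_deg k f -> o_deg (k + 1) (yy a f).
Proof. by move=> fk; apply: o_deg_sum => b _; apply/o_degZ/o_deg_xi. Qed.

Lemma o_deg_ee k (l : K) a f : o_deg k f -> o_deg (k - 1) (ee B l a f).
Proof.
move=> fk; apply: o_degD; first exact: o_deg_dx.
apply: o_degZ; have -> : k - 1 = k - 2 + 1 by lia.
exact/o_deg_yy/o_deg_dt.
Qed.

Lemma o_deg_osg k f : o_deg k f -> o_deg k (osg f).
Proof.
by move=> fk S r; rewrite ffunE (tcoefZ tl) mulf_eq0 negb_or => /andP[_ /fk].
Qed.

Lemma o_deg_par k f : o_deg k f -> o_par (odd `|k|%N) f.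
Proof.
move=> fk S nz; have [n hn] := tcoef_fin tl (f S).
have /existsP[r /fk <-] : [exists r : 'I_n, t_coef r (f S) != 0].
  apply: contraNT nz; rewrite negb_exists => /forallP z; apply/eqP/(tcoef_ext tl) => r.
  case: (ltnP r n) => [rn|/hn//]; by have := z (Ordinal rn); rewrite negbK => /eqP.
by rewrite /= oddD mul2n odd_double.
Qed.

Lemma o_deg_uniq k k' f : o_deg k f -> o_deg k' f -> k != k' -> f = 0.
Proof.
move=> fk fk' kk'; apply/ffunP => S; rewrite ffunE; apply: (tcoef_ext tl) => r.
apply/eqP; apply: contraNT kk' => nz; by rewrite -(fk _ _ nz) (fk' _ _ nz).
Qed.

Lemma o_deg_one : o_deg 0 (o_one T).
Proof.
move=> S r; rewrite ffunE; case: (S =P set0) => [->|_]; last by rewrite (tcoef0 tl) eqxx.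
by rewrite cards0 -(tau0 tl); have [->//|r0] := eqVneq r 0%N; rewrite (tcoef_tau tl) // eqxx.
Qed.

Lemma v_degP k D :
  v_deg k D <-> forall i, o_deg (k + (if i is Some _ then 1 else 2)) ((D : vect T) i).
Proof.
split=> Dk i S r nz.
  by rewrite -(Dk i S r nz) subrK.
by rewrite (Dk i S r nz) addrK.
Qed.

Lemma v_deg_par k D : v_deg k D -> v_par (odd `|k|%N) D.
Proof.
move=> /v_degP Dk [a|] /=; have := o_deg_par (Dk _).
  by move=> /(_ (Some a)); congr o_par; lia.
by move=> /(_ None); congr o_par; lia.
Qed.

Lemma v_deg_lin k (l : K) D D' : v_deg k D -> v_deg k D' -> v_deg k (l *: D + D').
Proof.
move=> /v_degP Dk /v_degP Dk'; apply/v_degP => i; rewrite !ffunE; exact: o_deg_lin.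
Qed.

Lemma v_deg0 k : v_deg k (0 : V).
Proof. by apply/v_degP => i; rewrite ffunE; apply: o_deg0. Qed.

Lemma v_deg_KF k f : o_deg k f -> v_deg (k - 2) (KF f).
Proof.
move=> fk; apply/v_degP => -[a|]; rewrite ?KFSome ?KFNone.
  apply: o_deg_sum => b _; apply/o_degZ/o_deg_osg.
  have -> : k - 2 + 1 = k - 1 by lia. exact: o_deg_ee.
rewrite subrK addrC -scaleNr; apply: o_deg_lin => //; apply: o_deg_sum => c _.
have -> : k = k - 1 + 1 by lia.
exact/o_deg_xi/o_deg_ee.
Qed.

Lemma o_degM k l f g : o_deg k f -> o_deg l g -> o_deg (k + l) (o_mul f g).
Proof.
move=> fk gl S r; rewrite o_mulE (tcoef_sum tl) => nz.
have /existsP[A /andP[AS nA]] : [exists A : {set 'I_7}, (A \subset S) &&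
    (t_coef r ((-1) ^+ inversions A (S :\: A) *: t_mul (f A) (g (S :\: A))) != 0)].
  apply: contraNT nz; rewrite negb_exists => /forallP z; apply/eqP/big1 => A AS.
  by apply/eqP; have := z A; rewrite AS negbK.
have /existsP[i /andP[fi gi]] : [exists i : 'I_r.+1,
    (t_coef i (f A) != 0) && (t_coef (r - i)%N (g (S :\: A)) != 0)].
  apply: contraNT nA; rewrite negb_exists => /forallP z; rewrite (tcoefZ tl).
  rewrite (tcoef_mul tl) ?mulr0 // => i ir.
  have := z (Ordinal (ir : (i < r.+1)%N)); rewrite negb_and !negbK => /orP[]/eqP; by [left|right].
rewrite -(fk _ _ fi) -(gl _ _ gi) -(cardsID A S) (setIidPr AS).
by rewrite -PoszD addnACA -mulnDr subnKC // -ltnS.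
Qed.

Lemma v_deg_br k l D D' : v_deg k D -> v_deg l D' -> v_deg (k + l) (br D D').
Proof.
move=> Dk Dl; have Ds := v_deg_par Dk; have Ds' := v_deg_par Dl.
have act m n (E : V) f : v_deg m E -> o_deg n f -> o_deg (m + n) (v_act E f).
  move=> /v_degP Em fn; apply: o_deg_sum => -[a|] _.
    have -> : m + n = (m + 1) + (n - 1) by lia.
    by apply: o_degM; [exact: (Em (Some a))|exact: o_deg_dx].
  have -> : m + n = (m + 2) + (n - 2) by lia.
  by apply: o_degM; [exact: (Em None)|exact: o_deg_dt].
have dk := Dk; have dl := Dl; move/v_degP: dk => dk; move/v_degP: dl => dl.
apply/v_degP => i; rewrite [br D D' _](v_brE tl i Ds Ds') -scaleNr [X in o_deg _ X]addrC.
apply: o_deg_lin; rewrite -addrA; last exact: act.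
by rewrite addrCA; apply: act.
Qed.

Hypothesis two : (2%:R : K) != 0.

Lemma B_neq0 : exists a b, B a b != 0.
Proof.
case: (pickP (fun ab : 'I_7 * 'I_7 => B ab.1 ab.2 != 0)) => [[a b] ab|z].
  by exists a, b.
have B0 : B = 0.
  by apply/matrixP => a b; have /negbT := z (a, b); rewrite negbK mxE => /eqP.
have /matrixP/(_ 0 0)/eqP := BBi; rewrite B0 mul0mx !mxE eqxx eq_sym.
by rewrite oner_eq0.
Qed.

Lemma ea_const f : (forall b, ea b f = 0) -> exists l, f = l *: o_one T.
Proof.
move=> ef; have [a [b ab]] := B_neq0.
have dtf : dt f = 0.
  have := ea_ea tl two Bsym a b f; rewrite !ef !(linop0 (ea_lin tl B _)) addr0.
  by move/esym/eqP; rewrite scaler_eq0 (negPf ab) => /eqP.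
have dxf c : dx c f = 0.
  by have := ef c; rewrite /ea /ee dtf (linop0 (yy_lin tl B _)) scaler0 addr0.
have [l fl] : exists l, f set0 = l *: t_one T.
  rewrite -(tau0 tl); apply: (tau_span tl) => -[//|r] _; apply/(tcoef_der tl).
  by have /ffunP/(_ set0) := dtf; rewrite !ffunE => ->; rewrite (tcoef0 tl).
exists l; apply/ffunP => S; rewrite !ffunE; case: (set_0Vmem S) => [->|[c cS]].
  by rewrite eqxx.
rewrite ifN; last by apply: contraTneq cS => ->; rewrite inE.
have /ffunP/(_ (S :\ c)) := dxf c; rewrite o_derE !inE eqxx /= setD1K // ffunE scaler0.
by move/eqP; rewrite scaler_eq0 signr_eq0 => /eqP.
Qed.

Lemma o_deg_const k (l : K) : o_deg k (l *: o_one T) -> k != 0 -> l *: o_one T = 0.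
Proof. by move=> fk; apply: (o_deg_uniq fk); apply/o_degZ/o_deg_one. Qed.

Lemma v_inj k D : v_deg k D -> 0 <= k -> (forall b, v_br (v_e T B b) D = 0 :> V) -> D = 0.
Proof.
move=> Dk k0 eD; have Ds := v_deg_par Dk; move/v_degP: Dk => Dk.
have Da a : (D : vect T) (Some a) = 0.
  have /ea_const[l fl] : forall b, ea b ((D : vect T) (Some a)) = 0.
    by move=> b; rewrite -(v_br_e_Some tl _ _ _ Ds) eD ffunE.
  by have := Dk (Some a); rewrite fl => /o_deg_const; apply; lia.
apply/ffunP => -[a|]; rewrite ffunE //.
have /ea_const[l fl] : forall b, ea b ((D : vect T) None) = 0.
  move=> b; have /ffunP/(_ None) := eD b; rewrite (v_br_e_None tl _ _ Ds) ffunE.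
  by rewrite big1 ?scaler0 ?subr0 // => c _; rewrite Da scaler0.
by have := Dk None; rewrite fl => /o_deg_const; apply; lia.
Qed.

Definition contact_pot D : O := (D : vect T) None +
  2%:R^-1 *: \sum_a yy a (osg ((D : vect T) (Some a))).

Lemma contact_pot_KF f : contact_pot (KF f) = f.
Proof.
rewrite /contact_pot KFNone; set X := \sum_c _; set Y := \sum_a _.
suff -> : Y = X by rewrite subrK.
rewrite /Y /yy exchange_big; apply: eq_bigr => c _ /=.
rewrite -[eh _ _ _]osgK -(BKFa BBi) (linop_sum _ _ _ (@osg_lin _ _)) (linop_sum _ _ _ (xi_lin tl c)).
apply: eq_bigr => a _; rewrite KFSome (linopZ (@osg_lin _ _)) (linopZ (xi_lin tl c)).
by rewrite (Bsymm Bsym).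
Qed.

Lemma contact_pot_deg k D : v_deg k D -> o_deg (k + 2) (contact_pot D).
Proof.
move=> /v_degP Dk; apply: o_degD; first exact: (Dk None).
apply/o_degZ/o_deg_sum => a _; have -> : k + 2 = k + 1 + 1 by lia.
exact/o_deg_yy/o_deg_osg/(Dk (Some a)).
Qed.

Lemma ea_yy a b f : ea a (yy b f) = B a b *: f - yy b (ea a f).
Proof.
rewrite /ea /ee (dx_yy tl Bsym) (dt_yy tl) (linopD (yy_lin tl B _)) (linopZ (yy_lin tl B _)).
by rewrite (yy_yy tl) scalerN; zmod.
Qed.

Lemma ea_contact_pot k b D : v_deg k D ->
  ea b (contact_pot D) = contact_pot (v_br (v_e T B b) D).
Proof.
move=> Dk; have Ds := v_deg_par Dk; rewrite /contact_pot (v_br_e_None tl _ _ Ds).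
rewrite (linopD (ea_lin tl B _)) (linopZ (ea_lin tl B _)) (linop_sum _ _ _ (ea_lin tl B _)).
rewrite -[RHS]addrA; congr (_ + _).
have -> : \sum_a yy a (osg ((v_br (v_e T B b) D : vect T) (Some a))) =
    \sum_a - yy a (ea b (osg ((D : vect T) (Some a)))).
  apply: eq_bigr => a _.
  by rewrite (v_br_e_Some tl _ _ _ Ds) (osg_ea tl) (linopN (yy_lin tl B _)).
under eq_bigr => a _ do rewrite ea_yy.
rewrite big_split /= scalerDr; congr (_ + _).
rewrite [X in _ = - X]scalerA [_ * 2%:R^-1]mulrC -scalerA -scalerN; congr (_ *: _).
rewrite scaler_sumr -sumrN; apply: eq_bigr => a _.
rewrite (osg_par (Ds (Some a))) /= addbT.
by case: (odd _); rewrite /= ?expr0 ?expr1 ?scale1r ?scaleN1r ?opprK ?scalerN.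
Qed.

Lemma eq_KF_contact_pot k D : v_deg k D -> 0 <= k ->
  (forall b, exists f, v_br (v_e T B b) D = KF f :> V) -> D = KF (contact_pot D).
Proof.
move=> Dk k0 De; apply/eqP; rewrite -subr_eq0; apply/eqP; apply: (v_inj (k := k)) => //.
  rewrite addrC -scaleN1r; apply: v_deg_lin => //; have -> : k = k + 2 - 2 by lia.
  exact/v_deg_KF/contact_pot_deg.
move=> b; have [f Df] := De b; rewrite addrC -scaleN1r (v_br_linr tl) Df.
rewrite (v_br_e_KF tl Bsym BBi) (ea_contact_pot b Dk) Df contact_pot_KF.
by rewrite scaleN1r addNr.
Qed.

Lemma KF_inj : injective KF.
Proof. by move=> f g fg; rewrite -[f]contact_pot_KF fg contact_pot_KF. Qed.

Lemma KF_one : KF (o_one T) = v_dt T.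
Proof.
have e1 c : eh B c (o_one T) = 0 by apply: ee_one tl _ _ _.
apply/ffunP => -[a|]; rewrite ?KFSome ?KFNone [RHS]ffunE.
  by rewrite /KFa big1 // => b _; rewrite e1 (linop0 (@osg_lin _ _)) scaler0.
by rewrite big1 ?scaler0 ?subr0 // => b _; rewrite e1 (linop0 (xi_lin tl b)).
Qed.

Lemma ee_yy_one (l : K) a b : ee B l a (yy b (o_one T)) = B a b *: o_one T.
Proof.
rewrite /ee (dx_yy tl Bsym) (dt_yy tl) (dx_one tl) (dt_one tl).
by rewrite !(linop0 (yy_lin tl B _)) scaler0 subr0 addr0.
Qed.

Lemma ea_yy_one a b : ea a (yy b (o_one T)) = B a b *: o_one T.
Proof. exact: ee_yy_one. Qed.
Lemma ea_one a : ea a (o_one T) = 0.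
Proof. exact: ee_one tl _ _ _. Qed.

Lemma KF_yy_one a : KF (yy a (o_one T)) = v_e T B a.
Proof.
apply/ffunP => -[b|]; rewrite ?KFSome ?KFNone [RHS]ffunE.
  rewrite /KFa; under eq_bigr => c _.
    rewrite /eh ee_yy_one (linopZ (@osg_lin _ _)) (osg_par (@o_par1 K T)) expr0 scale1r scalerA; over.
  rewrite -scaler_suml; have /matrixP/(_ b a) := mulmx1C BBi; rewrite !mxE => E.
  rewrite (_ : \sum_i _ = (b == a)%:R); last first.
    by rewrite -E.
  by case: eqP; rewrite ?scale1r ?scale0r.
under eq_bigr => c _ do rewrite /eh ee_yy_one (linopZ (xi_lin tl c)).
rewrite (_ : \sum_c _ = yy a (o_one T)); last first.
  by apply: eq_bigr => c _; rewrite (Bsymm Bsym c a).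
set Y := yy a _; have {1}-> : Y = 2%:R^-1 *: Y + 2%:R^-1 *: Y.
  by rewrite -scalerDl (half2 two) scale1r.
rewrite addrK scaler_sumr.
apply: eq_bigr => c _; rewrite scalerA mulrC; congr (_ *: _); exact: (o_mulr1 tl).
Qed.

End Degrees.

Section LieSubalgebras.
Variables (K : fieldType) (V : superAlg K).
Hypothesis VL : is_lie_superalgebra (full (V := V)).
Implicit Types (x y w : V).

Lemma lbrD x y w : br (x + y) w = br x w + br y w.
Proof. by have := lie_linl VL 1 (x := x) (y := y) (w := w) I I I; rewrite !scale1r. Qed.
Lemma lbrDr x y w : br w (x + y) = br w x + br w y.
Proof. by have := lie_linr VL 1 (x := x) (y := y) (w := w) I I I; rewrite !scale1r. Qed.
Lemma lbr0 w : br 0 w = 0.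
Proof.
by have := lie_linl VL (-1) (x := 0) (y := 0) (w := w) I I I;
  rewrite scaler0 addr0 scaleN1r addNr.
Qed.
Lemma lbr0r w : br w 0 = 0.
Proof.
by have := lie_linr VL (-1) (x := 0) (y := 0) (w := w) I I I;
  rewrite scaler0 addr0 scaleN1r addNr.
Qed.
Lemma lbrZ (c : K) x w : br (c *: x) w = c *: br x w.
Proof. by have := lie_linl VL c (x := x) (y := 0) (w := w) I I I; rewrite !addr0 lbr0 addr0. Qed.
Lemma lbrZr (c : K) x w : br w (c *: x) = c *: br w x.
Proof. by have := lie_linr VL c (x := x) (y := 0) (w := w) I I I; rewrite !addr0 lbr0r addr0. Qed.
Lemma lbr_sum (I : Type) (r : seq I) (P : pred I) (F : I -> V) w :
  br (\sum_(i <- r | P i) F i) w = \sum_(i <- r | P i) br (F i) w.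
Proof. by apply: (big_morph (fun x => br x w)) => [x y|]; rewrite ?lbr0 ?lbrD. Qed.
Lemma lbr_sumr (I : Type) (r : seq I) (P : pred I) (F : I -> V) w :
  br w (\sum_(i <- r | P i) F i) = \sum_(i <- r | P i) br w (F i).
Proof. by apply: (big_morph (br w)) => [x y|]; rewrite ?lbr0r ?lbrDr. Qed.

Lemma lparZ s (c : K) x : par s x -> par s (c *: x).
Proof.
by move=> xs; have [p0 pl] := lie_par VL s; rewrite -[_ *: _]addr0; apply: pl.
Qed.

Lemma lpar_sum s (I : Type) (r : seq I) (P : pred I) (F : I -> V) :
  (forall i, P i -> par s (F i)) -> par s (\sum_(i <- r | P i) F i).
Proof.
have [p0 pl] := lie_par VL s; move=> Fs; apply: (big_ind (fun x : V => par s x)) => //.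
by move=> x y xs ys; rewrite -[x]scale1r; apply: pl.
Qed.

Lemma sub_lie (U : V -> Prop) : subsuperspace U ->
  (forall x y, U x -> U y -> U (br x y)) -> is_lie_superalgebra U.
Proof.
move=> sU cU; split=> //.
- exact: (lie_par VL).
- exact: (lie_par_disj VL).
- by move=> *; apply: (lie_linl VL).
- by move=> *; apply: (lie_linr VL).
- by move=> s t x y _ _; apply: (lie_br_par VL).
- by move=> s t x y _ _; apply: (lie_skew VL).
- by move=> s t x y w _ _ _; apply: (lie_jacobi VL).
- by move=> x _; apply: (lie_odd_cube VL).
Qed.

End LieSubalgebras.

(** * Graded subalgebras and simplicity *)

Lemma subspaceZ (K : fieldType) (V : lmodType K) (U : V -> Prop) : subspace U ->
  forall (c : K) x, U x -> U (c *: x).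
Proof. by move=> [U0 Ul] c x Ux; rewrite -[_ *: _]addr0; apply: Ul. Qed.
Lemma subspaceD (K : fieldType) (V : lmodType K) (U : V -> Prop) : subspace U ->
  forall x y, U x -> U y -> U (x + y).
Proof. by move=> [U0 Ul] x y Ux Uy; rewrite -[x]scale1r; apply: Ul. Qed.
Lemma subspaceN (K : fieldType) (V : lmodType K) (U : V -> Prop) : subspace U ->
  forall x, U x -> U (- x).
Proof. by move=> sU x Ux; rewrite -scaleN1r; apply: subspaceZ. Qed.
Lemma subspace_sum (K : fieldType) (V : lmodType K) (U : V -> Prop) : subspace U ->
  forall (I : Type) (r : seq I) (P : pred I) (F : I -> V),
  (forall i, P i -> U (F i)) -> U (\sum_(i <- r | P i) F i).
Proof.
move=> sU I r P F UF; apply: (big_ind U) => //; first by case: sU.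
exact: subspaceD sU.
Qed.

Lemma span_of_subspace (K : fieldType) (V : lmodType K) n (b : 'I_n -> V) :
  subspace (span_of b).
Proof.
split; first by exists (fun=> 0); rewrite big1 // => i _; rewrite scale0r.
move=> c _ _ [u ->] [v ->]; exists (fun i => c * u i + v i).
rewrite scaler_sumr -big_split; apply: eq_bigr => i _.
by rewrite scalerDl scalerA.
Qed.

Lemma span_of_mem (K : fieldType) (V : lmodType K) n (b : 'I_n -> V) i : span_of b (b i).
Proof.
exists (fun j => (j == i)%:R); rewrite (bigD1 i) //= eqxx scale1r big1 ?addr0 //.
by move=> j /negPf->; rewrite scale0r.
Qed.

(* [hh n] is the component of degree n - 2. *)
Section GradedFamilies.
Variables (K : fieldType) (T : tAlg K) (ok : pred nat) (tau : nat -> T).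
Hypothesis tl : tlaws ok tau.
Variables (B Bi : 'M[K]_7).
Hypothesis Bsym : B^T = B.
Hypothesis BBi : B *m Bi = 1%:M.
Hypothesis two : (2%:R : K) != 0.
Notation V := (vect_alg T).
Notation e := (v_e T B : _ -> V).
Variable h : nat -> V -> Prop.

Definition hh n : V -> Prop :=
  match n with 0 => h_m2 (T := T) | 1 => h_m1 B | n'.+2 => h n' end.

Hypothesis h_sub : forall k, subspace (h k).
Hypothesis h_deg : forall k D, h k D -> v_deg k D.
Hypothesis h_e : forall n D b, hh n.+1 D -> hh n (br (e b) D).
Hypothesis h_00 : forall D D', h 0 D -> h 0 D' -> h 0 (br D D').
Hypothesis h_max : forall k l D D', (0 < k + l)%N -> h k D -> h l D' ->
  (forall b, hh (k + l).+1 (br (e b) (br D D'))) -> h (k + l) (br D D').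

Let VL := vect_lie tl.

Lemma hh_sub n : subspace (hh n).
Proof. by case: n => [|[|n]] //=; apply: span_of_subspace. Qed.

Lemma br_e_e a b : br (e a) (e b) = B a b *: v_dt T :> V.
Proof.
rewrite -(KF_yy_one tl Bsym BBi two b) -(KF_one tl B Bi) [LHS](v_br_e_KF tl Bsym BBi).
by rewrite (ea_yy_one tl Bsym) (KFZ tl).
Qed.

Lemma v_deg_dt : v_deg (-2) (v_dt T : V).
Proof.
by rewrite -(KF_one tl B Bi) -[- 2]sub0r; apply: (v_deg_KF tl); apply: (o_deg_one tl).
Qed.

Lemma v_deg_e a : v_deg (-1) (e a : V).
Proof.
rewrite -(KF_yy_one tl Bsym BBi two a) (_ : - 1 = 0 + 1 - 2) //; apply: (v_deg_KF tl).
exact/(o_deg_yy tl)/(o_deg_one tl).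
Qed.

Lemma v_degZ k (c : K) (D : V) : v_deg k D -> v_deg k (c *: D : V).
Proof.
by move=> Dk; rewrite -[_ *: _]addr0; apply: (v_deg_lin tl) => //; apply: (v_deg0 tl).
Qed.

Lemma v_deg_sum k (I : Type) (r : seq I) (P : pred I) (F : I -> V) :
  (forall i, P i -> v_deg k (F i)) -> v_deg k (\sum_(i <- r | P i) F i : V).
Proof.
move=> Fs; apply: (big_ind (fun D : V => v_deg k D)) => //; first exact: (v_deg0 tl).
by move=> x y xk yk; rewrite -[x]scale1r; apply: (v_deg_lin tl).
Qed.

Lemma hh_deg n D : hh n D -> v_deg (n%:Z - 2) D.
Proof.
case: n => [|[|n]] /=.
- move=> [c ->]; apply: v_deg_sum => i _; exact/v_degZ/v_deg_dt.
- move=> [c ->]; apply: v_deg_sum => i _; exact/v_degZ/v_deg_e.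
- by move/h_deg; congr v_deg; lia.
Qed.

Lemma hh_par n D : hh n D -> par (odd n) D.
Proof.
move=> /hh_deg/(v_deg_par tl) Dp; apply/v_parP.
suff -> : odd n = odd `|n%:Z - 2|%N by [].
case: n {Dp} => [|[|n]] //; have -> : n.+2%:Z - 2 = n by lia.
by rewrite /= negbK.
Qed.

Arguments hh_par {n D} _.

Lemma br_e_dt a : br (e a) (v_dt T) = 0 :> V.
Proof.
by rewrite -(KF_one tl B Bi) [LHS](v_br_e_KF tl Bsym BBi) (ea_one tl) (KF0 tl).
Qed.

Lemma br_e_hh0 D a : hh 0 D -> br (e a) D = 0 :> V.
Proof.
move=> [c ->]; rewrite big_ord1 (lbrZr VL) br_e_dt; exact: scaler0.
Qed.

Lemma par_e a : par true (e a : V).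
Proof. exact/(v_parP _ _)/(v_par_e). Qed.

Arguments par_e : clear implicits.

Lemma par_dt : par false (v_dt T : V).
Proof. exact/(v_parP _ _)/(v_par_dt). Qed.

Lemma br_dtE : exists a b c, forall D : V,
  br (v_dt T : V) D = c *: (br (e a) (br (e b) D) + br (e b) (br (e a) D)).
Proof.
have [a [b ab]] := B_neq0 BBi; exists a, b, (B a b)^-1 => D.
have := lie_jacobi VL (x := e a) (y := e b) (w := D) I I I (par_e a) (par_e b).
rewrite br_e_e (lbrZ VL) expr1 scaleN1r => ->.
by rewrite subrK scalerA mulVf // scale1r.
Qed.

Lemma br_dt_hh n D : hh n.+2 D -> hh n (br (v_dt T : V) D).
Proof.
move=> hD; have [a [b [c ->]]] := br_dtE; apply: (subspaceZ (hh_sub n)).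
by apply: (subspaceD (hh_sub n)); apply: h_e; apply: (h_e _ (n := n.+1)).
Qed.

Lemma br_dt_low n D : (n < 2)%N -> hh n D -> br (v_dt T : V) D = 0.
Proof.
have [a [b [c E]]] := br_dtE; case: n => [|[|//]] _ hD; rewrite E.
  by rewrite !(br_e_hh0 _ hD) !(lbr0r VL) addr0 scaler0.
have e0 i j : br (e i) (br (e j) D) = 0 by apply/br_e_hh0/(h_e (n := 0)).
by rewrite !e0 addr0 scaler0.
Qed.

Lemma br_hh m n D D' : hh m D -> hh n D' ->
  (if (m + n < 2)%N then br D D' = 0 else hh (m + n - 2) (br D D')).
Proof.
have [N] := ubnP (m + n)%N; elim: N m n D D' => // N IH m n D D' mnN Dm Dn.
have swap (P : V -> Prop) : subspace P -> P (br D' D) -> P (br D D').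
  move=> sP; rewrite (lie_skew VL (x := D) (y := D') I I (hh_par Dm) (hh_par Dn)) => PD.
  exact/(subspaceN sP)/(subspaceZ sP).
have low m' n' (E E' : V) : (m' < 2)%N -> hh m' E -> hh n' E' ->
    if (m' + n' < 2)%N then br E E' = 0 else hh (m' + n' - 2) (br E E').
  case: m' => [|[|//]] _ Em En.
    case: Em => c ->; rewrite big_ord1 (lbrZ VL) add0n.
    case: ltnP => n2; first by rewrite (br_dt_low n2 En) scaler0.
    apply: (subspaceZ (hh_sub _)); apply: br_dt_hh.
    by rewrite -addn2 subnK.
  case: Em => c ->; rewrite (lbr_sum VL).
  under eq_bigr => i _ do rewrite (lbrZ VL).
  case: n' En => [|n'] En.
    by rewrite big1 // => i _; rewrite (br_e_hh0 _ En); exact: scaler0.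
  have -> : (1 + n'.+1 < 2)%N = false by lia.
  have -> : (1 + n'.+1 - 2)%N = n' by lia.
  apply: (subspace_sum (hh_sub _)) => i _.
  by apply/(subspaceZ (hh_sub _))/h_e.
have [m2|m2] := ltnP m 2; first exact: low.
have [n2|n2] := ltnP n 2.
  have := low n m D' D n2 Dn Dm; rewrite [(n + m)%N]addnC; case: ifP => _.
    by move=> z; apply: (swap (fun x => x = 0)) => //; split=> // c x y -> ->; rewrite scaler0 addr0.
  by apply: swap; apply: hh_sub.
rewrite ltnNge (leq_trans m2 (leq_addr _ _)) /=.
case: m n m2 n2 mnN Dm Dn {swap low} => [|[|k]] [|[|l]] // _ _ mnN Dm Dn.
have -> : (k.+2 + l.+2 - 2 = (k + l).+2)%N by lia.
have [kl|kl] := posnP (k + l)%N.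
  have /andP[/eqP k0 /eqP l0] : (k == 0%N) && (l == 0%N) by rewrite -addn_eq0 kl.
  by move: Dm Dn; rewrite k0 l0; apply: h_00.
apply: h_max => // b.
rewrite (lie_jacobi VL I I I (par_e b) (hh_par Dm)).
apply: (subspaceD (hh_sub _)); last apply: (subspaceZ (hh_sub _)).
  have lt : (k.+1 + l.+2 < N)%N by lia.
  have := IH k.+1 l.+2 _ _ lt (h_e b Dm) Dn; rewrite ifF; last by lia.
  by have -> : (k.+1 + l.+2 - 2 = (k + l).+1)%N by lia.
have lt : (k.+2 + l.+1 < N)%N by lia.
have Hx := IH k.+2 l.+1 _ _ lt Dm (h_e b Dn).
by move: Hx; have -> : (k.+2 + l.+1 - 2 = (k + l).+1)%N by lia.
Qed.

Definition hsum (D : V) := exists n (F : nat -> V), (forall k, hh k (F k)) /\ D = \sum_(k < n) F k.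

Lemma with_negative_partE D : with_negative_part B h D <-> hsum D.
Proof.
split.
  move=> [D2 [D1 [n [F [h2 h1 hF ->]]]]].
  exists n.+2, (fun k => match k with 0 => D2 | 1 => D1 | k'.+2 => oapp F 0 (insub k') end).
  split.
    move=> [|[|k]] //=; case: insubP => [i _ <-|_] /=; first exact: hF.
    by case: (h_sub k).
  rewrite 2!big_ord_recl /= addrA; congr (_ + _); apply: eq_bigr => i _.
  by rewrite /bump /= ?add1n valK.
move=> [n [F [hF ->]]]; case: n => [|[|n]].
- exists 0, 0, 0%N, (fun=> 0); split; rewrite ?big_ord0 ?addr0 //.
  + by case: (hh_sub 0). + by case: (hh_sub 1). + by case.
- exists (F 0%N), 0, 0%N, (fun=> 0); split; rewrite ?big_ord0 ?big_ord1 ?addr0 //.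
  + exact: (hF 0%N). + by case: (hh_sub 1). + by case.
- exists (F 0%N), (F 1%N), n, (fun k => F k.+2); split.
  + exact: (hF 0%N). + exact: (hF 1%N). + by move=> k; apply: (hF k.+2).
  + by rewrite 2!big_ord_recl /= addrA.
Qed.

Lemma hsum_pad n N (F : nat -> V) : (n <= N)%N ->
  \sum_(k < n) F k = \sum_(k < N) (if (k < n)%N then F k else 0).
Proof. by move=> nN; rewrite (big_ord_widen N F nN) big_mkcond. Qed.

Lemma hsum_sub : subspace hsum.
Proof.
split.
  by exists 0%N, (fun=> 0); split; [move=> k; case: (hh_sub k)|rewrite big_ord0].
move=> c _ _ [n [F [hF ->]]] [m [G [hG ->]]].
exists (maxn n m), (fun k => c *: (if (k < n)%N then F k else 0) + (if (k < m)%N then G k else 0)).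
split.
  move=> k; have [h0 hl] := hh_sub k; apply: hl; case: ifP => //.
rewrite (hsum_pad F (leq_maxl n m)) (hsum_pad G (leq_maxr n m)) scaler_sumr.
by rewrite -big_split.
Qed.

Lemma hsum_hh n D : hh n D -> hsum D.
Proof.
move=> hD; exists n.+1, (fun k => if k == n then D else 0); split.
  by move=> k; case: eqP => [->//|_]; case: (hh_sub k).
rewrite big_ord_recr /= eqxx big1 ?add0r // => i _; by rewrite ltn_eqF.
Qed.

Lemma hsum_superspace : subsuperspace hsum.
Proof.
split; first exact: hsum_sub.
move=> _ [n [F [hF ->]]].
exists (\sum_(k < n | ~~ odd k) F k), (\sum_(k < n | odd k) F k); split.
- by apply: (subspace_sum hsum_sub) => k _; apply: hsum_hh (hF k).
- by apply: (subspace_sum hsum_sub) => k _; apply: hsum_hh (hF k).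
- by apply: (lpar_sum VL) => k /negPf ek; have := hh_par (hF k); rewrite ek.
- by apply: (lpar_sum VL) => k ek; have := hh_par (hF k); rewrite ek.
- by rewrite (bigID (fun k : 'I_n => odd k)) /= addrC.
Qed.

Lemma hsum_closed D D' : hsum D -> hsum D' -> hsum (br D D').
Proof.
move=> [n [F [hF ->]]] [m [G [hG ->]]].
rewrite (lbr_sum VL); apply: (subspace_sum hsum_sub) => i _.
rewrite (lbr_sumr VL); apply: (subspace_sum hsum_sub) => j _.
have := br_hh (hF i) (hG j); case: ifP => _; last exact: hsum_hh.
by move=> ->; case: hsum_sub.
Qed.

Lemma hsum_lie : is_lie_superalgebra hsum.
Proof. by apply: (sub_lie VL); [exact: hsum_superspace|exact: hsum_closed]. Qed.

End GradedFamilies.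

Section SimplicityCriterion.
Variables (K : fieldType) (T : tAlg K) (ok : pred nat) (tau : nat -> T).
Hypothesis tl : tlaws ok tau.
Variables (B Bi : 'M[K]_7).
Hypothesis Bsym : B^T = B.
Hypothesis BBi : B *m Bi = 1%:M.
Hypothesis two : (2%:R : K) != 0.
Notation V := (vect_alg T).
Notation e := (v_e T B : _ -> V).
Notation KF := (@KF K T B Bi).
Variable h : nat -> V -> Prop.
Hypothesis h_sub : forall k, subspace (h k).
Hypothesis h_deg : forall k D, h k D -> v_deg k D.
Hypothesis h_e : forall n D b, hh B h n.+1 D -> hh B h n (br (e b) D).
Hypothesis h_00 : forall D D', h 0 D -> h 0 D' -> h 0 (br D D').
Hypothesis h_max : forall k l D D', (0 < k + l)%N -> h k D -> h l D' ->
  (forall b, hh B h (k + l).+1 (br (e b) (br D D'))) -> h (k + l) (br D D').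
Hypothesis hKF : forall k D, h k D -> exists f, D = KF f.
Hypothesis h_dt : forall y : V, h_m1 B y -> exists2 x, h 1 x & br (v_dt T : V) x = y.
Hypothesis h_h0 : forall I : V -> Prop, subspace I ->
  (forall b x, h 1 x -> I (br x (e b))) -> forall y, h 0 y -> I y.
Hypothesis h_gen : forall I : V -> Prop, subspace I ->
  (forall x y, I x -> hsum B h y -> I (br x y)) -> (forall n x, (n < 3)%N -> hh B h n x -> I x) ->
  forall k x, h k x -> I x.

Let VL := vect_lie tl.

Lemma hhKF n D : hh B h n D -> exists f, D = KF f.
Proof.
case: n => [|[|n]] /=; last exact: hKF.
- case=> c ->; exists (c ord0 *: o_one T); by rewrite big_ord1 (KFZ tl) (KF_one tl).
- case=> c ->; exists (\sum_b c b *: yy B b (o_one T)).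
  rewrite (KF_sum tl); apply: eq_bigr => b _.
  by rewrite (KFZ tl) (KF_yy_one tl Bsym BBi two).
Qed.

Lemma ideal_dt (I : V -> Prop) : ideal (hsum B h) I ->
  forall x, I x -> x <> 0 -> I (v_dt T).
Proof.
move=> [IU [[sI _] Ibr]] x Ix x0.
have [n [F [hF xE]]] := IU x Ix.
elim: n x F Ix x0 hF xE => [|n IH] x F Ix x0 hF xE; first by rewrite xE big_ord0 in x0.
have [f xf] : exists f, x = KF f.
  rewrite {1}xE; apply: (big_ind (fun x : V => exists f, x = KF f)).
  - by exists 0; rewrite (KF0 tl).
  - by move=> _ _ [f ->] [g ->]; exists (f + g); rewrite (KFD tl).
  - by move=> i _; apply: hhKF (hF i).
have IeB b : I (br (e b) x).
  by apply: Ibr => //; apply: (hsum_hh h_sub (n := 1)); apply: span_of_mem.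
have efE b : br (e b) x = KF (ea B b f) by rewrite xf; apply: (v_br_e_KF tl Bsym BBi).
have brE b : br (e b) x = \sum_(k < n) br (e b) (F k.+1).
  rewrite xE (lbr_sumr VL) big_ord_recl /= -/(br (e b) (F 0%N)).
  by rewrite [X in X + _](br_e_hh0 tl Bsym BBi _ (hF 0%N)) add0r.
case: (pickP (fun b => ea B b f != 0)) => [b eb|e0].
  apply: (IH (br (e b) x) (fun k => br (e b) (F k.+1))) => //.
    move=> z; case/eqP: eb; apply: (KF_inj tl Bsym BBi); rewrite (KF0 tl) -efE //.
  by move=> k; apply: h_e.
have [l fl] : exists l, f = l *: o_one T.
  apply: (ea_const tl Bsym BBi two) => b.
  by have /negbT := e0 b; rewrite negbK => /eqP.
have l0 : l != 0.
  by apply/eqP => l0; apply: x0; rewrite xf fl l0 scale0r (KF0 tl).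
have -> : v_dt T = l^-1 *: x.
  by rewrite xf fl (KFZ tl) (KF_one tl) scalerA mulVf // scale1r.
exact: (subspaceZ sI).
Qed.

Lemma hsum_simple : is_simple (hsum B h).
Proof.
have hL := hsum_lie tl Bsym BBi two h_sub h_deg h_e h_00 h_max.
have hh_sub := hh_sub B h_sub.
have Uhh n D : hh B h n D -> hsum B h D := @hsum_hh _ _ _ _ h_sub n D.
have e1 b : hh B h 1 (e b) by apply: span_of_mem.
have dt0 : hh B h 0 (v_dt T) by apply: (span_of_mem (fun _ : 'I_1 => v_dt T : V) ord0).
have dt_neq0 : v_dt T <> 0 :> V.
  move=> /ffunP/(_ None)/ffunP/(_ set0); rewrite !ffunE /= eqxx -(tau0 tl) => t0.
  by have := tcoef_tau_neq0 tl (ok0 tl); rewrite t0 (tcoef0 tl) eqxx.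
have [a [b ab]] := B_neq0 BBi.
split => //.
  exists (e a), (e b); split; [exact: (Uhh 1)|exact: (Uhh 1)|].
  rewrite (br_e_e tl Bsym BBi two) => /eqP; rewrite scaler_eq0 (negPf ab) /=.
  by move/eqP.
move=> J Iid; have [IU [[sI splitI] Ibr]] := Iid.
case: (pselect (forall x, J x -> x = 0)) => [|nz]; [by left|right].
have Idt : J (v_dt T).
  have [x [Ix x0]] : exists x, J x /\ x <> 0.
    apply: contrapT => ne; apply: nz => x Ix; apply: contrapT => x0; apply: ne; by exists x.
  exact: ideal_dt Ix x0.
have Ibr' x y : J x -> hsum B h y -> J (br x y).
  move=> Ix Uy; have [x0 [x1 [Ix0 Ix1 p0 p1 ->]]] := splitI x Ix.
  have [_ /(_ _ Uy)[y0 [y1 [Uy0 Uy1 q0 q1 ->]]]] := lie_sub hL.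
  have flip s t (u v : V) : J u -> hsum B h v -> par s u -> par t v -> J (br u v).
    move=> Iu Uv us vt; rewrite (lie_skew VL (x := u) (y := v) I I us vt).
    by apply/(subspaceN sI)/(subspaceZ sI)/Ibr.
  rewrite (lbrD VL) !(lbrDr VL); apply: (subspaceD sI); apply: (subspaceD sI).
  - exact: flip Ix0 Uy0 p0 q0. - exact: flip Ix0 Uy1 p0 q1.
  - exact: flip Ix1 Uy0 p1 q0. - exact: flip Ix1 Uy1 p1 q1.
have I0 x : hh B h 0 x -> J x.
  by case=> c ->; rewrite big_ord1; apply: (subspaceZ sI).
have I1 x : hh B h 1 x -> J x.
  move=> /h_dt[y hy <-]; apply: Ibr' => //; exact: (Uhh 3).
have I2 x : hh B h 2 x -> J x.
  apply: h_h0 => // c y hy; apply: Ibr; first exact: (Uhh 3).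
  exact: I1.
have Ik k x : h k x -> J x.
  apply: h_gen => // -[|[|[|n]]] // y _; [exact: I0|exact: I1|exact: I2].
move=> _ [n [F [hF ->]]]; apply: (subspace_sum sI) => k _.
have := hF k; case: (val k) => [|[|m]]; [exact: I0|exact: I1|exact: Ik].
Qed.

End SimplicityCriterion.

Section Prolongs.
Variables (K : fieldType) (T : tAlg K) (ok : pred nat) (tau : nat -> T).
Hypothesis tl : tlaws ok tau.
Variables (B Bi : 'M[K]_7).
Hypothesis Bsym : B^T = B.
Hypothesis BBi : B *m Bi = 1%:M.
Hypothesis two : (2%:R : K) != 0.
Notation V := (vect_alg T).
Notation O := (O T).
Notation e := (v_e T B : _ -> V).
Notation KF := (@KF K T B Bi).
Variables (g : superAlg K) (z : g) (eg : 'I_7 -> g) (s : g -> Prop).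
Notation h := (h_comp (T := T) z eg B s).
Variable P0 : O -> Prop.
Hypothesis P0_sub : subspace P0.
Hypothesis P0_deg : forall f, P0 f -> o_deg 2 f.
Hypothesis h0E : forall D : V, h_0 z eg B s D <-> exists2 f, P0 f & D = KF f.
Hypothesis P0_e : forall f b, P0 f -> exists c : 'I_7 -> K, ea B b f = \sum_i c i *: yy B i (o_one T).

Let VL := vect_lie tl.

Fixpoint Pf (k : nat) (f : O) : Prop :=
  match k with
  | 0 => P0 f
  | k'.+1 => o_deg (k%:Z + 2) f /\ forall b, Pf k' (ea B b f)
  end.

Lemma Pf_sub k : subspace (Pf k).
Proof.
elim: k => [//|k [IH0 IHl]]; split.
  split; first exact: (o_deg0 tl).
  by move=> b; rewrite (linop0 (ea_lin tl B b)).
move=> c f f1 [fd fP] [fd1 fP1]; split; [exact: (o_deg_lin tl)|move=> b].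
by rewrite (ea_lin tl); apply: IHl; [exact: fP|exact: fP1].
Qed.

Lemma br_e_skew k (D : V) b : v_deg k D ->
  br D (e b) = - ((-1) ^+ odd `|k|%N *: br (e b) D).
Proof.
by move=> /(v_deg_par tl) Dp; rewrite [LHS](v_br_skew tl Dp (v_par_e B b)) andbT.
Qed.

Lemma sign_subspace (P : V -> Prop) (c : bool) (x : V) : subspace P ->
  P (- ((-1) ^+ c *: x)) <-> P x.
Proof.
move=> sP; split=> Px; last exact/(subspaceN sP)/(subspaceZ sP).
have -> : x = (-1) ^+ c *: - (- ((-1) ^+ c *: x)).
  by rewrite opprK scalerA -expr2 sqrr_sign scale1r.
exact/(subspaceZ sP)/(subspaceN sP).
Qed.

Lemma h_sub_deg k : subspace (h k) /\ forall D, h k D -> v_deg k D.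
Proof.
elim: k => [|k [IHs IHd]]; split.
- split; first by apply/h0E; exists 0; rewrite ?(KF0 tl) //; case: P0_sub.
  move=> c D D' /h0E[f Pf' ->] /h0E[f' Pf'' ->]; apply/h0E; exists (c *: f + f').
    by case: P0_sub => _; apply.
  by rewrite (KF_lin tl).
- by move=> D [].
- split.
    split; first exact: (v_deg0 tl).
    by move=> y _; rewrite (lbr0 VL); case: IHs.
  move=> c D D' [Dd hD] [Dd' hD']; split; first exact: (v_deg_lin tl).
  by move=> y hy; rewrite (lie_linl VL) //; case: IHs => _; apply; [apply: hD|apply: hD'].
- by move=> D [].
Qed.

Lemma h_compE k D : h k D <-> exists2 f, Pf k f & D = KF f.
Proof.
elim: k D => [|k IH] D; first exact: h0E.
have sP := proj1 (h_sub_deg k).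
split=> [[Dd hD]|[f [fd fP] ->]].
  have he b : exists2 f, Pf k f & br (e b) D = KF f.
    apply/IH/(sign_subspace (odd `|k.+1%:Z|) _ sP); rewrite -(br_e_skew _ Dd).
    by apply: hD; apply: span_of_mem.
  have DE : D = KF (contact_pot B D).
    by apply: (eq_KF_contact_pot tl Bsym BBi two Dd) => // b; have [f _ E] := he b; exists f.
  exists (contact_pot B D) => //; split; first exact: (contact_pot_deg tl).
  move=> b; rewrite (ea_contact_pot tl Bsym b Dd); have [f Pff E] := he b.
  rewrite -[v_br _ _]/(br (e b) D) E.
  by rewrite (contact_pot_KF tl Bsym BBi).
have Dd : v_deg k.+1%:Z (KF f).
  by have := v_deg_KF tl (B := B) (Bi := Bi) fd; rewrite addrK.
split=> // y [c ->]; rewrite (lbr_sumr VL); apply: (subspace_sum sP) => b _.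
rewrite (lbrZr VL); apply: (subspaceZ sP).
rewrite (br_e_skew _ Dd); apply/sign_subspace => //; apply/IH; exists (ea B b f); first exact: fP.
exact: (v_br_e_KF tl Bsym BBi).
Qed.

Lemma h_e n D b : hh B h n.+1 D -> hh B h n (br (e b) D).
Proof.
case: n => [|[|k]].
- move=> [c ->]; rewrite (lbr_sumr VL); apply: (subspace_sum (span_of_subspace _)) => i _.
  rewrite (lbrZr VL) (br_e_e tl Bsym BBi two); apply/(subspaceZ (span_of_subspace _)).
  apply/(subspaceZ (span_of_subspace _)).
  exact: (span_of_mem (fun _ : 'I_1 => v_dt T : V) ord0).
- move=> /h0E[f /(P0_e b)[c fc] ->]; exists c.
  rewrite [LHS](v_br_e_KF tl Bsym BBi) fc (KF_sum tl); apply: eq_bigr => i _.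
  by rewrite (KFZ tl) (KF_yy_one tl Bsym BBi two).
- move=> /(h_compE k.+1)[f [_ fP] ->]; apply/h_compE; exists (ea B b f); first exact: fP.
  exact: (v_br_e_KF tl Bsym BBi).
Qed.

Hypothesis h_00 : forall D D' : V, h_0 z eg B s D -> h_0 z eg B s D' -> h_0 z eg B s (br D D').

Lemma h_max k l D D' : (0 < k + l)%N -> h k D -> h l D' ->
  (forall b, hh B h (k + l).+1 (br (e b) (br D D'))) -> h (k + l) (br D D').
Proof.
case kl: (k + l)%N => [//|m] _ /(proj2 (h_sub_deg _)) Dd /(proj2 (h_sub_deg _)) Dd' he.
have bd : v_deg (m.+1%:Z) (br D D') by rewrite -kl PoszD; apply: (v_deg_br tl).
split=> // y [c ->]; have sP := proj1 (h_sub_deg m).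
rewrite (lbr_sumr VL); apply: (subspace_sum sP) => b _.
rewrite (lbrZr VL) (br_e_skew _ bd); apply: (subspaceZ sP).
by apply/sign_subspace => //; apply: he.
Qed.

End Prolongs.

(** * Characteristic 3 *)

Definition tmpl := seq ((nat * seq nat) * Z).

Definition TA : tmpl := [:: ((0, [::]), 1%Z); ((2, [:: 0; 1; 2; 6]), 1%Z); ((2, [:: 0; 3; 4; 5]), -1%Z); ((2, [:: 1; 2; 4; 5]), -1%Z); ((2, [:: 1; 3; 4; 6]), 1%Z); ((2, [:: 2; 3; 5; 6]), 1%Z)].
Definition TW : tmpl := [:: ((0, [:: 0; 1; 4]), 1%Z); ((0, [:: 0; 2; 5]), 1%Z); ((0, [:: 0; 3; 6]), -1%Z); ((0, [:: 1; 2; 6]), 1%Z); ((0, [:: 3; 4; 5]), 1%Z); ((2, [:: 0; 1; 2; 3; 4; 5; 6]), 1%Z)].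
Definition TB (i : nat) : tmpl := nth [::] [::
  [:: ((0, [:: 0]), 1%Z); ((1, [:: 1; 2; 6]), -1%Z); ((1, [:: 3; 4; 5]), 1%Z); ((2, [:: 0; 1; 2; 4; 5]), -1%Z); ((2, [:: 0; 1; 3; 4; 6]), 1%Z); ((2, [:: 0; 2; 3; 5; 6]), 1%Z)];
  [:: ((0, [:: 1]), 1%Z); ((1, [:: 0; 3; 5]), 1%Z); ((1, [:: 1; 2; 5]), 1%Z); ((1, [:: 1; 3; 6]), -1%Z); ((2, [:: 0; 1; 3; 4; 5]), 1%Z); ((2, [:: 1; 2; 3; 5; 6]), 1%Z)];
  [:: ((0, [:: 2]), 1%Z); ((1, [:: 0; 3; 4]), -1%Z); ((1, [:: 1; 2; 4]), -1%Z); ((1, [:: 2; 3; 6]), -1%Z); ((2, [:: 0; 2; 3; 4; 5]), 1%Z); ((2, [:: 1; 2; 3; 4; 6]), -1%Z)];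
  [:: ((0, [:: 3]), 1%Z); ((1, [:: 0; 1; 2]), 1%Z); ((1, [:: 1; 3; 4]), 1%Z); ((1, [:: 2; 3; 5]), 1%Z); ((2, [:: 0; 1; 2; 3; 6]), -1%Z); ((2, [:: 1; 2; 3; 4; 5]), -1%Z)];
  [:: ((0, [:: 4]), 1%Z); ((1, [:: 0; 2; 6]), 1%Z); ((1, [:: 2; 4; 5]), 1%Z); ((1, [:: 3; 4; 6]), -1%Z); ((2, [:: 0; 1; 2; 4; 6]), -1%Z); ((2, [:: 2; 3; 4; 5; 6]), 1%Z)];
  [:: ((0, [:: 5]), 1%Z); ((1, [:: 0; 1; 6]), -1%Z); ((1, [:: 1; 4; 5]), -1%Z); ((1, [:: 3; 5; 6]), -1%Z); ((2, [:: 0; 1; 2; 5; 6]), -1%Z); ((2, [:: 1; 3; 4; 5; 6]), -1%Z)];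
  [:: ((0, [:: 6]), 1%Z); ((1, [:: 0; 4; 5]), -1%Z); ((1, [:: 1; 4; 6]), 1%Z); ((1, [:: 2; 5; 6]), 1%Z); ((2, [:: 0; 3; 4; 5; 6]), -1%Z); ((2, [:: 1; 2; 4; 5; 6]), -1%Z)]] i.
Definition TC (i : nat) : tmpl := nth [::] [::
  [:: ((0, [:: 0; 4]), -1%Z); ((0, [:: 2; 6]), 1%Z); ((1, [:: 0; 2; 4; 5]), -1%Z); ((1, [:: 0; 3; 4; 6]), 1%Z); ((1, [:: 1; 2; 4; 6]), -1%Z); ((2, [:: 0; 2; 3; 4; 5; 6]), -1%Z)];
  [:: ((0, [:: 0; 1]), -1%Z); ((0, [:: 3; 5]), 1%Z); ((1, [:: 0; 1; 2; 5]), -1%Z); ((1, [:: 0; 1; 3; 6]), 1%Z); ((1, [:: 1; 3; 4; 5]), 1%Z); ((2, [:: 0; 1; 2; 3; 5; 6]), -1%Z)];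
  [:: ((0, [:: 0; 5]), 1%Z); ((0, [:: 1; 6]), 1%Z); ((1, [:: 0; 1; 4; 5]), -1%Z); ((1, [:: 0; 3; 5; 6]), -1%Z); ((1, [:: 1; 2; 5; 6]), 1%Z); ((2, [:: 0; 1; 3; 4; 5; 6]), -1%Z)];
  [:: ((0, [:: 0; 2]), -1%Z); ((0, [:: 3; 4]), -1%Z); ((1, [:: 0; 1; 2; 4]), 1%Z); ((1, [:: 0; 2; 3; 6]), 1%Z); ((1, [:: 2; 3; 4; 5]), 1%Z); ((2, [:: 0; 1; 2; 3; 4; 6]), 1%Z)];
  [:: ((0, [:: 0; 6]), 1%Z); ((0, [:: 4; 5]), 1%Z); ((1, [:: 0; 1; 4; 6]), 1%Z); ((1, [:: 0; 2; 5; 6]), 1%Z); ((1, [:: 3; 4; 5; 6]), 1%Z); ((2, [:: 0; 1; 2; 4; 5; 6]), -1%Z)];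
  [:: ((0, [:: 0; 3]), 1%Z); ((0, [:: 1; 2]), -1%Z); ((1, [:: 0; 1; 3; 4]), 1%Z); ((1, [:: 0; 2; 3; 5]), 1%Z); ((1, [:: 1; 2; 3; 6]), 1%Z); ((2, [:: 0; 1; 2; 3; 4; 5]), -1%Z)];
  [:: ((0, [:: 1; 4]), 1%Z); ((0, [:: 2; 5]), 1%Z); ((0, [:: 3; 6]), -1%Z); ((1, [:: 0; 1; 2; 6]), -1%Z); ((1, [:: 0; 3; 4; 5]), -1%Z); ((2, [:: 1; 2; 3; 4; 5; 6]), 1%Z)]] i.

Definition star (n : nat) : nat := nth 0%N [:: 0; 4; 5; 6; 1; 2; 3]%N n.

Fixpoint dxm (a : nat) (m : seq nat) : seq (seq nat * Z) :=
  match m with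
  | [::] => [::]
  | n :: m' => (if Nat.eqb a n then [:: (m', 1%Z)] else [::]) ++
               [seq (n :: y.1, (- y.2)%Z) | y <- dxm a m']
  end.

Fixpoint xim (a : nat) (m : seq nat) : option (seq nat * Z) :=
  match m with
  | [::] => Some ([:: a], 1%Z)
  | n :: m' => if Nat.ltb a n then Some (a :: m, 1%Z)
               else if Nat.eqb a n then None
               else omap (fun y => (n :: y.1, (- y.2)%Z)) (xim a m')
  end.

Definition dxT (a : nat) (t : tmpl) : tmpl :=
  flatten [seq [seq ((x.1.1, y.1), (x.2 * y.2)%Z) | y <- dxm a x.1.2] | x <- t].
Definition xiT (a : nat) (t : tmpl) : tmpl :=
  flatten [seq oapp (fun y => [:: ((x.1.1, y.1), (x.2 * y.2)%Z)]) [::] (xim a x.1.2) | x <- t].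
Definition shT (s : nat) (t : tmpl) : tmpl := [seq (((s + x.1.1)%N, x.1.2), x.2) | x <- t].
Definition scT (c : Z) (t : tmpl) : tmpl := [seq (x.1, (c * x.2)%Z) | x <- t].
Definition eT (b : nat) (t : tmpl) : tmpl := dxT b t ++ scT (-1) (xiT (star b) (shT 1 t)).

Definition keyeqb (k l : nat * seq nat) : bool := Nat.eqb k.1 l.1 && (all2 Nat.eqb k.2 l.2).
Definition coefT (k : nat * seq nat) (t : tmpl) : Z :=
  foldr (fun x c => if keyeqb x.1 k then (x.2 + c)%Z else c) 0%Z t.
Definition zeroT (t : tmpl) : bool :=
  all (fun x => Z.eqb (Z.modulo (coefT x.1 t) 3) 0) t.
Definition combT (l : seq (Z * tmpl)) : tmpl := flatten [seq scT x.1 x.2 | x <- l].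
Definition eqT (t : tmpl) (l : seq (Z * tmpl)) : bool := zeroT (t ++ scT (-1) (combT l)).
Definition wfT (t : tmpl) : bool := all (fun x => all (fun n => Nat.ltb n 7) x.1.2) t.

Lemma keyeqbP k l : reflect (k = l) (keyeqb k l).
Proof.
apply: (iffP andP) => [[/Nat.eqb_spec k1 k2]|->]; last first.
  split; first exact: Nat.eqb_refl.
  by elim: (l.2) => //= n s ->; rewrite Nat.eqb_refl.
case: k l k1 k2 => i m [j n] /= -> k2; congr (_, _).
by elim: m n k2 => [|a m IH] [|b n] //= /andP[/Nat.eqb_spec -> /IH ->].
Qed.

Section Templates.
Variables (K : fieldType) (T : tAlg K) (ok : pred nat) (tau : nat -> T).
Hypothesis tl : tlaws ok tau.
Hypothesis three : 3%:R = 0 :> K.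
Notation O := (O T).
Notation zK := (zK K).

Lemma two3 : (2%:R : K) != 0.
Proof.
apply/eqP => t0; have := oner_neq0 K.
by rewrite -(addrK 2%:R 1) -[1 + 2%:R]/(1%:R + 2%:R) -natrD three t0 subr0 eqxx.
Qed.

Lemma half3 : 2%:R^-1 = -1 :> K.
Proof.
apply: (mulfI two3); rewrite divff ?two3 // mulrN1; apply/eqP.
by rewrite -addr_eq0 -[1 + 2%:R]/(1%:R + 2%:R) -natrD three.
Qed.

Lemma zK_mod3 c : Z.modulo c 3 = 0%Z -> zK c = 0.
Proof.
move=> c0; have -> : c = (3 * (c / 3))%Z by rewrite {1}(Z.div_mod c 3) // c0 Z.add_0_r.
by rewrite zKM [zK 3]three mul0r.
Qed.

Definition ix (n : nat) : 'I_7 := inord n.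

Lemma ixK n : Nat.ltb n 7 -> ix n = n :> nat.
Proof. by move=> n7; rewrite inordK //; apply/ssrnat.ltP/Nat.ltb_lt. Qed.

Lemma ix_val (b : 'I_7) : ix b = b.
Proof. exact: inord_val. Qed.

Lemma ord7_ltb (b : 'I_7) : Nat.ltb b 7.
Proof. by apply/Nat.ltb_lt/ssrnat.ltP. Qed.

Lemma ord7_all (p : pred nat) : all p [:: 0; 1; 2; 3; 4; 5; 6]%N -> forall b : 'I_7, p b.
Proof. by move=> /allP h b; apply: h; case: b => [[|[|[|[|[|[|[|]]]]]]]]. Qed.

Lemma ix_eq a n : Nat.ltb a 7 -> Nat.ltb n 7 -> (ix a == ix n) = Nat.eqb a n.
Proof.
by move=> a7 n7; rewrite -val_eqE /= !ixK.
Qed.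

Lemma star_ltb n : Nat.ltb (star n) 7.
Proof. by case: n => [|[|[|[|[|[|[|n]]]]]]]; rewrite /star //= ?nth_nil. Qed.

Lemma star_lt n : (star n < 7)%N.
Proof. exact/ssrnat.ltP/Nat.ltb_lt/star_ltb. Qed.

Lemma gram3E (a b : 'I_7) : gram3 K a b = (b == ix (star a))%:R.
Proof.
rewrite mxE; congr (_%:R); rewrite /= !inE !xpair_eqE.
rewrite -!val_eqE /= !inordK ?star_lt //.
by case: a => [[|[|[|[|[|[|[|//]]]]]]] ?] /=; case: b => [[|[|[|[|[|[|[|//]]]]]]] ?].
Qed.

Lemma gram3_sym : (gram3 K)^T = gram3 K.
Proof.
apply/matrixP => a b; rewrite mxE !gram3E -!val_eqE /= !ixK ?star_ltb //.
by case: a => [[|[|[|[|[|[|[|//]]]]]]] ?] /=; case: b => [[|[|[|[|[|[|[|//]]]]]]] ?].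
Qed.

Lemma gram3_sq : gram3 K *m gram3 K = 1%:M.
Proof.
apply/matrixP => a c; rewrite !mxE (bigD1 (ix (star a))) //= big1 ?addr0 => [|b /negPf ba].
  rewrite !gram3E eqxx mul1r ixK ?star_ltb //; congr (_%:R).
  rewrite -!val_eqE /= !ixK ?star_ltb // eq_sym.
  by case: a => [[|[|[|[|[|[|[|//]]]]]]] ?].
by rewrite gram3E ba mul0r.
Qed.

Notation xi := (@xi K T).
Notation dx := (@dx K T).
Notation dt := (@dt K T).
Notation ea := (@ea K T (gram3 K)).
Notation yy := (@yy K T (gram3 K)).

Lemma yy3 a f : yy a f = xi (ix (star a)) f.
Proof.
rewrite /Submission.yy (bigD1 (ix (star a))) //= gram3E eqxx scale1r big1 ?addr0 // => b /negPf.
by rewrite gram3E => ->; rewrite scale0r.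
Qed.

Lemma ea3 a f : ea a f = dx a f - xi (ix (star a)) (dt f).
Proof. by rewrite /Submission.ea /Submission.ee half3 yy3 scaleN1r. Qed.

Definition tauO (r j : nat) : O :=
  if ok r && (j <= r)%N then [ffun S : {set 'I_7} => if S == set0 then tau (r - j)%N else 0]
  else 0.

Definition mono (m : seq nat) (f : O) : O := foldr (fun n g => xi (ix n) g) f m.
Definition interp (r : nat) (t : tmpl) : O :=
  \sum_(x <- t) zK x.2 *: mono x.1.2 (tauO r x.1.1).

Lemma interp_cat r t t' : interp r (t ++ t') = interp r t + interp r t'.
Proof. by rewrite /interp big_cat. Qed.

Lemma interp_scT r c t : interp r (scT c t) = zK c *: interp r t.
Proof.
rewrite /interp big_map scaler_sumr; apply: eq_bigr => x _ /=.
by rewrite zKM scalerA.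
Qed.

Lemma interp_combT r l : interp r (combT l) = \sum_(x <- l) zK x.1 *: interp r x.2.
Proof.
elim: l => [|x l IH]; first by rewrite /interp !big_nil.
by rewrite /combT /= interp_cat interp_scT big_cons -IH.
Qed.

Lemma tau_down r j : ok r -> ok (r - j)%N.
Proof. by elim: j => [|j IH]; rewrite ?subn0 // => /IH; rewrite subnS; case: (_ - _)%N => // n /(ok_down tl). Qed.

Lemma dx_tauO a r j : dx a (tauO r j) = 0.
Proof.
rewrite /tauO; case: ifP => _; last exact: (linop0 (dx_lin tl a)).
apply/ffunP => S; rewrite /Submission.dx o_derE !ffunE; case: ifP => // _.
case: eqP => [/setP/(_ a)|]; last by rewrite scaler0.
by rewrite !inE eqxx.
Qed.

Lemma dt_tauO r j : dt (tauO r j) = tauO r j.+1.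
Proof.
rewrite /tauO; case okr: (ok r) => /=; last exact: (linop0 (dt_lin tl)).
case: (ltngtP j r) => jr; last first.
- rewrite jr subnn; apply/ffunP => S; rewrite !ffunE.
  by case: eqP; rewrite ?(tau0 tl) ?(tder1 tl) ?(tder0 tl).
- exact: (linop0 (dt_lin tl)).
apply/ffunP => S; rewrite !ffunE; case: eqP => _; rewrite ?(tder0 tl) //.
have -> : (r - j = (r - j.+1).+1)%N by lia.
by apply: (tder_tau tl); rewrite -subSn // subSS; apply: tau_down.
Qed.

Lemma tauO_succ r j : tauO r.+1 j.+1 = if ok r.+1 then tauO r j else 0.
Proof.
rewrite /tauO ltnS subSS; case okr: (ok r.+1) => //=.
by rewrite (ok_down tl okr).
Qed.

Lemma dt_mono m f : dt (mono m f) = mono m (dt f).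
Proof. by elim: m => //= n m IH; rewrite (dt_xi tl) IH. Qed.

Lemma mono_lin m (c : K) f g : mono m (c *: f + g) = c *: mono m f + mono m g.
Proof. by elim: m => //= n m ->; rewrite (xi_lin tl). Qed.

Lemma dx_mono a m r j : Nat.ltb a 7 -> all (fun n => Nat.ltb n 7) m ->
  dx (ix a) (mono m (tauO r j)) = \sum_(y <- dxm a m) zK y.2 *: mono y.1 (tauO r j).
Proof.
move=> a7; elim: m => [|n m IH] /=; first by rewrite dx_tauO big_nil.
move=> /andP[n7 /IH{}IH]; rewrite (dx_xi tl) ix_eq // IH big_cat big_map; congr (_ + _).
  by case: Nat.eqb; rewrite ?big_seq1 ?big_nil ?zK1 ?scale1r ?scale0r.
rewrite (linop_sum _ _ _ (xi_lin tl _)) -sumrN; apply: eq_bigr => y _ /=.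
by rewrite (linopZ (xi_lin tl _)) zKN scaleNr.
Qed.

Lemma xi_mono a m f : xi (ix a) (mono m f) =
  oapp (fun y => zK y.2 *: mono y.1 f) 0 (xim a m).
Proof.
elim: m => [|n m IH] /=; first by rewrite zK1 scale1r.
case: Nat.ltb => /=; first by rewrite zK1 scale1r.
case: Nat.eqb_spec => [->|_] /=.
  have := xi_xi tl (ix n) (ix n) (mono m f) => /eqP; rewrite -addr_eq0 -mulr2n -scaler_nat.
  by rewrite scaler_eq0 (negPf two3) => /eqP.
rewrite (xi_xi tl) IH; case: (xim a m) => [y|] /=.
  by rewrite (linopZ (xi_lin tl _)) zKN scaleNr.
by rewrite (linop0 (xi_lin tl _)) oppr0.
Qed.

Lemma dxT_P a r t : Nat.ltb a 7 -> wfT t -> dx (ix a) (interp r t) = interp r (dxT a t).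
Proof.
move=> a7; elim: t => [|x t IH] /=; first by rewrite /interp !big_nil (linop0 (dx_lin tl _)).
move=> /andP[x7 /IH{}IH]; rewrite /dxT /= interp_cat -IH /interp big_cons.
rewrite (dx_lin tl) dx_mono // big_map scaler_sumr; congr (_ + _).
by apply: eq_bigr => y _ /=; rewrite scalerA zKM.
Qed.

Lemma xiT_P a r t : xi (ix a) (interp r t) = interp r (xiT a t).
Proof.
elim: t => [|x t IH] /=; first by rewrite /interp !big_nil (linop0 (xi_lin tl _)).
rewrite /xiT /= interp_cat -IH /interp big_cons (xi_lin tl) xi_mono; congr (_ + _).
by case: xim => [y|] /=; rewrite ?big_seq1 ?big_nil ?scaler0 // scalerA zKM.
Qed.

Lemma dt_interp r t : dt (interp r t) = interp r (shT 1 t).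
Proof.
rewrite /interp big_map (linop_sum _ _ _ (dt_lin tl)); apply: eq_bigr => x _.
by rewrite (linopZ (dt_lin tl)) dt_mono dt_tauO.
Qed.

Lemma interp_succ r t : interp r.+1 (shT 1 t) = if ok r.+1 then interp r t else 0.
Proof.
rewrite /interp big_map; case okr: (ok r.+1); last first.
  rewrite big1 // => x _; rewrite tauO_succ okr (linop0 (mono_lin _)) //; exact: scaler0.
by apply: eq_bigr => x _; rewrite tauO_succ okr.
Qed.

Lemma interp_not_ok r t : ~~ ok r -> interp r t = 0.
Proof.
move=> /negPf okr; rewrite /interp big1 // => x _.
by rewrite /tauO okr (linop0 (mono_lin _)) scaler0.
Qed.

Lemma eT_P b r t : Nat.ltb b 7 -> wfT t -> ea (ix b) (interp r t) = interp r (eT b t).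
Proof.
move=> b7 wt; rewrite ea3 dxT_P // dt_interp ixK // xiT_P interp_cat interp_scT.
by rewrite [zK (-1)]/(-1) scaleN1r.
Qed.

Lemma interp_group r t ks : uniq ks -> {subset [seq x.1 | x <- t] <= ks} ->
  interp r t = \sum_(k <- ks) zK (coefT k t) *: mono k.2 (tauO r k.1).
Proof.
move=> uk; elim: t => [|x t IH] sub /=.
  by rewrite /interp big_nil big1_seq // => k _; rewrite scale0r.
rewrite /interp big_cons -/(interp r t) IH => [|k kt]; last by apply: sub; rewrite inE kt orbT.
have xk : x.1 \in ks by apply: sub; rewrite inE eqxx.
rewrite !(big_rem _ xk) /= addrA; congr (_ + _).
  by rewrite (introT (keyeqbP _ _)) // zKD scalerDl.
rewrite !big_seq; apply: eq_bigr => k kr; case: keyeqbP => // xk'.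
by move: kr; rewrite -xk' mem_rem_uniqF.
Qed.

Lemma zeroT_P r t : zeroT t -> interp r t = 0.
Proof.
move=> /allP z; rewrite (@interp_group r t (undup [seq x.1 | x <- t])) ?undup_uniq //; last first.
  by move=> k; rewrite mem_undup.
rewrite big1_seq // => k /andP[_]; rewrite mem_undup => /mapP[x xt ->].
by rewrite zK_mod3 ?scale0r //; have /Z.eqb_spec := z x xt.
Qed.

Lemma eqT_P r t l : eqT t l -> interp r t = \sum_(x <- l) zK x.1 *: interp r x.2.
Proof.
move=> /(zeroT_P r); rewrite interp_cat interp_scT interp_combT [zK (-1)]/(-1) scaleN1r.
by move/eqP; rewrite subr_eq0 => /eqP.
Qed.

Lemma coef_interp r t : ok r ->
  t_coef r (interp r t set0) = zK (coefT (0%N, [::]) t) * t_coef r (tau r).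
Proof.
move=> okr; elim: t => [|x t IH] /=.
  by rewrite /interp big_nil ffunE (tcoef0 tl) zK0 mul0r.
rewrite /interp big_cons -/(interp r t) 2!ffunE (tcoefD tl) (tcoefZ tl) IH.
case: x => [[j m] c] /=; case: m => [|n m] /=; last first.
  rewrite {1}/Submission.xi (o_xiE tl) inE (tcoef0 tl) mulr0 add0r.
  by case: keyeqbP.
rewrite /tauO okr /=; case: keyeqbP => [[->]|/= j0].
  by rewrite leq0n ffunE eqxx subn0 zKD mulrDl.
case: ifP => jr; last by rewrite ffunE (tcoef0 tl) mulr0 add0r.
rewrite ffunE eqxx (tcoef_tau tl) ?mulr0 ?add0r //.
by apply/eqP => rj; case: j0; congr (_, _); lia.
Qed.

Lemma coef_interp_lt r r' t S : (r' < r)%N -> t_coef r (interp r' t S) = 0.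
Proof.
move=> rr; rewrite /interp sum_ffunE (tcoef_sum tl) big1 // => x _.
rewrite ffunE (tcoefZ tl); set f := tauO _ _.
suff : forall S, t_coef r (mono x.1.2 f S) = 0 by move=> ->; rewrite mulr0.
elim: (x.1.2) => [|n m IH] S' /=.
  rewrite /f /tauO; case: ifP => _; rewrite ffunE ?(tcoef0 tl) //.
  case: ifP => _; rewrite ?(tcoef0 tl) // (tcoef_tau tl) //; lia.
by rewrite {1}/Submission.xi (o_xiE tl); case: ifP; rewrite ?(tcoef0 tl) // (tcoefZ tl) IH mulr0.
Qed.

End Templates.

Definition I7 : seq nat := [:: 0; 1; 2; 3; 4; 5; 6]%N.
Definition I8 : seq nat := [:: 0; 1; 2; 3; 4; 5; 6; 7]%N.

Definition dxsT (w : seq nat) (t : tmpl) : tmpl := foldr dxT t w.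

(* The component of degree k has the basis [interp (lev (odd k) i k./2) (fam (odd k) i)],
   i < 8: the A and C_i for k even, the W and B_i for k odd. *)
Definition fam (o : bool) (i : nat) : tmpl :=
  if o then (if i is i'.+1 then TB i' else TW) else (if i is i'.+1 then TC i' else TA).
Definition lev (o : bool) (i j : nat) : nat := if o (+) (i == 0%N) then j.+1 else j.
(* [famkey o i] is a monomial occurring in the leading part of [fam o i] only *)
Definition famkey (o : bool) (i : nat) : seq nat :=
  if o then nth [::] [:: [:: 0; 1; 4]; [:: 0]; [:: 1]; [:: 2]; [:: 3]; [:: 4]; [:: 5]; [:: 6]]%N i
  else nth [::] [:: [::]; [:: 0; 4]; [:: 0; 1]; [:: 0; 5]; [:: 0; 2]; [:: 0; 6]; [:: 0; 3]; [:: 1; 4]]%N i.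

Definition dec (s : nat) (o : bool) (l : seq nat) (t : tmpl) : seq (Z * tmpl) :=
  [seq ((coefT (s, famkey o i) t * coefT (0%N, famkey o i) (fam o i))%Z, shT s (fam o i)) | i <- l].

Definition decE (o : bool) (i : nat) (t : tmpl) : seq (Z * tmpl) :=
  match o, i with
  | false, 0 => dec 1 true (behead I8) t
  | false, _ => dec 1 true [:: 0%N] t ++ dec 0 true (behead I8) t
  | true, 0 => dec 0 false (behead I8) t
  | true, _ => dec 0 false [:: 0%N] t ++ dec 1 false (behead I8) t
  end.

Arguments dec : simpl never.
Arguments fam : simpl never.
Arguments shT : simpl never.

Lemma decE_check : all (fun o => all (fun i => all (fun b =>
   eqT (eT b (fam o i)) (decE o i (eT b (fam o i)))) I7) I8) [:: false; true].
Proof. by vm_compute. Qed.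

Lemma fam_wf : all (fun o => all (fun i => wfT (fam o i)) I8) [:: false; true].
Proof. by vm_compute. Qed.

Definition famdeg (o : bool) (i : nat) : nat :=
  if o then (if i is 0 then 3 else 1)%N else (if i is 0 then 0 else 2)%N.

Lemma fam_deg : all (fun o => all (fun i =>
  all (fun x => Nat.eqb (size x.1.2) (x.1.1 + x.1.1 + famdeg o i)) (fam o i)) I8) [:: false; true].
Proof. by vm_compute. Qed.

Definition good3 (c : Z) : bool := ~~ Z.eqb (Z.modulo c 3) 0.

Lemma famkey_check : all (fun o => all (fun i => all (fun l => (~~ ((i == 0%N) == (l == 0%N))) ||
   (let c := coefT (0%N, [::]) (dxsT (rev (famkey o i)) (fam o l)) in
    if i == l then good3 c else Z.eqb (Z.modulo c 3) 0)) I8) I8) [:: false; true].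
Proof. by vm_compute. Qed.

Lemma I8_all (p : nat -> bool) : all p I8 -> forall i : 'I_8, p i.
Proof. by move=> /allP h b; apply: h; case: b => [[|[|[|[|[|[|[|[|]]]]]]]]]. Qed.

Lemma bool_all (p : bool -> bool) : all p [:: false; true] -> forall o, p o.
Proof. by move=> /and3P[p0 p1 _] []. Qed.

Section CharThree.
Variables (K : fieldType) (T : tAlg K) (ok : pred nat) (tau : nat -> T).
Hypothesis tl : tlaws ok tau.
Hypothesis three : 3%:R = 0 :> K.
Notation O := (O T).
Notation zK := (zK K).
Notation dx := (@dx K T).
Notation dt := (@dt K T).
Notation ea := (@ea K T (gram3 K)).
Notation interp := (@interp K T ok tau).
Notation two := (two3 three).

Definition Qg (k : nat) (i : 'I_8) : O := interp (lev (odd k) i k./2) (fam (odd k) i).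
Definition Q (k : nat) : O -> Prop := span_of (Qg k).

Lemma Q_sub k : subspace (Q k). Proof. exact: span_of_subspace. Qed.

Lemma Q_gen k (i : nat) : (i < 8)%N -> Q k (interp (lev (odd k) i k./2) (fam (odd k) i)).
Proof. by move=> i8; have := span_of_mem (Qg k) (Ordinal i8). Qed.

Lemma shT0 t : shT 0 t = t.
Proof. by rewrite /shT; elim: t => //= -[[j m] c] t ->. Qed.

Lemma dec_sub (U : O -> Prop) r s o l t : subspace U ->
  (forall i, i \in l -> U (interp r (shT s (fam o i)))) ->
  U (\sum_(x <- dec s o l t) zK x.1 *: interp r x.2).
Proof.
move=> sU Ul; rewrite /dec big_map big_seq; apply: (subspace_sum sU) => i il.
exact/(subspaceZ sU)/Ul.
Qed.

Lemma ea_interp (b : 'I_7) r (o : bool) (i : 'I_8) : ea b (interp r (fam o i)) =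
  \sum_(x <- decE o i (eT b (fam o i))) zK x.1 *: interp r x.2.
Proof.
have wf := I8_all (bool_all fam_wf o) i.
rewrite -{1}(ix_val b) (eT_P tl three) ?ord7_ltb // ; apply: (eqT_P _ _ three).
exact: (ord7_all (I8_all (bool_all decE_check o) i) b).
Qed.

Lemma behead_I8 i : i \in behead I8 -> (0 < i < 8)%N.
Proof. by have /allP h : all (fun i => (0 < i < 8)%N) (behead I8) by []; apply: h. Qed.

Lemma Q_e k b (f : O) : Q k.+1 f -> Q k (ea b f).
Proof.
have sQ := Q_sub k.
have shQ r t : Q k (interp r t) -> Q k (interp r.+1 (shT 1 t)).
  by move=> Qt; rewrite (interp_succ tl); case: ifP => // _; case: sQ.
move=> [c ->]; rewrite (linop_sum _ _ _ (ea_lin tl _ b)); apply: (subspace_sum sQ) => i _.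
rewrite (linopZ (ea_lin tl _ b)); apply: (subspaceZ sQ); rewrite /Qg ea_interp.
have half : (k.+1)./2 = if odd k then k./2.+1 else k./2 by rewrite /= uphalf_half; case: (odd k).
rewrite half; have Qk := Q_gen k; case: i => -[|i] i8; rewrite /= /lev /=.
  case ek : (odd k) Qk shQ sQ => Qk shQ sQ /=.
    apply: dec_sub => // l /behead_I8/andP[l0 l8]; apply: shQ.
    by have := Qk l l8; rewrite /lev /= gtn_eqF.
  apply: dec_sub => // l /behead_I8/andP[l0 l8]; rewrite shT0.
  by have := Qk l l8; rewrite /lev /= gtn_eqF.
case ek : (odd k) Qk shQ sQ => Qk shQ sQ /=; rewrite big_cons; apply: (subspaceD sQ).
- by apply/(subspaceZ sQ)/shQ; exact: (Qk 0%N).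
- apply: dec_sub => // l /behead_I8/andP[l0 l8]; rewrite shT0.
  by have := Qk l l8; rewrite /lev /= gtn_eqF.
- by apply/(subspaceZ sQ); rewrite shT0; exact: (Qk 0%N).
- apply: dec_sub => // l /behead_I8/andP[l0 l8]; apply: shQ.
  by have := Qk l l8; rewrite /lev /= gtn_eqF.
Qed.

Lemma tauO_deg r j : o_deg (2 * r - 2 * j)%:Z (tauO ok tau r j).
Proof.
rewrite /tauO; case: ifP => [/andP[okr jr]|_]; last exact: (o_deg0 tl).
move=> S s; rewrite ffunE; case: (S =P set0) => [->|_]; last by rewrite (tcoef0 tl) eqxx.
have [->|sr] := eqVneq s (r - j)%N; last by rewrite (tcoef_tau tl) // eqxx.
by rewrite cards0 addn0 mulnBr.
Qed.

Lemma mono_deg k m (f : O) : o_deg k f -> o_deg (k + size m) (mono m f).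
Proof.
move=> fk; elim: m => [|n m IH] /=; first by rewrite addr0.
by rewrite -addn1 PoszD addrA; apply: (o_deg_xi tl).
Qed.

Lemma interp_deg r (o : bool) (i : 'I_8) : o_deg (2 * r + famdeg o i)%:Z (interp r (fam o i)).
Proof.
have /allP dg := I8_all (bool_all fam_deg o) i.
rewrite /Submission.interp big_seq; apply: (o_deg_sum tl) => x /dg/Nat.eqb_spec sx.
apply: (o_degZ tl); case: (leqP x.1.1 r) => xr.
  have -> : (2 * r + famdeg o i)%:Z = (2 * r - 2 * x.1.1)%:Z + (size x.1.2)%:Z.
    by rewrite sx -PoszD; congr Posz; move: (x.1.1) (famdeg _ _) xr => j d jr; rewrite addnA addnn -mul2n subnK // leq_mul2l.
  exact/mono_deg/tauO_deg.
rewrite /tauO [(_ <= r)%N]leqNgt xr andbF (linop0 (mono_lin tl _)); exact: (o_deg0 tl).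
Qed.

Lemma Qg_deg k i : o_deg (k%:Z + 2) (Qg k i).
Proof.
have -> : k%:Z + 2 = (2 * lev (odd k) i k./2 + famdeg (odd k) i)%:Z; last exact: interp_deg.
have kE := odd_double_half k; rewrite -{1}kE /lev /famdeg; case: i => -[|i] i8 /=; case: (odd k) => /=; lia.
Qed.

Lemma Q_deg k (f : O) : Q k f -> o_deg (k%:Z + 2) f.
Proof. by case=> c ->; apply: (o_deg_sum tl) => i _; apply/(o_degZ tl)/Qg_deg. Qed.

Notation Pf := (@Pf K T (gram3 K) (Q 0)).

Lemma Q_Pf k (f : O) : Q k f -> Pf k f.
Proof.
elim: k f => [//|k IH] f Qf; split; first exact: Q_deg.
by move=> b; apply/IH/Q_e.
Qed.

Definition dxs (w : seq nat) (f : O) : O := foldr (fun n g => dx (ix n) g) f w.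

Lemma dxs_lin w (c : K) (f g : O) : dxs w (c *: f + g) = c *: dxs w f + dxs w g.
Proof. by elim: w => //= n w ->; rewrite (dx_lin tl). Qed.

Lemma dxs_dt w (f : O) : dxs w (dt f) = dt (dxs w f).
Proof. by elim: w => //= n w ->; rewrite (dt_dx tl). Qed.

Lemma dxm_wf a m : all (fun n => Nat.ltb n 7) m ->
  all (fun y => all (fun n => Nat.ltb n 7) y.1) (dxm a m).
Proof.
elim: m => //= n m IH /andP[n7 m7]; rewrite all_cat; apply/andP; split.
  by case: Nat.eqb => //=; rewrite m7.
rewrite all_map; apply/allP => y /(allP (IH m7)) y7 /=; by rewrite n7.
Qed.

Lemma dxT_wf a t : wfT t -> wfT (dxT a t).
Proof.
move=> /allP wt; apply/allP => x /flattenP[s /mapP[y yt ->] /mapP[z zy ->]] /=.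
exact: (allP (dxm_wf a (wt y yt))).
Qed.

Lemma dxs_interp w r t : all (fun n => Nat.ltb n 7) w -> wfT t ->
  dxs w (interp r t) = interp r (dxsT w t).
Proof.
move=> w7 wt; suff [] : dxs w (interp r t) = interp r (dxsT w t) /\ wfT (dxsT w t) by [].
elim: w w7 => //= n w IH /andP[n7 /IH[-> wd]].
by rewrite (dxT_P tl) //; split=> //; apply: dxT_wf.
Qed.

Lemma famkey_wf (o : bool) (i : 'I_8) : all (fun n => Nat.ltb n 7) (rev (famkey o i)).
Proof.
have /(I8_all) : all (fun i => all (fun n => Nat.ltb n 7) (rev (famkey o i))) I8 by case: o.
exact.
Qed.

Definition ext (k : nat) (i : 'I_8) (f : O) : K :=
  t_coef (lev (odd k) i k./2) (dxs (rev (famkey (odd k) i)) f set0).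

Lemma ext_sum k i (c : 'I_8 -> K) (F : 'I_8 -> O) :
  ext k i (\sum_l c l *: F l) = \sum_l c l * ext k i (F l).
Proof.
rewrite /ext (linop_sum _ _ _ (dxs_lin _)) sum_ffunE (tcoef_sum tl).
by apply: eq_bigr => l _; rewrite (linopZ (dxs_lin _)) ffunE (tcoefZ tl).
Qed.

Lemma good3_neq0 c : good3 c -> zK c != 0.
Proof.
move=> gc; have [c1|c2] : Z.modulo c 3 = 1%Z \/ Z.modulo c 3 = 2%Z.
  by have := Z.mod_pos_bound c 3; move: gc; rewrite /good3; case: Z.eqb_spec => //; lia.
- rewrite {1}(Z.div_mod c 3) // c1 zKD zKM [zK 3]three mul0r add0r; exact: oner_neq0.
- rewrite {1}(Z.div_mod c 3) // c2 zKD zKM [zK 3]three mul0r add0r; exact: two.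
Qed.

Lemma ext_Qg k (i l : 'I_8) : ok (lev (odd k) i k./2) -> ~~ ok (lev (odd k) i k./2).+1 ->
  (l != i -> ext k i (Qg k l) = 0) /\ ext k i (Qg k i) != 0.
Proof.
move=> okr nok; set o := odd k.
have chk (j : 'I_8) : ~~ ((i == 0%N :> nat) == (j == 0%N :> nat)) ||
   (let c := coefT (0%N, [::]) (dxsT (rev (famkey o i)) (fam o j)) in
    if i == j :> nat then good3 c else Z.eqb (Z.modulo c 3) 0) := 
  I8_all (I8_all (bool_all famkey_check o) i) j.
have extE (j : 'I_8) : ((i == 0%N :> nat) == (j == 0%N :> nat)) -> ext k i (Qg k j) =
  zK (coefT (0%N, [::]) (dxsT (rev (famkey o i)) (fam o j))) * t_coef (lev o i k./2) (tau (lev o i k./2)).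
  move=> ij; rewrite /ext /Qg -/o dxs_interp ?famkey_wf //; last exact: (I8_all (bool_all fam_wf o) j).
  by rewrite -(coef_interp tl) // {2}/lev -(eqP ij).
split; last first.
  rewrite extE ?eqxx //; apply: mulf_neq0; last exact: (tcoef_tau_neq0 tl).
  by have := chk i; rewrite eqxx /= eqxx => /good3_neq0.
move=> li; case ij : ((i == 0%N :> nat) == (l == 0%N :> nat)).
  rewrite extE //; have := chk l; rewrite ij /= val_eqE eq_sym (negPf li).
  by move/Z.eqb_spec => c0; rewrite (zK_mod3 three c0) mul0r.
rewrite /ext /Qg -/o dxs_interp ?famkey_wf //; last exact: (I8_all (bool_all fam_wf o) l).
have : lev o l k./2 = (lev o i k./2).+1 \/ (lev o l k./2 < lev o i k./2)%N.
  move: ij; rewrite /lev; case: (i == 0%N :> nat); case: (l == 0%N :> nat); case: o {chk extE} => //= _; by [left|right].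
case=> [->|lt]; last exact: (coef_interp_lt tl).
by rewrite (interp_not_ok tl) // ffunE (tcoef0 tl).
Qed.

Lemma dt_Qg k i : dt (Qg k.+2 i) = if ok (lev (odd k) i k./2).+1 then Qg k i else 0.
Proof.
rewrite /Qg /= negbK (dt_interp tl).
have -> : lev (odd k) i k./2.+1 = (lev (odd k) i k./2).+1 by rewrite /lev; case: ifP.
exact: (interp_succ tl).
Qed.

Lemma dt_top r (f : O) (S : {set 'I_7}) : ~~ ok r.+1 -> t_coef r (dt f S) = 0.
Proof. by move=> nok; rewrite ffunE; apply/(tcoef_der tl)/(tcoef_ok tl). Qed.

Lemma Q_lift k (c : 'I_8 -> K) (f : O) : dt f = \sum_i c i *: Qg k i ->
  dt f = dt (\sum_i c i *: Qg k.+2 i).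
Proof.
move=> fE; rewrite (linop_sum _ _ _ (dt_lin tl)) fE; apply: eq_bigr => i _.
rewrite (linopZ (dt_lin tl)) dt_Qg; case: ifPn => // nok.
case okr : (ok (lev (odd k) i k./2)); last by rewrite /Qg (interp_not_ok tl) ?okr.
suff -> : c i = 0 by rewrite !scale0r.
have : ext k i (dt f) = 0 by rewrite /ext dxs_dt dt_top.
rewrite fE ext_sum (bigD1 i) //= big1 ?addr0 => [|l li]; last first.
  by rewrite (proj1 (ext_Qg l okr nok) li) mulr0.
by move/eqP; rewrite mulf_eq0 (negPf (proj2 (ext_Qg i okr nok))) orbF => /eqP.
Qed.

End CharThree.

Definition red3 (c : Z) : Z := Z.modulo c 3.

Definition contact_rows : seq lrow :=
  [:: (6%N, 1%Z)] :: flatten [seq flatten [seq [seq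
    row_add red3
      (row_nz red3 [seq ((7 * b + i)%N, coefT (0%N, [::]) (dxT c (dxT a (TC i)))) | i <- I7])
      (row_nz red3 [seq ((7 * a + i)%N, coefT (0%N, [::]) (dxT c (dxT b (TC i)))) | i <- I7])
    | c <- I7] | b <- I7] | a <- I7].

Lemma contact_rows_solve : solves red3 good3 (iota 0 49) contact_rows.
Proof. by vm_compute. Qed.

Section CharThreeProlong.
Variables (K : fieldType) (T : tAlg K) (ok : pred nat) (tau : nat -> T).
Hypothesis tl : tlaws ok tau.
Hypothesis three : 3%:R = 0 :> K.
Notation O := (O T).
Notation zK := (zK K).
Notation dx := (@dx K T).
Notation dt := (@dt K T).
Notation ea := (@ea K T (gram3 K)).
Notation yy := (@yy K T (gram3 K)).
Notation interp := (@interp K T ok tau).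
Notation Bsym := (gram3_sym K).
Notation BBi := (gram3_sq K).
Notation two := (two3 three).
Notation Qg := (@Qg K T ok tau).
Notation Q := (@Q K T ok tau).
Notation Pf := (@Pf K T (gram3 K) (Q 0)).

Lemma red3_zK c : zK (red3 c) = zK c.
Proof.
rewrite {2}(Z.div_mod c 3) // zKD zKM [zK 3]three mul0r add0r; by [].
Qed.

Lemma interp_one : interp 0 TA = o_one T.
Proof.
have -> : interp 0 TA = interp 0 [:: ((0%N, [::]), 1%Z)].
  by rewrite /Submission.interp /TA !big_cons !big_nil /tauO /= andbF !(linop0 (xi_lin tl _)) !scaler0 !addr0.
rewrite /Submission.interp big_seq1 /= zK1 scale1r /tauO (ok0 tl) /=.
by apply/ffunP => S; rewrite !ffunE (tau0 tl).
Qed.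

Lemma interp0_TB (i : 'I_7) : interp 0 (TB i) = yy (ix (star i)) (o_one T).
Proof.
have sh t : interp 0 t = interp 0 [seq x <- t | Nat.eqb x.1.1 0].
  rewrite /Submission.interp big_filter [LHS](bigID (fun x => Nat.eqb x.1.1 0)) /= [X in _ + X]big1 ?addr0 //.
  move=> x; case: (x.1.1) => // j _.
  by rewrite /tauO andbF (linop0 (mono_lin tl _)) scaler0.
have lead : all (fun i => (fun s => if s is [:: ((0, [:: j]), 1%Z)] then Nat.eqb i j else false)
    [seq x <- TB i | Nat.eqb x.1.1 0]) I7 by vm_compute.
have st : all (fun i => Nat.eqb (star (star i)) i) I7 by vm_compute.
rewrite sh; move: (ord7_all lead i); case: filter => // -[[[|//] [//|j [|//]]] [|[]|]//] [|//] /Nat.eqb_spec <-.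
rewrite /Submission.interp big_seq1 /= zK1 scale1r yy3 ixK ?star_ltb //.
have /Nat.eqb_spec -> := ord7_all st i; congr (xi _ _).
rewrite /tauO (ok0 tl) /=.
by apply/ffunP => S; rewrite !ffunE (tau0 tl).
Qed.

Lemma span_yy_one f : (exists c : 'I_7 -> K, f = \sum_i c i *: interp 0 (TB i)) <->
  exists c : 'I_7 -> K, f = \sum_i c i *: yy i (o_one T).
Proof.
have st : all (fun i => Nat.eqb (star (star i)) i) I7 by vm_compute.
have sK : involutive (fun i : 'I_7 => ix (star i)).
  by move=> i; rewrite ixK ?star_ltb //; have /Nat.eqb_spec -> := ord7_all st i; apply: ix_val.
split=> -[c ->]; exists (fun i => c (ix (star i))); rewrite (reindex_inj (inv_inj sK)) /=;
  apply: eq_bigr => i _; rewrite ?interp0_TB //.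
by rewrite sK.
Qed.

Lemma Q0_e f b : Q 0 f -> exists c : 'I_7 -> K, ea b f = \sum_i c i *: yy i (o_one T).
Proof.
move=> [c ->]; apply/span_yy_one.
have sU := span_of_subspace (fun i : 'I_7 => interp 0 (TB i)).
change (span_of (fun i : 'I_7 => interp 0 (TB i)) (ea b (\sum_i c i *: Qg 0 i))).
have Ui i : i \in behead I8 -> span_of (fun i : 'I_7 => interp 0 (TB i)) (interp 0 (fam true i)).
  move=> /behead_I8/andP[]; case: i => // i _ i7.
  exact: (span_of_mem (fun i : 'I_7 => interp 0 (TB i)) (Ordinal (i7 : (i < 7)%N))).
rewrite (linop_sum _ _ _ (ea_lin tl _ b)); apply: (subspace_sum sU) => i _.
rewrite (linopZ (ea_lin tl _ b)); apply: (subspaceZ sU); rewrite /Submission.Qg (ea_interp tl three).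
case: i => -[|i] i8; rewrite /lev /=.
  apply: dec_sub => // l /Ui Ul; rewrite (interp_succ tl) (ok1 tl) //.
rewrite big_cons; apply: (subspaceD sU); last first.
  by apply: dec_sub => // l /Ui Ul; rewrite shT0.
apply: (subspaceZ sU); suff -> : interp 0 (shT 1 (fam true 0)) = 0 by case: sU.
rewrite /Submission.interp big_map big1 // => x _; rewrite /tauO andbF (linop0 (mono_lin tl _)) scaler0 //.
Qed.

Lemma one_neq0 : o_one T <> 0.
Proof.
move=> /ffunP/(_ set0); rewrite !ffunE eqxx -(tau0 tl) => t0.
by have := tcoef_tau_neq0 tl (ok0 tl); rewrite t0 (tcoef0 tl) eqxx.
Qed.

Lemma dt_span0 (a : 'I_8 -> K) : dt (\sum_i a i *: Qg 0 i) = a ord0 *: o_one T.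
Proof.
rewrite (linop_sum _ _ _ (dt_lin tl)) big_ord_recl big1 ?addr0 => [|i _].
  by rewrite (linopZ (dt_lin tl)) /Submission.Qg /lev /= (dt_interp tl) (interp_succ tl) (ok1 tl) interp_one.
rewrite (linopZ (dt_lin tl)) /Submission.Qg /lev /= (dt_interp tl).
rewrite /Submission.interp big_map big1 ?scaler0 // => x _.
by rewrite /tauO andbF (linop0 (mono_lin tl _)) scaler0.
Qed.

Lemma contact_kernel (f : O) (y : 'I_7 -> 'I_7 -> K) :
  (forall b, dx b f = \sum_i y b i *: interp 0 (TC i)) -> y (ix 0) (ix 6) = 0 ->
  forall b, dx b f = 0.
Proof.
move=> fy y06.
pose Y n := y (ix (n %/ 7)) (ix (n %% 7)).
have YE b i : Nat.ltb i 7 -> Y (7 * b + i)%N = y (ix b) (ix i).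
  move=> i7; have i7' : (i < 7)%N by apply/ssrnat.ltP/Nat.ltb_lt.
  by rewrite /Y mulnC divnMDl // divn_small // addn0 modnMDl modn_small.
have sumI7 (F : nat -> K) : \sum_(i <- I7) F i = \sum_(i < 7) F i.
  by rewrite big_mkord || (rewrite -[I7]/(iota 0 7) -[iota 0 7]/(index_iota 0 7) big_mkord).
have Y0 : forall n, n \in iota 0 49 -> Y n = 0.
  apply: (solvesP red3_zK (good3_neq0 three) contact_rows_solve) => r.
  rewrite inE => /orP[/eqP->|]; first by rewrite /rowval big_seq1 /= zK1 mul1r -[6%N]/(7 * 0 + 6)%N YE.
  move=> /flattenP[s /mapP[a aI ->]] /flattenP[s' /mapP[b bI ->]] /mapP[c cI ->].
  have I7_ltb n : n \in I7 -> Nat.ltb n 7 by move=> nI; have /allP h : all (fun n => Nat.ltb n 7) I7 by []; exact: h.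
  have := dx_dx tl (ix a) (ix b) f => /eqP; rewrite -addr_eq0 => /eqP ab0.
  have E n m : n \in I7 -> m \in I7 -> t_coef 0 (dx (ix c) (dx (ix n) (dx (ix m) f)) set0) =
      (\sum_(i < 7) y (ix m) i * zK (coefT (0%N, [::]) (dxT c (dxT n (TC i))))) * t_coef 0 (tau 0%N).
    move=> nI mI; rewrite fy (linop_sum _ _ _ (dx_lin tl _)) (linop_sum _ _ _ (dx_lin tl _)).
    rewrite sum_ffunE (tcoef_sum tl) mulr_suml; apply: eq_bigr => i _.
    have wf : wfT (TC i) by have := I8_all (bool_all fam_wf false) (lift ord0 i).
    rewrite !(linopZ (dx_lin tl _)) ffunE (tcoefZ tl) -mulrA; congr (_ * _).
    rewrite (dxT_P tl) ?I7_ltb // (dxT_P tl) ?I7_ltb ?dxT_wf // (coef_interp tl) //; exact: (ok0 tl).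
  have : t_coef 0 (dx (ix c) (dx (ix a) (dx (ix b) f) + dx (ix b) (dx (ix a) f)) set0) = 0.
    by rewrite ab0 (linop0 (dx_lin tl _)) ffunE (tcoef0 tl).
  rewrite (linopD (dx_lin tl _)) ffunE (tcoefD tl) E // E //.
  rewrite -mulrDl => /eqP; rewrite mulf_eq0 (negPf (tcoef_tau_neq0 tl (ok0 tl))) orbF => /eqP h0.
  rewrite (rowval_add red3_zK). rewrite !(rowval_nz red3_zK Y) /rowval !big_map !sumI7 -[RHS]h0; congr (_ + _); apply: eq_bigr => i _ /=.
    by rewrite YE ?ord7_ltb // ix_val mulrC.
  by rewrite YE ?ord7_ltb // ix_val mulrC.
move=> b; rewrite fy big1 // => i _; rewrite -(ix_val b) -{1}(ix_val i) -YE ?ord7_ltb // Y0 ?scale0r //.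
by rewrite mem_iota /=; have := ltn_ord b; have := ltn_ord i; lia.
Qed.

Lemma Pf_dt0 f : Pf 1 f -> dt f = 0 -> exists l, f = l *: Qg 1 ord0.
Proof.
move=> [fd fP] f0.
have {}fP b : exists y : 'I_7 -> K, dx b f = \sum_i y i *: interp 0 (TC i).
  have [a aE] : Q 0 (ea b f) := fP b.
  have eE : ea b f = dx b f by rewrite (ea3 three) f0 (linop0 (xi_lin tl _)) subr0.
  have a0 : a ord0 = 0.
    have : a ord0 *: o_one T = 0.
      by rewrite -dt_span0 -aE eE (dt_dx tl) f0 (linop0 (dx_lin tl _)).
    by move/eqP; rewrite scaler_eq0 => /orP[/eqP//|/eqP/one_neq0].
  exists (fun i => a (lift ord0 i)); rewrite -eE aE big_ord_recl a0 scale0r add0r //.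
have [y yE] := choice fP.
pose l := y (ix 0) (ix 6); exists l.
set w := Qg 1 ord0; apply/eqP; rewrite -subr_eq0; apply/eqP; set g := f - _.
have wE : w = interp 0 TW by [].
have dtw : dt w = 0.
  rewrite wE (dt_interp tl) /Submission.interp big_map big1 // => x _.
  by rewrite /tauO andbF (linop0 (mono_lin tl _)) scaler0.
have wd b : dx b w = \sum_(i < 7) zK (coefT (0%N, famkey false i.+1) (eT b TW) *
     coefT (0%N, famkey false i.+1) (fam false i.+1))%Z *: interp 0 (TC i).
  have -> : dx b w = ea b w by rewrite (ea3 three) dtw (linop0 (xi_lin tl _)) subr0.
  rewrite wE -[TW]/(fam true (@ord0 7)) (ea_interp tl three).
  have -> : decE true (@ord0 7) = dec 0 false (behead I8) by [].
  rewrite /dec big_map.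
  rewrite -[behead I8]/(index_iota 1 8) big_add1 /= big_mkord; apply: eq_bigr => i _.
  by rewrite shT0.
have gE : g = - l *: w + f by rewrite /g scaleNr addrC.
have dtg : dt g = 0 by rewrite gE (dt_lin tl) dtw f0 scaler0 addr0.
have dxg : forall b, dx b g = 0.
  apply: (contact_kernel (y := fun b i => - l * zK (coefT (0%N, famkey false i.+1) (eT b TW) *
     coefT (0%N, famkey false i.+1) (fam false i.+1))%Z + y b i)) => [b|].
    rewrite gE (dx_lin tl) wd yE scaler_sumr -big_split; apply: eq_bigr => i _.
    by rewrite /= scalerA scalerDl.
  rewrite !ixK //; set z := (_ * _)%Z; have -> : z = 1%Z by vm_compute.
  by rewrite zK1 mulr1 /l addNr.
have [c gc] : exists c, g = c *: o_one T.
  by apply: (ea_const tl Bsym BBi two) => b; rewrite (ea3 three) dxg dtg (linop0 (xi_lin tl _)) subr0.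
rewrite gc; apply: (o_deg_const tl (k := 1%:Z + 2)) => //; rewrite -gc gE.
by apply: (o_deg_lin tl); [exact: (@Qg_deg _ _ _ _ tl 1 ord0)|exact: fd].
Qed.

Lemma Pf_dt0_high k f : Pf k.+2 f -> dt f = 0 -> f = 0.
Proof.
elim: k f => [|k IH] f [fd fP] f0.
  suff dxf : forall b, ea b f = 0.
    have [c fc] := ea_const tl Bsym BBi two dxf.
    by move: fd; rewrite fc => /(o_deg_const tl); apply.
  move=> b; have eE : ea b f = dx b f.
    by rewrite (ea3 three) f0 (linop0 (xi_lin tl _)) subr0.
  have [l lE] : exists l, dx b f = l *: Qg 1 ord0.
    apply: Pf_dt0; first by rewrite -eE; apply: fP.
    by rewrite (dt_dx tl) f0 (linop0 (dx_lin tl _)).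
  have wE : Qg 1 ord0 = interp 0 TW by [].
  have dbw : l *: dx b (interp 0 TW) = 0.
    have := dx_dx tl b b f => /eqP; rewrite -addr_eq0 -mulr2n -scaler_nat scaler_eq0 (negPf two) /=.
    by rewrite lE wE (linopZ (dx_lin tl _)) => /eqP.
  have chk : all (fun b => let p := nth [::] [:: [:: 4; 1]; [:: 4; 0]; [:: 5; 0]; [:: 6; 0];
       [:: 1; 0]; [:: 2; 0]; [:: 3; 0]]%N b in
     all (fun n => Nat.ltb n 7) p && good3 (coefT (0%N, [::]) (dxsT p (dxT b TW)))) I7 by vm_compute.
  have /andP[] := ord7_all chk b; set p := nth _ _ _ => p7 /(good3_neq0 three) nz.
  have := congr1 (fun g => t_coef 0 (dxs p g set0)) dbw => /=.
  rewrite (linopZ (dxs_lin tl p)) -{1}(ix_val b) (dxT_P tl) ?ord7_ltb // (dxs_interp tl) ?dxT_wf //.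
  rewrite ffunE (tcoefZ tl) (coef_interp tl) ?(ok0 tl) // (linop0 (dxs_lin tl p)) ffunE (tcoef0 tl).
  move/eqP; rewrite !mulf_eq0 (negPf nz) (negPf (tcoef_tau_neq0 tl (ok0 tl))) !orbF => /eqP l0.
  by rewrite eE lE l0 scale0r.
have [c fc] : exists c, f = c *: o_one T.
  apply: (ea_const tl Bsym BBi two) => b; apply: IH; first exact: fP.
  by rewrite /Submission.ea (dt_ee tl) f0 (linop0 (ee_lin tl _ _ b)).
by move: fd; rewrite fc => /(o_deg_const tl); apply.
Qed.

Lemma dt_ea_ea f : dt f = 2%:R *: ea (ix 0) (ea (ix 0) f).
Proof.
have := ea_ea tl two Bsym (ix 0) (ix 0) f.
have -> : gram3 K (ix 0) (ix 0) = 1 by rewrite gram3E ixK // eqxx.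
by rewrite scale1r => <-; rewrite scaler_nat mulr2n.
Qed.

Lemma Pf_Q k f : Pf k f -> Q k f.
Proof.
have [m] := ubnP k; elim: m k f => // m IH [//|[|k]] f km Pff; have [fd fP] := Pff.
  have [c cE] : exists c : 'I_7 -> K, dt f = \sum_i c i *: interp 0 (TB i).
    apply/span_yy_one; have [c cE] := Q0_e (ix 0) (fP (ix 0)).
    exists (fun i => 2%:R * c i); rewrite dt_ea_ea cE scaler_sumr.
    by apply: eq_bigr => i _; rewrite scalerA.
  pose g := \sum_i c i *: Qg 1 (lift ord0 i).
  have Qgg : Q 1 g.
    apply: (subspace_sum (Q_sub _ _ _)) => i _; apply: (subspaceZ (Q_sub _ _ _)); exact: span_of_mem.
  have dtg : dt g = dt f.
    rewrite cE (linop_sum _ _ _ (dt_lin tl)); apply: eq_bigr => i _.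
    by rewrite (linopZ (dt_lin tl)) /Submission.Qg /lev /= (dt_interp tl) (interp_succ tl) (ok1 tl).
  have [l lE] : exists l, f - g = l *: Qg 1 ord0.
    have Pg := Q_Pf tl three Qgg; apply: Pf_dt0.
      rewrite addrC -scaleN1r; have [_ Pl] := Pf_sub tl (gram3 K) (Q_sub ok tau 0) 1; exact: Pl.
    by rewrite addrC -scaleN1r (dt_lin tl) dtg scaleN1r addNr.
  rewrite -[f](subrK g) lE; apply: (subspaceD (Q_sub _ _ _)) => //.
  apply: (subspaceZ (Q_sub _ _ _)); exact: span_of_mem.
have [c cE] : Q k (dt f).
  rewrite dt_ea_ea; apply: (subspaceZ (Q_sub _ _ _)); apply: (Q_e tl three).
  by apply: IH; [exact: km|exact: fP].
have dtE := Q_lift tl three cE; set g := \sum_i _ in dtE.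
have Qgg : Q k.+2 g by exists c.
suff : f - g = 0 by move/eqP; rewrite subr_eq0 => /eqP->.
have Pg := Q_Pf tl three Qgg; apply: (@Pf_dt0_high k).
  rewrite addrC -scaleN1r; have [_ Pl] := Pf_sub tl (gram3 K) (Q_sub ok tau 0) k.+2; exact: Pl.
by rewrite addrC -scaleN1r (dt_lin tl) -dtE scaleN1r addNr.
Qed.

End CharThreeProlong.

Definition zmat := seq (seq Z).
Definition zent (A : zmat) (i j : nat) : Z := nth 0%Z (nth [::] A i) j.
Definition mkmat (F : nat -> nat -> Z) : zmat := [seq [seq F i j | j <- I7] | i <- I7].
Definition zsum (F : nat -> Z) : Z := foldr (fun k c => (F k + c)%Z) 0%Z I7.
Definition mulmat A B := mkmat (fun i j => zsum (fun k => (zent A i k * zent B k j)%Z)).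
Definition submat A B := mkmat (fun i j => (zent A i j - zent B i j)%Z).
Definition commat A B := submat (mulmat A B) (mulmat B A).
Definition eqmat3 A B := all (fun i => all (fun j => Z.eqb (Z.modulo (zent A i j - zent B i j) 3) 0) I7) I7.

Definition delta (i j : nat) : Z := if Nat.eqb i j then 1%Z else 0%Z.
(* the matrix of R_{e_p, e_q} *)
Definition Rmat (p q : nat) : zmat :=
  mkmat (fun i k => (delta k (star q) * delta i p - delta k (star p) * delta i q)%Z).

(* the action of the field with potential [TC i] on the e_a *)
Definition MCtable : seq zmat := Eval vm_compute in
  [seq mkmat (fun b a => Z.opp (coefT (0%N, [:: star b]) (eT a (TC i)))) | i <- I7].
Definition MC (i : nat) : zmat := nth [::] MCtable i.

Lemma MCE : all (fun i => all (fun b => all (fun a =>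
  Z.eqb (zent (MC i) b a) (Z.opp (coefT (0%N, [:: star b]) (eT a (TC i))))) I7) I7) I7.
Proof. by vm_compute. Qed.

Definition X1pL := mkmat (fun i k => - zent (Rmat 3 5) i k - zent (Rmat 0 1) i k)%Z.
Definition X2pL := Rmat 2 4.
Definition X1mL := mkmat (fun i k => - zent (Rmat 2 6) i k - zent (Rmat 0 4) i k)%Z.
Definition X2mL := Rmat 1 5.

Lemma MC_check : let X3p := commat X1pL X2pL in let X3m := commat X1mL X2mL in
  all (fun i => eqmat3 (nth [::] [:: X1pL; X1mL; X3p; X3m; commat X1pL X3p; commat X1mL X3m;
    commat X1pL X1mL] i) (MC i)) I7.
Proof. by vm_compute. Qed.

Definition cstr_table : seq zmat := Eval vm_compute in [seq mkmat (fun j k =>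
  let key := famkey false k.+1 in let p := nth 0%N key 0 in let q := nth 0%N key 1 in
  Z.mul (zent (commat (MC i) (MC j)) (star q) p) (zent (MC k) (star q) p)) | i <- I7].
Definition cstr (i j k : nat) : Z := zent (nth [::] cstr_table i) j k.

Lemma cstr_check : all (fun i => all (fun j => eqmat3 (commat (MC i) (MC j))
  (mkmat (fun b a => zsum (fun k => cstr i j k * zent (MC k) b a)%Z))) I7) I7.
Proof. by vm_compute. Qed.

(* the coefficients of A_1 and C_k in the derivative of B_a along e_c *)
Definition beta_table : zmat := Eval vm_compute in
  mkmat (fun c a => coefT (0%N, [::]) (eT c (TB a))).
Definition gamma_table : seq zmat := Eval vm_compute in
  [seq mkmat (fun c a => Z.mul (coefT (1%N, famkey false k.+1) (eT c (TB a)))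
                               (coefT (0%N, famkey false k.+1) (TC k))) | k <- I7].
Definition betaB (c a : nat) : Z := zent beta_table c a.
Definition gammaB (c a k : nat) : Z := zent (nth [::] gamma_table k) c a.

Lemma betagammaE : all (fun c => all (fun a =>
  Z.eqb (betaB c a) (coefT (0%N, [::]) (eT c (TB a))) && all (fun k =>
  Z.eqb (gammaB c a k) (coefT (1%N, famkey false k.+1) (eT c (TB a)) *
                        coefT (0%N, famkey false k.+1) (TC k))) I7) I7) I7.
Proof. by vm_compute. Qed.

Definition nB (i a c : nat) : Z := zent (MC i) (star c) (star a).

Lemma nB_check : all (fun i => all (fun a => all (fun b =>
   Z.eqb (Z.modulo (- zsum (fun c => zent (MC i) c b * betaB c a) -
                    zsum (fun c => nB i a c * betaB b c)) 3) 0 &&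
   all (fun l => Z.eqb (Z.modulo (- zsum (fun c => zent (MC i) c b * gammaB c a l) +
       zsum (fun k => gammaB b a k * cstr i k l) -
       zsum (fun c => nB i a c * gammaB b c l)) 3) 0) I7) I7) I7) I7.
Proof. by vm_compute. Qed.

Section CharThreeBrackets.
Variables (K : fieldType) (T : tAlg K) (ok : pred nat) (tau : nat -> T).
Hypothesis tl : tlaws ok tau.
Hypothesis three : 3%:R = 0 :> K.
Notation O := (O T).
Notation V := (vect_alg T).
Notation zK := (zK K).
Notation dx := (@dx K T).
Notation dt := (@dt K T).
Notation ea := (@ea K T (gram3 K)).
Notation yy := (@yy K T (gram3 K)).
Notation interp := (@interp K T ok tau).
Notation Bsym := (gram3_sym K).
Notation BBi := (gram3_sq K).
Notation two := (two3 three).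
Notation Qg := (@Qg K T ok tau).
Notation KF := (@KF K T (gram3 K) (gram3 K)).
Notation e := (v_e T (gram3 K) : _ -> V).
Let VL := vect_lie tl.

Definition zmx (A : zmat) : 'M[K]_7 := \matrix_(i, j) zK (zent A i j).

Lemma zent_mkmat F (i j : 'I_7) : zent (mkmat F) i j = F i j.
Proof.
rewrite /zent /mkmat (nth_map 0%N) ?ltn_ord // (nth_map 0%N) ?ltn_ord //.
have nthI7 (k : 'I_7) : nth 0%N I7 k = k by case: k => [[|[|[|[|[|[|[|]]]]]]]].
by rewrite !nthI7.
Qed.

Lemma zK_zsum F : zK (zsum F) = \sum_(i < 7) zK (F i).
Proof.
rewrite /zsum; have : \sum_(i < 7) zK (F i) = \sum_(i <- I7) zK (F i).
  by rewrite -[I7]/(index_iota 0 7) big_mkord.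
move=> ->; elim: I7 => [|k s IH]; first by rewrite big_nil.
by rewrite big_cons /= zKD IH.
Qed.

Lemma zmx_com A B : zmx (commat A B) = zmx A *m zmx B - zmx B *m zmx A.
Proof.
apply/matrixP => i j; rewrite !mxE /commat /submat zent_mkmat.
rewrite -[(_ - _)%Z]/(_ + - _)%Z zKD zKN /mulmat !zent_mkmat !zK_zsum.
by congr (_ - _); apply: eq_bigr => k _; rewrite zKM !mxE.
Qed.

Lemma zK_eq3 a b : Z.eqb (Z.modulo (a - b) 3) 0 -> zK a = zK b.
Proof.
move=> /Z.eqb_spec /(zK_mod3 three); rewrite -[(_ - _)%Z]/(_ + - _)%Z zKD zKN.
by move/eqP; rewrite subr_eq0 => /eqP.
Qed.

Lemma eqmat3P A B : eqmat3 A B -> zmx A = zmx B.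
Proof.
move=> AB; apply/matrixP => i j; rewrite !mxE; apply: zK_eq3.
exact: (ord7_all (ord7_all AB i) j).
Qed.

Definition C0 (i : 'I_7) : O := Qg 0 (lift ord0 i).
Definition A1 : O := Qg 0 ord0.
Definition B1 (i : 'I_7) : O := Qg 1 (lift ord0 i).
Definition W0 : O := Qg 1 ord0.

Lemma ea_A1 a : ea a A1 = - yy a (o_one T).
Proof.
rewrite (ea3 three) yy3.
have d0 : dt A1 = o_one T.
  by rewrite /A1 /Submission.Qg /lev /= (dt_interp tl) (interp_succ tl) (ok1 tl) (interp_one tl).
rewrite d0; suff -> : dx a A1 = 0 by rewrite sub0r.
rewrite /A1 /Submission.Qg /lev /= -(ix_val a) (dxT_P tl) ?ord7_ltb //.
rewrite /Submission.interp big_seq big1 // => x.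
have /allP h : all (fun b => all (fun x => Nat.ltb 1 x.1.1) (dxT b (fam false 0))) I7 by vm_compute.
have aI : (a : nat) \in I7 by case: a => [[|[|[|[|[|[|[|]]]]]]]].
move=> /(allP (h a aI))/Nat.ltb_lt/ssrnat.ltP x1.
by rewrite /tauO leqNgt x1 andbF (linop0 (mono_lin tl _)) scaler0.
Qed.

Lemma ea_C0 a i : ea a (C0 i) = - \sum_b zmx (MC i) b a *: yy b (o_one T).
Proof.
have st : all (fun i => Nat.eqb (star (star i)) i) I7 by vm_compute.
have sK : involutive (fun i : 'I_7 => ix (star i)).
  by move=> j; rewrite ixK ?star_ltb //; have /Nat.eqb_spec -> := ord7_all st j; apply: ix_val.
rewrite /C0 /Submission.Qg (ea_interp tl three).
have -> : decE (odd 0) (lift ord0 i) (eT a (fam (odd 0) (lift ord0 i))) =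
   dec 1 true [:: 0%N] (eT a (TC i)) ++ dec 0 true (behead I8) (eT a (TC i)) by [].
rewrite big_cat /dec !big_map big_seq1.
have -> : interp (lev (odd 0) (lift ord0 i) 0./2) (shT 1 (fam true 0)) = 0.
 
  by rewrite /Submission.interp big_map big1 // => x _; rewrite /tauO andbF (linop0 (mono_lin tl _)) scaler0.
rewrite scaler0 Monoid.mul1m -[behead I8]/(index_iota 1 8) big_add1 big_mkord -sumrN.
rewrite [RHS](reindex_inj (inv_inj sK)) /=; apply: eq_bigr => l _.
rewrite shT0 -[interp _ _]/(interp 0 (TB l)) (interp0_TB tl) -scaleNr mxE; congr (_ *: _).
have /Z.eqb_spec -> : Z.eqb (zent (MC i) (ix (star l)) a) (- coefT (0%N, [:: star (ix (star l))]) (eT a (TC i)))%Z.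
  exact: (ord7_all (ord7_all (ord7_all MCE i) _) a).
rewrite -zKN Z.opp_involutive ixK ?star_ltb //.
have /Nat.eqb_spec -> := ord7_all st l; congr zK.
have /Z.eqb_spec -> : Z.eqb (coefT (0%N, famkey true l.+1) (fam true l.+1)) 1.
  have h : all (fun l => Z.eqb (coefT (0%N, famkey true l.+1) (fam true l.+1)) 1) I7 by vm_compute.
  exact: (ord7_all h l).
rewrite Z.mul_1_r; congr (coefT (_, _) _); by case: l => [[|[|[|[|[|[|[|]]]]]]]].
Qed.

Lemma dt_A1 : dt A1 = o_one T.
Proof. by rewrite /A1 /Submission.Qg /lev /= (dt_interp tl) (interp_succ tl) (ok1 tl) (interp_one tl). Qed.

Lemma dt_C0 i : dt (C0 i) = 0.
Proof.
rewrite /C0 /Submission.Qg /lev /= (dt_interp tl) /Submission.interp big_map big1 // => x _.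
by rewrite /tauO andbF (linop0 (mono_lin tl _)) scaler0.
Qed.

Lemma ea_B1 c a : ea c (B1 a) = zK (betaB c a) *: A1 + \sum_(k < 7) zK (gammaB c a k) *: C0 k.
Proof.
rewrite /B1 /Submission.Qg (ea_interp tl three).
have -> : decE (odd 1) (lift ord0 a) (eT c (fam (odd 1) (lift ord0 a))) =
   dec 0 false [:: 0%N] (eT c (TB a)) ++ dec 1 false (behead I8) (eT c (TB a)) by [].
rewrite big_cat /dec !big_map big_seq1 shT0; congr (_ + _).
  have /andP[/Z.eqb_spec -> _] := ord7_all (ord7_all betagammaE c) a.
  by congr (zK _ *: _); rewrite -[coefT _ (fam _ _)]/(1%Z) Z.mul_1_r.
rewrite -[behead I8]/(index_iota 1 8) big_add1 /= big_mkord; apply: eq_bigr => l _ /=.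
have /andP[_ h] := ord7_all (ord7_all betagammaE c) a.
have /Z.eqb_spec -> := ord7_all h l.
by rewrite -[lev _ _ _]/(1%N) (interp_succ tl) (ok1 tl).
Qed.

Lemma br_dt_KF (f : O) : br (v_dt T : V) (KF f) = KF (dt f).
Proof.
elim/(o_par_ind): f => [s f fs|f g IHf IHg]; last first.
  by rewrite (KFD tl) (lbrDr VL) IHf IHg (linopD (dt_lin tl)) (KFD tl).
rewrite [LHS](v_br_dt tl (v_par_KF tl fs)).
have dtosg (h : O) : dt (osg h) = osg (dt h) by rewrite /Submission.dt (o_der_osg tl) expr0 scale1r.
apply/ffunP => -[a|]; rewrite ffunE ?KFSome ?KFNone.
  rewrite /KFa (linop_sum _ _ _ (dt_lin tl)); apply: eq_bigr => b _.
  by rewrite (linopZ (dt_lin tl)) dtosg /eh (dt_ee tl).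
rewrite (linopD (dt_lin tl)) (linopN (dt_lin tl)) (linopZ (dt_lin tl)) (linop_sum _ _ _ (dt_lin tl)).
by congr (_ - _ *: _); apply: eq_bigr => b _; rewrite (dt_xi tl) /eh (dt_ee tl).
Qed.

Lemma br_e_KF a (f : O) : br (e a) (KF f) = KF (ea a f).
Proof. exact: (v_br_e_KF tl Bsym BBi). Qed.

Lemma br_KF_e k a (f : O) : o_deg k f -> br (KF f) (e a) = - ((-1) ^+ odd `|k|%N *: KF (ea a f)).
Proof.
move=> fk; rewrite [LHS](v_br_skew tl (v_par_KF tl (o_deg_par tl fk)) (v_par_e _ a)) andbT.
by rewrite -br_e_KF.
Qed.

Lemma br_A1_e a : br (KF A1) (e a) = e a.
Proof.
rewrite (br_KF_e a (@Qg_deg _ _ _ _ tl 0 ord0)) /= scale1r ea_A1.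
rewrite -[X in KF X]scaleN1r (KFZ tl) scaleN1r opprK; exact: (KF_yy_one tl Bsym BBi two).
Qed.

Lemma br_C0_e i a : br (KF (C0 i)) (e a) = \sum_b zmx (MC i) b a *: e b.
Proof.
rewrite (br_KF_e a (@Qg_deg _ _ _ _ tl 0 _)) /= scale1r ea_C0.
rewrite -[- \sum_b _]scaleN1r (KFZ tl) scaleN1r opprK (KF_sum tl); apply: eq_bigr => b _.
by rewrite (KFZ tl) (KF_yy_one tl Bsym BBi two).
Qed.

Lemma br_A1_dt : br (KF A1) (v_dt T : V) = - (v_dt T : V).
Proof.
rewrite (lie_skew VL (s := false) (t := false) I I); [|exact/v_parP/(v_par_KF tl)/(o_deg_par tl (@Qg_deg _ _ _ _ tl 0 ord0))|exact/v_parP/v_par_dt].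
by rewrite expr0 scale1r br_dt_KF dt_A1 (KF_one tl).
Qed.

Lemma br_C0_dt i : br (KF (C0 i)) (v_dt T : V) = 0.
Proof.
rewrite (lie_skew VL (s := false) (t := false) I I); [|exact/v_parP/(v_par_KF tl)/(o_deg_par tl (@Qg_deg _ _ _ _ tl 0 _))|exact/v_parP/v_par_dt].
by rewrite br_dt_KF dt_C0 (KF0 tl) scaler0 oppr0.
Qed.

Lemma e_inj k (D : V) : v_deg k D -> 0 <= k -> (forall b, br (e b) D = 0) -> D = 0.
Proof. exact: (v_inj tl Bsym BBi two). Qed.

Lemma par_KF s (f : O) : o_par s f -> par s (KF f : V).
Proof. by move=> fs; apply/v_parP/(v_par_KF tl). Qed.

Lemma par_Q0 i : par false (KF (Qg 0 i) : V).
Proof. exact/par_KF/(o_deg_par tl (@Qg_deg _ _ _ _ tl 0 i)). Qed.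

Lemma v_deg_Qg k i : v_deg k%:Z (KF (Qg k i)).
Proof.
have -> : k%:Z = k%:Z + 2 - 2 by lia.
exact/(v_deg_KF tl)/(@Qg_deg _ _ _ _ tl k i).
Qed.

Lemma e_jacobi b i (D : V) : br (e b) (br (KF (Qg 0 i)) D) =
  br (KF (ea b (Qg 0 i))) D + br (KF (Qg 0 i)) (br (e b) D).
Proof.
rewrite (lie_jacobi VL I I I (@par_e K T (gram3 K) b) (@par_Q0 i)) andbF expr0 scale1r.
by rewrite br_e_KF.
Qed.

Section Euler.
Variable h : nat -> V -> Prop.
Hypothesis h_deg : forall k D, h k D -> v_deg k D.
Hypothesis h_e : forall n D b, hh (gram3 K) h n.+1 D -> hh (gram3 K) h n (br (e b) D).

Lemma euler n D : hh (gram3 K) h n D -> br (KF A1) D = - ((n%:Z - 2)%:~R *: D).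
Proof.
elim: n D => [|[|n] IH] D hD.
- case: hD => c ->; rewrite big_ord1 (lbrZr VL) br_A1_dt scalerN; congr (- _).
  rewrite scalerA mulrC -scalerA; congr (_ *: _).
  have -> : (0%:Z - 2)%:~R = 1 :> K by apply/eqP; rewrite -subr_eq0 -oppr_eq0 opprB -[0%:Z - 2]/(- (2%:Z)) mulrNz opprK -[1]/(1%N%:R) -natrD three.
  by rewrite scale1r.
- case: hD => c ->; rewrite (lbr_sumr VL) -scaleNr -[- _]/(- (-1)%:~R) mulrNz opprK scale1r.
  by apply: eq_bigr => i _; rewrite (lbrZr VL) br_A1_e.
apply/eqP; rewrite -subr_eq0 opprK; apply/eqP.
have Dd := h_deg hD; apply: (e_inj (k := n%:Z)) => //.
  rewrite addrC; apply: (v_deg_lin tl) => //; rewrite -[n%:Z]add0r; apply: (v_deg_br tl) => //.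
  exact: (@v_deg_Qg 0 ord0).
move=> b; rewrite (lbrDr VL) (lbrZr VL) e_jacobi IH; last exact: h_e.
rewrite (ea_A1 b) -[X in KF X]scaleN1r (KFZ tl) (KF_yy_one tl Bsym BBi two) (lbrZ VL).
rewrite -!scaleNr -!scalerDl; have -> : n.+2%:Z - 2 = n.+1%:Z - 2 + 1 by lia.
set a := n.+1%:Z - 2; have -> : (a + 1)%:~R = a%:~R + 1 :> K by rewrite rmorphD.
by rewrite -addrA addKr addNr scale0r.
Qed.

End Euler.

End CharThreeBrackets.

Definition genT (o : bool) (i : nat) : seq (Z * (nat * nat)) :=
  (if o then nth [::] [:: [:: ((-1)%Z, (1, 2)); ((-1)%Z, (5, 3))]; [:: ((-1)%Z, (1, 2)); (1%Z, (5, 3))];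
     [:: ((-1)%Z, (0, 2))]; [:: ((-1)%Z, (0, 4))]; [:: (1%Z, (0, 6))]; [:: ((-1)%Z, (0, 1))]; [:: (1%Z, (0, 3))];
     [:: (1%Z, (0, 5))]] i
   else nth [::] [:: [:: (1%Z, (0, 1))]; [:: (1%Z, (0, 5))]; [:: (1%Z, (0, 2))]; [:: ((-1)%Z, (0, 6))];
     [:: (1%Z, (0, 3))]; [:: ((-1)%Z, (0, 7))]; [:: ((-1)%Z, (0, 4))]; [:: (1%Z, (1, 2)); ((-1)%Z, (0, 1))]] i)%N.

Lemma genT_check : all (fun o => all (fun i =>
  eqT (combT [seq (x.1, eT x.2.1 (fam (~~ o) x.2.2)) | x <- genT o i])
      [:: (1%Z, shT (o == (i == 0%N)) (fam o i))] &&
  all (fun x => Nat.ltb x.2.1 7 && (0 < x.2.2 < 8)%N) (genT o i)) I8) [:: false; true].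
Proof. by vm_compute. Qed.

Definition wC (b i : nat) : Z :=
  (coefT (1%N, famkey true 0) (eT b (TC i)) * coefT (0%N, famkey true 0) (fam true 0))%Z.

Lemma wC_pivot : all (fun i => has (fun b => good3 (wC b i) &&
  all (fun i' => Nat.eqb i' i || Z.eqb (Z.modulo (wC b i') 3) 0) I7) I7) I7.
Proof. by vm_compute. Qed.

Lemma A2_check : all (fun a => all (fun l => Z.eqb
  (coefT (1%N, famkey true l.+1) (eT a TA) * coefT (0%N, famkey true l.+1) (fam true l.+1))%Z
  (if Nat.eqb l (star a) then -1 else 0)%Z) I7) I7.
Proof. by vm_compute. Qed.

Lemma zKB (K : fieldType) a b : zK K (a - b) = zK K a - zK K b.
Proof. by rewrite -[(_ - _)%Z]/(_ + - _)%Z zKD zKN. Qed.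

Section Combinations.
Variables (K : fieldType) (U : lmodType K) (a : U) (C : 'I_7 -> U).

Lemma sum_single (c : K) i0 : \sum_i (if i == i0 then c else 0) *: C i = c *: C i0.
Proof.
by rewrite (bigD1 i0) //= eqxx big1 ?addr0 // => i /negPf ->; rewrite scale0r.
Qed.

Lemma comb_recl (c : 'I_8 -> K) (F : 'I_8 -> U) :
  \sum_i c i *: F i = c ord0 *: F ord0 + \sum_(i < 7) c (lift ord0 i) *: F (lift ord0 i).
Proof. exact: big_ord_recl. Qed.

Lemma comb_comb (G : 'I_7 -> K) (s : 'I_7 -> 'I_7 -> K) :
  \sum_k G k *: (\sum_l s k l *: C l) = \sum_l (\sum_k G k * s k l) *: C l.
Proof.
under eq_bigr => k _ do rewrite scaler_sumr.
rewrite exchange_big /=; apply: eq_bigr => l _; rewrite scaler_suml.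
by apply: eq_bigr => k _; rewrite scalerA.
Qed.

Lemma comb_comb_add (m beta : 'I_7 -> K) (gamma : 'I_7 -> 'I_7 -> K) :
  \sum_c m c *: (beta c *: a + \sum_l gamma c l *: C l) =
  (\sum_c m c * beta c) *: a + \sum_l (\sum_c m c * gamma c l) *: C l.
Proof.
under eq_bigr => c _ do rewrite scalerDr scalerA.
by rewrite big_split /= -scaler_suml comb_comb.
Qed.

End Combinations.

Arguments Submission.Qg : simpl never.
Arguments Submission.interp : simpl never.
Arguments Submission.KF : simpl never.
Arguments Submission.A1 : simpl never.
Arguments Submission.B1 : simpl never.
Arguments Submission.C0 : simpl never.
Arguments Submission.W0 : simpl never.

Section CharThreeCore.
Variables (K : fieldType) (T : tAlg K) (ok : pred nat) (tau : nat -> T).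
Hypothesis tl : tlaws ok tau.
Hypothesis three : 3%:R = 0 :> K.
Hypothesis ok_step : forall r, ok r -> (r %% 3 != 2)%N -> ok r.+1.
Notation O := (O T).
Notation V := (vect_alg T).
Notation zK := (zK K).
Notation dt := (@dt K T).
Notation ea := (@ea K T (gram3 K)).
Notation yy := (@yy K T (gram3 K)).
Notation interp := (@interp K T ok tau).
Notation Bsym := (gram3_sym K).
Notation BBi := (gram3_sq K).
Notation two := (two3 three).
Notation Qg := (@Qg K T ok tau).
Notation Q := (@Q K T ok tau).
Notation KF := (@KF K T (gram3 K) (gram3 K)).
Notation e := (v_e T (gram3 K) : _ -> V).
Notation zmx := (@zmx K).
Notation A1 := (@A1 K T ok tau).
Notation C0 := (@C0 K T ok tau).
Notation B1 := (@B1 K T ok tau).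
Notation W0 := (@W0 K T ok tau).
Notation hh := (hh (gram3 K)).
Let VL := vect_lie tl.

Lemma Qg_gen k i (U : O -> Prop) : subspace U -> ok k./2.+1 ->
  (forall b (a : 'I_8), (0 < a)%N -> U (ea b (Qg k.+1 a))) -> U (Qg k i).
Proof.
move=> sU okk Ue; have /andP[chk /allP wf] := I8_all (bool_all genT_check (odd k)) i.
have -> : Qg k i = interp k./2.+1 (shT (odd k == (i == 0%N :> nat)) (fam (odd k) i)).
  rewrite /Submission.Qg /lev; case: (odd k); case: (i == 0%N :> nat); rewrite /= ?shT0 //;
  by rewrite (interp_succ tl) okk.
have := @eqT_P _ _ ok tau three k./2.+1 _ _ chk; rewrite big_seq1 zK1 scale1r => <-.
rewrite interp_combT big_map big_seq; apply: (subspace_sum sU) => x /wf/andP[b7 a8].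
apply: (subspaceZ sU) => /=; have /andP[a0 a7] := a8.
have /= := Ue (ix x.2.1) (Ordinal a7) a0.
have -> : Qg k.+1 (Ordinal a7) = interp k./2.+1 (fam (~~ odd k) x.2.2).
  rewrite /Submission.Qg /lev /= uphalf_half; move: a0; case: (x.2.2 : nat) => // a _.
  by case: (odd k).
by rewrite (eT_P tl three) //; have := I8_all (bool_all fam_wf (~~ odd k)) (Ordinal a7).
Qed.

Definition hQ k (D : V) := exists2 f, Q k f & D = KF f.

Lemma hQ_sub k : subspace (hQ k).
Proof.
split; first by exists 0; [case: (Q_sub ok tau k)|rewrite (KF0 tl)].
move=> c _ _ [f Qf ->] [g Qg' ->]; exists (c *: f + g); last by rewrite (KF_lin tl).
by case: (Q_sub ok tau k) => _; apply.
Qed.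

Lemma hQ_mem k i : hQ k (KF (Qg k i)).
Proof. by exists (Qg k i) => //; apply: span_of_mem. Qed.

Lemma hQE k D : hQ k D -> exists c : 'I_8 -> K, D = \sum_i c i *: KF (Qg k i).
Proof.
case=> _ [c ->] ->; exists c; rewrite (KF_sum tl); apply: eq_bigr => i _.
by rewrite (KFZ tl).
Qed.

Lemma hQ_deg k D : hQ k D -> v_deg k%:Z D.
Proof.
case=> f /(Q_deg tl) fd ->; have := v_deg_KF tl (B := gram3 K) (Bi := gram3 K) fd.
by rewrite addrK.
Qed.

Lemma hQ_e n D b : hh hQ n.+1 D -> hh hQ n (br (e b) D).
Proof.
case: n => [|[|k]].
- case=> c ->; exists (fun _ => \sum_i c i * gram3 K b i).
  rewrite big_ord1 (lbr_sumr VL) scaler_suml; apply: eq_bigr => i _.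
  by rewrite (lbrZr VL) (br_e_e tl Bsym BBi two) scalerA.
- case=> f /(Q0_e tl three b)[c fc] ->; exists c.
  rewrite (br_e_KF tl) fc (KF_sum tl); apply: eq_bigr => i _.
  by rewrite (KFZ tl) (KF_yy_one tl Bsym BBi two).
- case=> f Qf ->; exists (ea b f); first exact: (Q_e tl three).
  by rewrite (br_e_KF tl).
Qed.

Lemma hQ_of_e m (D : V) : v_deg m.+1%:Z D -> (forall b, hQ m (br (e b) D)) -> hQ m.+1 D.
Proof.
move=> Dd hD; have DE : D = KF (contact_pot (gram3 K) D).
  by apply: (eq_KF_contact_pot tl Bsym BBi two Dd) => // b; have [f _ E] := hD b; exists f.
exists (contact_pot (gram3 K) D) => //; apply: (Pf_Q tl three); split.
  exact: (contact_pot_deg tl two).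
move=> b; rewrite (ea_contact_pot tl Bsym b Dd); have [f Qf E] := hD b.
rewrite -[v_br _ _]/(br (e b) D) E (contact_pot_KF tl Bsym BBi).
exact: (Q_Pf tl three).
Qed.

Lemma hQ_euler n D : hh hQ n D -> br (KF A1) D = - ((n%:Z - 2)%:~R *: D).
Proof. exact: (euler tl three hQ_deg hQ_e). Qed.

Lemma deg_C0 i : v_deg 0 (KF (C0 i)).
Proof. exact: (hQ_deg (hQ_mem 0 (lift ord0 i))). Qed.

Lemma deg_B1 i : v_deg 1 (KF (B1 i)).
Proof. exact: (hQ_deg (hQ_mem 1 (lift ord0 i))). Qed.

Definition eM (A : 'M[K]_7) (b : 'I_7) : V := \sum_c A c b *: e c.

Lemma eM_mul (A A' : 'M[K]_7) b : \sum_c A c b *: eM A' c = eM (A' *m A) b.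
Proof.
rewrite /eM; under eq_bigr => c _ do rewrite scaler_sumr.
rewrite exchange_big /=; apply: eq_bigr => d _; rewrite mxE scaler_suml.
by apply: eq_bigr => c _; rewrite scalerA mulrC.
Qed.

Lemma eMB (A A' : 'M[K]_7) b : eM (A - A') b = eM A b - eM A' b.
Proof. by rewrite /eM -sumrB; apply: eq_bigr => c _; rewrite !mxE scalerBl. Qed.

Lemma eM_sum (z : 'I_7 -> K) (A : 'I_7 -> 'M[K]_7) b :
  eM (\sum_k z k *: A k) b = \sum_k z k *: eM (A k) b.
Proof.
rewrite /eM; under [RHS]eq_bigr => k _ do rewrite scaler_sumr.
rewrite [RHS]exchange_big /=; apply: eq_bigr => c _; rewrite summxE scaler_suml.
by apply: eq_bigr => k _; rewrite mxE scalerA.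
Qed.

Lemma br_C0_eM i a : br (KF (C0 i)) (e a) = eM (zmx (MC i)) a.
Proof. exact: (br_C0_e tl three). Qed.

Lemma br_e_C0 b i : br (e b) (KF (C0 i)) = - eM (zmx (MC i)) b.
Proof.
rewrite (br_e_KF tl) (ea_C0 tl three) -[X in KF X]scaleN1r (KFZ tl) scaleN1r (KF_sum tl).
by congr (- _); apply: eq_bigr => c _; rewrite (KFZ tl) (KF_yy_one tl Bsym BBi two).
Qed.

Lemma br_eM A b (D : V) : br (eM A b) D = \sum_c A c b *: br (e c) D.
Proof. by rewrite (lbr_sum VL); apply: eq_bigr => c _; rewrite (lbrZ VL). Qed.

Lemma br_eMr A b (D : V) : br D (eM A b) = \sum_c A c b *: br D (e c).
Proof. by rewrite (lbr_sumr VL); apply: eq_bigr => c _; rewrite (lbrZr VL). Qed.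

Lemma lbrN (x y : V) : br (- x) y = - br x y.
Proof. by rewrite -scaleN1r (lbrZ VL) scaleN1r. Qed.

Lemma lbrNr (x y : V) : br x (- y) = - br x y.
Proof. by rewrite -scaleN1r (lbrZr VL) scaleN1r. Qed.

Lemma e_jacobi_C0 b i (D : V) : br (e b) (br (KF (C0 i)) D) =
  - \sum_c zmx (MC i) c b *: br (e c) D + br (KF (C0 i)) (br (e b) D).
Proof.
have := e_jacobi tl b (lift ord0 i) D; rewrite -[Submission.Qg _ _ _ _]/(C0 i) => ->.
by rewrite -(br_e_KF tl) br_e_C0 lbrN br_eM.
Qed.

Lemma cstrE (i j : 'I_7) : zmx (MC i) *m zmx (MC j) - zmx (MC j) *m zmx (MC i) =
  \sum_(k < 7) zK (cstr i j k) *: zmx (MC k).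
Proof.
rewrite -zmx_com (eqmat3P three (ord7_all (ord7_all cstr_check i) j)).
apply/matrixP => b a; rewrite mxE zent_mkmat zK_zsum summxE.
by apply: eq_bigr => k _; rewrite zKM !mxE.
Qed.

Lemma br_C0_C0 (i j : 'I_7) : br (KF (C0 i)) (KF (C0 j)) =
  \sum_(k < 7) zK (cstr i j k) *: KF (C0 k).
Proof.
apply/eqP; rewrite -subr_eq0; apply/eqP; apply: (e_inj tl three (k := 0)) => //.
  rewrite addrC -scaleN1r; apply: (v_deg_lin tl).
    by apply: (v_deg_sum tl) => k _; apply: (v_degZ tl); apply: deg_C0.
  by rewrite -[0]addr0; apply: (v_deg_br tl); apply: deg_C0.
move=> b; rewrite (lbrDr VL) lbrNr e_jacobi_C0 br_e_C0 lbrNr br_eMr.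
under eq_bigr => c _ do rewrite br_e_C0 scalerN.
under [X in _ - X + _]eq_bigr => c _ do rewrite br_C0_eM.
rewrite sumrN opprK !eM_mul (lbr_sumr VL).
under [X in _ - X]eq_bigr => k _ do rewrite (lbrZr VL) br_e_C0 scalerN.
by rewrite [X in _ - X]sumrN opprK -eM_sum -cstrE eMB addrA subrK subrr.
Qed.

Lemma nB_beta (i a b : 'I_7) : - \sum_(c < 7) zmx (MC i) c b * zK (betaB c a) =
  \sum_(c < 7) zK (nB i a c) * zK (betaB b c).
Proof.
have /andP[/Z.eqb_spec/(zK_mod3 three) + _] := ord7_all (ord7_all (ord7_all nB_check i) a) b.
rewrite zKB zKN !zK_zsum => /eqP; rewrite subr_eq0 => /eqP E.
under eq_bigr => c _ do rewrite mxE -zKM.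
by rewrite E; apply: eq_bigr => c _; rewrite zKM.
Qed.

Lemma nB_gamma (i a b l : 'I_7) : - \sum_(c < 7) zmx (MC i) c b * zK (gammaB c a l) +
    \sum_(k < 7) zK (gammaB b a k) * zK (cstr i k l) =
  \sum_(c < 7) zK (nB i a c) * zK (gammaB b c l).
Proof.
have /andP[_ h] := ord7_all (ord7_all (ord7_all nB_check i) a) b.
have /Z.eqb_spec/(zK_mod3 three) := ord7_all h l.
rewrite zKB zKD zKN !zK_zsum => /eqP; rewrite subr_eq0 => /eqP E.
under eq_bigr => c _ do rewrite mxE -zKM.
under [X in _ + X]eq_bigr => k _ do rewrite -zKM.
by rewrite E; apply: eq_bigr => c _; rewrite zKM.
Qed.

Lemma br_e_B1 b a : br (e b) (KF (B1 a)) =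
  zK (betaB b a) *: KF A1 + \sum_(k < 7) zK (gammaB b a k) *: KF (C0 k).
Proof.
rewrite (br_e_KF tl) (ea_B1 tl three) (KF_lin tl) [KF (\sum_(k < 7) _)](KF_sum tl).
by congr (_ + _); apply: eq_bigr => k _; rewrite (KFZ tl).
Qed.

Lemma br_C0_A1 i : br (KF (C0 i)) (KF A1) = 0.
Proof.
rewrite (lie_skew VL I I (@par_Q0 _ _ _ _ tl (lift ord0 i)) (@par_Q0 _ _ _ _ tl ord0)).
by rewrite expr0 scale1r (@hQ_euler 2) ?scale0r ?oppr0 //; apply: hQ_mem.
Qed.

Lemma br_C0_B1 (i a : 'I_7) : br (KF (C0 i)) (KF (B1 a)) =
  \sum_(c < 7) zK (nB i a c) *: KF (B1 c).
Proof.
apply/eqP; rewrite -subr_eq0; apply/eqP; apply: (e_inj tl three (k := 1)) => //.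
  rewrite addrC -scaleN1r; apply: (v_deg_lin tl).
    by apply: (v_deg_sum tl) => k _; apply: (v_degZ tl); apply: deg_B1.
  by rewrite -[1]add0r; apply: (v_deg_br tl); [apply: deg_C0|apply: deg_B1].
move=> b; rewrite (lbrDr VL) lbrNr e_jacobi_C0 br_e_B1 (lbrDr VL) (lbrZr VL) br_C0_A1 scaler0 add0r.
under eq_bigr => c _ do rewrite br_e_B1.
rewrite !(lbr_sumr VL).
under [X in _ - X]eq_bigr => c _ do rewrite (lbrZr VL) br_e_B1.
under [X in _ + X - _]eq_bigr => k _ do rewrite (lbrZr VL) br_C0_C0.
rewrite !comb_comb_add comb_comb -nB_beta.
under [X in _ - (_ + X)]eq_bigr => l _ do rewrite -nB_gamma scalerDl.
rewrite [X in _ - (_ + X)]big_split /=; under [X in _ - (_ + (X + _))]eq_bigr => l _ do rewrite scaleNr.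
rewrite sumrN scaleNr; set x := _ *: _; set y := \sum_(i0 < 7) _; set w := \sum_(i0 < 7) _.
by zmod.
Qed.

Lemma hQ_00 D D' : hQ 0 D -> hQ 0 D' -> hQ 0 (br D D').
Proof.
move=> /hQE[c ->] /hQE[c' ->]; rewrite (lbr_sum VL); apply: (subspace_sum (hQ_sub 0)) => i _.
rewrite (lbrZ VL); apply/(subspaceZ (hQ_sub 0)); rewrite (lbr_sumr VL).
apply: (subspace_sum (hQ_sub 0)) => j _; rewrite (lbrZr VL); apply/(subspaceZ (hQ_sub 0)).
have sA : forall j, hQ 0 (br (KF (Qg 0 ord0)) (KF (Qg 0 j))).
  move=> j'; rewrite (@hQ_euler 2 _ (hQ_mem 0 j')).
  exact/(subspaceN (hQ_sub 0))/(subspaceZ (hQ_sub 0))/hQ_mem.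
case: (unliftP ord0 i) => [i' ->|->]; last exact: sA.
case: (unliftP ord0 j) => [j' ->|->]; last first.
  rewrite (br_C0_A1 i'); by case: (hQ_sub 0).
rewrite (br_C0_C0 i' j'); apply: (subspace_sum (hQ_sub 0)) => k _.
exact/(subspaceZ (hQ_sub 0))/hQ_mem.
Qed.

Lemma star_ixK : involutive (fun i : 'I_7 => ix (star i)).
Proof.
have st : all (fun i => Nat.eqb (star (star i)) i) I7 by vm_compute.
by move=> j; rewrite ixK ?star_ltb //; have /Nat.eqb_spec -> := ord7_all st j; apply: ix_val.
Qed.

Lemma dt_B1 a : dt (B1 a) = yy (ix (star a)) (o_one T).
Proof. by rewrite /Submission.B1 /Submission.Qg /lev /= (dt_interp tl) (interp_succ tl) (ok1 tl) (interp0_TB tl). Qed.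

Lemma dt_W0 : dt W0 = 0.
Proof.
rewrite /Submission.W0 /Submission.Qg /lev /= (dt_interp tl) /Submission.interp big_map big1 // => x _.
by rewrite /tauO andbF (linop0 (mono_lin tl _)) scaler0.
Qed.

Definition P1 : V -> Prop := span_of (fun a => KF (B1 a)).

Lemma P1_hQ D : P1 D -> hQ 1 D.
Proof.
case=> c ->; apply: (subspace_sum (hQ_sub 1)) => a _; apply: (subspaceZ (hQ_sub 1)).
exact: (hQ_mem 1 (lift ord0 a)).
Qed.

Lemma br_dt_P1 c : br (v_dt T : V) (\sum_(a < 7) c a *: KF (B1 a)) = \sum_(a < 7) c (ix (star a)) *: e a.
Proof.
rewrite (lbr_sumr VL) [RHS](reindex_inj (inv_inj star_ixK)); apply: eq_bigr => a _.
by rewrite (lbrZr VL) (br_dt_KF tl) dt_B1 (KF_yy_one tl Bsym BBi two) star_ixK.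
Qed.

Lemma P1_dt (y : V) : h_m1 (gram3 K) y -> exists2 x, P1 x & br (v_dt T : V) x = y.
Proof.
case=> c ->; exists (\sum_(a < 7) c (ix (star a)) *: KF (B1 a)); first by eexists.
by rewrite br_dt_P1; apply: eq_bigr => a _; rewrite star_ixK.
Qed.

Lemma KF_subspace (I : V -> Prop) : subspace I -> subspace (fun f : O => I (KF f)).
Proof. by case=> I0 Il; split=> [|c f g If Ig]; rewrite ?(KF0 tl) ?(KF_lin tl) //; apply: Il. Qed.

Lemma gen_h0 (I : V -> Prop) : subspace I -> (forall b x, P1 x -> I (br x (e b))) ->
  forall y, hQ 0 y -> I y.
Proof.
move=> sI Ie y /hQE[c ->]; apply: (subspace_sum sI) => i _; apply: (subspaceZ sI).
apply: (@Qg_gen 0 i (fun f : O => I (KF f)) (KF_subspace sI) (ok1 tl)) => b a; case: (unliftP ord0 a) => [a' -> _|->//].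
have /(Ie b) := span_of_mem (fun a => KF (B1 a)) a'.
rewrite (br_e_skew tl _ _ (@deg_B1 a')) => /(sign_subspace _ _ sI).
by rewrite (br_e_KF tl).
Qed.

Lemma natr3 k : (k %% 3 != 0)%N -> k%:R != 0 :> K.
Proof.
rewrite {2}(divn_eq k 3) natrD natrM three mulr0 add0r.
have : (k %% 3 < 3)%N by rewrite ltn_pmod.
by case: (k %% 3)%N => [|[|[|]]] // _ _; [rewrite oner_eq0|apply: two].
Qed.

Lemma gen_euler (h : nat -> V -> Prop) (I : V -> Prop) k D :
  (forall k, subspace (h k)) -> (forall k D, h k D -> v_deg k%:Z D) ->
  (forall n D b, hh h n.+1 D -> hh h n (br (e b) D)) ->
  subspace I -> (forall x y, I x -> hsum (gram3 K) h y -> I (br x y)) -> I (KF A1) ->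
  h k D -> (k %% 3 != 0)%N -> I D.
Proof.
move=> h_sub h_deg h_e sI Ibr IA hD k3.
have := Ibr _ D IA (hsum_hh h_sub (n := k.+2) hD).
rewrite (euler tl three h_deg h_e (n := k.+2) hD) => /(subspaceN sI).
have -> : k.+2%:Z - 2 = k%:Z by lia.
rewrite opprK => /(subspaceZ sI (k%:R^-1)); rewrite scalerA mulVf ?natr3 // scale1r; exact.
Qed.

Lemma gen_hQ (I : V -> Prop) : subspace I ->
  (forall x y, I x -> hsum (gram3 K) hQ y -> I (br x y)) ->
  (forall n x, (n < 3)%N -> hh hQ n x -> I x) -> forall k x, hQ k x -> I x.
Proof.
move=> sI Ibr I3 k x hx.
have IA : I (KF A1) by apply: (I3 2) => //; apply: (hQ_mem 0 ord0).
have Iq k' D : hQ k' D -> (k' %% 3 != 0)%N -> I D.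
  exact: (gen_euler hQ_sub hQ_deg hQ_e).
case k3 : (k %% 3 == 0)%N; last by apply: Iq hx _; rewrite k3.
move: hx => /hQE[c ->]; apply: (subspace_sum sI) => i _; apply: (subspaceZ sI).
case okk : (ok k./2); last first.
  have nok : ~~ ok (lev (odd k) i k./2).
    rewrite /lev; case: ifP => _; last by rewrite okk.
    by apply/negP => /(ok_down tl); rewrite okk.
  by rewrite /Submission.Qg (interp_not_ok tl) // (KF0 tl); case: sI.
have okk1 : ok k./2.+1.
  apply: ok_step okk _; move: k3 (odd_double_half k); case: (odd k); lia.
apply: (@Qg_gen k i (fun f : O => I (KF f)) (KF_subspace sI) okk1) => b a _.
have IQ : I (KF (Qg k.+1 a)) by apply: (Iq k.+1); [apply: hQ_mem|lia].
have := Ibr _ (e b) IQ (hsum_hh hQ_sub (n := 1) (span_of_mem e b)).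
rewrite (br_e_skew tl _ _ (hQ_deg (hQ_mem k.+1 a))) => /(sign_subspace _ _ sI).
by rewrite (br_e_KF tl).
Qed.

Lemma hQ_max k l D D' : (0 < k + l)%N -> hQ k D -> hQ l D' ->
  (forall b, hh hQ (k + l).+1 (br (e b) (br D D'))) -> hQ (k + l) (br D D').
Proof.
case kl: (k + l)%N => [//|m] _ /hQ_deg Dd /hQ_deg Dd' he; apply: hQ_of_e => //.
by rewrite -kl PoszD; apply: (v_deg_br tl).
Qed.

Lemma hQ_KF k D : hQ k D -> exists f, D = KF f.
Proof. by case=> f _ ->; exists f. Qed.

Lemma hQ_simple : is_simple (hsum (gram3 K) hQ).
Proof.
apply: (hsum_simple tl Bsym BBi two hQ_sub hQ_deg hQ_e hQ_00 hQ_max hQ_KF).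
- by move=> y /P1_dt[x /P1_hQ]; exists x.
- move=> I sI Ie; apply: gen_h0 sI _ => b x /P1_hQ; exact: Ie.
- exact: gen_hQ.
Qed.

Fixpoint hP k (D : V) : Prop :=
  match k with
  | 0 => hQ 0 D
  | 1 => P1 D
  | k'.+1 => hQ k D /\ forall b, hP k' (br (e b) D)
  end.

Lemma hP_hQ k D : hP k D -> hQ k D.
Proof. by case: k => [|[|k]] //; [apply: P1_hQ|case]. Qed.

Lemma hP_deg k D : hP k D -> v_deg k%:Z D.
Proof. by move/hP_hQ/hQ_deg. Qed.

Lemma hP_sub k : subspace (hP k).
Proof.
elim: k => [|[|k] IH]; [exact: hQ_sub|exact: span_of_subspace|split].
  by split=> [|b]; [case: (hQ_sub k.+2)|rewrite (lbr0r VL); case: IH].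
move=> c x y [x1 x2] [y1 y2]; split; first by case: (hQ_sub k.+2) => _; apply.
by move=> b; rewrite (lbrDr VL) (lbrZr VL); exact: (proj2 IH c _ _ (x2 b) (y2 b)).
Qed.

Lemma hP_e n D b : hh hP n.+1 D -> hh hP n (br (e b) D).
Proof.
case: n => [|[|[|k]]]; [exact: (@hQ_e 0 D b)|exact: (@hQ_e 1 D b)| |by case=> _; apply].
by move/P1_hQ; apply: (@hQ_e 2 D b).
Qed.

Lemma br_Q0_P1 D D' : hQ 0 D -> P1 D' -> P1 (br D D').
Proof.
move=> /hQE[c ->] [c' ->]; have sP := span_of_subspace (fun a => KF (B1 a)).
rewrite (lbr_sum VL); apply: (subspace_sum sP) => i _.
rewrite (lbrZ VL); apply/(subspaceZ sP); rewrite (lbr_sumr VL).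
apply: (subspace_sum sP) => a _; rewrite (lbrZr VL); apply/(subspaceZ sP).
case: (unliftP ord0 i) => [i' ->|->].
  rewrite (br_C0_B1 i' a); apply: (subspace_sum sP) => k _.
  exact/(subspaceZ sP)/(span_of_mem (fun a => KF (B1 a))).
rewrite (hQ_euler (n := 3) (hQ_mem 1 (lift ord0 a))).
exact/(subspaceN sP)/(subspaceZ sP)/(span_of_mem (fun a => KF (B1 a))).
Qed.

Lemma hP_max k l D D' : (0 < k + l)%N -> hP k D -> hP l D' ->
  (forall b, hh hP (k + l).+1 (br (e b) (br D D'))) -> hP (k + l) (br D D').
Proof.
move=> kl hD hD' he; case klE : (k + l)%N he kl => [//|[|m]] he _.
  move: klE hD hD'; case: k => [|[|//]] /=; case: l => [|[|//]] //= _ hD hD'.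
    exact: br_Q0_P1.
  have pD : par true D by apply/v_parP/(v_deg_par tl (hP_deg (k := 1) hD)).
  have pD' : par false D' by apply/v_parP/(v_deg_par tl (hQ_deg hD')).
  rewrite -[v_br D D']/(br D D') (lie_skew VL I I pD pD') expr0 scale1r; apply: (subspaceN (span_of_subspace _)).
  exact: br_Q0_P1.
split; last exact: he.
rewrite -klE; apply: hQ_max; rewrite ?klE //; [exact: hP_hQ|exact: hP_hQ|].
by move=> b; apply: (@hP_hQ m.+1); apply: he.
Qed.

Lemma interp1_W : interp 1 (shT 1 TW) = W0.
Proof. by rewrite (interp_succ tl) (ok1 tl). Qed.

Lemma ea_C1 b (i : 'I_7) : exists c : 'I_7 -> K,
  ea b (Qg 2 (lift ord0 i)) = zK (wC b i) *: W0 + \sum_a c a *: B1 a.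
Proof.
exists (fun l => zK (coefT (0%N, famkey true l.+1) (eT b (TC i)) *
                     coefT (0%N, famkey true l.+1) (fam true l.+1))).
rewrite /Submission.Qg (ea_interp tl three).
have -> : decE (odd 2) (lift ord0 i) (eT b (fam (odd 2) (lift ord0 i))) =
   dec 1 true [:: 0%N] (eT b (TC i)) ++ dec 0 true (behead I8) (eT b (TC i)) by [].
rewrite big_cat /dec !big_map big_seq1 -[behead I8]/(index_iota 1 8) big_add1 big_mkord.
congr (_ *: _ + _); first exact: interp1_W.
by apply: eq_bigr => l _; rewrite shT0.
Qed.

Lemma ea_A2 a : ea a (Qg 2 ord0) = - B1 (ix (star a)).
Proof.
rewrite /Submission.Qg (ea_interp tl three).
have -> : decE (odd 2) (@ord0 7) (eT a (fam (odd 2) (@ord0 7))) =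
   dec 1 true (behead I8) (eT a TA) by [].
rewrite /dec !big_map -[behead I8]/(index_iota 1 8) big_add1 big_mkord.
rewrite (bigD1 (ix (star a))) //= big1 ?addr0 => [|l /negPf la].
  have /Z.eqb_spec -> := ord7_all (ord7_all A2_check a) (ix (star a)).
  have -> : zK (if Nat.eqb (ix (star a)) (star a) then (-1)%Z else 0%Z) = -1 :> K.
    by rewrite ixK ?star_ltb // Nat.eqb_refl.
  rewrite scaleN1r; congr (- _).
  rewrite -[lev _ _ _]/(2%N) (interp_succ tl) (ok2 tl) /Submission.B1 /Submission.Qg /=.
  by rewrite /bump /= ixK ?star_ltb.
have /Z.eqb_spec -> := ord7_all (ord7_all A2_check a) l.
case: Nat.eqb_spec => [lE|_]; last by rewrite zK0 scale0r.
by move: la; rewrite -val_eqE /= ixK ?star_ltb // lE eqxx.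
Qed.
Lemma W0_neq0 : W0 <> 0.
Proof.
have wf := I8_all (bool_all fam_wf true) ord0.
have := @dxs_interp _ _ _ _ tl (rev (famkey true 0)) 0 TW isT wf.
rewrite -[interp 0 TW]/W0 => + W00; rewrite W00.
have lin0 w : @dxs K T w 0 = 0 by elim: w => //= a w ->; rewrite (linop0 (dx_lin tl _)).
rewrite lin0 => /(congr1 (fun f : O => t_coef 0 (f set0))).
rewrite (coef_interp tl) ?(ok0 tl) // ffunE (tcoef0 tl) => /esym/eqP.
rewrite mulf_eq0 (negPf (tcoef_tau_neq0 tl (ok0 tl))) orbF.
have /(good3_neq0 three)/negPf-> // : good3 (coefT (0%N, [::]) (dxsT (rev (famkey true 0)) TW)).
by vm_compute.
Qed.

Lemma e_indep (c : 'I_7 -> K) : \sum_a c a *: e a = 0 -> forall a, c a = 0.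
Proof.
move=> c0 a; have /ffunP/(_ (Some a))/ffunP/(_ set0) := c0.
rewrite sum_ffunE sum_ffunE (bigD1 a) //= big1 ?addr0 => [|b /negPf ba]; last first.
  by rewrite !ffunE eq_sym ba ffunE scaler0.
rewrite !ffunE eqxx ffunE eqxx => /(congr1 (t_coef 0)).
rewrite (tcoefZ tl) (tcoef0 tl) -(tau0 tl) => /eqP.
by rewrite mulf_eq0 (negPf (tcoef_tau_neq0 tl (ok0 tl))) orbF => /eqP.
Qed.

Lemma B1_indep (c : 'I_7 -> K) : \sum_a c a *: KF (B1 a) = 0 -> forall a, c a = 0.
Proof.
move=> c0 a; rewrite -(star_ixK a).
apply: (e_indep (c := fun a : 'I_7 => c (ix (star a)))).
by rewrite -br_dt_P1 c0 (lbr0r VL).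
Qed.

Lemma br_dt_W0 : br (v_dt T : V) (KF W0) = 0.
Proof. by rewrite (br_dt_KF tl) dt_W0 (KF0 tl). Qed.

Lemma W0_P1 l : P1 (l *: KF W0) -> l = 0.
Proof.
case=> c E; have c0 : forall a : 'I_7, c (ix (star a)) = 0.
  apply: (e_indep (c := fun a : 'I_7 => c (ix (star a)))).
  by rewrite -br_dt_P1 -E (lbrZr VL) br_dt_W0 scaler0.
have W00 : KF (l *: W0) = KF 0.
  rewrite (KFZ tl) (KF0 tl) E big1 // => a _.
  by rewrite -(star_ixK a) c0 scale0r.
have /eqP := KF_inj tl Bsym BBi W00.
by rewrite scaler_eq0 => /orP[/eqP//|/eqP/W0_neq0].
Qed.

Local Opaque Submission.KF Submission.Qg Submission.B1 Submission.W0.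

Lemma hP2_line D : hP 2 D -> exists l, D = l *: KF (Qg 2 ord0).
Proof.
case=> /hQE[c ->] he; exists (c ord0); rewrite big_ord_recl big1 ?addr0 // => i _.
suff -> : c (lift ord0 i) = 0 by rewrite scale0r.
have sP := span_of_subspace (fun a => KF (B1 a)).
have cw (b : 'I_7) : \sum_(i < 7) c (lift ord0 i) * zK (wC b i) = 0.
  have := he b; rewrite comb_recl (lbrDr VL) (lbrZr VL) (br_e_KF tl) (ea_A2 b) (lbr_sumr VL).
  move=> Pb; apply: W0_P1; move: Pb.
  set x := c ord0 *: KF _; have Px : P1 x.
    rewrite /x -[- B1 _]scaleN1r (KFZ tl).
    exact/(subspaceZ sP)/(subspaceZ sP)/(span_of_mem (fun a => KF (B1 a))).
  move=> /(subspaceD sP) /(_ (subspaceN sP Px)); rewrite addrAC subrr add0r.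
  set y := \sum_(i < 7) _ => Py.
  suff [z Pz zE] : exists2 z, P1 z & y = (\sum_(i < 7) c (lift ord0 i) * zK (wC b i)) *: KF W0 + z.
    have -> : (\sum_(i < 7) c (lift ord0 i) * zK (wC b i)) *: KF W0 = y - z by rewrite zE addrK.
    exact: (subspaceD sP Py (subspaceN sP Pz)).
  rewrite /y; elim/big_ind2: _ {y Py x Px} => //.
  - by exists 0; rewrite ?scale0r ?add0r //; case: sP.
  - move=> u1 y1 u2 y2 [z1 P1z ->] [z2 P2z ->]; exists (z1 + z2); first exact: (subspaceD sP).
    by rewrite scalerDl addrACA.
  move=> i' _; have [n nE] := ea_C1 b i'.
  exists (c (lift ord0 i') *: \sum_a n a *: KF (B1 a)); first by apply: (subspaceZ sP); eexists.
  rewrite (lbrZr VL) (br_e_KF tl) nE (KF_lin tl) [KF (\sum_(a < 7) _)](KF_sum tl) scalerDr scalerA.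
  by congr (_ + _ *: _); apply: eq_bigr => a _; rewrite (KFZ tl).
have /hasP[b bI /andP[gb ob]] := ord7_all wC_pivot i.
have := cw (ix b); have -> : (ix b : nat) = b.
  rewrite ixK //; move: b bI {gb ob}; exact/allP.
rewrite (bigD1 i) //= big1 ?addr0 => [/eqP|i' /negPf i'i]; last first.
  have := ord7_all ob i'; case: Nat.eqb_spec => [E|_ /Z.eqb_spec/(zK_mod3 three) -> ]; last by rewrite mulr0.
  by move: i'i; rewrite -val_eqE /= E eqxx.
by rewrite mulf_eq0 (negPf (good3_neq0 three gb)) orbF => /eqP.
Qed.

Lemma hP3_zero D : hP 3 D -> D = 0.
Proof.
move=> hD; have dD := hP_deg hD; move: hD => [/hQ_KF[f DE] he].
have le b : exists l, br (e b) D = l *: KF (Qg 2 ord0) by apply: hP2_line; apply: (he b).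
have /choice [l lE] := le.
have ll a b : gram3 K a b = 0 -> l b *: KF (B1 (ix (star a))) + l a *: KF (B1 (ix (star b))) = 0.
  move=> ab; have := congr1 KF (ea_ea tl two Bsym a b f); rewrite ab scale0r (KF0 tl) (KFD tl).
  rewrite -!(br_e_KF tl) -DE !lE !(lbrZr VL) !(br_e_KF tl) !ea_A2 -![- B1 _]scaleN1r !(KFZ tl).
  have lin (x y : K) (u v : V) : x *: (-1 *: u) + y *: (-1 *: v) = 0 -> x *: u + y *: v = 0.
    by rewrite !scaleN1r !scalerN -opprD => /eqP; rewrite oppr_eq0 => /eqP.
  exact: lin.
have single (c : K) a : c *: KF (B1 a) = 0 -> c = 0.
  move=> ca; have := B1_indep (c := fun a' => if a' == a then c else 0) _ a; rewrite eqxx; apply.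
  by rewrite sum_single.
have st : all (fun b => Nat.eqb b 0 || ~~ Nat.eqb b (star b)) I7 by [].
have l0 b : b != ix 0 -> l b = 0.
  move=> b0; have /ll : gram3 K b b = 0.
    rewrite gram3E -val_eqE /= ixK ?star_ltb //; have := ord7_all st b.
    case: Nat.eqb_spec => [E|_ /=]; first by move: b0; rewrite -val_eqE /= ixK // E eqxx.
    by case: Nat.eqb_spec => // + _; case: eqP.
  rewrite -scalerDl => /single/eqP; rewrite -mulr2n -mulr_natr mulf_eq0 (negPf two) orbF.
  by move/eqP.
have l00 : l (ix 0) = 0.
  have /ll : gram3 K (ix 1) (ix 0) = 0 by rewrite gram3E -val_eqE /= !ixK.
  rewrite (l0 (ix 1)) ?scale0r ?addr0; last by rewrite -val_eqE /= !ixK.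
  exact: single.
apply: (e_inj tl three dD) => // b; rewrite lE.
by case: (eqVneq b (ix 0)) => [->|/l0 ->]; rewrite ?l00 scale0r.
Qed.

Lemma hP_zero k D : hP k.+3 D -> D = 0.
Proof.
elim: k D => [|k IH] D; first exact: hP3_zero.
move=> hD; have dD := hP_deg hD; case: hD => _ he.
by apply: (e_inj tl three dD) => // b; apply: IH; apply: he.
Qed.

Lemma hP_simple : is_simple (hsum (gram3 K) hP).
Proof.
apply: (hsum_simple tl Bsym BBi two hP_sub hP_deg hP_e hQ_00 hP_max).
- by move=> k D /hP_hQ/hQ_KF.
- by move=> y /P1_dt[x]; exists x.
- move=> I sI Ie; apply: gen_h0 sI _ => b x; exact: Ie.
move=> I sI Ibr I3 [|[|[|k]]] x hx.
- exact: (I3 2).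
- apply: (gen_euler (k := 1) hP_sub hP_deg hP_e sI Ibr _ hx) => //.
  by apply: (I3 2) => //; apply: (hQ_mem 0 ord0).
- apply: (gen_euler (k := 2) hP_sub hP_deg hP_e sI Ibr _ hx) => //.
  by apply: (I3 2) => //; apply: (hQ_mem 0 ord0).
by rewrite (hP_zero hx); case: sI.
Qed.

End CharThreeCore.

Section CommonAction.
Variables (K : fieldType) (g : superAlg K) (z : g) (eg : 'I_7 -> g) (g0 : g -> Prop).
Hypothesis three : 3%:R = 0 :> K.
Hypothesis g_linl : forall (c : K) (x y w : g), br (c *: x + y) w = c *: br x w + br y w.
Hypothesis g_linr : forall (c : K) (x y w : g), br w (c *: x + y) = c *: br w x + br w y.
Hypothesis g_jac : forall x y w, g0 x -> g0 y -> br (br x y) w = br x (br y w) - br y (br x w).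
Hypothesis g0_br : forall x y, g0 x -> g0 y -> g0 (br x y).

Definition acts (x : g) (l : K) (M : 'M[K]_7) :=
  br x z = l *: z /\ forall a, br x (eg a) = \sum_b M b a *: eg b.

Lemma g_br0 w : br (0 : g) w = 0.
Proof.
have := g_linl 1 0 0 w; rewrite !scale1r addr0 => /(congr1 (fun x => x - br (0 : g) w)).
by rewrite subrr addrK => <-.
Qed.

Lemma g_br0r w : br w (0 : g) = 0.
Proof.
have := g_linr 1 0 0 w; rewrite !scale1r addr0 => /(congr1 (fun x => x - br w (0 : g))).
by rewrite subrr addrK => <-.
Qed.

Lemma g_brZr (c : K) (x w : g) : br w (c *: x) = c *: br w x.
Proof. by rewrite -[c *: x]addr0 g_linr g_br0r addr0. Qed.

Lemma g_br_sumr (c : 'I_7 -> K) (F : 'I_7 -> g) w :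
  br w (\sum_i c i *: F i) = \sum_i c i *: br w (F i).
Proof.
apply: (big_ind2 (fun x y => br w x = y)); first exact: g_br0r.
  by move=> x1 y1 x2 y2 <- <-; rewrite -[x1]scale1r g_linr !scale1r.
by move=> i _; rewrite g_brZr.
Qed.

Lemma acts0 : acts 0 0 0.
Proof.
split; rewrite ?g_br0 ?scale0r // => a; rewrite g_br0 big1 // => b _.
by rewrite mxE scale0r.
Qed.

Lemma acts_lin c x l M y l' M' : acts x l M -> acts y l' M' ->
  acts (c *: x + y) (c * l + l') (c *: M + M').
Proof.
move=> [xz xe] [yz ye]; split; first by rewrite g_linl xz yz scalerA -scalerDl.
move=> a; rewrite g_linl xe ye scaler_sumr -big_split /=; apply: eq_bigr => b _.
by rewrite !mxE scalerDl scalerA.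
Qed.

Lemma acts_br x l M y l' M' : g0 x -> g0 y -> acts x l M -> acts y l' M' ->
  acts (br x y) 0 (M *m M' - M' *m M).
Proof.
move=> gx gy [xz xe] [yz ye]; split.
  by rewrite g_jac // yz xz !g_brZr xz yz !scalerA mulrC subrr scale0r.
move=> a; rewrite g_jac // ye xe !g_br_sumr.
have E (A A' : 'M[K]_7) : \sum_i A' i a *: (\sum_b A b i *: eg b) = \sum_b (A *m A') b a *: eg b.
  under eq_bigr => i _ do rewrite scaler_sumr.
  rewrite exchange_big /=; apply: eq_bigr => b _; rewrite mxE scaler_suml.
  by apply: eq_bigr => i _; rewrite scalerA mulrC.
under eq_bigr => i _ do rewrite xe.
under [X in _ - X]eq_bigr => i _ do rewrite ye.
by rewrite !E -sumrB; apply: eq_bigr => b _; rewrite !mxE scalerBl.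
Qed.

Lemma acts_sum n (c : 'I_n -> K) (X : 'I_n -> g) l M : (forall i, acts (X i) (l i) (M i)) ->
  acts (\sum_i c i *: X i) (\sum_i c i * l i) (\sum_i c i *: M i).
Proof.
move=> aX; elim/big_ind3: _ => //; first exact: acts0.
  move=> x1 y1 w1 x2 y2 w2 h1 h2; have := acts_lin 1 h1 h2.
  by rewrite !scale1r mul1r.
by move=> i _; have := acts_lin (c i) (aX i) acts0; rewrite !addr0.
Qed.

Lemma R_opE (p q : nat) (k : 'I_7) : Nat.ltb p 7 -> Nat.ltb q 7 ->
  R_op eg (ix p) (ix q) k = \sum_i zmx K (Rmat p q) i k *: eg i.
Proof.
have dK (i : 'I_7) n : Nat.ltb n 7 -> zK K (delta i n) = (i == ix n)%:R.
  move=> n7; rewrite -val_eqE /= ixK // /delta; case: Nat.eqb_spec => [->|].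
    by rewrite eqxx zK1.
  by move/eqP/negPf => ->; rewrite zK0.
move=> p7 q7; rewrite /R_op !gram3E.
under eq_bigr => i _ do rewrite mxE /Rmat zent_mkmat zKB !zKM !dK ?star_ltb // scalerBl -!scalerA.
rewrite sumrB -!scaler_sumr !ixK //.
have E n : \sum_i (i == ix n)%:R *: eg i = eg (ix n).
  by rewrite (bigD1 (ix n)) //= eqxx scale1r big1 ?addr0 // => i /negPf ->; rewrite scale0r.
by rewrite !E.
Qed.

Variables (X1p X2p X1m X2m Z : g).
Hypothesis hX : is_g0_tilde z eg g0 X1p X2p X1m X2m Z.

Definition l8 (i : 'I_8) : K := if unlift ord_max i is Some _ then 0 else - 2%:R.
Definition M8 (i : 'I_8) : 'M[K]_7 := if unlift ord_max i is Some j then zmx K (MC j) else - 1%:M.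

Lemma l8_max : l8 ord_max = - 2%:R. Proof. by rewrite /l8 unlift_none. Qed.
Lemma l8_lift j : l8 (lift ord_max j) = 0. Proof. by rewrite /l8 liftK. Qed.
Lemma M8_max : M8 ord_max = - 1%:M. Proof. by rewrite /M8 unlift_none. Qed.
Lemma M8_lift j : M8 (lift ord_max j) = zmx K (MC j). Proof. by rewrite /M8 liftK. Qed.
Notation X8 := (fun i : 'I_8 => nth 0 [:: X1p; X1m; br X1p X2p; br X1m X2m;
  br X1p (br X1p X2p); br X1m (br X1m X2m); br X1p X1m; Z] i).

Lemma acts_X8 i : acts (X8 i) (l8 i) (M8 i).
Proof.
have [[g1 g2 g3 g4 gZ] [z1 a1] [z2 a2] [z3 a3] [z4 a4] [zZ aZ]] := hX.
have A1 : acts X1p 0 (zmx K X1pL).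
  split=> [|k]; first by rewrite z1 scale0r.
  rewrite a1 (R_opE (p := 3) (q := 5)) // (R_opE (p := 0) (q := 1)) // -sumrN -sumrB.
  by apply: eq_bigr => b _; rewrite [in RHS]mxE /X1pL zent_mkmat zKB zKN scalerBl scaleNr !mxE.
have A2 : acts X2p 0 (zmx K X2pL).
  by split=> [|k]; [rewrite z2 scale0r|rewrite a2 (R_opE (p := 2) (q := 4))].
have A3 : acts X1m 0 (zmx K X1mL).
  split=> [|k]; first by rewrite z3 scale0r.
  rewrite a3 (R_opE (p := 2) (q := 6)) // (R_opE (p := 0) (q := 4)) // -sumrN -sumrB.
  by apply: eq_bigr => b _; rewrite [in RHS]mxE /X1mL zent_mkmat zKB zKN scalerBl scaleNr !mxE.
have A4 : acts X2m 0 (zmx K X2mL).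
  by split=> [|k]; [rewrite z4 scale0r|rewrite a4 (R_opE (p := 1) (q := 5))].
have B x y A A' : g0 x -> g0 y -> acts x 0 (zmx K A) -> acts y 0 (zmx K A') ->
    acts (br x y) 0 (zmx K (commat A A')).
  by move=> gx gy hx hy; rewrite zmx_com; apply: acts_br gx gy hx hy.
have chk (i : 'I_7) := eqmat3P three (ord7_all MC_check i).
rewrite /l8 /M8; case: unliftP => [j ->|->].
  rewrite lift_max -chk; case: j => [[|[|[|[|[|[|[|//]]]]]]] j7] /=.
  - exact: A1. - exact: A3. - exact: (B _ _ X1pL X2pL). - exact: (B _ _ X1mL X2mL).
  - by apply: (B _ _ X1pL (commat X1pL X2pL)); [|exact: g0_br|exact: A1|exact: (B _ _ X1pL X2pL)].
  - by apply: (B _ _ X1mL (commat X1mL X2mL)); [|exact: g0_br|exact: A3|exact: (B _ _ X1mL X2mL)].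
  - exact: (B _ _ X1pL X1mL).
split=> [|a] /=; first by rewrite zZ scaleNr.
rewrite aZ (bigD1 a) //= big1 ?addr0 => [|b ba]; last by rewrite !mxE (negPf ba) oppr0 scale0r.
by rewrite !mxE eqxx scaleN1r.
Qed.

End CommonAction.
Local Opaque Submission.KF Submission.Qg Submission.B1 Submission.W0 Submission.C0 Submission.A1.

Section CharThreeDegreeZero.
Variables (K : fieldType) (T : tAlg K) (ok : pred nat) (tau : nat -> T).
Hypothesis tl : tlaws ok tau.
Hypothesis three : 3%:R = 0 :> K.
Hypothesis ok_step : forall r, ok r -> (r %% 3 != 2)%N -> ok r.+1.
Notation V := (vect_alg T).
Notation Bsym := (gram3_sym K).
Notation BBi := (gram3_sq K).
Notation two := (two3 three).
Notation KF := (@KF K T (gram3 K) (gram3 K)).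
Notation e := (v_e T (gram3 K) : _ -> V).
Notation zmx := (@zmx K).
Notation A1 := (@A1 K T ok tau).
Notation C0 := (@C0 K T ok tau).
Let VL := vect_lie tl.
Notation hQ := (@hQ K T ok tau).
Notation hP := (@hP K T ok tau).
Notation P1 := (@P1 K T ok tau).
Notation eM := (@eM K T).

Variables (g : superAlg K) (z : g) (eg : 'I_7 -> g) (g0 : g -> Prop).
Hypothesis g_linl : forall (c : K) (x y w : g), br (c *: x + y) w = c *: br x w + br y w.
Hypothesis g_linr : forall (c : K) (x y w : g), br w (c *: x + y) = c *: br w x + br w y.
Hypothesis g_jac : forall x y w, g0 x -> g0 y -> br (br x y) w = br x (br y w) - br y (br x w).
Hypothesis g0_br : forall x y, g0 x -> g0 y -> g0 (br x y).
Hypothesis eg_indep : lin_indep eg.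
Variables (X1p X2p X1m X2m Z : g).
Hypothesis hX : is_g0_tilde z eg g0 X1p X2p X1m X2m Z.
Notation s := (g0_tilde X1p X2p X1m X2m Z).
Notation l8 := (@l8 K).
Notation M8 := (@M8 K).

Let D8 (c : 'I_8 -> K) : V := \sum_(j < 7) c (lift ord_max j) *: KF (C0 j) - c ord_max *: KF A1.

Lemma D8_hQ c : hQ 0 (D8 c).
Proof.
have sQ := hQ_sub tl (ok := ok) (tau := tau) 0.
rewrite /D8 -scaleNr; apply: (subspaceD sQ).
  by apply: (subspace_sum sQ) => j _; apply: (subspaceZ sQ); apply: (hQ_mem _ _ _ (lift ord0 j)).
by apply: (subspaceZ sQ); apply: (hQ_mem _ _ _ ord0).
Qed.

Lemma hQ_D8 D : hQ 0 D -> exists c, D = D8 c.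
Proof.
move=> /(hQE tl)[c ->]; exists (fun i => if unlift ord_max i is Some j then c (lift ord0 j) else - c ord0).
rewrite /D8 unlift_none scaleNr opprK comb_recl addrC; congr (_ + _).
by apply: eq_bigr => j _; rewrite liftK.
Qed.

Lemma comb_recr (U : lmodType K) (F : 'I_8 -> U) :
  \sum_i F i = \sum_(j < 7) F (lift ord_max j) + F ord_max.
Proof.
rewrite big_ord_recr /=; congr (_ + _); apply: eq_bigr => j _.
by congr F; apply: val_inj; rewrite /= /bump leqNgt ltn_ord.
Qed.

Lemma D8_dt c : br (D8 c) (v_dt T : V) = (\sum_i c i * l8 i) *: (v_dt T : V).
Proof.
rewrite /D8 -scaleNr (lbrD VL) (lbr_sum VL) big1 ?add0r => [|j _]; last first.
  by rewrite (lbrZ VL) (br_C0_dt tl) scaler0.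
rewrite (lbrZ VL) (br_A1_dt tl) scalerN scaleNr opprK; congr (_ *: _).
rewrite (@comb_recr K^o) big1 => [|j _]; last by rewrite l8_lift mulr0.
have m2 : - 2%:R = 1 :> K by apply/eqP; rewrite eq_sym -subr_eq0 opprK -[1]/(1%:R) -natrD three.
by rewrite add0r l8_max m2 mulr1.
Qed.

Lemma M8_sum c : \sum_i c i *: M8 i =
  \sum_(j < 7) c (lift ord_max j) *: zmx (MC j) - c ord_max *: 1%:M.
Proof.
rewrite comb_recr M8_max scalerN; congr (_ - _).
by apply: eq_bigr => j _; rewrite M8_lift.
Qed.

Lemma D8_e c a : br (D8 c) (e a) = eM (\sum_i c i *: M8 i) a.
Proof.
have -> : eM (\sum_i c i *: M8 i) a =
    \sum_(j < 7) c (lift ord_max j) *: eM (zmx (MC j)) a - eM (c ord_max *: 1%:M) a.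
  by rewrite M8_sum eMB eM_sum.
have -> : br (D8 c) (e a) = br (\sum_(j < 7) c (lift ord_max j) *: KF (C0 j)) (e a) - br (c ord_max *: KF A1) (e a).
  by rewrite -(lbrN tl) -(lbrD VL).
congr (_ - _).
  by rewrite (lbr_sum VL); apply: eq_bigr => j _; rewrite (lbrZ VL) (br_C0_eM tl three).
have -> : eM (c ord_max *: 1%:M) a = c ord_max *: e a.
  rewrite /Submission.eM (bigD1 a) //= big1 ?addr0 => [|b ba]; first by rewrite !mxE eqxx mulr1.
  by rewrite !mxE (negPf ba) mulr0 scale0r.
by rewrite (lbrZ VL); congr (_ *: _); apply: (br_A1_e tl three).
Qed.

Lemma h_0_hQ (D : V) : h_0 z eg (gram3 K) s D <-> hQ 0 D.
Proof.
have aX := acts_X8 three g_linr g_jac g0_br hX.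
split=> [[Dd [x [l [M [[c ->] _ xe _ De]]]]]|/hQ_D8[c ->]].
  have [_ ce] := acts_sum g_linl c aX.
  have ME : M = \sum_i c i *: M8 i.
    apply/matrixP => b a; apply/eqP; rewrite -subr_eq0; apply/eqP.
    apply: (eg_indep (a := fun b => M b a - (\sum_i c i *: M8 i) b a)).
    under eq_bigr => i _ do rewrite scalerBl.
    by rewrite sumrB -xe -ce subrr.
  suff -> : D = D8 c by apply: D8_hQ.
  have cd := hQ_deg tl (D8_hQ c).
  have dd : v_deg 0 (D - D8 c) by rewrite addrC -scaleN1r; apply: (v_deg_lin tl).
  apply/eqP; rewrite -subr_eq0; apply/eqP; apply: (e_inj tl three dd) => // b.
  have : br (D - D8 c) (e b) = 0.
    by rewrite (lbrD VL) -scaleN1r (lbrZ VL) scaleN1r D8_e -[br D _]/(v_br D _) De ME subrr.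
  rewrite (br_e_skew tl _ _ dd) expr0 scale1r => /eqP; rewrite oppr_eq0 => /eqP; exact.
split; first exact: (hQ_deg tl (D8_hQ c)).
have [cz ce] := acts_sum g_linl c aX.
exists (\sum_i c i *: nth 0 [:: X1p; X1m; br X1p X2p; br X1m X2m;
  br X1p (br X1p X2p); br X1m (br X1m X2m); br X1p X1m; Z] i), (\sum_i c i * l8 i), (\sum_i c i *: M8 i).
split=> //; [by exists c|exact: D8_dt|exact: D8_e].
Qed.

Lemma h_comp_hQ : h_comp (T := T) z eg (gram3 K) s = hQ.
Proof.
apply/funext => k; apply/funext => D; apply/propext.
rewrite (h_compE tl Bsym BBi two (Q_sub ok tau 0) h_0_hQ k D).
by split=> -[f fP ->]; exists f => //; [apply: (Pf_Q tl three)|apply: (Q_Pf tl three)].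
Qed.

Lemma m_comp_hP : m_comp (T := T) z eg (gram3 K) s P1 = hP.
Proof.
apply/funext => k; apply/funext => D; apply/propext; elim: k D => [|[|k] IH] D //.
  by rewrite -[m_comp _ _ _ _ _ 0%N D]/(h_0 z eg (gram3 K) s D) h_0_hQ.
have -> : m_comp (T := T) z eg (gram3 K) s P1 k.+2 D =
  (hQ k.+2 D /\ forall y, h_m1 (gram3 K) y -> m_comp (T := T) z eg (gram3 K) s P1 k.+1 (br D y)).
  by rewrite -h_comp_hQ.
have -> : hP k.+2 D = (hQ k.+2 D /\ forall b, hP k.+1 (br (e b) D)) by [].
have sP := hP_sub tl (ok := ok) (tau := tau) k.+1.
split=> -[hD he]; split=> //; [move=> b|move=> y [c ->]].
  have := he _ (span_of_mem e b); rewrite IH (br_e_skew tl _ _ (hQ_deg tl hD)).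
  by move/(sign_subspace _ _ sP).
apply/IH; rewrite (lbr_sumr VL); apply: (subspace_sum sP) => b _.
rewrite (lbrZr VL) (br_e_skew tl _ _ (hQ_deg tl hD)); apply: (subspaceZ sP).
by apply/sign_subspace.
Qed.

End CharThreeDegreeZero.

Definition nextB (p : nat) : nat * nat :=
  nth (0, 0)%N [:: (1, 1); (3, 3); (4, 4); (0, 2); (2, 6); (3, 0); (1, 5)]%N p.

Lemma nextB_check : all (fun p => Nat.ltb (nextB p).1 7 && all (fun d =>
    if Nat.eqb d (nextB p).2 then good3 (nB (nextB p).1 p d) else Z.eqb (Z.modulo (nB (nextB p).1 p d) 3) 0) I7 &&
  all (fun d => has (fun n => Nat.eqb (ssrnat.iter n (fun p => (nextB p).2) p) d) I7) I7) I7.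
Proof. by vm_compute. Qed.

Definition sqB i a d : Z := zsum (fun k => nB i a k * nB i k d)%Z.

(* The squares of the root vectors of psl(3) are, up to a factor, matrix units. *)
Lemma sqB_check : all (fun a => Nat.eqb a 0 || has (fun i => all (fun a' => all (fun d =>
   if Nat.eqb a' a && Nat.eqb d (star a) then good3 (sqB i a' d) else Z.eqb (Z.modulo (sqB i a' d) 3) 0)
   I7) I7) I7) I7.
Proof. by vm_compute. Qed.

Lemma cstr_perfect : all (fun l => has (fun i => has (fun j => all (fun k =>
  if Nat.eqb k l then good3 (cstr i j k) else Z.eqb (Z.modulo (cstr i j k) 3) 0) I7) I7) I7) I7.
Proof. by vm_compute. Qed.

Lemma comb_one (K : fieldType) (U : lmodType K) (G : 'I_7 -> K) (C : 'I_7 -> U) i0 :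
  (forall i, i != i0 -> G i = 0) -> \sum_i G i *: C i = G i0 *: C i0.
Proof. by move=> G0; rewrite (bigD1 i0) //= big1 ?addr0 // => i /G0 ->; rewrite scale0r. Qed.

Lemma superdim_odd (K : fieldType) (T : tAlg K) (ok : pred nat) (tau : nat -> T) n (b : 'I_n -> vect_alg T) :
  tlaws ok tau -> (forall i, par true (b i)) -> lin_indep b -> superdim (span_of b) 0 n.
Proof.
move=> tl bt bI; have VL := vect_lie tl.
have sb x : span_of b x -> par true x.
  by case=> c ->; apply: (lpar_sum VL) => i _; apply: (lparZ VL).
have p0 : par false (0 : vect_alg T) by case: (lie_par VL false).
split.
- split; first exact: span_of_subspace.
  move=> x xb; exists 0, x; split=> //; rewrite ?add0r //; last exact: sb.
  by case: (span_of_subspace b).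
- exists (fun _ => 0); split=> [x|a _ [[]//]]; split.
    move=> [/sb xt xf]; exists (fun _ => 0); rewrite big_ord0.
    exact: (lie_par_disj VL).
  by move=> [c ->]; rewrite big_ord0; split=> //; case: (span_of_subspace b).
by exists b; split=> // x; split=> [[]//|xb]; split=> //; apply: sb.
Qed.
Local Opaque Submission.KF Submission.Qg Submission.B1 Submission.W0 Submission.C0 Submission.A1.

Section CharThreeSplitting.
Variables (K : fieldType) (T : tAlg K) (ok : pred nat) (tau : nat -> T).
Hypothesis tl : tlaws ok tau.
Hypothesis three : 3%:R = 0 :> K.
Hypothesis ok_step : forall r, ok r -> (r %% 3 != 2)%N -> ok r.+1.
Notation V := (vect_alg T).
Notation zK := (zK K).
Notation Bsym := (gram3_sym K).
Notation BBi := (gram3_sq K).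
Notation KF := (@KF K T (gram3 K) (gram3 K)).
Notation C0 := (@C0 K T ok tau).
Notation B1 := (@B1 K T ok tau).
Notation W0 := (@W0 K T ok tau).
Let VL := vect_lie tl.
Notation hQ := (@hQ K T ok tau).
Notation P1 := (@P1 K T ok tau).

Notation mW := (span_of (fun _ : 'I_1 => KF W0)).

Lemma zK_if (c : Z) (b : bool) : (if b then good3 c else Z.eqb (Z.modulo c 3) 0) -> b = (zK c != 0).
Proof.
case: b => [/(good3_neq0 three)->//|/Z.eqb_spec/(zK_mod3 three)->].
by rewrite eqxx.
Qed.

Lemma has_I7 (p : pred nat) : has p I7 -> exists i : 'I_7, p i.
Proof. move=> /hasP[i iI pI]; have i7 : (i < 7)%N by move: i iI {pI}; apply/allP.
by exists (Ordinal i7). Qed.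

Lemma hQ1E D : hQ 1 D -> exists w c, D = w *: KF W0 + \sum_(a < 7) c a *: KF (B1 a).
Proof.
move=> /(hQE tl)[c ->]; exists (c ord0), (fun a => c (lift ord0 a)).
by rewrite comb_recl.
Qed.

Lemma hQ1_kernel D : hQ 1 D -> br (v_dt T : V) D = 0 -> mW D.
Proof.
move=> /hQ1E[w [c ->]]; rewrite (lbrDr VL) (lbrZr VL) (br_dt_W0 tl) scaler0 add0r (br_dt_P1 tl three) => c0.
exists (fun _ => w); rewrite big_ord1 big1 ?addr0 // => a _.
have := e_indep tl (c := fun a => c (ix (star a))) c0 (ix (star a)).
by rewrite star_ixK => ->; rewrite scale0r.
Qed.

Lemma hQ_W0 : hQ 1 (KF W0). Proof. exact: (hQ_mem _ _ 1 ord0). Qed.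

Lemma br_Q0_Q1 D D' : hQ 0 D -> hQ 1 D' -> hQ 1 (br D D').
Proof.
move=> hD hD'; apply: (hQ_max tl three (k := 0) (l := 1) isT hD hD') => b.
have pD : par false D by apply/v_parP/(v_deg_par tl (hQ_deg tl hD)).
rewrite (lie_jacobi VL I I I (@par_e K T (gram3 K) b) pD) andbF expr0 scale1r.
apply: (subspaceD (hQ_sub tl 0)); last exact: (hQ_00 tl three hD (hQ_e tl three (n := 2) b hD')).
have [c ->] := hQ_e tl three (n := 1) b hD.
rewrite (lbr_sum VL); apply: (subspace_sum (hQ_sub tl 0)) => i _.
by rewrite (lbrZ VL); apply: (subspaceZ (hQ_sub tl 0)); apply: (hQ_e tl three (n := 2) i hD').
Qed.

Lemma lbr_comb0 (u : V) (c : 'I_7 -> K) (b : 'I_7 -> V) :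
  br u (\sum_a c a *: b a) = \sum_a c a *: br u (b a).
Proof. by rewrite (lbr_sumr VL); apply: eq_bigr => a _; rewrite (lbrZr VL). Qed.

Lemma lbr_comb (u y : V) w (c : 'I_7 -> K) (b : 'I_7 -> V) :
  br u y = 0 -> br u (w *: y + \sum_a c a *: b a) = \sum_a c a *: br u (b a).
Proof. by move=> uy; rewrite (lbrDr VL) (lbrZr VL) lbr_comb0 uy scaler0 add0r. Qed.

Lemma perfect_character (u : 'I_7 -> V) (w : V) (l : 'I_7 -> K) c i j k :
  (forall j, par false (u j)) -> (forall j, br (u j) w = l j *: w) ->
  br (u j) (u k) = c *: u i -> c != 0 -> br (u i) w = 0.
Proof.
move=> pu lE jk c0; have := lie_jacobi VL (w := w) I I I (pu j) (pu k).
rewrite expr0 scale1r !lE !(lbrZr VL) !lE !scalerA mulrC jk (lbrZ VL) lE scalerA => /eqP.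
rewrite -subr_eq subrr eq_sym scaler_eq0 => /orP[|/eqP->]; last by rewrite scaler0.
by rewrite mulf_eq0 (negPf c0) => /= /eqP ->; rewrite scale0r.
Qed.

Lemma br_C0_W0 i : br (KF (C0 i)) (KF W0) = 0.
Proof.
have hC j : hQ 0 (KF (C0 j)) by apply: (hQ_mem _ _ _ (lift ord0 j)).
have pC j : par false (KF (C0 j)) by apply/v_parP/(v_deg_par tl (hQ_deg tl (hC j))).
have line j : exists l, br (KF (C0 j)) (KF W0) = l *: KF W0.
  have [] // : mW (br (KF (C0 j)) (KF W0)); last by move=> c ->; exists (c ord0); rewrite big_ord1.
  apply: hQ1_kernel; first exact: (br_Q0_Q1 (hC j) hQ_W0).
  rewrite (lie_jacobi VL I I I (@par_dt K T) (pC j)) expr0 scale1r (br_dt_W0 tl) (lbr0r VL) addr0.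
  by rewrite (br_dt_KF tl) (dt_C0 tl) (KF0 tl) (lbr0 VL).
have [l lE] := choice line.
have /has_I7[j /has_I7[k jk]] := ord7_all cstr_perfect i.
have jkE : br (KF (C0 j)) (KF (C0 k)) = zK (cstr j k i) *: KF (C0 i).
  rewrite (br_C0_C0 tl three) -(sum_single (fun i => KF (C0 i))); apply: eq_bigr => k' _; congr (_ *: _).
  have := zK_if (ord7_all jk k'); case: Nat.eqb_spec => [E _|E /esym/negbFE/eqP->].
    by have -> : k' = i by [apply: val_inj]; rewrite eqxx.
  by case: eqP => // k'i; case: E; rewrite k'i.
apply: (perfect_character (u := fun i => KF (C0 i)) pC lE jkE).
by have := zK_if (ord7_all jk i); rewrite Nat.eqb_refl => /esym.
Qed.

Lemma C0_sq i a : br (KF (C0 i)) (br (KF (C0 i)) (KF (B1 a))) = \sum_(d < 7) zK (sqB i a d) *: KF (B1 d).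
Proof.
rewrite (br_C0_B1 tl three) (lbr_sumr VL).
under eq_bigr => k _ do rewrite (lbrZr VL) (br_C0_B1 tl three).
rewrite comb_comb; apply: eq_bigr => d _; congr (_ *: _).
by rewrite /sqB zK_zsum; apply: eq_bigr => k _; rewrite zKM.
Qed.

Lemma P1_gen (W : V -> Prop) x : subspace W -> (forall i y, W y -> W (br (KF (C0 i)) y)) ->
  hQ 1 x -> W x -> ~ mW x -> forall y, P1 y -> W y.
Proof.
move=> sW WC /hQ1E[w [c xE]] Wx nx.
have brx i : br (KF (C0 i)) x = \sum_(a < 7) c a *: br (KF (C0 i)) (KF (B1 a)).
  by rewrite xE; apply: lbr_comb (br_C0_W0 i).
have WZ l y : l != 0 -> W (l *: y) -> W y.
  by move=> l0 /(subspaceZ sW (l^-1)); rewrite scalerA mulVf // scale1r.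
have [d Wd] : exists d : 'I_7, W (KF (B1 d)).
  case: (pickP (fun a : 'I_7 => (a != ix 0) && (c a != 0))) => [a /andP[a0 ca]|c0].
    have /orP[/Nat.eqb_spec E|/has_I7[i chk]] := ord7_all sqB_check a.
      by move: a0; rewrite -val_eqE /= ixK // E eqxx.
    exists (ix (star a)); have := WC i _ (WC i _ Wx); rewrite brx lbr_comb0.
    under eq_bigr => a' _ do rewrite C0_sq.
    have sq a' d := zK_if (ord7_all (ord7_all chk a') d).
    rewrite (bigD1 a) //= [X in _ + X]big1 ?addr0 => [|a' /negPf a'a]; last first.
      rewrite big1 ?scaler0 // => d _; have := sq a' d.
      case: Nat.eqb_spec => [E|_ /esym/negbFE/eqP->]; last by rewrite scale0r.
      by move: a'a; rewrite -val_eqE /= E eqxx.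
    rewrite (bigD1 (ix (star a))) //= big1 ?addr0 => [|d /negPf da]; last first.
      have := sq a d; rewrite Nat.eqb_refl.
      case: Nat.eqb_spec => [E|_ /esym/negbFE/eqP->]; last by rewrite scale0r.
      by move: da; rewrite -val_eqE /= ixK ?star_ltb // E eqxx.
    have := sq a (ix (star a)); rewrite Nat.eqb_refl ixK ?star_ltb // Nat.eqb_refl => /esym sn.
    by rewrite scalerA; apply: WZ; rewrite mulf_neq0.
  have c0' a : a != ix 0 -> c a = 0 by move=> a0; have := c0 a; rewrite a0 /= => /negbFE/eqP.
  have c00 : c (ix 0) != 0.
    apply/eqP => c00; apply: nx; rewrite xE big1 ?addr0 => [|a _]; first by exists (fun _ => w); rewrite big_ord1.
    by case: (eqVneq a (ix 0)) => [->|/c0'->]; rewrite ?c00 scale0r.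
  exists (ix 1); have := WC (ix 1) _ Wx; rewrite brx (bigD1 (ix 0)) // big1 ?addr0 => [|a /c0'->]; last by rewrite scale0r.
  rewrite (br_C0_B1 tl three) (bigD1 (ix 1)) //= big1 ?addr0 => [|d /negPf d1].
    by rewrite !ixK // scalerA; apply: WZ; rewrite mulf_neq0 // (good3_neq0 three).
  have h : all (fun d => Nat.eqb d 1 || Z.eqb (nB 1 0 d) 0) I7 by vm_compute.
  rewrite !ixK //; have := ord7_all h d; case: Nat.eqb_spec => [E|_ /Z.eqb_spec->]; last by rewrite zK0 scale0r.
  by move: d1; rewrite -val_eqE /= ixK // E eqxx.
have next (p : 'I_7) : W (KF (B1 p)) -> W (KF (B1 (ix (nextB p).2))).
  have /andP[/andP[i7 chk] _] := ord7_all nextB_check p.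
  have p7 : Nat.ltb (nextB p).2 7 by case: p {chk i7} => [[|[|[|[|[|[|[|]]]]]]]].
  have i7E : ix (nextB p).1 = (nextB p).1 :> nat by apply: ixK.
  have p7E : ix (nextB p).2 = (nextB p).2 :> nat by apply: ixK.
  move=> /(WC (ix (nextB p).1)); rewrite (br_C0_B1 tl three) i7E (@comb_one _ _ _ _ (ix (nextB p).2)).
    have := zK_if (ord7_all chk (ix (nextB p).2)); rewrite p7E Nat.eqb_refl => /esym; exact: WZ.
  move=> d' /negPf dp; have := zK_if (ord7_all chk d').
  case: Nat.eqb_spec => [E|_ /esym/negbFE/eqP->] //.
  by move: dp; rewrite -val_eqE /= p7E E eqxx.
have all_B a : W (KF (B1 a)).
  have /andP[_ /ord7_all/(_ a)/has_I7[n /Nat.eqb_spec nE]] := ord7_all nextB_check d.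
  rewrite -(ix_val a) -nE; elim: (n : nat) => [|m IH]; first by rewrite ix_val.
  rewrite iterS; set p := ssrnat.iter _ _ _ in IH *.
  have p7 : Nat.ltb p 7.
    rewrite /p; case: m {IH p} => [|m]; first exact: ord7_ltb.
    by rewrite iterS; case: (ssrnat.iter _ _ _) => [|[|[|[|[|[|[|q]]]]]]] //; rewrite /nextB nth_default.
  by have := next _ IH; rewrite ixK.
by move=> _ [c' ->]; apply: (subspace_sum sW) => a _; apply: (subspaceZ sW).
Qed.

Lemma par_hQ1 D : hQ 1 D -> par true D.
Proof. by move=> hD; apply/v_parP/(v_deg_par tl (hQ_deg tl hD)). Qed.

Lemma subsuper_hQ1 (W : V -> Prop) : subspace W -> (forall x, W x -> hQ 1 x) -> subsuperspace W.
Proof.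
move=> sW Wh; split=> // x Wx; exists 0, x; split; rewrite ?add0r //.
- by case: sW. - by case: (lie_par VL false). - exact/par_hQ1/Wh.
Qed.

Lemma hQ_C0 i : hQ 0 (KF (C0 i)). Proof. exact: (hQ_mem _ _ 0 (lift ord0 i)). Qed.

Lemma mW_hQ x : mW x -> hQ 1 x.
Proof. by case=> c ->; rewrite big_ord1; apply: (subspaceZ (hQ_sub tl 1)); apply: hQ_W0. Qed.

Lemma mW_P1 x : mW x -> P1 x -> x = 0.
Proof.
case=> c ->; rewrite big_ord1 => /(W0_P1 tl three)->; exact: scale0r.
Qed.

Lemma irreducible_mW : irreducible (hQ 0) mW.
Proof.
have sW := span_of_subspace (fun _ : 'I_1 => KF W0).
split.
- split; first exact: (subsuper_hQ1 sW mW_hQ).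
  move=> x y /(hQE tl)[c ->] [c' ->]; rewrite big_ord1 (lbrZr VL); apply: (subspaceZ sW).
  rewrite comb_recl (lbrD VL) (lbrZ VL) (lbr_sum VL) big1 ?addr0 => [|i _]; last first.
    by rewrite (lbrZ VL) br_C0_W0 scaler0.
  rewrite (hQ_euler tl three (n := 3) hQ_W0).
  exact/(subspaceZ sW)/(subspaceN sW)/(subspaceZ sW)/(span_of_mem (fun _ : 'I_1 => KF W0) ord0).
- exists (KF W0); split; first exact: (span_of_mem (fun _ : 'I_1 => KF W0) ord0).
  by rewrite -(KF0 tl (gram3 K) (gram3 K)) => /(KF_inj tl Bsym BBi)/(W0_neq0 tl three).
move=> W' [[sW' _] _] W'W.
case: (pselect (forall x, W' x -> x = 0)) => [|nz]; [by left|right=> x xW].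
have [y [W'y y0]] : exists y, W' y /\ y <> 0.
  by apply: contrapT => ne; apply: nz => y W'y; apply: contrapT => y0; apply: ne; exists y.
have [c yE] := W'W y W'y; have [c' ->] := xW; rewrite !big_ord1 in yE *.
have c0 : c ord0 != 0 by apply/eqP => c0; apply: y0; rewrite yE c0 scale0r.
have -> : c' ord0 *: KF W0 = (c' ord0 / c ord0) *: y by rewrite yE scalerA divfK.
exact: (subspaceZ sW').
Qed.

Lemma irreducible_P1 : irreducible (hQ 0) P1.
Proof.
have sP := span_of_subspace (fun a => KF (B1 a)).
split.
- by split; [exact: (subsuper_hQ1 sP (@P1_hQ _ _ _ _ tl))|exact: (br_Q0_P1 tl three)].
- exists (KF (B1 ord0)); split; first exact: (span_of_mem (fun a => KF (B1 a))).
  move=> b0; have := B1_indep tl three (c := fun a => if a == ord0 then 1 else 0).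
  rewrite sum_single b0 scaler0 => /(_ erefl ord0)/eqP.
  by rewrite ?eqxx oner_eq0.
move=> W' [[sW' _] W'C] W'P.
case: (pselect (forall x, W' x -> x = 0)) => [|nz]; [by left|right].
have [y [W'y y0]] : exists y, W' y /\ y <> 0.
  by apply: contrapT => ne; apply: nz => y W'y; apply: contrapT => y0; apply: ne; exists y.
apply: (P1_gen sW' _ (P1_hQ tl (W'P y W'y)) W'y) => [i x|yW]; first exact/W'C/hQ_C0.
exact/y0/mW_P1/W'P.
Qed.

Definition splits m' m'' := [/\ direct_sum (hQ 1) m' m'', irreducible (hQ 0) m', superdim m' 0 1,
  irreducible (hQ 0) m'' & superdim m'' 0 7].

Lemma splits_mW_P1 : splits mW P1.
Proof.
split.
- split; last exact: mW_P1.
  move=> x; split=> [/hQ1E[w [c ->]]|[x1 [x2 [/mW_hQ h1 /(P1_hQ tl) h2 ->]]]].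
    by exists (w *: KF W0), (\sum_(a < 7) c a *: KF (B1 a)); split=> //; [exists (fun _ => w); rewrite big_ord1|exists c].
  exact: (subspaceD (hQ_sub tl 1)).
- exact: irreducible_mW.
- apply: (superdim_odd tl) => [_|c]; first exact/par_hQ1/hQ_W0.
  rewrite big_ord1 => c0 i; rewrite ord1; apply: (W0_P1 tl three); rewrite c0.
  by case: (span_of_subspace (fun a => KF (B1 a))).
- exact: irreducible_P1.
apply: (superdim_odd tl) => [i|c /(B1_indep tl three)//]; apply/par_hQ1/(P1_hQ tl).
exact: (span_of_mem (fun a => KF (B1 a))).
Qed.

Lemma splits_P1 m' m'' : splits m' m'' -> m'' = P1.
Proof.
case=> [[mE _] [[[s1 _] _] _ _] _ [[[s2 _] m2C] _ m2I] [_ _ [b [bE bI]]]].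
have m2h x : m'' x -> hQ 1 x.
  by move=> xm; apply/mE; exists 0, x; rewrite add0r; split=> //; case: s1.
have [x [xm nx]] : exists x, m'' x /\ ~ mW x.
  apply: contrapT => ne.
  have bW i : exists l, b i = l *: KF W0.
    have [bm _] : m'' (b i) /\ par true (b i) by apply/bE; apply: span_of_mem.
    have [c ->] : mW (b i) by apply: contrapT => nb; apply: ne; exists (b i).
    by exists (c ord0); rewrite big_ord1.
  have [l lE] := choice bW.
  have [h0 h1] : l ord_max = 0 /\ l ord0 = 0.
    have := bI (fun i => (if i == ord0 then l ord_max else 0) - (if i == ord_max then l ord0 else 0)).
    under eq_bigr => i _ do rewrite scalerBl.
    rewrite sumrB !sum_single !lE !scalerA mulrC subrr => /(_ erefl) h.
    split; first by have := h ord0; rewrite eqxx subr0.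
    by have := h ord_max; rewrite eqxx sub0r => /eqP; rewrite oppr_eq0 => /eqP.
  have := bI (fun i => if i == ord0 then 1 else 0).
  rewrite sum_single lE h1 scale0r scaler0 => /(_ erefl ord0)/eqP.
  by rewrite ?eqxx oner_eq0.
have Pm : forall y, P1 y -> m'' y.
  by apply: (P1_gen s2 _ (m2h x xm) xm nx) => i y; apply/m2C/hQ_C0.
apply/funext => y; apply/propext; split; last exact: Pm.
have [PS [w [Pw w0]] _] := irreducible_P1.
by case: (m2I P1 PS Pm) => [/(_ w Pw)|]; [|exact].
Qed.

End CharThreeSplitting.

(** * Divided powers of different heights *)

Transparent KF Qg B1 W0 C0 A1.

Lemma bin_overflow (K : fieldType) p N k i : p \in [pchar K] -> (i < expn p N)%N ->
  (k - i < expn p N)%N -> (expn p N <= k)%N -> 'C(k, i)%:R = 0 :> K.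
Proof.
move=> pK ih kih hk; rewrite -(subnKC hk) -binomial.Vandermonde natr_sum big1 // => j _.
rewrite natrM; case: (posnP j) => [->|j0].
  by rewrite bin0 mul1r subn0 bin_small //; lia.
by rewrite (pchar_binX pK) ?mul0r // j0 (leq_ltn_trans _ ih) // -ltnS.
Qed.

Section AlgebraMap.
Variables (K : fieldType) (T T' : tAlg K) (iota : T -> T').
Hypothesis iota_lin : forall (c : K) f g, iota (c *: f + g) = c *: iota f + iota g.
Hypothesis iota_mul : forall f g, iota (t_mul f g) = t_mul (iota f) (iota g).
Hypothesis iota_der : forall f, iota (t_der f) = t_der (iota f).
Hypothesis iota_one : iota (t_one T) = t_one T'.
Hypothesis iota_inj : injective iota.

Lemma iota0 : iota 0 = 0.
Proof.
have := iota_lin 1 0 0; rewrite !scale1r addr0 => /(congr1 (fun x => x - iota 0)).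
by rewrite subrr addrK => <-.
Qed.

Lemma iotaZ (c : K) f : iota (c *: f) = c *: iota f.
Proof. by rewrite -[c *: f]addr0 iota_lin iota0 addr0. Qed.

Lemma iotaD f g : iota (f + g) = iota f + iota g.
Proof. by rewrite -{1}[f]scale1r iota_lin scale1r. Qed.

Lemma iota_sum (I : Type) (r : seq I) (P : pred I) (F : I -> T) :
  iota (\sum_(i <- r | P i) F i) = \sum_(i <- r | P i) iota (F i).
Proof. by apply: (big_morph iota iotaD iota0). Qed.

Definition om (f : O T) : O T' := [ffun S => iota (f S)].
Definition vm (D : vect_alg T) : vect_alg T' := [ffun i => om ((D : vect T) i)].

Lemma om_lin (c : K) (f g : O T) : om (c *: f + g) = c *: om f + om g.
Proof. by apply/ffunP => S; rewrite !ffunE iota_lin. Qed.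

Lemma om0 : om 0 = 0.
Proof. by apply/ffunP => S; rewrite !ffunE iota0. Qed.

Lemma omZ (c : K) (f : O T) : om (c *: f) = c *: om f.
Proof. by rewrite -[c *: f]addr0 om_lin om0 addr0. Qed.

Lemma omD (f g : O T) : om (f + g) = om f + om g.
Proof. by rewrite -{1}[f]scale1r om_lin scale1r. Qed.

Lemma omB (f g : O T) : om (f - g) = om f - om g.
Proof. by rewrite omD -scaleN1r omZ scaleN1r. Qed.

Lemma om_sum (I : Type) (r : seq I) (P : pred I) (F : I -> O T) :
  om (\sum_(i <- r | P i) F i) = \sum_(i <- r | P i) om (F i).
Proof. by apply: (big_morph om omD om0). Qed.

Lemma om_mul (f g : O T) : om (o_mul f g) = o_mul (om f) (om g).
Proof.
apply/ffunP => S; rewrite !ffunE iota_sum; apply: eq_bigr => S' _.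
by rewrite iotaZ iota_mul !ffunE.
Qed.

Lemma om_der i (f : O T) : om (o_der i f) = o_der i (om f).
Proof.
by case: i => [a|]; apply/ffunP => S; rewrite !ffunE //; case: ifP; rewrite ?iota0 ?iotaZ.
Qed.

Lemma om_xi a : om (o_xi T a) = o_xi T' a.
Proof. by apply/ffunP => S; rewrite !ffunE; case: ifP; rewrite ?iota0 ?iota_one. Qed.

Lemma om_one : om (o_one T) = o_one T'.
Proof. by apply/ffunP => S; rewrite !ffunE; case: ifP; rewrite ?iota0 ?iota_one. Qed.

Lemma om_osg (f : O T) : om (osg f) = osg (om f).
Proof. by apply/ffunP => S; rewrite !ffunE iotaZ. Qed.

Lemma om_ee (B : 'M[K]_7) l a (f : O T) : om (ee B l a f) = ee B l a (om f).
Proof.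
rewrite /ee /yy omD omZ om_sum /dx om_der; congr (_ + _ *: _); apply: eq_bigr => b _.
by rewrite omZ /xi om_mul om_xi /dt om_der.
Qed.

Lemma vm_lin (c : K) (D D' : vect_alg T) : vm (c *: D + D') = c *: vm D + vm D'.
Proof. by apply/ffunP => i; rewrite !ffunE om_lin. Qed.

Lemma vm0 : vm 0 = 0.
Proof. by apply/ffunP => i; rewrite !ffunE om0. Qed.

Lemma vmZ (c : K) (D : vect_alg T) : vm (c *: D) = c *: vm D.
Proof. by rewrite -[c *: D]addr0 vm_lin vm0 addr0. Qed.

Lemma vmD (D D' : vect_alg T) : vm (D + D') = vm D + vm D'.
Proof. by rewrite -{1}[D]scale1r vm_lin scale1r. Qed.

Lemma vm_sum (I : Type) (r : seq I) (P : pred I) (F : I -> vect_alg T) :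
  vm (\sum_(i <- r | P i) F i) = \sum_(i <- r | P i) vm (F i).
Proof. by apply: (big_morph vm vmD vm0). Qed.

Lemma vm_part s D : vm (v_part s D) = v_part s (vm D).
Proof. by apply/ffunP => i; apply/ffunP => S; rewrite !ffunE; case: ifP; rewrite ?iota0. Qed.

Lemma om_act (D : vect_alg T) f : om (v_act D f) = v_act (vm D) (om f).
Proof.
rewrite /v_act om_sum; apply: eq_bigr => i _.
by rewrite om_mul om_der ffunE.
Qed.

Lemma vm_br (D D' : vect_alg T) : vm (br D D') = br (vm D) (vm D').
Proof.
rewrite /= /v_br vm_sum; apply: eq_bigr => s _; rewrite vm_sum; apply: eq_bigr => s' _.
apply/ffunP => i; rewrite !ffunE omB omZ !om_act !vm_part.
by congr (v_act _ _ - _ *: v_act _ _); apply/ffunP => S; rewrite !ffunE; case: ifP; rewrite ?iota0.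
Qed.

Lemma vm_KF (B Bi : 'M[K]_7) (f : O T) : vm (KF B Bi f) = KF B Bi (om f).
Proof.
apply/ffunP => -[a|]; rewrite ffunE ?KFSome ?KFNone.
  by rewrite /KFa om_sum; apply: eq_bigr => b _; rewrite omZ om_osg /eh om_ee.
rewrite omB omZ om_sum; congr (_ - _ *: _); apply: eq_bigr => b _.
by rewrite /xi om_mul om_xi /eh om_ee.
Qed.

Lemma vm_dt : vm (v_dt T) = v_dt T'.
Proof. by apply/ffunP => -[a|]; rewrite !ffunE ?om0 ?om_one. Qed.

Lemma vm_e (B : 'M[K]_7) a : vm (v_e T B a) = v_e T' B a.
Proof.
apply/ffunP => -[b|]; rewrite !ffunE; last first.
  by rewrite om_sum; apply: eq_bigr => c _; rewrite omZ om_xi.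
by case: ifP; rewrite ?om0 ?om_one.
Qed.

Lemma vm_inj : injective vm.
Proof.
move=> D D' /ffunP E; apply/ffunP => i; apply/ffunP => S.
by have /ffunP/(_ S) := E i; rewrite !ffunE; apply: iota_inj.
Qed.

Lemma vm_par s D : par s D -> par s (vm D).
Proof.
by move=> Ds i S; rewrite !ffunE => n0; apply: Ds; apply: contraNneq n0 => ->; rewrite iota0.
Qed.

Lemma vm_span n (b : 'I_n -> vect_alg T) (b' : 'I_n -> vect_alg T') :
  (forall i, vm (b i) = b' i) ->
  (forall x, span_of b x -> span_of b' (vm x)) /\
  (forall y, span_of b' y -> exists2 x, span_of b x & vm x = y).
Proof.
move=> bb'; have E c : vm (\sum_i c i *: b i) = \sum_i c i *: b' i.
  by rewrite vm_sum; apply: eq_bigr => i _; rewrite vmZ bb'.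
split=> [_ [c ->]|_ [c ->]]; first by exists c; rewrite E.
by exists (\sum_i c i *: b i); [exists c|].
Qed.

Variables (ok ok' : pred nat) (tau : nat -> T) (tau' : nat -> T').
Hypothesis tl : tlaws ok tau.
Hypothesis tl' : tlaws ok' tau'.
Hypothesis three : 3%:R = 0 :> K.
Hypothesis ok_ok' : forall r, ok r -> ok' r.
Hypothesis iota_tau : forall r, ok r -> iota (tau r) = tau' r.

Lemma om_interp r t : ok r -> om (interp ok tau r t) = interp ok' tau' r t.
Proof.
move=> okr; rewrite /interp om_sum; apply: eq_bigr => x _; rewrite omZ; congr (_ *: _).
elim: x.1.2 => [|n m IH] /=; last by rewrite /xi om_mul om_xi IH.
rewrite /tauO okr (ok_ok' okr) /=; case: ifP => // _; last exact: om0.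
apply/ffunP => S; rewrite !ffunE; case: ifP; rewrite ?iota0 // => _.
by rewrite iota_tau //; apply: (tau_down tl).
Qed.

Notation hP := (@hP K T ok tau).
Notation hP' := (@Submission.hP K T' ok' tau').

Lemma A2_hP (T0 : tAlg K) (ok0 : pred nat) (tau0 : nat -> T0) : tlaws ok0 tau0 ->
  Submission.hP ok0 tau0 2 (KF (gram3 K) (gram3 K) (Qg ok0 tau0 2 ord0)).
Proof.
move=> tl0; split=> [|b]; first exact: (hQ_mem _ _ 2 ord0).
rewrite (br_e_KF tl0) (ea_A2 tl0 three b) -scaleN1r (KFZ tl0).
apply: (subspaceZ (hP_sub tl0 1)).
exact: (span_of_mem (fun a => KF (gram3 K) (gram3 K) (B1 ok0 tau0 a))).
Qed.

Lemma hh_vm n : (forall x, hh (gram3 K) hP n x -> hh (gram3 K) hP' n (vm x)) /\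
  (forall y, hh (gram3 K) hP' n y -> exists2 x, hh (gram3 K) hP n x & vm x = y).
Proof.
have oQ k (i : 'I_8) : (k <= 2)%N -> ok (lev (odd k) i k./2) ->
    vm (KF (gram3 K) (gram3 K) (Qg ok tau k i)) = KF (gram3 K) (gram3 K) (Qg ok' tau' k i).
  by move=> _ okl; rewrite vm_KF /Submission.Qg om_interp.
have okr r : (r <= 2)%N -> ok r.
  by case: r => [|[|[|//]]] _; [apply: (ok0 tl)|apply: (ok1 tl)|apply: (ok2 tl)].
case: n => [|[|[|[|[|n]]]]].
- by apply: vm_span => _; apply: vm_dt.
- by apply: vm_span => a; apply: vm_e.
- have [h1 h2] := vm_span (b := fun i => KF (gram3 K) (gram3 K) (Qg ok tau 0 i))
    (b' := fun i => KF (gram3 K) (gram3 K) (Qg ok' tau' 0 i))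
    (fun i => oQ 0 i isT (okr (lev (odd 0) i 0./2) (ltac:(by rewrite /lev; case: ifP)))).
  have E (T0 : tAlg K) (ok0 : pred nat) (tau0 : nat -> T0) D : tlaws ok0 tau0 ->
      hQ ok0 tau0 0 D <-> span_of (fun i => KF (gram3 K) (gram3 K) (Qg ok0 tau0 0 i)) D.
    move=> tl0; split=> [/(hQE tl0)[c ->]|[c ->]]; first by exists c.
    apply: (subspace_sum (hQ_sub tl0 0)) => i _; apply: (subspaceZ (hQ_sub tl0 0)).
    exact: (hQ_mem _ _ 0 i).
  split=> [x /(E _ _ _ _ tl)/h1/(E _ _ _ _ tl')//|y /(E _ _ _ _ tl')/h2[x /(E _ _ _ _ tl) hx <-]].
  by exists x.
- apply: (vm_span (b := fun a => KF (gram3 K) (gram3 K) (B1 ok tau a))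
    (b' := fun a => KF (gram3 K) (gram3 K) (B1 ok' tau' a))) => a.
  exact: (oQ 1 (lift ord0 a) isT (okr 1 isT)).
- have A2E : vm (KF (gram3 K) (gram3 K) (Qg ok tau 2 ord0)) = KF (gram3 K) (gram3 K) (Qg ok' tau' 2 ord0).
    by apply: oQ => //; apply: okr.
  split=> [x /(hP2_line tl three)[l ->]|y /(hP2_line tl' three)[l ->]].
    by rewrite vmZ A2E; apply: (subspaceZ (hP_sub tl' 2)); apply: A2_hP.
  exists (l *: KF (gram3 K) (gram3 K) (Qg ok tau 2 ord0)); last by rewrite vmZ A2E.
  by apply: (subspaceZ (hP_sub tl 2)); apply: A2_hP.
split=> [x /(hP_zero tl three)->|y /(hP_zero tl' three)->].
  by rewrite vm0; case: (hP_sub tl' n.+3).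
by exists 0; [case: (hP_sub tl n.+3)|apply: vm0].
Qed.

Lemma vm_iso : is_iso (hsum (gram3 K) hP) (hsum (gram3 K) hP') vm.
Proof.
split.
- by move=> c x y _ _; apply: vm_lin.
- by move=> s x _; apply: vm_par.
- by move=> x y _ _; apply: vm_br.
- by move=> x y _ _; apply: vm_inj.
move=> y; split=> [[n [F [hF ->]]]|[x [n [F [hF ->]]] <-]]; last first.
  exists n, (fun k => vm (F k)); rewrite vm_sum; split=> // k.
  by apply: (proj1 (hh_vm k)).
have /choice[G hG] : forall k, exists x, hh (gram3 K) hP k x /\ vm x = F k.
  by move=> k; have [x hx xE] := proj2 (hh_vm k) _ (hF k); exists x.
exists (\sum_(k < n) G k).
  by exists n, G; split=> // k; have [] := hG k.
by rewrite vm_sum; apply: eq_bigr => k _; have [] := hG k.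
Qed.

End AlgebraMap.

Section DividedPowerInclusion.
Variables (K : fieldType) (p N N' : nat).
Hypothesis pK : p \in [pchar K].
Hypothesis NN' : (N <= N')%N.
Notation T := (dp_tAlg K (expn p N)).
Notation T' := (dp_tAlg K (expn p N')).

Definition dp_incl (f : T) : T' := \row_(r < expn p N') dp_coef r f.

Lemma dp_incl_le : (expn p N <= expn p N')%N.
Proof. by rewrite leq_exp2l // prime_gt1 // (pcharf_prime pK). Qed.

Lemma dp_coef_incl k f : dp_coef k (dp_incl f) = dp_coef k f.
Proof.
rewrite (@dp_coef_row K _ (fun k => dp_coef k f)); case: ltnP => // k_ge.
by rewrite dp_coef_ge // (leq_trans dp_incl_le).
Qed.

Lemma dp_eq h (f g : dp_tAlg K h) : (forall k, dp_coef k f = dp_coef k g) -> f = g.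
Proof. by move=> fg; apply/rowP => i; rewrite -!dp_coefE. Qed.

Lemma dp_incl_lin (c : K) f g : dp_incl (c *: f + g) = c *: dp_incl f + dp_incl g.
Proof. by apply: dp_eq => k; rewrite dp_coefD !dp_coef_incl dp_coefD. Qed.

Lemma dp_incl_der f : dp_incl (t_der f) = t_der (dp_incl f).
Proof. by apply: dp_eq => k; rewrite dp_coef_der !dp_coef_incl dp_coef_der. Qed.

Lemma dp_incl_mul f g : dp_incl (t_mul f g) = t_mul (dp_incl f) (dp_incl g).
Proof.
apply: dp_eq => k; rewrite dp_coef_incl !dp_coef_mul.
case: (ltnP k (expn p N)) => kh.
  rewrite (leq_trans kh dp_incl_le) /bconv; apply: eq_bigr => i _.
  by rewrite !dp_coef_incl.
case: ifP => // _; rewrite /bconv big1 // => i _; rewrite !dp_coef_incl.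
case: (ltnP i (expn p N)) => ih; last by rewrite (dp_coef_ge _ ih) mulr0 mul0r.
case: (ltnP (k - i) (expn p N)) => kih; last by rewrite (dp_coef_ge _ kih) mulr0.
by rewrite (bin_overflow pK ih kih kh) !mul0r.
Qed.

Lemma dp_incl_tau r : (r < expn p N)%N -> dp_incl (dp_tau K (expn p N) r) = dp_tau K (expn p N') r.
Proof.
move=> rh; apply: dp_eq => k; rewrite dp_coef_incl !dp_coef_tau.
case: (ltnP k (expn p N)) => kh; first by rewrite (leq_trans kh dp_incl_le).
by case: ifP => //; case: eqP => // kr; rewrite kr leqNgt rh in kh.
Qed.

Lemma dp_incl_inj : injective dp_incl.
Proof. by move=> f g fg; apply: dp_eq => k; rewrite -dp_coef_incl fg dp_coef_incl. Qed.

End DividedPowerInclusion.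

(** * Reduction of structure constants *)

Record struct_laws (m : nat) (q : 'I_m -> bool) (d : 'I_m -> int)
    (c : 'I_m -> 'I_m -> 'I_m -> int) : Prop := StructLaws {
  sl_par : forall i, q i = odd `|d i|%N;
  sl_deg : forall i j k, c i j k != 0 -> d k = d i + d j;
  sl_skew : forall i j k, c i j k = - ((-1) ^+ (q i && q j) * c j i k);
  sl_jac : forall i j k n, \sum_l c j k l * c i l n =
    \sum_l c i j l * c l k n + (-1) ^+ (q i && q j) * \sum_l c i k l * c j l n
}.

Lemma odd_absD (k l : int) : odd `|(k + l)%R|%N = odd `|k|%N (+) odd `|l|%N.
Proof. by rewrite -oddD; case: k => k; case: l => l; lia. Qed.

Section StructureConstants.
Variables (F : numFieldType) (L : superAlg F) (Ep Em H : 'I_3 -> L).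
Hypothesis hL : is_gA ag2_cartan ag2_odd Ep Em H.
Notation deg := (rgrade Ep Em H ag2_r).
Let LL := gA_lie hL.

Lemma rgrade_par k x : deg k x -> par (odd `|k|%N) x.
Proof.
have sp s := lie_par LL s.
elim=> {k x} [i|i|i|k|k a x y _ IHx _ IHy|k l x y _ IHx _ IHy].
- have := gA_parEp hL i; rewrite /ag2_odd /ag2_r; by case: eqP.
- have := gA_parEm hL i; rewrite /ag2_odd /ag2_r; by case: eqP.
- exact: (gA_parH hL i).
- by case: (sp (odd `|k|)).
- by case: (sp (odd `|k|)) => _; apply.
- by rewrite odd_absD; apply: (lie_br_par LL).
Qed.

(* twice the grading element *)
Definition hdeg : L := H (inord 0) - 2%:R *: H (inord 1) - 3%:R *: H (inord 2).

Lemma par_hdeg : par false hdeg.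
Proof.
have sp := lie_par LL false.
by rewrite /hdeg; apply: (subspaceD sp); [apply: (subspaceD sp)|];
  rewrite -?scaleNr; try apply: (subspaceZ sp); rewrite ?scaleNr; try apply: (subspaceN sp);
  try apply: (subspaceZ sp); apply: (gA_parH hL).
Qed.

Lemma hdeg_br x : br hdeg x = br (H (inord 0)) x - 2%:R *: br (H (inord 1)) x - 3%:R *: br (H (inord 2)) x.
Proof. by rewrite /hdeg -!scaleNr !(lbrD LL) !(lbrZ LL). Qed.

Lemma rgrade_hdeg k x : deg k x -> br hdeg x = (2 * k)%:~R *: x.
Proof.
elim=> {k x} [i|i|i|k|k a x y _ IHx _ IHy|k l x y hx IHx hy IHy].
- rewrite hdeg_br !(gA_HEp hL) !scalerA -!scaleNr -!scalerDl; congr (_ *: _).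
  by rewrite !mxE !inordK // /ag2_r; case: i => [[|[|[|//]]] i3] /=; rewrite -?intrM; ring.
- rewrite hdeg_br !(gA_HEm hL) !scalerN !scalerA -!scaleNr -!scalerDl; congr (_ *: _).
  by rewrite !mxE !inordK // /ag2_r; case: i => [[|[|[|//]]] i3] /=; ring.
- by rewrite hdeg_br !(gA_HH hL) !scaler0 !subr0 mulr0 scale0r.
- by rewrite (lbr0r LL) scaler0.
- by rewrite (lbrDr LL) (lbrZr LL) IHx IHy scalerDr !scalerA [a * _]mulrC.
rewrite (lie_jacobi LL I I I par_hdeg (rgrade_par hx)) expr0 scale1r IHx IHy.
by rewrite (lbrZ LL) (lbrZr LL) -scalerDl -intrD -mulrDr.
Qed.

Variables (m : nat) (b : 'I_m -> L) (q : 'I_m -> bool) (d : 'I_m -> int).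
Variable c : 'I_m -> 'I_m -> 'I_m -> int.
Hypothesis hb : is_integral_basis ag2_odd Ep Em H ag2_r b q d c.

Lemma int_indep (z : 'I_m -> int) : \sum_k (z k)%:~R *: b k = 0 -> forall k, z k = 0.
Proof.
have [_ bI] := ib_basis hb; move=> /bI z0 k.
by apply/eqP; rewrite -(@intr_eq0 F) z0.
Qed.

Lemma basis_neq0 i : b i <> 0.
Proof.
move=> bi0; have := int_indep (z := fun k => (k == i)%:R) _ i; rewrite eqxx => h.
suff : (1 : int) = 0 by []. apply: h; rewrite (bigD1 i) //= bi0 scaler0 add0r big1 // => k /negPf ->.
by rewrite scale0r.
Qed.

Lemma integral_basis_struct : struct_laws q d c.
Proof.
have deg_b := ib_deg hb.
have qE i : q i = odd `|d i|%N.
  have := ib_par hb i; have := rgrade_par (deg_b i); move: (odd _) => s.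
  case: s; case: (q i) => // p1 p2; case: (@basis_neq0 i).
    exact: (lie_par_disj LL).
  exact: (lie_par_disj LL).
split=> // [i j k cn|i j k|i j k n].
- have := rgrade_hdeg (rgrade_br (deg_b i) (deg_b j)); rewrite (ib_br hb) (lbr_sumr LL) scaler_sumr.
  move/eqP; rewrite -subr_eq0 -sumrB => /eqP E.
  have := int_indep (z := fun k => c i j k * (2 * d k) - (2 * (d i + d j)) * c i j k) _ k.
  move=> h; suff : c i j k * (2 * d k) - (2 * (d i + d j)) * c i j k = 0 by move=> /eqP; rewrite mulrC -mulrBl mulf_eq0 (negPf cn) orbF; lia.
  apply: h; rewrite -[RHS]E; apply: eq_bigr => k' _.
  rewrite (lbrZr LL) (rgrade_hdeg (deg_b k')) !scalerA -scalerBl; congr (_ *: _).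
  by rewrite intrB !intrM.
- have := lie_skew LL I I (ib_par hb i) (ib_par hb j); rewrite !(ib_br hb) scaler_sumr => /eqP.
  rewrite -subr_eq0 opprK -big_split /= => /eqP E.
  have := int_indep (z := fun k => c i j k + (-1) ^+ (q i && q j) * c j i k) _ k.
  move=> h; suff : c i j k + (-1) ^+ (q i && q j) * c j i k = 0 by move=> /eqP; rewrite addr_eq0 => /eqP.
  apply: h; rewrite -[RHS]E; apply: eq_bigr => k' _.
  by rewrite scalerA -scalerDl intrD intrM intr_sign.
have E2 i' (z : 'I_m -> int) : br (b i') (\sum_l (z l)%:~R *: b l) = \sum_n (\sum_l z l * c i' l n)%:~R *: b n.
  rewrite (lbr_sumr LL); under eq_bigr => l _ do rewrite (lbrZr LL) (ib_br hb) scaler_sumr.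
  rewrite exchange_big /=; apply: eq_bigr => n' _; rewrite rmorph_sum /= scaler_suml.
  by apply: eq_bigr => l _; rewrite scalerA intrM.
have E1 k' (z : 'I_m -> int) : br (\sum_l (z l)%:~R *: b l) (b k') = \sum_n (\sum_l z l * c l k' n)%:~R *: b n.
  rewrite (lbr_sum LL); under eq_bigr => l _ do rewrite (lbrZ LL) (ib_br hb) scaler_sumr.
  rewrite exchange_big /=; apply: eq_bigr => n' _; rewrite rmorph_sum /= scaler_suml.
  by apply: eq_bigr => l _; rewrite scalerA intrM.
have := lie_jacobi LL (w := b k) I I I (ib_par hb i) (ib_par hb j).
rewrite !(ib_br hb) !E2 E1 scaler_sumr -big_split /= => /eqP; rewrite -subr_eq0 -sumrB => /eqP E.
have := int_indep (z := fun n => \sum_l c j k l * c i l n - (\sum_l c i j l * c l k n +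
  (-1) ^+ (q i && q j) * \sum_l c i k l * c j l n)) _ n.
move=> h; apply/eqP; rewrite -subr_eq0; apply/eqP; apply: h; rewrite -[RHS]E; apply: eq_bigr => n' _.
by rewrite intrB intrD intrM intr_sign scalerBl scalerDl scalerA.
Qed.

End StructureConstants.

Section ReductionLaws.
Variables (K : fieldType) (m : nat) (q : 'I_m -> bool) (d : 'I_m -> int).
Variable (c : 'I_m -> 'I_m -> 'I_m -> int).
Hypothesis sl : struct_laws q d c.
Notation M := (reduction K q c).
Notation rdeg := (@red_deg K m q d c).
Implicit Types x y w : M.

Lemma red_linl (a : K) x y w : br (a *: x + y) w = a *: br x w + br y w.
Proof.
apply/rowP => k; rewrite !mxE mulr_sumr -big_split /=; apply: eq_bigr => i _.
rewrite mulr_sumr -big_split /=; apply: eq_bigr => j _.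
by rewrite !mxE; ring.
Qed.

Lemma red_linr (a : K) x y w : br w (a *: x + y) = a *: br w x + br w y.
Proof.
apply/rowP => k; rewrite !mxE mulr_sumr -big_split /=; apply: eq_bigr => i _.
rewrite mulr_sumr -big_split /=; apply: eq_bigr => j _.
by rewrite !mxE; ring.
Qed.

Definition dl (i : 'I_m) : M := (delta_mx 0 i : 'rV[K]_m).

Lemma red_expand x : x = \sum_i (x : 'rV[K]_m) 0 i *: dl i.
Proof. exact: row_sum_delta. Qed.

Lemma red_dl i j : br (dl i) (dl j) = \sum_k (c i j k)%:~R *: dl k.
Proof.
rewrite [LHS]red_expand; apply: eq_bigr => k _; congr (_ *: _); rewrite !mxE.
rewrite (bigD1 i) //= [X in _ + X]big1 ?addr0 => [|i' /negPf i'i]; last first.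
  by rewrite big1 // => j' _; rewrite !mxE i'i andbF mulr0 mul0r.
rewrite (bigD1 j) //= [X in _ + X]big1 ?addr0 => [|j' /negPf j'j]; last by rewrite !mxE j'j andbF mulr0.
by rewrite !mxE !eqxx !mulr1.
Qed.

Definition klin (f : M -> M) := forall (a : K) x y, f (a *: x + y) = a *: f x + f y.

Lemma klin0 f : klin f -> f 0 = 0.
Proof.
move=> fl; have := fl 1 0 0; rewrite !scale1r addr0 => /(congr1 (fun x => x - f 0)).
by rewrite subrr addrK => <-.
Qed.

Lemma klin_sum f (I : Type) (r : seq I) (P : pred I) (a : I -> K) (F : I -> M) : klin f ->
  f (\sum_(i <- r | P i) a i *: F i) = \sum_(i <- r | P i) a i *: f (F i).
Proof.
move=> fl; apply: (big_ind2 (fun x y => f x = y)); first exact: klin0.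
  by move=> x1 y1 x2 y2 <- <-; rewrite -[x1]scale1r fl !scale1r.
by move=> i _; rewrite -[a i *: F i]addr0 fl klin0 // addr0.
Qed.

Lemma klin_vanish (f : M -> M) (P : 'I_m -> Prop) x : klin f ->
  (forall i, (x : 'rV[K]_m) 0 i != 0 -> P i) -> (forall i, P i -> f (dl i) = 0) -> f x = 0.
Proof.
move=> fl xP fP; rewrite [x]red_expand klin_sum // big1 // => i _.
by case: (eqVneq ((x : 'rV[K]_m) 0 i) 0) => [->|/xP/fP->]; rewrite ?scale0r ?scaler0.
Qed.

Lemma red_skew s t x y : par s x -> par t y -> br x y = - ((-1) ^+ (s && t) *: br y x).
Proof.
move=> xs yt; apply/eqP; rewrite -addr_eq0; apply/eqP.
apply: (klin_vanish (f := fun x => br x y + (-1) ^+ (s && t) *: br y x) _ xs) => [a x1 x2|i qi].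
  by rewrite red_linl red_linr !scalerDr !scalerA [_ * a]mulrC addrACA.
apply: (klin_vanish (f := fun y => br (dl i) y + (-1) ^+ (s && t) *: br y (dl i)) _ yt) => [a x1 x2|j qj].
  by rewrite red_linl red_linr !scalerDr !scalerA [_ * a]mulrC addrACA.
rewrite !red_dl scaler_sumr -big_split big1 //= => k _.
rewrite scalerA -scalerDl (sl_skew sl) qi qj intrN intrM intr_sign addNr; exact: scale0r.
Qed.

Lemma red_jacobi s t x y w : par s x -> par t y ->
  br x (br y w) = br (br x y) w + (-1) ^+ (s && t) *: br y (br x w).
Proof.
move=> xs yt; apply/eqP; rewrite -subr_eq0; apply/eqP.
have E2 i' (z : 'I_m -> K) : br (dl i') (\sum_l z l *: dl l) = \sum_n (\sum_l z l * (c i' l n)%:~R) *: dl n.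
  rewrite klin_sum; last by move=> a x1 x2; apply: red_linr.
  under eq_bigr => l _ do rewrite red_dl scaler_sumr.
  rewrite exchange_big /=; apply: eq_bigr => n' _; rewrite scaler_suml.
  by apply: eq_bigr => l _; rewrite scalerA.
have E1 k' (z : 'I_m -> K) : br (\sum_l z l *: dl l) (dl k') = \sum_n (\sum_l z l * (c l k' n)%:~R) *: dl n.
  rewrite (klin_sum (f := fun x => br x (dl k'))); last by move=> a x1 x2; apply: red_linl.
  under eq_bigr => l _ do rewrite red_dl scaler_sumr.
  rewrite exchange_big /=; apply: eq_bigr => n' _; rewrite scaler_suml.
  by apply: eq_bigr => l _; rewrite scalerA.
apply: (klin_vanish (f := fun x => br x (br y w) -
  (br (br x y) w + (-1) ^+ (s && t) *: br y (br x w))) _ xs) => [a x1 x2|i qi].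
  rewrite !red_linl red_linr !scalerBr !scalerDr !scalerA [_ * a]mulrC ?opprD; zmod.
apply: (klin_vanish (f := fun y => br (dl i) (br y w) -
  (br (br (dl i) y) w + (-1) ^+ (s && t) *: br y (br (dl i) w))) _ yt) => [a x1 x2|j qj].
  rewrite !(red_linl, red_linr) !scalerBr !scalerDr !scalerA [_ * a]mulrC ?opprD; zmod.
apply: (klin_vanish (f := fun w => br (dl i) (br (dl j) w) -
  (br (br (dl i) (dl j)) w + (-1) ^+ (s && t) *: br (dl j) (br (dl i) w))) (P := fun=> True)) => [a x1 x2|//|k _].
  rewrite !(red_linl, red_linr) !scalerBr !scalerDr !scalerA [_ * a]mulrC ?opprD; zmod.
rewrite !red_dl !E2 E1 scaler_sumr -big_split -sumrB big1 //= => n _.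
rewrite scalerA -scalerDl -scalerBl; apply/eqP; rewrite scaler_eq0; apply/orP; left.
have := congr1 (fun z : int => z%:~R : K) (sl_jac sl i j k n).
rewrite rmorphD rmorphM /= !rmorph_sum /= intr_sign qi qj.
under eq_bigr => l _ do rewrite intrM; move=> ->.
under eq_bigr => l _ do rewrite intrM; under [X in _ + _ * X - _]eq_bigr => l _ do rewrite intrM.
by rewrite subrr.
Qed.

Lemma red_deg_sub k : subspace (rdeg k).
Proof.
split=> [i|a x y xk yk i]; first by rewrite mxE eqxx.
rewrite !mxE => n0; case: (eqVneq ((x : 'rV[K]_m) 0 i) 0) => [x0|/xk//].
by apply: yk; apply: contraNneq n0 => ->; rewrite x0 mulr0 addr0.
Qed.

Lemma red_deg_br k l x y : rdeg k x -> rdeg l y -> rdeg (k + l) (br x y).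
Proof.
move=> xk yl n; rewrite mxE; apply: contraNeq => dn; apply/eqP; rewrite big1 // => i _.
rewrite big1 // => j _; case: (eqVneq ((x : 'rV[K]_m) 0 i) 0) => [->|/xk di]; first by rewrite mulr0 mul0r.
case: (eqVneq ((y : 'rV[K]_m) 0 j) 0) => [->|/yl dj]; first by rewrite mulr0.
case: (eqVneq (c i j n) 0) => [->|/(sl_deg sl) dE]; first by rewrite !mul0r.
by rewrite dE di dj eqxx in dn.
Qed.

Lemma red_deg_par k x : rdeg k x -> par (odd `|k|%N) x.
Proof. by move=> xk i /xk <-; rewrite (sl_par sl). Qed.

End ReductionLaws.

Section PartTwo.
Variables (K : fieldType) (m : nat) (q : 'I_m -> bool) (d : 'I_m -> int).
Variable (c : 'I_m -> 'I_m -> 'I_m -> int).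
Hypothesis sl : struct_laws q d c.
Hypothesis K3 : 3%N \in [pchar K].
Notation M := (reduction K q c).
Variables (z : M) (e : 'I_7 -> M) (X1p X2p X1m X2m Z : M).
Hypothesis hf : is_frame d z e (gram3 K).
Hypothesis hX : is_g0_tilde z e (red_deg d 0) X1p X2p X1m X2m Z.
Notation s := (g0_tilde X1p X2p X1m X2m Z).

Let three : 3%:R = 0 :> K := pcharf0 K3.

Let jac0 (x y w : M) : red_deg d 0 x -> red_deg d 0 y ->
  br (br x y) w = br x (br y w) - br y (br x w).
Proof.
move=> /(red_deg_par sl) x0 /(red_deg_par sl) y0.
by rewrite (red_jacobi sl w x0 y0) expr0 scale1r addrK.
Qed.

Let br0 (x y : M) : red_deg d 0 x -> red_deg d 0 y -> red_deg d 0 (br x y).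
Proof. by move=> x0 y0; have := red_deg_br sl x0 y0; rewrite addr0. Qed.

Let e_ind : lin_indep e := proj2 (frame_e hf).

Section FixedHeight.
Variable N : nat.
Hypothesis N0 : (1 <= N)%N.
Notation T := (dp_tAlg K (3 ^ N)).
Notation ok := (fun r => r < 3 ^ N)%N.
Notation tau := (dp_tau K (3 ^ N)).
Let tl : tlaws ok tau := dp_tlaws_pchar K3 isT N0.

Let ok_step r : ok r -> (r %% 3 != 2)%N -> ok r.+1.
Proof.
move=> /= rN r3; rewrite ltn_neqAle rN andbT; apply: contraNneq r3 => rE.
have : (3 %| r.+1)%N by rewrite rE -(prednK N0) expnS dvdn_mulr.
by lia.
Qed.

Let hcomp : h_comp (T := T) z e (gram3 K) s = hQ ok tau.
Proof. exact: (h_comp_hQ tl three (@red_linl _ _ _ _) (@red_linr _ _ _ _) jac0 br0 e_ind hX). Qed.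

Let h0E : h_0 (T := T) z e (gram3 K) s = hQ ok tau 0.
Proof. by rewrite -hcomp. Qed.

Lemma cts_hsum : cts_prolong (T := T) z e (gram3 K) s = hsum (gram3 K) (hQ ok tau).
Proof. by apply/funext => D; apply/propext; rewrite /cts_prolong hcomp; apply: (with_negative_partE _ (hQ_sub tl)). Qed.

Lemma partial_hsum : partial_prolong (T := T) z e (gram3 K) s (P1 ok tau) = hsum (gram3 K) (hP ok tau).
Proof.
apply/funext => D; apply/propext.
have mE := m_comp_hP tl three (@red_linl _ _ _ _) (@red_linr _ _ _ _) jac0 br0 e_ind hX.
by rewrite /partial_prolong mE; apply: (with_negative_partE _ (hP_sub tl)).
Qed.

Lemma degree1_splitsE m' m'' :
  degree1_splits (T := T) z e (gram3 K) s m' m'' = splits ok tau m' m''.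
Proof. by rewrite /degree1_splits hcomp h0E. Qed.

Lemma cts3_simple : is_simple (cts_prolong (T := T) z e (gram3 K) s).
Proof. by rewrite cts_hsum; apply: (hQ_simple tl three ok_step). Qed.

Lemma degree1_splits_ex : exists m' m'', degree1_splits (T := T) z e (gram3 K) s m' m''.
Proof. by do 2 eexists; rewrite degree1_splitsE; apply: (splits_mW_P1 tl three). Qed.

Lemma degree1_splits_P1 m' m'' :
  degree1_splits (T := T) z e (gram3 K) s m' m'' -> m'' = P1 ok tau.
Proof. by rewrite degree1_splitsE; apply: (splits_P1 tl three). Qed.

Lemma partial_simple : is_simple (partial_prolong (T := T) z e (gram3 K) s (P1 ok tau)).
Proof. by rewrite partial_hsum; apply: (hP_simple tl three). Qed.

End FixedHeight.

Lemma partial_iso N N' : (1 <= N)%N -> (N <= N')%N ->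
  is_iso (partial_prolong (T := dp_tAlg K (3 ^ N)) z e (gram3 K) s (P1 (fun r => r < 3 ^ N)%N (dp_tau K (3 ^ N))))
    (partial_prolong (T := dp_tAlg K (3 ^ N')) z e (gram3 K) s (P1 (fun r => r < 3 ^ N')%N (dp_tau K (3 ^ N'))))
    (@v_incl K (3 ^ N) (3 ^ N')).
Proof.
move=> N0 NN'; have N0' := leq_trans N0 NN'; rewrite !partial_hsum //.
have le := dp_incl_le K3 NN'.
apply: (vm_iso (iota := @dp_incl K 3 N N') (dp_incl_lin K3 NN') (dp_incl_mul K3 NN')
  (dp_incl_der K3 NN') _ (dp_incl_inj K3 NN') (dp_tlaws_pchar K3 isT N0) (dp_tlaws_pchar K3 isT N0') three).
- by rewrite !dp_one (dp_incl_tau K3 NN') // expn_gt0.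
- by move=> r rN; apply: leq_trans rN le.
- by move=> r rN; rewrite (dp_incl_tau K3 NN').
Qed.

Theorem part_two :
  (forall N : nat, (1 <= N)%N ->
      is_simple (cts_prolong (T := dp_tAlg K (3 ^ N)) z e (gram3 K) s)) /\
    (forall N : nat, (1 <= N)%N ->
      (exists m' m'' : vect_alg (dp_tAlg K (3 ^ N)) -> Prop,
        degree1_splits z e (gram3 K) s m' m'') /\
      (forall m' m'' : vect_alg (dp_tAlg K (3 ^ N)) -> Prop,
        degree1_splits z e (gram3 K) s m' m'' ->
        is_simple (partial_prolong z e (gram3 K) s m''))) /\
    (forall N N' : nat, (1 <= N)%N -> (N <= N')%N ->
      forall (m' m'' : vect_alg (dp_tAlg K (3 ^ N)) -> Prop)
             (n' n'' : vect_alg (dp_tAlg K (3 ^ N')) -> Prop),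
      degree1_splits z e (gram3 K) s m' m'' ->
      degree1_splits z e (gram3 K) s n' n'' ->
      is_iso (partial_prolong z e (gram3 K) s m'')
             (partial_prolong z e (gram3 K) s n'')
             (@v_incl K (3 ^ N) (3 ^ N'))).
Proof.
split; [|split].
- exact: cts3_simple.
- move=> N N0; split; first exact: degree1_splits_ex.
  by move=> m' m'' /(degree1_splits_P1 N0)->; apply: partial_simple.
move=> N N' N0 NN' m' m'' n' n'' /(degree1_splits_P1 N0)->.
move=> /(degree1_splits_P1 (leq_trans N0 NN'))->; exact: partial_iso.
Qed.

End PartTwo.

(** * Prolongs with vanishing first cohomology *)

Section Poincare.
Variables (K : fieldType) (T : tAlg K) (ok : pred nat) (tau : nat -> T).
Hypothesis tl : tlaws ok tau.
Variables (B Bi : 'M[K]_7).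
Hypothesis Bsym : B^T = B.
Hypothesis BBi : B *m Bi = 1%:M.
Hypothesis two : (2%:R : K) != 0.
Notation O := (O T).
Notation dx := (@dx K T).
Notation dt := (@dt K T).
Notation yy := (@yy K T B).
Notation ea := (@ea K T B).

Lemma dxE a (f : O) S : dx a f S =
  if a \in S then 0 else (-1) ^+ #|[set b in S | (b < a)%N]| *: f (a |: S).
Proof. by rewrite ffunE. Qed.

Lemma set_min (S : {set 'I_7}) : S != set0 -> exists2 m, m \in S & forall i, i \in S -> (m <= i)%N.
Proof.
by case/set0Pn => i iS; case: (arg_minnP (fun i : 'I_7 => i : nat) iS) => m mS mP; exists m.
Qed.

(* The Poincare lemma for the Grassmann algebra; integrating along the least
   variable avoids dividing by the degree, which may vanish in K. *)
Lemma dx_exact (g : 'I_7 -> O) : (forall a b, dx a (g b) + dx b (g a) = 0) ->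
  exists f : O, f set0 = 0 /\ forall a, dx a f = g a.
Proof.
move=> gg.
have gS a (S : {set 'I_7}) : a \in S -> g a S = 0.
  move=> aS; have /ffunP/(_ (S :\ a)) := gg a a.
  rewrite ffunE [RHS]ffunE dxE !inE eqxx /= setD1K // -scalerDr => /eqP.
  rewrite scaler_eq0 signr_eq0 /= -mulr2n -scaler_nat scaler_eq0 (negPf two) /=.
  by move/eqP.
have /choice[mn mnP] : forall S : {set 'I_7}, exists m, S != set0 -> m \in S /\ forall i, i \in S -> (m <= i)%N.
  move=> S; case: (eqVneq S set0) => [_|/set_min[m mS mP]]; first by exists ord0.
  by exists m.
exists [ffun S => if S == set0 then 0 else g (mn S) (S :\ mn S)]; split=> [|a]; first by rewrite ffunE eqxx.
apply/ffunP => S; rewrite dxE; case: ifPn => aS; first by rewrite gS.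
have n0 : a |: S != set0 by apply/set0Pn; exists a; rewrite setU11.
rewrite ffunE (negPf n0); have [] := mnP _ n0; move: (mn _) => m mS mle.
have ma : (m <= a)%N by apply: mle; rewrite setU11.
case: (eqVneq m a) mS => [mE _|mna].
  rewrite mE setU1K // (_ : [set b in S | (b < a)%N] = set0) ?cards0 ?expr0 ?scale1r //.
  apply/setP => b; rewrite !inE; case bS : (b \in S) => //=.
  by apply/negbTE; rewrite -leqNgt -mE; apply: mle; rewrite in_setU1 bS orbT.
rewrite in_setU1 (negPf mna) /= => mS.
have /ffunP/(_ (S :\ m)) := gg a m; rewrite ffunE [RHS]ffunE !dxE !inE (negPf aS) andbF eqxx /= setD1K //.
have -> : #|[set b in S :\ m | (b < m)%N]| = 0%N.
  apply/eqP; rewrite cards_eq0; apply/eqP/setP => b; rewrite !inE.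
  case bS : (b \in S); rewrite ?andbF //=; apply/negbTE; rewrite negb_and -leqNgt.
  by rewrite (mle b) ?orbT // in_setU1 bS orbT.
rewrite expr0 scale1r => /eqP; rewrite addr_eq0 => /eqP E.
have -> : (a |: S) :\ m = a |: (S :\ m).
  by apply/setP => b; rewrite !inE; case: (eqVneq b m) => [->|//]; rewrite (negPf mna).
have -> : [set b in S | (b < a)%N] = m |: [set b in S :\ m | (b < a)%N].
  apply/setP => b; rewrite !inE; case: (eqVneq b m) => [->|//]; rewrite mS /= ltn_neqAle ma andbT.
  by rewrite mna.
by rewrite cardsU1 !inE eqxx /= add1n exprS mulN1r scaleNr E opprK.
Qed.

Lemma t_primitive n (w : O) : (n <= 2)%N -> o_deg n%:Z w ->
  exists2 t : T, t_der t = w set0 & forall r, t_coef r t != 0 -> (2 * r)%N = n.+2.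
Proof.
move=> n2 wn; have wr r : t_coef r (w set0) != 0 -> (2 * r)%N = n.
  by move=> /wn; rewrite cards0 addn0 => -[].
case nodd : (odd n).
  exists 0 => [|r]; last by rewrite (tcoef0 tl) eqxx.
  rewrite (tder0 tl); apply/esym/(tcoef_ext tl) => r; apply/eqP/negPn/negP => /wr rn.
  by move: nodd; rewrite -rn oddM.
have nE : n = (2 * n./2)%N by rewrite mul2n -[LHS]odd_double_half nodd.
have okr : ok n./2.+1.
  by move: n n2 {wn wr nodd nE} => [|[|[|//]]] _; [exact: (ok1 tl)|exact: (ok1 tl)|exact: (ok2 tl)].
have [l wE] : exists l, w set0 = l *: tau n./2.
  apply: (tau_span tl) => r rn.
  by apply/eqP/negPn/negP => /wr; lia.
exists (l *: tau n./2.+1) => [|r]; first by rewrite (tderZ tl) (tder_tau tl okr) wE.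
rewrite (tcoefZ tl) mulf_eq0 negb_or => /andP[_ tr].
case: (eqVneq r n./2.+1) => [->|/(tcoef_tau tl) t0]; first by lia.
by rewrite t0 eqxx in tr.
Qed.

Lemma dx_const (v : O) : (forall a, dx a v = 0) -> v set0 = 0 -> v = 0.
Proof.
move=> dv v0; apply/ffunP => S; rewrite [RHS]ffunE; case: (eqVneq S set0) => [->//|/set0Pn[a aS]].
have /ffunP/(_ (S :\ a)) := dv a; rewrite dxE [RHS]ffunE !inE eqxx /= setD1K // => /eqP.
by rewrite scaler_eq0 signr_eq0 => /eqP.
Qed.

Lemma poincare n (F : 'I_7 -> O) (w : O) : (n <= 2)%N -> o_deg n%:Z w ->
  (forall b, o_deg n.+1%:Z (F b)) ->
  (forall a b, ea a (F b) + ea b (F a) = B a b *: w) -> (forall b, dt (F b) = ea b w) ->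
  exists f, [/\ o_deg n.+2%:Z f, dt f = w & forall b, ea b f = F b].
Proof.
move=> n2 wn Fn Fc Fd; pose g b := F b - 2%:R^-1 *: yy b w.
have eaE a f : ea a f = dx a f + 2%:R^-1 *: yy a (dt f) by [].
have dg b : dt (g b) = dx b w.
  rewrite /g (linopD (dt_lin tl)) (linopN (dt_lin tl)) (linopZ (dt_lin tl)) (dt_yy tl) Fd eaE.
  by rewrite addrK.
have gn b : o_deg n.+1%:Z (g b).
  rewrite /g -scaleNr addrC; apply: (o_deg_lin tl) => //.
  by rewrite -addn1 PoszD; apply: (o_deg_yy tl).
have gg a b : dx a (g b) + dx b (g a) = 0.
  have Bba : B b a = B a b by rewrite -{1}Bsym mxE.
  have E a' b' : dx a' (g b') = ea a' (F b') - 2%:R^-1 *: yy a' (dx b' w)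
     - (2%:R^-1 * 2%:R^-1) *: yy a' (yy b' (dt w)) - (2%:R^-1 * B a' b') *: w + 2%:R^-1 *: yy b' (dx a' w).
    rewrite /g (linopD (dx_lin tl _)) (linopN (dx_lin tl _)) (linopZ (dx_lin tl _)) (dx_yy tl Bsym).
    rewrite [ea a' _]eaE Fd [ea b' w]eaE (linopD (yy_lin tl B _)) (linopZ (yy_lin tl B _)).
    rewrite !scalerDr ?scalerN !scalerA; set x1 := dx _ _; set x2 := _ *: yy a' (dx b' w).
    set x3 := _ *: yy a' _; set x4 := _ *: w; set x5 := _ *: yy b' _. zmod.
  rewrite !E Bba (yy_yy tl B b a); have := Fc a b.
  have -> : B a b *: w = (2%:R^-1 * B a b) *: w + (2%:R^-1 * B a b) *: w.
    by rewrite -scalerDl -mulrDl (half2 two) mul1r.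
  rewrite scalerN; set X := ea a (F b); set Y := ea b (F a) => XY.
  have -> : Y = (2%:R^-1 * B a b) *: w + (2%:R^-1 * B a b) *: w - X by rewrite -XY addrC addKr.
  set x1 := _ *: w; set x2 := _ *: yy a (dx b w); set x3 := _ *: yy b (dx a w); set x4 := _ *: yy a _.
  zmod.
have [f0 [f00 f0g]] := dx_exact gg.
have [t tw tn] := t_primitive n2 wn.
pose u : O := [ffun S : {set 'I_7} => if S == set0 then t else 0].
have du a : dx a u = 0.
  apply/ffunP => S; rewrite dxE [RHS]ffunE; case: ifP => // _; rewrite ffunE.
  case: eqP => [/setP/(_ a)|]; last by rewrite scaler0.
  by rewrite !inE eqxx.
have dxf a : dx a (f0 + u) = g a by rewrite (linopD (dx_lin tl _)) du addr0 f0g.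
have dtf : dt (f0 + u) = w.
  apply/eqP; rewrite -subr_eq0; apply/eqP; apply: dx_const.
    move=> a; rewrite (linopD (dx_lin tl _)) (linopN (dx_lin tl _)) -(dt_dx tl) dxf dg.
    by rewrite subrr.
  rewrite ffunE [(- w) set0]ffunE /Submission.dt ffunE ffunE [u set0]ffunE eqxx f00 add0r tw.
  by rewrite subrr.
exists (f0 + u); split=> // [S r|b]; last by rewrite eaE dxf dtf /g subrK.
case: (eqVneq S set0) => [->|S0]; first by rewrite ffunE f00 add0r ffunE eqxx cards0 addn0 => /tn->.
have /set0Pn[a aS] := S0.
have -> : (f0 + u) S = (-1) ^+ #|[set b in S :\ a | (b < a)%N]| *: g a (S :\ a).
  rewrite -dxf dxE !inE eqxx /= setD1K // scalerA -expr2 sqrr_sign; exact/esym/scale1r.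
rewrite (tcoefZ tl) mulf_eq0 signr_eq0 /= => /gn; rewrite [#|S|](cardsD1 a) aS; lia.
Qed.

End Poincare.

Section GradedPotential.
Variables (K : fieldType) (T : tAlg K) (ok : pred nat) (tau : nat -> T).
Hypothesis tl : tlaws ok tau.
Variables (B Bi : 'M[K]_7).
Hypothesis Bsym : B^T = B.
Hypothesis BBi : B *m Bi = 1%:M.
Hypothesis two : (2%:R : K) != 0.
Notation O := (O T).
Notation V := (vect_alg T).
Notation dt := (@dt K T).
Notation yy := (@yy K T B).
Notation ea := (@ea K T B).
Notation KF := (@KF K T B Bi).
Notation ve := (v_e T B : _ -> V).
Let VL := vect_lie tl.

Variables (g : superAlg K) (gd : int -> g -> Prop) (z : g) (e : 'I_7 -> g).
Hypothesis gd_sub : forall k, subspace (gd k).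
Hypothesis g_linl : forall (c : K) (x y w : g), br (c *: x + y) w = c *: br x w + br y w.
Hypothesis g_linr : forall (c : K) (x y w : g), br w (c *: x + y) = c *: br w x + br w y.
Hypothesis gd_br : forall k l x y, gd k x -> gd l y -> gd (k + l) (br x y).
Hypothesis gd_par : forall k x, gd k x -> par (odd `|k|%N) x.
Hypothesis g_skew : forall s t (x y : g), par s x -> par t y -> br x y = - ((-1) ^+ (s && t) *: br y x).
Hypothesis g_jac : forall s t (x y w : g), par s x -> par t y ->
  br x (br y w) = br (br x y) w + (-1) ^+ (s && t) *: br y (br x w).
Hypothesis gz : forall x, gd (-2) x <-> span_of (fun _ : 'I_1 => z) x.
Hypothesis z_ind : lin_indep (fun _ : 'I_1 => z).
Hypothesis ge : forall x, gd (-1) x <-> span_of e x.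
Hypothesis e_ind : lin_indep e.
Hypothesis gB : forall a b, br (e a) (e b) = B a b *: z.
Hypothesis g_high : forall (k : nat) x, (3 <= k)%N -> gd k%:Z x -> x = 0.
Hypothesis g_low : forall k x, k <= -3 -> gd k x -> x = 0.

Lemma gbr0 w : br w (0 : g) = 0.
Proof.
have := g_linr 1 0 0 w; rewrite !scale1r addr0 => /(congr1 (fun x => x - br w (0 : g))).
by rewrite subrr addrK => <-.
Qed.

Lemma gbr0l w : br (0 : g) w = 0.
Proof.
have := g_linl 1 0 0 w; rewrite !scale1r addr0 => /(congr1 (fun x => x - br (0 : g) w)).
by rewrite subrr addrK => <-.
Qed.

Lemma gbrZ (c : K) (x w : g) : br w (c *: x) = c *: br w x.
Proof. by rewrite -[c *: x]addr0 g_linr gbr0 addr0. Qed.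

Lemma gbrZl (c : K) (x w : g) : br (c *: x) w = c *: br x w.
Proof. by rewrite -[c *: x]addr0 g_linl gbr0l addr0. Qed.

Lemma gbrD (x y w : g) : br w (x + y) = br w x + br w y.
Proof. by rewrite -[x]scale1r g_linr !scale1r. Qed.

Lemma gbrDl (x y w : g) : br (x + y) w = br x w + br y w.
Proof. by rewrite -[x]scale1r g_linl !scale1r. Qed.

Lemma gbr_sum (I : Type) (r : seq I) (P : pred I) (F : I -> g) w :
  br w (\sum_(i <- r | P i) F i) = \sum_(i <- r | P i) br w (F i).
Proof. by apply: (big_morph (br w)) => [x y|]; rewrite ?gbr0 ?gbrD. Qed.

Lemma gbr_suml (I : Type) (r : seq I) (P : pred I) (F : I -> g) w :
  br (\sum_(i <- r | P i) F i) w = \sum_(i <- r | P i) br (F i) w.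
Proof. by apply: (big_morph (fun x => br x w)) => [x y|]; rewrite ?gbr0l ?gbrDl. Qed.

Lemma gd_e a : gd (-1) (e a). Proof. exact/ge/span_of_mem. Qed.
Lemma gd_z : gd (-2) z. Proof. exact/gz/(span_of_mem (fun _ : 'I_1 => z) ord0). Qed.

Lemma e_jac a b w : br (e a) (br (e b) w) + br (e b) (br (e a) w) = B a b *: br z w.
Proof.
rewrite (g_jac w (gd_par (gd_e a)) (gd_par (gd_e b))) gB expr1 scaleN1r gbrZl.
by rewrite subrK.
Qed.

Lemma br_e_z a : br (e a) z = 0.
Proof. by apply: (@g_low (-3)) => //; apply: (gd_br (gd_e a) gd_z). Qed.

Lemma ez_comm a w : br (e a) (br z w) = br z (br (e a) w).
Proof.
rewrite (g_jac w (gd_par (gd_e a)) (gd_par gd_z)) andbF expr0 scale1r br_e_z gbr0l.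
exact: add0r.
Qed.

Lemma gd_step n x b : gd (n.+1%:Z - 2) x -> gd (n%:Z - 2) (br (e b) x).
Proof. move=> /(gd_br (gd_e b)); by have -> : -1 + (n.+1%:Z - 2) = n%:Z - 2 by lia. Qed.

Lemma gd_step2 n x : gd (n.+2%:Z - 2) x -> gd (n%:Z - 2) (br z x).
Proof. move=> /(gd_br gd_z); by have -> : -2 + (n.+2%:Z - 2) = n%:Z - 2 by lia. Qed.

(* [Rf n x f]: the contact field with potential f represents the element x of
   degree n - 2. *)
Fixpoint Rf n (x : g) (f : O) : Prop :=
  match n with
  | 0 => exists l, x = l *: z /\ f = l *: o_one T
  | 1 => exists c : 'I_7 -> K, x = \sum_a c a *: e a /\ f = \sum_a c a *: yy a (o_one T)
  | n'.+1 => [/\ gd (n%:Z - 2) x, o_deg n%:Z f & forall b, Rf n' (br (e b) x) (ea b f)]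
  end.

Lemma RfSS n x f : Rf n.+2 x f =
  [/\ gd (n.+2%:Z - 2) x, o_deg n.+2%:Z f & forall b, Rf n.+1 (br (e b) x) (ea b f)].
Proof. by []. Qed.

Lemma Rf_gd n x f : Rf n x f -> gd (n%:Z - 2) x.
Proof.
case: n => [|[|n]] /=; last by case.
- by case=> l [-> _]; apply: (subspaceZ (gd_sub _)); apply: gd_z.
- by case=> c [-> _]; apply/ge; exists c.
Qed.

Lemma Rf_deg n x f : Rf n x f -> o_deg n%:Z f.
Proof.
case: n => [|[|n]] /=; last by case.
- by case=> l [_ ->]; apply: (o_degZ tl); apply: (o_deg_one tl).
- case=> c [_ ->]; apply: (o_deg_sum tl) => a _; apply: (o_degZ tl).
  by rewrite -[1%:Z]add0r; apply: (o_deg_yy tl); apply: (o_deg_one tl).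
Qed.

Lemma Rf_lin n (c : K) x y f h : Rf n x f -> Rf n y h -> Rf n (c *: x + y) (c *: f + h).
Proof.
elim: n x y f h => [|[|n] IH] x y f h.
- by case=> l [-> ->] [l' [-> ->]]; exists (c * l + l'); rewrite !scalerA -!scalerDl.
- case=> l [-> ->] [l' [-> ->]]; exists (fun a => c * l a + l' a).
  by rewrite !scaler_sumr -!big_split /=; split; apply: eq_bigr => a _; rewrite scalerA -scalerDl.
rewrite !RfSS; case=> x1 f1 xf [y1 h1 yh]; split=> [||b]; last by rewrite g_linr (ea_lin tl); apply: IH.
  by case: (gd_sub (n.+2%:Z - 2)) => _; apply.
exact: (o_deg_lin tl).
Qed.

Lemma Rf0 n : Rf n 0 0.
Proof.
elim: n => [|[|n] IH] /=.
- by exists 0; rewrite !scale0r.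
- by exists (fun=> 0); split; rewrite big1 // => a _; rewrite scale0r.
split=> [||b]; [by case: (gd_sub (n.+2%:Z - 2))|exact: (o_deg0 tl)|].
by rewrite gbr0 (linop0 (ea_lin tl B b)).
Qed.

Lemma RfZ n (c : K) x f : Rf n x f -> Rf n (c *: x) (c *: f).
Proof. by move=> /(Rf_lin c) /(_ (Rf0 n)); rewrite !addr0. Qed.

Lemma RfD n x y f h : Rf n x f -> Rf n y h -> Rf n (x + y) (f + h).
Proof. by move=> xf yh; have := Rf_lin 1 xf yh; rewrite !scale1r. Qed.

Lemma RfB n x y f h : Rf n x f -> Rf n y h -> Rf n (x - y) (f - h).
Proof.
by move=> xf yh; have := Rf_lin (-1) yh xf; rewrite !scaleN1r ![- _ + _]addrC.
Qed.

Lemma Rf_uniq0 n f : Rf n 0 f -> f = 0.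
Proof.
elim: n f => [|[|n] IH] f /=.
- case=> l [z0 ->]; have := z_ind (a := fun=> l); rewrite big_ord1 => /(_ (esym z0) ord0) ->.
  exact: scale0r.
- by case=> c [e0 ->]; rewrite big1 // => a _; rewrite (e_ind (esym e0)) scale0r.
case=> _ fd fb; have f0 b : ea b f = 0 by apply: IH; have := fb b; rewrite gbr0.
have [l fl] := ea_const tl Bsym BBi two f0; rewrite fl.
by apply: (o_deg_const tl (k := n.+2%:Z)) => //; rewrite -fl.
Qed.

Lemma Rf_uniq n x f h : Rf n x f -> Rf n x h -> f = h.
Proof.
by move=> xf xh; apply/eqP; rewrite -subr_eq0; apply/eqP/(@Rf_uniq0 n); rewrite -(subrr x); apply: RfB.
Qed.

Lemma Rf_e n x f b : Rf n.+1 x f -> Rf n (br (e b) x) (ea b f).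
Proof.
case: n => [|n]; last by rewrite RfSS; case.
case=> c [-> ->]; exists (\sum_a c a * B b a).
rewrite gbr_sum (linop_sum _ _ _ (ea_lin tl B b)) !scaler_suml; split; apply: eq_bigr => a _.
  by rewrite gbrZ gB scalerA.
by rewrite (linopZ (ea_lin tl B b)) (ea_yy_one tl Bsym) scalerA.
Qed.

Lemma Rf_z n x f : Rf n.+2 x f -> Rf n (br z x) (dt f).
Proof.
move=> xf; have [a [b ab]] := B_neq0 BBi.
have := RfD (Rf_e a (Rf_e b xf)) (Rf_e b (Rf_e a xf)).
rewrite e_jac (ea_ea tl two Bsym) => /(RfZ (B a b)^-1).
by rewrite !scalerA mulVf // !scale1r.
Qed.

Lemma Rf_ex n x : gd (n%:Z - 2) x -> exists f, Rf n x f.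
Proof.
have [N] := ubnP n; elim: N n x => // N IH [|[|n]] x nN xn.
- have [c ->] : span_of (fun _ : 'I_1 => z) x by apply/gz.
  by rewrite big_ord1; exists (c ord0 *: o_one T), (c ord0).
- have [c ->] : span_of e x by apply/ge.
  by exists (\sum_a c a *: yy a (o_one T)), c.
case: (leqP n 2) => n2; last first.
  have -> : x = 0 by apply: (g_high n2); rewrite (_ : n%:Z = n.+2%:Z - 2) //; lia.
  by exists 0; apply: Rf0.
have /choice[F FP] : forall b, exists f, Rf n.+1 (br (e b) x) f.
  by move=> b; apply: IH; [lia|apply: gd_step].
have [w wP] : exists f, Rf n (br z x) f by apply: IH; [lia|apply: gd_step2].
have FF a b : ea a (F b) + ea b (F a) = B a b *: w.
  apply: (@Rf_uniq n (B a b *: br z x)); last exact: RfZ.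
  by rewrite -e_jac; apply: RfD; apply: Rf_e.
have Fd b : dt (F b) = ea b w.
  move: FP wP {IH nN n2 FF xn}; case: n => [|n] FP wP.
    have [l [_ ->]] := wP; rewrite (linopZ (ea_lin tl B b)) (ea_one tl) scaler0.
    have [c [_ ->]] := FP b; rewrite (linop_sum _ _ _ (dt_lin tl)) big1 // => a _.
    by rewrite (linopZ (dt_lin tl)) (dt_yy tl) (dt_one tl) (linop0 (yy_lin tl B _)) scaler0.
  by apply: (@Rf_uniq n (br (e b) (br z x))); [rewrite ez_comm; apply: Rf_z|apply: Rf_e].
have [f [fn _ fb]] := poincare tl Bsym two n2 (Rf_deg wP) (fun b => Rf_deg (FP b)) FF Fd.
by exists f; split=> // b; rewrite fb.
Qed.

Lemma par_KF_Rf n x f : Rf n x f -> par (odd n) (KF f : V).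
Proof. by move=> /Rf_deg fd; apply/v_parP/(v_par_KF tl)/(o_deg_par tl fd). Qed.

Lemma v_deg_Rf n x f : Rf n x f -> v_deg (n%:Z - 2) (KF f : V).
Proof. by move=> /Rf_deg fd; apply: (v_deg_KF tl). Qed.

Lemma par_Rf n x f : Rf n x f -> par (odd n) x.
Proof.
move=> /Rf_gd/gd_par; have -> // : odd `|(n%:Z - 2)%R|%N = odd n.
case: n => [|[|n]] //; have -> : n.+2%:Z - 2 = n%:Z by lia.
by rewrite /= negbK.
Qed.

Lemma br_ve_KF a f : br (ve a) (KF f) = KF (ea a f).
Proof. exact: (v_br_e_KF tl Bsym BBi). Qed.

Lemma br_dt_KFg f : br (v_dt T : V) (KF f) = KF (dt f).
Proof.
have [a [b ab]] := B_neq0 BBi.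
have := lie_jacobi VL (w := KF f) I I I (@par_e K T B a) (@par_e K T B b).
rewrite (br_e_e tl Bsym BBi two) (lbrZ VL) !br_ve_KF expr1 scaleN1r => /eqP.
rewrite eq_sym subr_eq -(KFD tl) (ea_ea tl two Bsym) (KFZ tl) => /eqP.
by move=> /(congr1 (fun x => (B a b)^-1 *: x)); rewrite !scalerA mulVf // !scale1r.
Qed.

Lemma Rf_br_low n m x f y h : (n <= 1)%N -> (2 <= n + m)%N -> Rf n x f -> Rf m y h ->
  exists2 k, Rf (n + m - 2) (br x y) k & br (KF f) (KF h) = KF k.
Proof.
case: n => [|[|//]] _ nm xf yh.
- case: m nm yh => [|[|m]] // _ yh; have [l [-> ->]] := xf.
  exists (l *: dt h); first by rewrite add0n subn2 gbrZl; apply: RfZ; apply: Rf_z.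
  by rewrite !(KFZ tl) (KF_one tl) (lbrZ VL) br_dt_KFg.
case: m nm yh => [|m] // _ yh; have [c [-> ->]] := xf.
exists (\sum_a c a *: ea a h).
  rewrite add1n subn2 /= gbr_suml; apply: (big_ind2 (Rf m)); first exact: Rf0.
    by move=> *; apply: RfD.
  by move=> a _; rewrite gbrZl; apply: RfZ; apply: Rf_e.
rewrite !(KF_sum tl) (lbr_sum VL); apply: eq_bigr => a _.
by rewrite !(KFZ tl) (KF_yy_one tl Bsym BBi two) (lbrZ VL) br_ve_KF.
Qed.

Lemma Rf_br n m x f y h : (2 <= n + m)%N -> Rf n x f -> Rf m y h ->
  exists2 k, Rf (n + m - 2) (br x y) k & br (KF f) (KF h) = KF k.
Proof.
have [N] := ubnP (n + m); elim: N n m x f y h => // N IH n m x f y h nN nm xf yh.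
case: (leqP n 1) => n1; first exact: Rf_br_low.
case: (leqP m 1) => m1.
  have [|k kR kE] := Rf_br_low m1 _ yh xf; first by rewrite addnC.
  exists (- ((-1) ^+ (odd n && odd m) *: k)).
    rewrite (g_skew (par_Rf xf) (par_Rf yh)) -!scaleN1r addnC; exact/RfZ/RfZ.
  rewrite (lie_skew VL I I (par_KF_Rf xf) (par_KF_Rf yh)) kE.
  by rewrite -[in RHS]scaleN1r !(KFZ tl) scaleN1r.
have [k kR] : exists k, Rf (n + m - 2) (br x y) k.
  apply: Rf_ex; have := gd_br (Rf_gd xf) (Rf_gd yh).
  by have -> : n%:Z - 2 + (m%:Z - 2) = (n + m - 2)%N%:Z - 2 by lia.
exists k => //; apply/eqP; rewrite -subr_eq0; apply/eqP.
have dd : v_deg ((n + m - 2)%N%:Z - 2) (br (KF f) (KF h) - KF k).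
  have -> : br (KF f) (KF h) - KF k = -1 *: KF k + br (KF f) (KF h) by rewrite scaleN1r addrC.
  apply: (v_deg_lin tl); first exact: v_deg_Rf kR.
  have -> : (n + m - 2)%N%:Z - 2 = n%:Z - 2 + (m%:Z - 2) by lia.
  by apply: (v_deg_br tl); [apply: v_deg_Rf xf|apply: v_deg_Rf yh].
apply: (v_inj tl Bsym BBi two dd) => [|b]; first by lia.
have E (D D' : V) : br (ve b) (D - D') = br (ve b) D - br (ve b) D'.
  by rewrite addrC -scaleN1r (lie_linr VL) // scaleN1r addrC.
rewrite -[v_br _ _]/(br (ve b) _) E br_ve_KF.
rewrite (lie_jacobi VL I I I (@par_e K T B b) (par_KF_Rf xf)) !br_ve_KF.
case: n m xf yh {dd} nN nm n1 m1 kR => [//|n] [//|m] xf yh nN nm n1 m1 kR.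
have [||k1 k1R k1E] := IH n m.+1 _ _ _ _ _ _ (Rf_e b xf) yh; [lia|lia|].
have [||k2 k2R k2E] := IH n.+1 m _ _ _ _ _ _ xf (Rf_e b yh); [lia|lia|].
have kb : Rf (n + m.+1 - 2) (br (e b) (br x y)) (ea b k).
  by apply: Rf_e; rewrite (_ : (n + m.+1 - 2).+1 = (n.+1 + m.+1 - 2)%N) //; lia.
have k12 : ea b k = k1 + (-1) ^+ odd n.+1 *: k2.
  apply: (Rf_uniq kb); rewrite (g_jac _ (gd_par (gd_e b)) (par_Rf xf)).
  apply: RfD => //; apply: RfZ; move: k2R; by have -> : (n.+1 + m - 2 = n + m.+1 - 2)%N by lia.
by rewrite k1E k2E k12 (KFD tl) (KFZ tl) subrr.
Qed.
Hypothesis F1 : forall (k : nat) x, gd k%:Z x -> (forall b, br (e b) x = 0) -> x = 0.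
Hypothesis F2 : forall (k : nat) (y : 'I_7 -> g) w, (0 < k <= 3)%N ->
  (forall b, gd (k%:Z - 1) (y b)) -> gd (k%:Z - 2) w ->
  (forall a b, br (e a) (y b) + br (e b) (y a) = B a b *: w) ->
  (forall a, br (e a) w = br z (y a)) -> exists2 x, gd k%:Z x & forall b, y b = br (e b) x.
Variable comp : nat -> g -> g.
Hypothesis comp_lin : forall n (c : K) x y, comp n (c *: x + y) = c *: comp n x + comp n y.
Hypothesis comp_gd : forall n x, gd (n%:Z - 2) (comp n x).
Hypothesis comp_sum : forall x, x = \sum_(n < 5) comp n x.
Hypothesis comp_id : forall n n' x, gd (n%:Z - 2) x -> comp n' x = if n' == n then x else 0.
Hypothesis comp_par : forall s n x, par s x -> par s (comp n x).
Hypothesis g_disj : forall x : g, par false x -> par true x -> x = 0.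
Hypothesis g_split : forall x : g, exists x0 x1, [/\ par false x0, par true x1 & x = x0 + x1].

Lemma o_one_neq0 : o_one T <> 0.
Proof.
move=> /ffunP/(_ set0); rewrite !ffunE eqxx -(tau0 tl) => /(congr1 (t_coef 0)).
by rewrite (tcoef0 tl) => /eqP; rewrite (negPf (tcoef_tau_neq0 tl (ok0 tl))).
Qed.

Lemma Rf_inj0 n x : Rf n x 0 -> x = 0.
Proof.
elim: n x => [|[|n] IH] x.
- case=> l [-> /esym/eqP]; rewrite scaler_eq0 => /orP[/eqP->|/eqP/o_one_neq0 //].
  exact: scale0r.
- case=> c [-> c0]; rewrite big1 // => a _; suff -> : c a = 0 by rewrite scale0r.
  have cB b : \sum_a B b a * c a = 0.
    have := congr1 (ea b) c0; rewrite (linop0 (ea_lin tl B b)) (linop_sum _ _ _ (ea_lin tl B b)).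
    under eq_bigr => i _ do rewrite (linopZ (ea_lin tl B b)) (ea_yy_one tl Bsym) scalerA mulrC.
    rewrite -scaler_suml => /esym/eqP; rewrite scaler_eq0 => /orP[/eqP//|/eqP/o_one_neq0 //].
  have Bc : B *m (\col_i c i) = 0.
    by apply/matrixP => b j; rewrite !mxE -[RHS](cB b); apply: eq_bigr => i _; rewrite mxE.
  have /matrixP/(_ a ord0) := congr1 (mulmx Bi) Bc.
  by rewrite mulmxA (mulmx1C BBi) mul1mx mulmx0 !mxE.
rewrite RfSS; case=> xn _ xe; apply: (F1 (k := n)) => [|b].
  by have -> : n%:Z = n.+2%:Z - 2 by lia.
by apply: IH; have := xe b; rewrite (linop0 (ea_lin tl B b)).
Qed.

Lemma Rf_inj n x y f : Rf n x f -> Rf n y f -> x = y.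
Proof.
move=> xf yf; apply/eqP; rewrite -subr_eq0; apply/eqP/(@Rf_inj0 n).
by rewrite -(subrr f); apply: RfB.
Qed.

Definition pot n (x : g) : O :=
  if pselect (exists f, Rf n x f) is left H then proj1_sig (cid H) else 0.

Lemma potP n x : gd (n%:Z - 2) x -> Rf n x (pot n x).
Proof.
move=> xn; rewrite /pot; case: pselect => [H|[]]; last exact: Rf_ex.
by case: (cid H).
Qed.

Definition Phi (x : g) : V := \sum_(n < 5) KF (pot n (comp n x)).

Lemma comp0 n : comp n 0 = 0.
Proof. by rewrite (comp_id (n := 2)) ?if_same //; case: (gd_sub 0). Qed.

Lemma pot0 n : pot n 0 = 0.
Proof. by apply: (@Rf_uniq0 n); apply: potP; case: (gd_sub (n%:Z - 2)). Qed.

Lemma Phi_Rf n x f : Rf n x f -> Phi x = KF f.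
Proof.
move=> xf; have xn := Rf_gd xf; case: (ltnP n 5) => n5; last first.
  have x0 : x = 0 by apply: (g_high (k := n - 2)); [lia|have -> : (n - 2)%N%:Z = n%:Z - 2 by lia].
  move: xf; rewrite x0 => /Rf_uniq0 ->; rewrite /Phi big1 ?(KF0 tl) // => i _.
  by rewrite comp0 pot0 (KF0 tl).
rewrite /Phi (bigD1 (Ordinal n5)) //= (comp_id _ xn) eqxx (Rf_uniq (potP xn) xf).
rewrite big1 ?addr0 // => i; rewrite -val_eqE /= => /negPf ni.
by rewrite (comp_id _ xn) ni pot0 (KF0 tl).
Qed.

Lemma Phi_lin (c : K) x y : Phi (c *: x + y) = c *: Phi x + Phi y.
Proof.
rewrite /Phi scaler_sumr -big_split /=; apply: eq_bigr => n _.
rewrite -(KF_lin tl); congr KF; rewrite comp_lin.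
have h v := potP (comp_gd n v).
apply: (@Rf_uniq n (c *: comp n x + comp n y)); last exact: Rf_lin.
by rewrite -comp_lin.
Qed.

Lemma Phi0 : Phi 0 = 0. Proof. by rewrite (Phi_Rf (Rf0 0)) (KF0 tl). Qed.

Lemma PhiD x y : Phi (x + y) = Phi x + Phi y.
Proof. by rewrite -{1}[x]scale1r Phi_lin scale1r. Qed.

Lemma Phi_sum (I : Type) (r : seq I) (P : pred I) (F : I -> g) :
  Phi (\sum_(i <- r | P i) F i) = \sum_(i <- r | P i) Phi (F i).
Proof. by apply: (big_morph Phi PhiD Phi0). Qed.

Lemma v_deg_indep N (D : nat -> V) : (forall n, v_deg (n%:Z - 2) (D n)) ->
  \sum_(n < N) D n = 0 -> forall n, (n < N)%N -> D n = 0.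
Proof.
move=> Dd D0 n nN; apply/ffunP => i; apply/ffunP => S; rewrite [(0 : vect T) i]ffunE [RHS]ffunE.
apply: (tcoef_ext tl) => r; apply/eqP/negPn/negP => nz.
have /ffunP/(_ i)/ffunP/(_ S) := D0; rewrite sum_ffunE sum_ffunE [(0 : vect T) i]ffunE [RHS]ffunE.
move/(congr1 (t_coef r)); rewrite (tcoef_sum tl) (tcoef0 tl) (bigD1 (Ordinal nN)) //= big1 ?addr0.
  by move/eqP; rewrite (negPf nz).
move=> n'; rewrite -val_eqE /= => /eqP n'n; apply/eqP/negPn/negP => /(Dd n') E.
by have := Dd n _ _ _ nz; rewrite E; lia.
Qed.

Lemma Phi_inj0 x : Phi x = 0 -> x = 0.
Proof.
move=> x0; rewrite [x]comp_sum big1 // => n _; apply: (@Rf_inj0 n).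
have := v_deg_indep (D := fun n => KF (pot n (comp n x))) _ x0 (ltn_ord n).
rewrite -{1}(KF0 tl B Bi) => h; have /(KF_inj tl Bsym BBi) <- := h (fun n => v_deg_Rf (potP (comp_gd n x))).
exact: potP.
Qed.

Lemma Phi_inj : injective Phi.
Proof.
move=> x y xy; apply/eqP; rewrite -subr_eq0; apply/eqP/Phi_inj0.
by rewrite addrC -scaleN1r Phi_lin xy scaleN1r addNr.
Qed.

Lemma Phi_par s x : par s x -> par s (Phi x).
Proof.
move=> xs; apply: (lpar_sum VL) => n _; have cs := comp_par n xs.
have pn := potP (comp_gd n x); case: (eqVneq (odd n) s) => [<-|ns]; first exact: par_KF_Rf pn.
have c0 : comp n x = 0.
  have := par_Rf pn; move: ns cs; case: s {xs}; case: (odd n) => // _ c1 c2; exact: g_disj.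
by rewrite c0 pot0 (KF0 tl); case: (lie_par VL s).
Qed.

Lemma br_low_levels n m x f y h : (n + m <= 1)%N -> Rf n x f -> Rf m y h ->
  br x y = 0 /\ br (KF f) (KF h) = 0.
Proof.
move=> nm xf yh; split.
  by apply: (g_low _ (gd_br (Rf_gd xf) (Rf_gd yh))); lia.
have low y' h' m' : (m' <= 1)%N -> Rf m' y' h' -> dt h' = 0.
  case: m' => [|[|//]] _.
    by case=> l [_ ->]; rewrite (linopZ (dt_lin tl)) (dt_one tl) scaler0.
  case=> c [_ ->]; rewrite (linop_sum _ _ _ (dt_lin tl)) big1 // => a _.
  by rewrite (linopZ (dt_lin tl)) (dt_yy tl) (dt_one tl) (linop0 (yy_lin tl B _)) scaler0.
have zero x' f' y' h' m' : (m' <= 1)%N -> Rf 0 x' f' -> Rf m' y' h' -> br (KF f') (KF h') = 0.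
  move=> m1 [l [_ ->]] y'h'.
  by rewrite (KFZ tl) (KF_one tl) (lbrZ VL) br_dt_KFg (low _ _ _ m1 y'h') (KF0 tl) scaler0.
case: n nm xf => [|[|//]] nm xf; first exact: zero xf yh.
have m0 : m = 0%N by lia.
rewrite m0 in yh; rewrite (lie_skew VL I I (par_KF_Rf xf) (par_KF_Rf yh)).
by rewrite (zero _ _ _ _ 1%N isT yh xf) scaler0 oppr0.
Qed.

Lemma Phi_br x y : Phi (br x y) = br (Phi x) (Phi y).
Proof.
rewrite [in LHS](comp_sum x) [in LHS](comp_sum y) gbr_suml Phi_sum (lbr_sum VL).
apply: eq_bigr => n _; rewrite gbr_sum Phi_sum (lbr_sumr VL); apply: eq_bigr => m _.
have xn := potP (comp_gd n x); have ym := potP (comp_gd m y).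
case: (leqP 2 (n + m)) => nm.
  by have [k kR ->] := Rf_br nm xn ym; apply: Phi_Rf kR.
by have [-> ->] := br_low_levels nm xn ym; apply: Phi0.
Qed.

Notation h := (h_comp (T := T) z e B (gd 0)).

Lemma h_0_Rf (D : V) : h_0 (T := T) z e B (gd 0) D <-> exists x f, Rf 2 x f /\ D = KF f.
Proof.
split=> [[Dd [x [l [M [x0 xz xe Dz De]]]]]|[x [f [xf ->]]]].
  have [f xf] := Rf_ex (n := 2) x0; exists x, f; split=> //.
  apply/eqP; rewrite -subr_eq0; apply/eqP.
  have dd : v_deg 0 (D - KF f).
    have -> : D - KF f = -1 *: KF f + D by rewrite scaleN1r addrC.
    by apply: (v_deg_lin tl) => //; apply: (v_deg_Rf xf).
  apply: (v_inj tl Bsym BBi two dd) => // b.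
  have E (X Y : V) : br (ve b) (X - Y) = br (ve b) X - br (ve b) Y.
    by rewrite addrC -scaleN1r (lie_linr VL) // scaleN1r addrC.
  rewrite -[v_br _ _]/(br (ve b) _) E br_ve_KF.
  have fb : ea b f = \sum_a - M a b *: yy a (o_one T).
    apply: (Rf_uniq (Rf_e b xf)); exists (fun a => - M a b); split=> //.
    have := g_skew (par_Rf xf) (gd_par (gd_e b)); rewrite expr0 scale1r xe => /(congr1 -%R).
    by rewrite opprK => <-; rewrite -sumrN; apply: eq_bigr => a _; rewrite scaleNr.
  have := br_e_skew tl B b Dd; rewrite expr0 scale1r -[br D _]/(v_br D _) De => /(congr1 -%R).
  rewrite opprK => <-; rewrite fb (KF_sum tl) -sumrN -sumrB big1 // => a _.
  by rewrite (KFZ tl) (KF_yy_one tl Bsym BBi two) scaleNr subrr.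
have x0 := Rf_gd xf; split; first exact: (v_deg_Rf xf).
have [l0 xz] : span_of (fun _ : 'I_1 => z) (br x z) by apply/gz; have := gd_br x0 gd_z.
have /choice[C xe] : forall a, exists c : 'I_7 -> K, br x (e a) = \sum_b c b *: e b.
  by move=> a; have [c ->] : span_of e (br x (e a)); [apply/ge; have := gd_br x0 (gd_e a)|exists c].
rewrite big_ord1 in xz; exists x, (l0 ord0), (\matrix_(b, a) C a b); split=> //.
- by move=> a; rewrite xe; apply: eq_bigr => b _; rewrite mxE.
- have fz : dt f = - l0 ord0 *: o_one T.
    apply: (Rf_uniq (Rf_z xf)); exists (- l0 ord0); split=> //.
    have := g_skew (par_Rf xf) (gd_par gd_z); rewrite expr0 scale1r xz => /(congr1 -%R).
    by rewrite opprK scaleNr.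
  have := lie_skew VL I I (par_KF_Rf xf) (@par_dt K T); rewrite expr0 scale1r br_dt_KFg fz.
  by rewrite (KFZ tl) (KF_one tl) scaleNr opprK.
move=> a; have fb : ea a f = \sum_b - C a b *: yy b (o_one T).
  apply: (Rf_uniq (Rf_e a xf)); exists (fun b => - C a b); split=> //.
  have := g_skew (par_Rf xf) (gd_par (gd_e a)); rewrite expr0 scale1r xe => /(congr1 -%R).
  by rewrite opprK => <-; rewrite -sumrN; apply: eq_bigr => b _; rewrite scaleNr.
have := br_e_skew tl B a (v_deg_Rf xf); rewrite expr0 scale1r br_ve_KF fb (KF_sum tl) -sumrN.
move=> E; rewrite -[v_br _ _]/(br (KF f) (ve a)) E; apply: eq_bigr => b _.
by rewrite mxE (KFZ tl) (KF_yy_one tl Bsym BBi two) scaleNr opprK.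
Qed.

Lemma dt_ee_comm a f : ea a (dt f) = dt (ea a f).
Proof. by rewrite /Submission.ea (dt_ee tl). Qed.

Lemma hh_Rf n (D : V) : hh B h n D <-> exists x f, Rf n x f /\ D = KF f.
Proof.
case: n => [|[|n]].
- split=> [[c ->]|[x [f [[l [_ ->]] ->]]]].
    rewrite big_ord1; exists (c ord0 *: z), (c ord0 *: o_one T); split; first by exists (c ord0).
    by rewrite (KFZ tl) (KF_one tl).
  by exists (fun=> l); rewrite big_ord1 (KFZ tl) (KF_one tl).
- have E c : KF (\sum_a c a *: yy a (o_one T)) = \sum_a c a *: ve a.
    rewrite (KF_sum tl); apply: eq_bigr => a _.
    by rewrite (KFZ tl) (KF_yy_one tl Bsym BBi two).
  split=> [[c ->]|[x [f [[c [_ ->]] ->]]]]; last by exists c; rewrite E.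
  by exists (\sum_a c a *: e a), (\sum_a c a *: yy a (o_one T)); rewrite E; split=> //; exists c.
rewrite -[hh B h n.+2 D]/(h n D); elim: n D => [|k IH] D; first exact: h_0_Rf.
split=> [[Dd hD]|[x [f [xf ->]]]]; last first.
  have fd := v_deg_Rf xf; have fd' : v_deg k.+1%:Z (KF f) by have -> : k.+1%:Z = k.+3%:Z - 2 by lia.
  split=> // _ [c ->]; apply/IH.
  pose s : K := - (-1) ^+ odd `|k.+1%:Z|%N.
  exists (\sum_b (c b * s) *: br (e b) x), (\sum_b (c b * s) *: ea b f); split.
    apply: (big_ind2 (Rf k.+2)); first exact: Rf0.
      by move=> *; apply: RfD.
    by move=> b _; apply/RfZ/Rf_e.
  rewrite (lbr_sumr VL) (KF_sum tl); apply: eq_bigr => b _.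
  by rewrite (lbrZr VL) (br_e_skew tl B b fd') br_ve_KF (KFZ tl) -scaleNr scalerA.
have /choice[Y YP] : forall b, exists y : g * O, Rf k.+2 y.1 y.2 /\ br (ve b) D = KF y.2.
  move=> b; have /IH[x [f [xf fE]]] := hD _ (span_of_mem ve b).
  pose s : K := - (-1) ^+ odd `|k.+1%:Z|%N.
  have ss : s * s = 1 by rewrite mulrNN -expr2 sqrr_sign.
  exists (s *: x, s *: f); split; first exact: RfZ.
  by rewrite /= (KFZ tl) -fE (br_e_skew tl B b Dd) -scaleNr scalerA ss scale1r.
have DE : D = KF (contact_pot B D).
  by apply: (eq_KF_contact_pot tl Bsym BBi two Dd) => // b; exists (Y b).2; apply: (proj2 (YP b)).
set p := contact_pot B D in DE; have pd : o_deg k.+3%:Z p.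
  have k3E : k.+3%:Z = k.+1%:Z + 2 by lia.
  rewrite k3E; exact: (@contact_pot_deg _ _ _ _ tl B two _ _ Dd).
have pb b : ea b p = (Y b).2.
  by apply: (KF_inj tl Bsym BBi); rewrite -br_ve_KF -DE; apply: (proj2 (YP b)).
have [a0 [b0 ab]] := B_neq0 BBi.
have Yab a b : Rf k.+1 (br (e a) (Y b).1 + br (e b) (Y a).1) (B a b *: dt p).
  rewrite -(ea_ea tl two Bsym) !pb; apply: RfD; apply: Rf_e; exact: (proj1 (YP _)).
pose w := (B a0 b0)^-1 *: (br (e a0) (Y b0).1 + br (e b0) (Y a0).1).
have wR : Rf k.+1 w (dt p).
  by have := RfZ (B a0 b0)^-1 (Yab a0 b0); rewrite scalerA mulVf // scale1r.
have wE a b : br (e a) (Y b).1 + br (e b) (Y a).1 = B a b *: w.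
  exact: (Rf_inj (Yab a b) (RfZ (B a b) wR)).
have Yd b : gd (k.+1%:Z - 1) (Y b).1.
  by have := Rf_gd (proj1 (YP b)); have -> : k.+2%:Z - 2 = k.+1%:Z - 1 by lia.
suff [x xk xY] : exists2 x, gd k.+1%:Z x & forall b, (Y b).1 = br (e b) x.
  exists x, p; split=> //; rewrite RfSS; split=> // b.
  by rewrite -xY pb; apply: (proj1 (YP b)).
case: (leqP k.+1 3) => k3.
  apply: (F2 (w := w)) => //; first by have := Rf_gd wR.
  move=> a; apply: (Rf_inj (Rf_e a wR)); rewrite (dt_ee_comm a p) pb.
  exact/Rf_z/(proj1 (YP a)).
exists 0; first by case: (gd_sub k.+1%:Z).
move=> b; rewrite gbr0; apply: (g_high (k := k)) => //.
by have := Yd b; have -> : k.+1%:Z - 1 = k%:Z by lia.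
Qed.

Lemma h_sub_Rf k : subspace (h k).
Proof.
have E D := hh_Rf k.+2 D; rewrite -[hh B h k.+2]/(h k) in E.
split; first by apply/E; exists 0, 0; rewrite (KF0 tl); split=> //; apply: Rf0.
move=> c D D' /E[x [f [xf ->]]] /E[y [f' [yf ->]]]; apply/E.
by exists (c *: x + y), (c *: f + f'); split; [apply: Rf_lin|rewrite (KF_lin tl)].
Qed.

Lemma cts_Phi (D : V) : cts_prolong (T := T) z e B (gd 0) D <-> exists x, Phi x = D.
Proof.
rewrite /cts_prolong (with_negative_partE B h_sub_Rf); split=> [[n [F [hF ->]]]|[x <-]].
  have /choice[X XP] : forall k, exists x, Phi x = F k.
    by move=> k; have /hh_Rf[x [f [xf ->]]] := hF k; exists x; apply: Phi_Rf xf.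
  by exists (\sum_(k < n) X k); rewrite Phi_sum; apply: eq_bigr => k _.
exists 5, (fun n => KF (pot n (comp n x))); split=> // k; apply/hh_Rf.
by exists (comp k x), (pot k (comp k x)); split=> //; apply: potP.
Qed.

Lemma cts_isomorphic : isomorphic (cts_prolong (T := T) z e B (gd 0)) (full (V := g)).
Proof.
pose f (D : V) : g := if pselect (exists x, Phi x = D) is left H then proj1_sig (cid H) else 0.
have fP D : cts_prolong (T := T) z e B (gd 0) D -> Phi (f D) = D.
  by move=> /cts_Phi DU; rewrite /f; case: pselect => // H; case: (cid H).
have fK x : f (Phi x) = x by apply: Phi_inj; apply: fP; apply/cts_Phi; exists x.
have im (D : V) : cts_prolong (T := T) z e B (gd 0) D -> exists x, D = Phi x.
  by move=> /cts_Phi[x <-]; exists x.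
exists f; split.
- move=> c D D' /im[x ->] /im[y ->].
  apply: etrans (congr1 f (esym (Phi_lin c x y))) _; apply: etrans (fK _) _.
  exact: (esym (congr2 (fun u v => c *: u + v) (fK x) (fK y))).
- move=> s D /im[x ->] Ds; rewrite fK; have [x0 [x1 [p0 p1 xE]]] := g_split x.
  have sB (s' : bool) (a b : V) : par s' a -> par s' b -> par s' (a - b).
    by move=> pa pb; apply: (subspaceD (lie_par VL s')) => //; apply: (subspaceN (lie_par VL s')).
  case: s Ds => Ds.
    suff x00 : x0 = 0 by rewrite xE x00 add0r.
    apply: Phi_inj0; apply: (lie_par_disj VL); first exact: Phi_par.
    have -> : Phi x0 = Phi x - Phi x1 by rewrite xE PhiD addrK.
    by apply: sB; [exact: Ds|exact: Phi_par].
  suff x10 : x1 = 0 by rewrite xE x10 addr0.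
  apply: Phi_inj0; apply: (lie_par_disj VL); last exact: Phi_par.
  have -> : Phi x1 = Phi x - Phi x0 by rewrite xE PhiD addrC addKr.
  by apply: sB; [exact: Ds|exact: Phi_par].
- move=> D D' /im[x ->] /im[y ->].
  apply: etrans (congr1 f (esym (Phi_br x y))) _; apply: etrans (fK _) _.
  exact: (esym (congr2 (fun u v : g => br u v) (fK x) (fK y))).
- move=> D D' /im[x ->] /im[y ->] E; congr Phi.
  by apply: etrans (esym (fK x)) _; apply: etrans E _; apply: fK.
by move=> y; split=> // _; exists (Phi y); [apply/cts_Phi; exists y|].
Qed.

End GradedPotential.

(** * The table of structure constants *)

Definition brT : seq (seq (seq (nat * Z))) := ([::
  [:: [::]; [::]; [::]; [::]; [::]; [::]; [::]; [::]; [::]; [::]; [::]; [::]; [::]; [::]; [:: (0%N, 4)]; [::]; [::]; [::]; [::]; [::]; [::]; [::]; [::]; [:: (1%N, 4)]; [:: (2%N, (-4))]; [:: (3%N, (-4))]; [:: (4%N, 4)]; [:: (5%N, (-4))]; [:: (6%N, (-4))]; [:: (7%N, 4)]; [:: (14%N, 8);  (15%N, (-16));  (16%N, (-24))]];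
  [:: [::]; [::]; [::]; [::]; [::]; [::]; [::]; [:: (0%N, 1)]; [::]; [::]; [::]; [::]; [::]; [::]; [:: (1%N, 4)]; [:: (1%N, 1)]; [::]; [::]; [:: (2%N, (-1))]; [:: (3%N, 1)]; [:: (4%N, 1)]; [:: (5%N, (-1))]; [:: (6%N, (-1))]; [::]; [:: (8%N, (-3))]; [:: (9%N, (-3))]; [:: (10%N, 2)]; [:: (11%N, 1)]; [:: (12%N, (-1))]; [:: (14%N, 1);  (15%N, (-4));  (16%N, (-6))]; [:: (23%N, 4)]];
  [:: [::]; [::]; [::]; [::]; [::]; [::]; [:: (0%N, 1)]; [::]; [::]; [::]; [::]; [::]; [:: (1%N, (-1))]; [::]; [:: (2%N, 3)]; [:: (2%N, (-1))]; [:: (2%N, 1)]; [:: (3%N, (-1))]; [::]; [:: (4%N, (-1))]; [:: (5%N, 1)]; [::]; [:: (7%N, 1)]; [:: (8%N, (-3))]; [::]; [:: (10%N, (-1))]; [:: (11%N, 2)]; [:: (13%N, 3)]; [:: (14%N, (-1));  (15%N, 3);  (16%N, 6)]; [:: (18%N, 1)]; [:: (24%N, (-4))]];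
  [:: [::]; [::]; [::]; [::]; [::]; [:: (0%N, (-1))]; [::]; [::]; [::]; [::]; [::]; [:: (1%N, (-1))]; [::]; [:: (2%N, (-1))]; [:: (3%N, 3)]; [:: (3%N, 2)]; [:: (3%N, (-1))]; [::]; [:: (4%N, (-1))]; [::]; [:: (6%N, 1)]; [:: (7%N, (-1))]; [::]; [:: (9%N, (-3))]; [:: (10%N, 1)]; [::]; [:: (12%N, (-2))]; [:: (14%N, 1);  (15%N, (-3));  (16%N, (-3))]; [:: (17%N, (-3))]; [:: (19%N, (-1))]; [:: (25%N, (-4))]];
  [:: [::]; [::]; [::]; [::]; [:: (0%N, (-2))]; [::]; [::]; [::]; [::]; [::]; [:: (1%N, 2)]; [:: (2%N, 2)]; [:: (3%N, (-2))]; [::]; [:: (4%N, 2)]; [::]; [::]; [::]; [:: (5%N, 2)]; [:: (6%N, (-2))]; [:: (7%N, 2)]; [::]; [::]; [:: (10%N, (-2))]; [:: (11%N, 2)]; [:: (12%N, (-2))]; [:: (14%N, (-2));  (15%N, 4);  (16%N, 6)]; [:: (18%N, 2)]; [:: (19%N, (-2))]; [:: (20%N, (-2))]; [:: (26%N, 4)]];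
  [:: [::]; [::]; [::]; [:: (0%N, (-1))]; [::]; [::]; [::]; [::]; [::]; [:: (1%N, 1)]; [:: (2%N, 1)]; [::]; [:: (4%N, 1)]; [::]; [:: (5%N, 1)]; [:: (5%N, (-2))]; [:: (5%N, 1)]; [:: (6%N, (-1))]; [::]; [:: (7%N, 1)]; [::]; [::]; [::]; [:: (11%N, 1)]; [:: (13%N, (-3))]; [:: (14%N, 1);  (15%N, (-1));  (16%N, (-3))]; [:: (18%N, 2)]; [::]; [:: (20%N, 1)]; [:: (21%N, 3)]; [:: (27%N, (-4))]];
  [:: [::]; [::]; [:: (0%N, 1)]; [::]; [::]; [::]; [::]; [::]; [:: (1%N, (-1))]; [::]; [:: (3%N, 1)]; [:: (4%N, 1)]; [::]; [:: (5%N, (-1))]; [:: (6%N, 1)]; [:: (6%N, 1)]; [:: (6%N, (-1))]; [::]; [:: (7%N, 1)]; [::]; [::]; [::]; [::]; [:: (12%N, (-1))]; [:: (14%N, (-1));  (15%N, 1)]; [:: (17%N, 3)]; [:: (19%N, (-2))]; [:: (20%N, (-1))]; [::]; [:: (22%N, 3)]; [:: (28%N, (-4))]];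
  [:: [::]; [:: (0%N, 1)]; [::]; [::]; [::]; [::]; [::]; [::]; [:: (2%N, 1)]; [:: (3%N, 1)]; [:: (4%N, 1)]; [:: (5%N, (-1))]; [:: (6%N, 1)]; [::]; [::]; [:: (7%N, (-1))]; [::]; [::]; [::]; [::]; [::]; [::]; [::]; [:: (14%N, 1)]; [:: (18%N, 1)]; [:: (19%N, (-1))]; [:: (20%N, 2)]; [:: (21%N, 3)]; [:: (22%N, 3)]; [::]; [:: (29%N, 4)]];
  [:: [::]; [::]; [::]; [::]; [::]; [::]; [:: (1%N, 1)]; [:: (2%N, (-1))]; [::]; [::]; [::]; [::]; [::]; [::]; [:: (8%N, 3)]; [::]; [:: (8%N, 1)]; [:: (9%N, (-1))]; [::]; [:: (10%N, (-1))]; [:: (11%N, (-1))]; [:: (13%N, (-1))]; [:: (15%N, (-1));  (16%N, (-2))]; [::]; [::]; [::]; [::]; [::]; [:: (23%N, (-1))]; [:: (24%N, 1)]; [::]];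
  [:: [::]; [::]; [::]; [::]; [::]; [:: (1%N, (-1))]; [::]; [:: (3%N, (-1))]; [::]; [::]; [::]; [::]; [::]; [:: (8%N, (-1))]; [:: (9%N, 3)]; [:: (9%N, 3)]; [:: (9%N, (-1))]; [::]; [:: (10%N, (-1))]; [::]; [:: (12%N, 1)]; [:: (15%N, 1);  (16%N, 1)]; [:: (17%N, 1)]; [::]; [::]; [::]; [::]; [:: (23%N, 1)]; [::]; [:: (25%N, 1)]; [::]];
  [:: [::]; [::]; [::]; [::]; [:: (1%N, (-2))]; [:: (2%N, (-1))]; [:: (3%N, (-1))]; [:: (4%N, (-1))]; [::]; [::]; [::]; [:: (8%N, 3)]; [:: (9%N, (-3))]; [::]; [:: (10%N, 2)]; [:: (10%N, 1)]; [::]; [::]; [:: (11%N, (-2))]; [:: (12%N, (-2))]; [:: (15%N, (-2));  (16%N, (-3))]; [:: (18%N, (-1))]; [:: (19%N, 1)]; [::]; [::]; [::]; [:: (23%N, (-2))]; [:: (24%N, (-1))]; [:: (25%N, (-1))]; [:: (26%N, (-1))]; [::]];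
  [:: [::]; [::]; [::]; [:: (1%N, 1)]; [:: (2%N, (-2))]; [::]; [:: (4%N, (-1))]; [:: (5%N, 1)]; [::]; [::]; [:: (8%N, (-3))]; [::]; [:: (10%N, (-2))]; [::]; [:: (11%N, 1)]; [:: (11%N, (-1))]; [:: (11%N, 1)]; [:: (12%N, 1)]; [:: (13%N, (-3))]; [:: (15%N, 1);  (16%N, 3)]; [:: (18%N, 2)]; [::]; [:: (20%N, 1)]; [::]; [::]; [:: (23%N, (-1))]; [:: (24%N, 2)]; [::]; [:: (26%N, 1)]; [:: (27%N, (-1))]; [::]];
  [:: [::]; [::]; [:: (1%N, 1)]; [::]; [:: (3%N, 2)]; [:: (4%N, (-1))]; [::]; [:: (6%N, (-1))]; [::]; [::]; [:: (9%N, 3)]; [:: (10%N, 2)]; [::]; [:: (11%N, 1)]; [:: (12%N, 1)]; [:: (12%N, 2)]; [:: (12%N, (-1))]; [::]; [:: (15%N, (-1))]; [:: (17%N, 3)]; [:: (19%N, 2)]; [:: (20%N, 1)]; [::]; [::]; [:: (23%N, (-1))]; [::]; [:: (25%N, (-2))]; [:: (26%N, 1)]; [::]; [:: (28%N, 1)]; [::]];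
  [:: [::]; [::]; [::]; [:: (2%N, 1)]; [::]; [::]; [:: (5%N, 1)]; [::]; [::]; [:: (8%N, 1)]; [::]; [::]; [:: (11%N, (-1))]; [::]; [::]; [:: (13%N, (-3))]; [:: (13%N, 2)]; [:: (16%N, (-1))]; [::]; [:: (18%N, (-1))]; [::]; [::]; [:: (21%N, 1)]; [::]; [::]; [:: (24%N, 1)]; [::]; [::]; [:: (27%N, 1)]; [::]; [::]];
  [:: [:: (0%N, (-4))]; [:: (1%N, (-4))]; [:: (2%N, (-3))]; [:: (3%N, (-3))]; [:: (4%N, (-2))]; [:: (5%N, (-1))]; [:: (6%N, (-1))]; [::]; [:: (8%N, (-3))]; [:: (9%N, (-3))]; [:: (10%N, (-2))]; [:: (11%N, (-1))]; [:: (12%N, (-1))]; [::]; [::]; [::]; [::]; [::]; [:: (18%N, 1)]; [:: (19%N, 1)]; [:: (20%N, 2)]; [:: (21%N, 3)]; [:: (22%N, 3)]; [::]; [:: (24%N, 1)]; [:: (25%N, 1)]; [:: (26%N, 2)]; [:: (27%N, 3)]; [:: (28%N, 3)]; [:: (29%N, 4)]; [:: (30%N, 4)]];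
  [:: [::]; [:: (1%N, (-1))]; [:: (2%N, 1)]; [:: (3%N, (-2))]; [::]; [:: (5%N, 2)]; [:: (6%N, (-1))]; [:: (7%N, 1)]; [::]; [:: (9%N, (-3))]; [:: (10%N, (-1))]; [:: (11%N, 1)]; [:: (12%N, (-2))]; [:: (13%N, 3)]; [::]; [::]; [::]; [:: (17%N, (-3))]; [:: (18%N, 2)]; [:: (19%N, (-1))]; [:: (20%N, 1)]; [:: (21%N, 3)]; [::]; [:: (23%N, (-1))]; [:: (24%N, 1)]; [:: (25%N, (-2))]; [::]; [:: (27%N, 2)]; [:: (28%N, (-1))]; [:: (29%N, 1)]; [::]];
  [:: [::]; [::]; [:: (2%N, (-1))]; [:: (3%N, 1)]; [::]; [:: (5%N, (-1))]; [:: (6%N, 1)]; [::]; [:: (8%N, (-1))]; [:: (9%N, 1)]; [::]; [:: (11%N, (-1))]; [:: (12%N, 1)]; [:: (13%N, (-2))]; [::]; [::]; [::]; [:: (17%N, 2)]; [:: (18%N, (-1))]; [:: (19%N, 1)]; [::]; [:: (21%N, (-1))]; [:: (22%N, 1)]; [::]; [:: (24%N, (-1))]; [:: (25%N, 1)]; [::]; [:: (27%N, (-1))]; [:: (28%N, 1)]; [::]; [::]];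
  [:: [::]; [::]; [:: (3%N, 1)]; [::]; [::]; [:: (6%N, 1)]; [::]; [::]; [:: (9%N, 1)]; [::]; [::]; [:: (12%N, (-1))]; [::]; [:: (16%N, 1)]; [::]; [:: (17%N, 3)]; [:: (17%N, (-2))]; [::]; [:: (19%N, (-1))]; [::]; [::]; [:: (22%N, 1)]; [::]; [::]; [:: (25%N, 1)]; [::]; [::]; [:: (28%N, 1)]; [::]; [::]; [::]];
  [:: [::]; [:: (2%N, 1)]; [::]; [:: (4%N, 1)]; [:: (5%N, (-2))]; [::]; [:: (7%N, (-1))]; [::]; [::]; [:: (10%N, 1)]; [:: (11%N, 2)]; [:: (13%N, 3)]; [:: (15%N, 1)]; [::]; [:: (18%N, (-1))]; [:: (18%N, (-2))]; [:: (18%N, 1)]; [:: (19%N, 1)]; [::]; [:: (20%N, 2)]; [:: (21%N, 3)]; [::]; [::]; [:: (24%N, (-1))]; [::]; [:: (26%N, (-1))]; [:: (27%N, 2)]; [::]; [:: (29%N, 1)]; [::]; [::]];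
  [:: [::]; [:: (3%N, (-1))]; [:: (4%N, 1)]; [::]; [:: (6%N, 2)]; [:: (7%N, (-1))]; [::]; [::]; [:: (10%N, 1)]; [::]; [:: (12%N, 2)]; [:: (15%N, (-1));  (16%N, (-3))]; [:: (17%N, (-3))]; [:: (18%N, 1)]; [:: (19%N, (-1))]; [:: (19%N, 1)]; [:: (19%N, (-1))]; [::]; [:: (20%N, (-2))]; [::]; [:: (22%N, (-3))]; [::]; [::]; [:: (25%N, 1)]; [:: (26%N, (-1))]; [::]; [:: (28%N, (-2))]; [:: (29%N, 1)]; [::]; [::]; [::]];
  [:: [::]; [:: (4%N, (-1))]; [:: (5%N, (-1))]; [:: (6%N, (-1))]; [:: (7%N, (-2))]; [::]; [::]; [::]; [:: (11%N, 1)]; [:: (12%N, (-1))]; [:: (15%N, 2);  (16%N, 3)]; [:: (18%N, (-2))]; [:: (19%N, (-2))]; [::]; [:: (20%N, (-2))]; [:: (20%N, (-1))]; [::]; [::]; [:: (21%N, (-3))]; [:: (22%N, 3)]; [::]; [::]; [::]; [:: (26%N, (-1))]; [:: (27%N, (-1))]; [:: (28%N, (-1))]; [:: (29%N, (-2))]; [::]; [::]; [::]; [::]];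
  [:: [::]; [:: (5%N, 1)]; [::]; [:: (7%N, 1)]; [::]; [::]; [::]; [::]; [:: (13%N, 1)]; [:: (15%N, (-1));  (16%N, (-1))]; [:: (18%N, 1)]; [::]; [:: (20%N, (-1))]; [::]; [:: (21%N, (-3))]; [:: (21%N, (-3))]; [:: (21%N, 1)]; [:: (22%N, (-1))]; [::]; [::]; [::]; [::]; [::]; [:: (27%N, (-1))]; [::]; [:: (29%N, (-1))]; [::]; [::]; [::]; [::]; [::]];
  [:: [::]; [:: (6%N, 1)]; [:: (7%N, (-1))]; [::]; [::]; [::]; [::]; [::]; [:: (15%N, 1);  (16%N, 2)]; [:: (17%N, (-1))]; [:: (19%N, (-1))]; [:: (20%N, (-1))]; [::]; [:: (21%N, (-1))]; [:: (22%N, (-3))]; [::]; [:: (22%N, (-1))]; [::]; [::]; [::]; [::]; [::]; [::]; [:: (28%N, (-1))]; [:: (29%N, 1)]; [::]; [::]; [::]; [::]; [::]; [::]];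
  [:: [:: (1%N, (-4))]; [::]; [:: (8%N, (-3))]; [:: (9%N, (-3))]; [:: (10%N, (-2))]; [:: (11%N, 1)]; [:: (12%N, (-1))]; [:: (14%N, 1)]; [::]; [::]; [::]; [::]; [::]; [::]; [::]; [:: (23%N, 1)]; [::]; [::]; [:: (24%N, 1)]; [:: (25%N, (-1))]; [:: (26%N, 1)]; [:: (27%N, 1)]; [:: (28%N, 1)]; [::]; [::]; [::]; [::]; [::]; [::]; [:: (30%N, 1)]; [::]];
  [:: [:: (2%N, 4)]; [:: (8%N, (-3))]; [::]; [:: (10%N, 1)]; [:: (11%N, 2)]; [:: (13%N, (-3))]; [:: (14%N, (-1));  (15%N, 1)]; [:: (18%N, 1)]; [::]; [::]; [::]; [::]; [:: (23%N, 1)]; [::]; [:: (24%N, (-1))]; [:: (24%N, (-1))]; [:: (24%N, 1)]; [:: (25%N, (-1))]; [::]; [:: (26%N, 1)]; [:: (27%N, 1)]; [::]; [:: (29%N, (-1))]; [::]; [::]; [::]; [::]; [::]; [:: (30%N, 1)]; [::]; [::]];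
  [:: [:: (3%N, 4)]; [:: (9%N, (-3))]; [:: (10%N, (-1))]; [::]; [:: (12%N, (-2))]; [:: (14%N, 1);  (15%N, (-1));  (16%N, (-3))]; [:: (17%N, 3)]; [:: (19%N, (-1))]; [::]; [::]; [::]; [:: (23%N, 1)]; [::]; [:: (24%N, (-1))]; [:: (25%N, (-1))]; [:: (25%N, 2)]; [:: (25%N, (-1))]; [::]; [:: (26%N, 1)]; [::]; [:: (28%N, 1)]; [:: (29%N, 1)]; [::]; [::]; [::]; [::]; [::]; [:: (30%N, (-1))]; [::]; [::]; [::]];
  [:: [:: (4%N, (-4))]; [:: (10%N, 2)]; [:: (11%N, 2)]; [:: (12%N, (-2))]; [:: (14%N, (-2));  (15%N, 4);  (16%N, 6)]; [:: (18%N, 2)]; [:: (19%N, (-2))]; [:: (20%N, 2)]; [::]; [::]; [:: (23%N, 2)]; [:: (24%N, (-2))]; [:: (25%N, 2)]; [::]; [:: (26%N, (-2))]; [::]; [::]; [::]; [:: (27%N, (-2))]; [:: (28%N, 2)]; [:: (29%N, 2)]; [::]; [::]; [::]; [::]; [::]; [:: (30%N, (-2))]; [::]; [::]; [::]; [::]];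
  [:: [:: (5%N, 4)]; [:: (11%N, 1)]; [:: (13%N, 3)]; [:: (14%N, 1);  (15%N, (-3));  (16%N, (-3))]; [:: (18%N, 2)]; [::]; [:: (20%N, (-1))]; [:: (21%N, 3)]; [::]; [:: (23%N, (-1))]; [:: (24%N, 1)]; [::]; [:: (26%N, (-1))]; [::]; [:: (27%N, (-3))]; [:: (27%N, (-2))]; [:: (27%N, 1)]; [:: (28%N, (-1))]; [::]; [:: (29%N, (-1))]; [::]; [::]; [::]; [::]; [::]; [:: (30%N, (-1))]; [::]; [::]; [::]; [::]; [::]];
  [:: [:: (6%N, 4)]; [:: (12%N, (-1))]; [:: (14%N, (-1));  (15%N, 3);  (16%N, 6)]; [:: (17%N, (-3))]; [:: (19%N, (-2))]; [:: (20%N, 1)]; [::]; [:: (22%N, 3)]; [:: (23%N, 1)]; [::]; [:: (25%N, 1)]; [:: (26%N, (-1))]; [::]; [:: (27%N, (-1))]; [:: (28%N, (-3))]; [:: (28%N, 1)]; [:: (28%N, (-1))]; [::]; [:: (29%N, (-1))]; [::]; [::]; [::]; [::]; [::]; [:: (30%N, 1)]; [::]; [::]; [::]; [::]; [::]; [::]];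
  [:: [:: (7%N, (-4))]; [:: (14%N, 1);  (15%N, (-4));  (16%N, (-6))]; [:: (18%N, 1)]; [:: (19%N, (-1))]; [:: (20%N, (-2))]; [:: (21%N, 3)]; [:: (22%N, 3)]; [::]; [:: (24%N, (-1))]; [:: (25%N, (-1))]; [:: (26%N, 1)]; [:: (27%N, 1)]; [:: (28%N, (-1))]; [::]; [:: (29%N, (-4))]; [:: (29%N, (-1))]; [::]; [::]; [::]; [::]; [::]; [::]; [::]; [:: (30%N, 1)]; [::]; [::]; [::]; [::]; [::]; [::]; [::]];
  [:: [:: (14%N, (-8));  (15%N, 16);  (16%N, 24)]; [:: (23%N, (-4))]; [:: (24%N, 4)]; [:: (25%N, 4)]; [:: (26%N, (-4))]; [:: (27%N, 4)]; [:: (28%N, 4)]; [:: (29%N, (-4))]; [::]; [::]; [::]; [::]; [::]; [::]; [:: (30%N, (-4))]; [::]; [::]; [::]; [::]; [::]; [::]; [::]; [::]; [::]; [::]; [::]; [::]; [::]; [::]; [::]; [::]]])%Z.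
Definition degn : seq nat := [:: 0; 1; 1; 1; 1; 1; 1; 1; 2; 2; 2; 2; 2; 2; 2; 2; 2; 2; 2; 2; 2; 2; 2; 3; 3; 3; 3; 3; 3; 3; 4]%N.
Definition htn : seq nat := [:: 2; 3; 4; 5; 6; 7; 8; 9; 5; 6; 7; 8; 9; 9; 10; 10; 10; 11; 11; 12; 13; 14; 15; 11; 12; 13; 14; 15; 16; 17; 18]%N.

Definition I31 : seq nat := iota 0 31.
Definition rcoef (n : nat) (r : lrow) : Z := foldr (fun x s => if Nat.eqb x.1 n then (x.2 + s)%Z else s) 0%Z r.
Definition brow (i j : nat) : lrow := nth [::] (nth [::] brT i) j.
Definition cTz (i j k : nat) : Z := rcoef k (brow i j).
Definition bind (r : lrow) (f : nat -> lrow) : lrow :=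
  flatten [seq [seq (y.1, (x.2 * y.2)%Z) | y <- f x.1] | x <- r].
Definition oddT (i : nat) : bool := odd (nth 0%N degn i).
Definition signz (b : bool) : Z := if b then (-1)%Z else 1%Z.

Lemma rcoef_cat n r s : rcoef n (r ++ s) = (rcoef n r + rcoef n s)%Z.
Proof. by elim: r => //= x r ->; case: Nat.eqb => //; rewrite Z.add_assoc. Qed.

Lemma rcoef_scale n c r : rcoef n [seq (y.1, (c * y.2)%Z) | y <- r] = (c * rcoef n r)%Z.
Proof.
elim: r => [|y r IH] /=; first by rewrite Z.mul_0_r.
by rewrite IH; case: Nat.eqb => //; rewrite Z.mul_add_distr_l.
Qed.

Lemma rcoef_notin n r : n \notin [seq x.1 | x <- r] -> rcoef n r = 0%Z.
Proof.
elim: r => //= x r IH; rewrite inE negb_or => /andP[xn /IH ->].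
by case: Nat.eqb_spec xn => // ->; rewrite eqxx.
Qed.

Notation zi := (fun c => int_of_Z c : int).

Lemma ziD a b : zi (a + b)%Z = zi a + zi b. Proof. exact: (rmorphD int_of_Z a b). Qed.
Lemma ziM a b : zi (a * b)%Z = zi a * zi b. Proof. exact: (rmorphM int_of_Z a b). Qed.

Lemma I31_all (p : nat -> bool) : all p I31 -> forall i : 'I_31, p i.
Proof. by move=> /allP h i; apply: h; rewrite mem_iota /= ltn_ord. Qed.

Definition keys_lt (r : lrow) := all (fun x => Nat.ltb x.1 31) r.

Lemma zi_bind n r f : keys_lt r ->
  zi (rcoef n (bind r f)) = \sum_(l < 31) zi (rcoef l r) * zi (rcoef n (f l)).
Proof.
elim: r => [_|x r IH]; first by rewrite big1 // => l _; rewrite mul0r.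
move=> /andP[x31 kr]; have -> : bind (x :: r) f = [seq (y.1, (x.2 * y.2)%Z) | y <- f x.1] ++ bind r f by [].
rewrite rcoef_cat rcoef_scale ziD ziM (IH kr).
have x31' : (x.1 < 31)%N by apply/ssrnat.ltP/Nat.ltb_lt.
have -> : \sum_(l < 31) zi (if Nat.eqb x.1 l then (x.2 + rcoef l r)%Z else rcoef l r) * zi (rcoef n (f l)) =
   \sum_(l < 31) ((if l == Ordinal x31' then zi x.2 * zi (rcoef n (f x.1)) else 0) + zi (rcoef l r) * zi (rcoef n (f l))).
  apply: eq_bigr => l _; rewrite -val_eqE /=.
  case: Nat.eqb_spec => [E|E]; last by rewrite (introF eqP) ?add0r // => lE; apply: E; rewrite lE.
  by rewrite E eqxx ziD mulrDl.
by rewrite big_split /= -big_mkcond /= big_pred1_eq.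
Qed.

Lemma brow_keys : all (fun i => all (fun j => keys_lt (brow i j)) I31) I31.
Proof. by vm_compute. Qed.

Lemma deg_check : all (fun i => all (fun j => all (fun x =>
  Nat.eqb (nth 0 degn x.1 + 2) (nth 0 degn i + nth 0 degn j)) (brow i j)) I31) I31.
Proof. by vm_compute. Qed.

Lemma skew_check : all (fun i => all (fun j => let r := brow i j in let s := brow j i in
  all (fun n => Z.eqb (rcoef n r) (- signz (oddT i && oddT j) * rcoef n s))
    ([seq x.1 | x <- r] ++ [seq x.1 | x <- s])) I31) I31.
Proof. by vm_compute. Qed.

Lemma jac_check : all (fun i => all (fun j => let ij := brow i j in all (fun k =>
  let r1 := bind (brow j k) (brow i) in let r2 := bind ij (fun l => brow l k) in
  let r3 := bind (brow i k) (brow j) in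
  all (fun n => Z.eqb (rcoef n r1) (rcoef n r2 + signz (oddT i && oddT j) * rcoef n r3))
    ([seq x.1 | x <- r1] ++ [seq x.1 | x <- r2] ++ [seq x.1 | x <- r3])) I31) I31) I31.
Proof. by vm_compute. Qed.

Definition cT (i j k : 'I_31) : int := int_of_Z (cTz i j k).
Definition dT (i : 'I_31) : int := (nth 0%N degn i)%:Z - 2.
Definition qT (i : 'I_31) : bool := oddT i.

Lemma zi_signz b : zi (signz b) = (-1) ^+ b. Proof. by case: b. Qed.

Lemma table_struct : struct_laws qT dT cT.
Proof.
split=> [i|i j k|i j k|i j k n].
- rewrite /qT /oddT /dT; have : (nth 0%N degn i < 5)%N.
    have h : all (fun i => nth 0%N degn i < 5)%N I31 by [].
    exact: (I31_all h).
  by case: (nth _ _ _) => [|[|[|[|[|]]]]].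
- rewrite /cT /cTz => cn; have kin : (k : nat) \in [seq x.1 | x <- brow i j].
    by apply/negPn/negP => /rcoef_notin E; rewrite E eqxx in cn.
  have [x xr xk] := mapP kin; have /allP/(_ x xr)/Nat.eqb_spec := I31_all (I31_all deg_check i) j.
  rewrite /dT -xk; move: (nth _ _ _) (nth _ _ _) (nth _ _ _) => u v w; lia.
- rewrite /cT /cTz -zi_signz -rmorphM -rmorphN; congr int_of_Z.
  rewrite -[(- (_ * _))%R]/(- (signz (qT i && qT j) * rcoef k (brow j i)))%Z -Z.mul_opp_l.
  case kin : ((k : nat) \in [seq x.1 | x <- brow i j] ++ [seq x.1 | x <- brow j i]).
    by have /allP/(_ _ kin)/Z.eqb_spec := I31_all (I31_all skew_check i) j.
  move/negbT: kin; rewrite mem_cat negb_or => /andP[/rcoef_notin-> /rcoef_notin->].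
  by rewrite Z.mul_0_r.
have kl (i' j' : 'I_31) : keys_lt (brow i' j') := I31_all (I31_all brow_keys i') j'.
rewrite /cT /cTz -(zi_bind n (brow i) (kl j k)) -(zi_bind n (fun l => brow l k) (kl i j)).
rewrite -(zi_bind n (brow j) (kl i k)) -zi_signz -rmorphM -rmorphD; congr int_of_Z.
set r1 := bind _ _; set r2 := bind _ _; set r3 := bind _ _.
case kin : ((n : nat) \in [seq x.1 | x <- r1] ++ [seq x.1 | x <- r2] ++ [seq x.1 | x <- r3]).
  by have /allP/(_ _ kin)/Z.eqb_spec := I31_all (I31_all (I31_all jac_check i) j) k.
move/negbT: kin; rewrite !mem_cat !negb_or => /and3P[/rcoef_notin-> /rcoef_notin-> /rcoef_notin->].
by rewrite mulr0.
Qed.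

Definition idz (c : Z) := c.
Definition good6 (c : Z) : bool := ~~ Z.eqb c 0 && Z.eqb (Z.modulo (6 ^ 30) c) 0.

Definition adrow (b n : nat) : lrow := row_nz idz [seq (j, cTz b j n) | j <- I31].
Definition rows1 (k : nat) : seq lrow :=
  [seq [:: (j, 1%Z)] | j <- I31 & ~~ Nat.eqb (nth 0%N degn j) (k + 2)] ++
  [seq adrow x.1 x.2 | x <- [seq (b, n) | b <- iota 1 7, n <- I31]].

Lemma rows1_solve : all (fun k => solves idz good6 I31 (rows1 k)) [:: 0; 1; 2]%N.
Proof. by vm_compute. Qed.

Definition gauge (k : nat) : seq (nat * (nat * (nat * Z))) :=
  nth [::] [:: [::]; [:: (23, (5, (11, 1%Z))); (24, (3, (10, 1%Z))); (25, (2, (10, (-1)%Z)));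
    (26, (1, (10, 2%Z))); (27, (1, (11, 1%Z))); (28, (1, (12, (-1)%Z))); (29, (1, (14, 1%Z)))];
    [:: (30, (1, (23, 4%Z)))]]%N k.

Definition shift_row (s : nat) (r : lrow) : lrow := [seq ((s + x.1)%N, x.2) | x <- r].

(* The unknowns are the coordinates of the images of the basis vectors of degree
   -1 (at 31 b + j) and of w (at 217 + j). *)
Definition rowA (a b n : nat) : lrow :=
  row_add idz (shift_row (31 * b) (adrow a.+1 n)) (row_add idz (shift_row (31 * a) (adrow b.+1 n))
    (row_nz idz [:: ((217 + n)%N, - cTz a.+1 b.+1 0)%Z])).
Definition rowB (a n : nat) : lrow :=
  row_add idz (shift_row (31 * a) (row_scale idz (-1) (adrow 0 n))) (shift_row 217 (adrow a.+1 n)).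
Definition rowT (t : nat * (nat * (nat * nat))) : lrow :=
  match t with
  | (0, (a, (b, n))) => rowA a b n
  | (1, (a, (_, n))) => rowB a n
  | (_, (b, (j, _))) => [:: ((31 * b + j)%N, 1%Z)]
  end.

(* The equations split into blocks by weight; for each block, its unknowns and
   enough equations. *)
Definition blocks (k : nat) : seq (seq nat * seq (nat * (nat * (nat * nat)))) :=
  nth [::] [:: [::];
  [:: ([:: 8; 72; 104; 137; 169; 170; 171; 204; 219], [:: (0, (0, (6, 2))); (0, (2, (4, 2))); (0, (2, (6, 4))); (0, (3, (5, 4))); (0, (3, (6, 5))); (0, (5, (5, 6))); (0, (5, (6, 7))); (1, (5, (0, 0))); (2, (2, (10, 0)))]); ([:: 9; 41; 105; 138; 139; 140; 172; 205; 220], [:: (0, (0, (6, 3))); (0, (1, (5, 3))); (0, (1, (6, 4))); (0, (3, (4, 4))); (0, (3, (6, 6))); (0, (4, (4, 5))); (0, (4, (6, 7))); (1, (4, (0, 0))); (2, (1, (10, 0)))]); ([:: 10; 42; 74; 107; 108; 109; 142; 174; 206; 221], [:: (0, (0, (5, 3))); (0, (1, (6, 5))); (0, (2, (4, 4))); (0, (2, (6, 6))); (0, (3, (4, 5))); (0, (3, (5, 6))); (0, (3, (6, 7))); (0, (4, (5, 7))); (1, (3, (0, 0))); (2, (0, (10, 0)))]); ([:: 11; 44; 76; 77; 78; 111; 175; 207; 222], [:: (0, (0, (5, 4))); (0, (0, (6, 5))); (0, (1, (5, 5))); (0, (2, (2, 3))); (0, (2, (6, 7))); (0, (3, (3, 5)));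 (0, (3, (5, 7))); (1, (2, (0, 0))); (2, (0, (11, 0)))]); ([:: 12; 45; 46; 47; 79; 112; 144; 208; 223], [:: (0, (0, (4, 4))); (0, (0, (6, 6))); (0, (1, (1, 2))); (0, (1, (6, 7))); (0, (2, (4, 6))); (0, (3, (3, 6))); (0, (3, (4, 7))); (1, (1, (0, 0))); (2, (0, (12, 0)))]); ([:: 13; 80; 176], [:: (0, (0, (5, 5))); (0, (2, (3, 5))); (0, (2, (5, 7)))]); ([:: 14; 15; 16; 49; 81; 113; 145; 177; 224], [:: (0, (0, (5, 6))); (0, (0, (6, 7))); (0, (1, (3, 5))); (0, (1, (5, 7))); (0, (2, (3, 6))); (0, (2, (4, 7))); (0, (3, (3, 7))); (1, (0, (0, 0))); (2, (0, (14, 0)))]); ([:: 17; 50; 146], [:: (0, (0, (4, 6))); (0, (1, (3, 6))); (0, (1, (4, 7)))]); ([:: 18; 82; 114], [:: (0, (0, (5, 7))); (0, (2, (2, 6))); (0, (2, (3, 7)))]); ([:: 19; 51; 115], [:: (0, (0, (4, 7))); (0, (1, (2, 6))); (0, (1, (3, 7)))]); ([:: 20; 52; 84], [:: (0, (0, (2, 6))); (0, (0, (3, 7))); (0, (1, (2, 7)))]); ([:: 21], [:: (0, (0, (2, 7)))]); ([:: 22], [:: (0, (0, (1, 7)))]); ([:: 39; 71; 103; 135; 167; 200; 201; 202; 218], [:: (0, (1, (5, 1))); (0, (2, (4, 1))); (0, (3, (5, 3))); (0, (3, (6, 4))); (0, (4, (5, 4))); (0, (5, (6, 6))); (0, (6,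 (6, 7))); (1, (6, (0, 0))); (2, (4, (11, 0)))]); ([:: 40; 136; 203], [:: (0, (1, (6, 3))); (0, (4, (4, 4))); (0, (4, (6, 6)))]); ([:: 43; 110; 143], [:: (0, (1, (6, 6))); (0, (3, (4, 6))); (0, (4, (4, 7)))]); ([:: 48], [:: (0, (1, (4, 6)))]); ([:: 53], [:: (0, (1, (1, 7)))]); ([:: 70; 166; 199], [:: (0, (2, (6, 2))); (0, (5, (5, 4))); (0, (5, (6, 5)))]); ([:: 73; 106; 173], [:: (0, (2, (6, 5))); (0, (3, (5, 5))); (0, (5, (5, 7)))]); ([:: 75], [:: (0, (2, (5, 5)))]); ([:: 83], [:: (0, (2, (2, 7)))]); ([:: 101; 165; 197], [:: (0, (3, (6, 2))); (0, (5, (5, 3))); (0, (6, (6, 5)))]); ([:: 102; 134; 198], [:: (0, (3, (6, 3))); (0, (4, (5, 3))); (0, (6, (6, 6)))]); ([:: 132; 164; 196], [:: (0, (4, (6, 2))); (0, (5, (6, 3))); (0, (6, (6, 4)))]); ([:: 133], [:: (0, (4, (6, 3)))]); ([:: 141], [:: (0, (4, (4, 6)))]); ([:: 163], [:: (0, (5, (6, 2)))]); ([:: 168], [:: (0, (5, (5, 5)))]); ([:: 194], [:: (0, (6, (6, 2)))]); ([:: 195], [:: (0, (6, (6, 3)))])];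
  [:: ([:: 147; 211; 226], [:: (0, (3, (3, 9))); (0, (4, (5, 12))); (0, (6, (6, 19)))]); ([:: 116; 148; 180; 212; 227], [:: (0, (2, (3, 9))); (0, (4, (4, 13))); (0, (5, (5, 17))); (0, (6, (6, 20))); (1, (6, (0, 4)))]); ([:: 149], [:: (1, (4, (0, 3)))]); ([:: 54; 118; 150; 214; 229], [:: (0, (1, (2, 9))); (0, (3, (5, 17))); (0, (4, (5, 19))); (0, (6, (6, 22))); (1, (6, (0, 6)))]); ([:: 23; 55; 87; 119; 151; 183; 215; 231; 232; 233], [:: (0, (0, (5, 12))); (0, (1, (6, 18))); (0, (2, (6, 19))); (0, (3, (3, 16))); (0, (3, (6, 20))); (0, (4, (6, 21))); (0, (5, (6, 22))); (1, (3, (0, 4))); (1, (6, (0, 7))); (2, (0, (23, 0)))]); ([:: 24; 88; 120; 184; 235], [:: (0, (0, (4, 13))); (0, (2, (6, 20))); (0, (3, (6, 21))); (0, (5, (5, 22))); (1, (5, (0, 7)))]); ([:: 25; 57; 121; 153; 236], [:: (0, (0, (5, 17))); (0, (1, (6, 20))); (0, (3, (6, 22))); (0, (4, (5, 22))); (1, (4, (0, 7)))]); ([:: 26; 58; 90; 122; 237], [:: (0, (0, (5, 19))); (0, (1, (6, 21))); (0, (2, (6, 22))); (0, (3, (5, 22))); (1, (3, (0, 7)))]); ([:: 27; 91; 238], [:: (0, (0, (5, 20))); (0, (2, (5, 22))); (0, (3, (3, 21)))]); ([:: 28; 60; 239], [:: (0, (0, (4, 20))); (0, (1, (4, 21)));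 (0, (3, (3, 22)))]); ([:: 29], [:: (1, (0, (0, 7)))]); ([:: 56; 152; 234], [:: (0, (1, (6, 19))); (0, (3, (3, 17))); (0, (4, (6, 22)))]); ([:: 178; 210; 225], [:: (0, (3, (3, 8))); (0, (5, (5, 12))); (0, (6, (6, 18)))]); ([:: 179], [:: (1, (5, (0, 2)))]); ([:: 85; 117; 181; 213; 228], [:: (0, (2, (2, 9))); (0, (3, (4, 13))); (0, (5, (5, 19))); (0, (6, (6, 21))); (1, (6, (0, 5)))]); ([:: 59], [:: (1, (1, (0, 6)))]); ([:: 86; 182; 230], [:: (0, (2, (6, 18))); (0, (3, (3, 13))); (0, (5, (6, 21)))]); ([:: 209], [:: (1, (6, (0, 1)))]); ([:: 89], [:: (1, (2, (0, 5)))])];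
  [:: ([:: 216; 240], [:: (1, (5, (0, 12))); (1, (6, (0, 16)))]); ([:: 185; 241], [:: (1, (5, (0, 16))); (1, (6, (0, 18)))]); ([:: 154; 242], [:: (0, (4, (6, 29))); (1, (6, (0, 19)))]); ([:: 123; 243], [:: (0, (3, (6, 29))); (1, (6, (0, 20)))]); ([:: 92; 244], [:: (0, (2, (6, 29))); (1, (6, (0, 21)))]); ([:: 61; 245], [:: (0, (1, (6, 29))); (1, (6, (0, 22)))]); ([:: 30; 246], [:: (0, (0, (5, 28))); (1, (5, (0, 22)))])]]%N k.

Lemma blocks_solve : all (fun k => all (fun x => solves idz good6 x.1 [seq rowT t | t <- x.2]) (blocks k))
  [:: 1; 2; 3]%N.
Proof. by vm_compute. Qed.

Lemma blocks_wf : all (fun k => all (fun x => all (fun t => [&& Nat.ltb t.2.1 7, Nat.ltb t.2.2.2 31 &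
  match t.1 with 0 => Nat.ltb t.2.2.1 7 | 1 => true
   | _ => has (fun g => Nat.eqb g.2.1 t.2.1.+1 && Nat.eqb g.2.2.1 t.2.2.1) (gauge k) end]) x.2) (blocks k))
  [:: 1; 2; 3]%N.
Proof. by vm_compute. Qed.

Lemma blocks_cover : all (fun k => all (fun j =>
   (~~ Nat.eqb (nth 0%N degn j) k.+1 || all (fun b => has (fun x => (31 * b + j)%N \in x.1) (blocks k)) (iota 0 7)) &&
   (~~ Nat.eqb (nth 0%N degn j) k || has (fun x => (217 + j)%N \in x.1) (blocks k))) I31) [:: 1; 2; 3]%N.
Proof. by vm_compute. Qed.

Lemma gauge_check : all (fun k => all (fun g => [&& Nat.ltb g.1 31, Nat.ltb g.2.2.1 31, (0 < g.2.1 < 8)%N,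
   Nat.eqb (nth 0%N degn g.1) (k + 2), good6 g.2.2.2 &
   all (fun g' => Z.eqb (cTz g.2.1 g'.1 g.2.2.1) (if Nat.eqb g'.1 g.1 then g.2.2.2 else 0%Z)) (gauge k)]) (gauge k)
   && uniq [seq g.1 | g <- gauge k]) [:: 1; 2; 3]%N.
Proof. by vm_compute. Qed.

Lemma uniq_map_inj (A B : eqType) (f : A -> B) (s : seq A) : uniq (map f s) -> {in s &, injective f}.
Proof.
elim: s => //= a s IH /andP[an us] x y; rewrite !inE => /predU1P[->|xs] /predU1P[->|ys] // E.
- by case/negP: an; rewrite E map_f.
- by case/negP: an; rewrite -E map_f.
exact: IH us x y xs ys E.
Qed.

Section TableAlgebra.
Variable K : fieldType.
Hypothesis two : (2%:R : K) != 0.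
Hypothesis three : (3%:R : K) != 0.
Notation M := (reduction K qT cT).
Notation zK := (zK K).
Notation rdeg := (@red_deg K 31 qT dT cT).
Notation Tb := (fun n : nat => dl K qT cT (inord n)).

Lemma good6_neq0 c : good6 c -> zK c != 0.
Proof.
move=> /andP[/Z.eqb_spec c0 /Z.eqb_spec /(Z.mod_divide _ _ c0)[d dE]].
apply: contraTneq (oner_neq0 K) => zc; have := congr1 zK dE; rewrite zKM zc mulr0 => /eqP.
have E n : zK (6 ^ Z.of_nat n) = 6%:R ^+ n.
  elim: n => [//|n IH]; rewrite Nat2Z.inj_succ Z.pow_succ_r ?zKM ?IH ?exprS //.
  exact: Zle_0_nat.
rewrite -[30%Z]/(Z.of_nat 30) E expf_eq0 /= -[6%N]/(2 * 3)%N natrM mulf_eq0.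
by rewrite (negPf two) (negPf three).
Qed.

Lemma idz_zK c : zK (idz c) = zK c. Proof. by []. Qed.

Definition crd (x : M) (n : nat) : K := (x : 'rV[K]_31) 0 (inord n).

Lemma crdB (x y : M) n : crd (x - y) n = crd x n - crd y n.
Proof. by rewrite /crd !mxE. Qed.

Lemma crdD (x y : M) n : crd (x + y) n = crd x n + crd y n.
Proof. by rewrite /crd !mxE. Qed.

Lemma crdZ (c : K) (x : M) n : crd (c *: x) n = c * crd x n.
Proof. by rewrite /crd !mxE. Qed.

Lemma crd_eq0 (x : M) : (forall n, (n < 31)%N -> crd x n = 0) -> x = 0.
Proof. by move=> x0; apply/rowP => i; rewrite mxE -(x0 i (ltn_ord i)) /crd inord_val. Qed.

Lemma sum31 (F : nat -> K) : \sum_(j <- I31) F j = \sum_(j < 31) F j.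
Proof. by rewrite -[I31]/(index_iota 0 31) big_mkord. Qed.

Lemma adrowP y b n : rowval y (adrow b n) = \sum_(j < 31) zK (cTz b j n) * y j.
Proof. by rewrite /adrow (rowval_nz idz_zK) /rowval big_map sum31. Qed.

Lemma br_dl_crd b n (x : M) : (b < 31)%N -> (n < 31)%N ->
  crd (br (Tb b) x) n = rowval (crd x) (adrow b n).
Proof.
move=> b31 n31; rewrite adrowP /crd mxE (bigD1 (inord b)) //= [X in _ + X]big1 ?addr0 => [|i /negPf ib].
  apply: eq_bigr => j _; rewrite mxE !eqxx mulr1 /cT !inordK // inord_val; congr (zK _ * _).
by rewrite big1 // => j _; rewrite mxE ib andbF mulr0 mul0r.
Qed.

Lemma rowval_shift (y : nat -> K) s r : rowval y (shift_row s r) = rowval (fun i => y (s + i)%N) r.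
Proof. by rewrite /rowval big_map. Qed.

Lemma rdeg_crd (k : int) (x : M) n : rdeg k x -> (n < 31)%N -> (nth 0%N degn n)%:Z - 2 != k -> crd x n = 0.
Proof.
move=> xk n31 nk; apply/eqP/negPn/negP => /xk; rewrite /dT inordK // => E.
by rewrite E eqxx in nk.
Qed.

Lemma rdeg_Tb n : (n < 31)%N -> rdeg ((nth 0%N degn n)%:Z - 2) (Tb n).
Proof.
move=> n31 i; rewrite /dl mxE eqxx andTb; case: (i =P inord n) => [->|_]; last by rewrite eqxx.
by rewrite /dT inordK.
Qed.

Lemma F1_table (k : nat) (x : M) : rdeg k%:Z x -> (forall b : 'I_7, br (Tb b.+1) x = 0) -> x = 0.
Proof.
move=> xk xb; case: (leqP k 2) => k2; last first.
  apply: crd_eq0 => n n31; apply: (rdeg_crd xk n31).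
  have h : all (fun n => nth 0%N degn n < 5)%N I31 by [].
  by have := I31_all h (Ordinal n31) => /=; lia.
have kI : k \in [:: 0; 1; 2]%N by case: k k2 {xk} => [|[|[|]]].
have sol := allP rows1_solve k kI.
apply: crd_eq0 => n n31; apply: (solvesP idz_zK good6_neq0 sol); last by rewrite mem_iota.
move=> r; rewrite mem_cat => /orP[/mapP[j]|/mapP[[b n']]].
  rewrite mem_filter mem_iota /= => /andP[/Nat.eqb_spec jk j31] ->.
  rewrite /rowval big_seq1 zK1 mul1r; apply: (rdeg_crd xk j31); lia.
move=> /allpairsP[[b1 n1] [bI nI [-> ->]]] ->; move: bI nI; rewrite !mem_iota /= => b7 n31'.
have b31 : (b1 < 31)%N by lia.
rewrite -(br_dl_crd x b31 n31').
have b17 : (b1.-1 < 7)%N by lia.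
have := xb (Ordinal b17) => /=; rewrite prednK; last by lia.
by move=> ->; rewrite /crd mxE.
Qed.

Definition BT (a b : nat) : K := zK (cTz a.+1 b.+1 0).

Lemma brTT (a b : 'I_7) : br (Tb a.+1) (Tb b.+1) = BT a b *: Tb 0%N.
Proof.
have d1 (c : 'I_7) : nth 0%N degn c.+1 = 1%N by case: c => [[|[|[|[|[|[|[|]]]]]]]].
have a31 (c : 'I_7) : (c.+1 < 31)%N by have := ltn_ord c; lia.
rewrite (red_dl K qT cT) (bigD1 (inord 0)) //= big1 ?addr0 => [|i i0].
  by rewrite /cT !inordK.
have -> : cT (inord a.+1) (inord b.+1) i = 0; last by rewrite scale0r.
apply/eqP/negPn/negP => /(sl_deg table_struct); rewrite /dT !inordK // !d1 => iE.
have h : all (fun i => Nat.eqb i 0 || (0 < nth 0%N degn i)%N) I31 by [].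
have := I31_all h i => /orP[/Nat.eqb_spec i0'|]; last by lia.
by move: i0; rewrite -val_eqE /= inordK // i0' eqxx.
Qed.

Let linl := @red_linl K 31 qT cT.
Let linr := @red_linr K 31 qT cT.

Lemma T_odd (a : 'I_7) : par true (Tb a.+1).
Proof.
have a31 : (a.+1 < 31)%N by have := ltn_ord a; lia.
have := red_deg_par table_struct (rdeg_Tb a31).
by have -> : nth 0%N degn a.+1 = 1%N by case: a {a31} => [[|[|[|[|[|[|[|]]]]]]]].
Qed.

Lemma T0_even : par false (Tb 0%N).
Proof. exact: (red_deg_par table_struct (@rdeg_Tb 0 isT)). Qed.

Lemma klin_brl (w : M) : klin (fun x : M => br x w). Proof. by move=> a x y; apply: linl. Qed.
Lemma klin_brr (w : M) : klin (fun x : M => br w x). Proof. by move=> a x y; apply: linr. Qed.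

Lemma brMZl (c : K) (x w : M) : br (c *: x) w = c *: br x w.
Proof. by rewrite -[c *: x]addr0 linl (klin0 (klin_brl w)) addr0. Qed.

Lemma brMB (w x y : M) : br w (x - y) = br w x - br w y.
Proof. by rewrite addrC -scaleN1r linr scaleN1r addrC. Qed.

Lemma T_jac (a b : 'I_7) (x : M) :
  br (Tb a.+1) (br (Tb b.+1) x) + br (Tb b.+1) (br (Tb a.+1) x) = BT a b *: br (Tb 0%N) x.
Proof.
rewrite (red_jacobi table_struct x (@T_odd a) (@T_odd b)) brTT brMZl expr1 scaleN1r.
exact: subrK.
Qed.

Lemma T_comm (a : 'I_7) (x : M) : br (Tb a.+1) (br (Tb 0%N) x) = br (Tb 0%N) (br (Tb a.+1) x).
Proof.
have a31 : (a.+1 < 31)%N by have := ltn_ord a; lia.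
rewrite (red_jacobi table_struct x (@T_odd a) T0_even) andbF expr0 scale1r.
have -> : br (Tb a.+1) (Tb 0%N) = 0; last by rewrite (klin0 (klin_brl x)) add0r.
apply: crd_eq0 => n n31; apply: (rdeg_crd (red_deg_br table_struct (rdeg_Tb a31) (@rdeg_Tb 0 isT)) n31).
have -> : nth 0%N degn a.+1 = 1%N by case: a {a31} => [[|[|[|[|[|[|[|]]]]]]]].
by rewrite -[nth _ _ 0%N]/(0%N); lia.
Qed.

Lemma F2_gauged (k : nat) (Y : 'I_7 -> M) (w : M) : (0 < k <= 3)%N ->
  (forall b, rdeg (k%:Z - 1) (Y b)) -> rdeg (k%:Z - 2) w ->
  (forall a b : 'I_7, br (Tb a.+1) (Y b) + br (Tb b.+1) (Y a) = BT a b *: w) ->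
  (forall a : 'I_7, br (Tb a.+1) w = br (Tb 0%N) (Y a)) ->
  (forall g, g \in gauge k -> crd (Y (inord g.2.1.-1)) g.2.2.1 = 0) ->
  (forall b, Y b = 0) /\ w = 0.
Proof.
move=> k3 Yd wd YY Yw Yg; have kI : k \in [:: 1; 2; 3]%N by case: k k3 {Yd wd Yg} => [|[|[|[|]]]].
pose y i := if (i < 217)%N then crd (Y (inord (i %/ 31))) (i %% 31) else crd w (i - 217).
have yY b n : (b < 7)%N -> (n < 31)%N -> y (31 * b + n)%N = crd (Y (inord b)) n.
  move=> b7 n31; rewrite /y ifT; last by lia.
  by rewrite mulnC divnMDl // divn_small // addn0 modnMDl modn_small.
have yw n : y (217 + n)%N = crd w n by rewrite /y ltnNge leq_addr /= addKn.
have r1 b c n : (b < 7)%N -> (c < 31)%N -> (n < 31)%N ->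
    rowval (fun i => y (31 * b + i)%N) (adrow c n) = crd (br (Tb c) (Y (inord b))) n.
  move=> b7 c31 n31; rewrite br_dl_crd // !adrowP; apply: eq_bigr => j _; by rewrite yY.
have r2 c n : (c < 31)%N -> (n < 31)%N -> rowval (fun i => y (217 + i)%N) (adrow c n) = crd (br (Tb c) w) n.
  by move=> c31 n31; rewrite br_dl_crd // !adrowP; apply: eq_bigr => j _; rewrite yw.
have rT t x : x \in blocks k -> t \in x.2 -> rowval y (rowT t) = 0.
  move=> xb tx; have /allP/(_ x xb)/allP/(_ t tx) := allP blocks_wf k kI.
  case: t {tx} => [[|[|i]] [a [b n]]] /= /and3P[/Nat.ltb_lt/ssrnat.ltP a7 /Nat.ltb_lt/ssrnat.ltP n31].
  - move=> /Nat.ltb_lt/ssrnat.ltP b7; rewrite /rowA !(rowval_add idz_zK) !rowval_shift (rowval_nz idz_zK).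
    rewrite !r1 //; [|lia..]; have := YY (inord a) (inord b); rewrite !inordK // => /(congr1 (fun v => crd v n)).
    rewrite crdD crdZ addrA => ->.
    by rewrite /rowval big_seq1 /= yw zKN mulNr subrr.
  - move=> _; rewrite /rowB (rowval_add idz_zK) !rowval_shift (rowval_scale idz_zK) r1 // r2 //; last by lia.
    have := Yw (inord a); rewrite !inordK // => ->.
    by rewrite -[zK (-1)]/(-1) mulN1r addNr.
  move=> /hasP[g gk /andP[/Nat.eqb_spec ga /Nat.eqb_spec gb]].
  have b31 : (b < 31)%N.
    have /andP[/allP/(_ g gk) + _] := allP gauge_check k kI.
    by case/and5P=> _ /Nat.ltb_lt/ssrnat.ltP; rewrite gb.
  by rewrite /rowval big_seq1 zK1 mul1r yY // -[RHS](Yg g gk) ga gb.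
have y0 x u : x \in blocks k -> u \in x.1 -> y u = 0.
  move=> xb; have sol := allP (allP blocks_solve k kI) x xb.
  apply: (solvesP idz_zK good6_neq0 sol) => r /mapP[t tx ->]; exact: rT xb tx.
have nI n : (n < 31)%N -> n \in I31 by rewrite mem_iota.
have cov := allP blocks_cover k kI.
split=> [b|]; apply: crd_eq0 => n n31; have /andP[c1 c2] := allP cov n (nI n n31).
  move: c1; case: Nat.eqb_spec => [_ /orP[//|/allP/(_ (b : nat)) c1]|E _]; last by apply: (rdeg_crd (Yd b) n31); lia.
  have b7 : (b : nat) \in iota 0 7 by rewrite mem_iota ltn_ord.
  have /hasP[x xb ux] := c1 b7.
  by rewrite -[b]inord_val -yY // (y0 x).
move: c2; case: Nat.eqb_spec => [_ /orP[//|/hasP[x xb ux]]|E _]; first by rewrite -yw (y0 x).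
by apply: (rdeg_crd wd n31); lia.
Qed.

Lemma F2_table (k : nat) (Y : 'I_7 -> M) (w : M) : (0 < k <= 3)%N ->
  (forall b, rdeg (k%:Z - 1) (Y b)) -> rdeg (k%:Z - 2) w ->
  (forall a b : 'I_7, br (Tb a.+1) (Y b) + br (Tb b.+1) (Y a) = BT a b *: w) ->
  (forall a : 'I_7, br (Tb a.+1) w = br (Tb 0%N) (Y a)) ->
  exists2 x, rdeg k%:Z x & forall b : 'I_7, Y b = br (Tb b.+1) x.
Proof.
move=> k3 Yd wd YY Yw; have kI : k \in [:: 1; 2; 3]%N by case: k k3 {Yd wd} => [|[|[|[|]]]].
have /andP[gwf guniq] := allP gauge_check k kI.
pose x : M := \sum_(g <- gauge k) (crd (Y (inord g.2.1.-1)) g.2.2.1 / zK g.2.2.2) *: Tb g.1.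
have sR := @red_deg_sub K 31 qT dT cT k%:Z.
have xk : rdeg k%:Z x.
  rewrite /x big_seq; apply: (subspace_sum sR) => g gk; apply: (subspaceZ sR).
  have /and5P[/Nat.ltb_lt/ssrnat.ltP g31 _ _ /Nat.eqb_spec gd _] := allP gwf g gk.
  by have := rdeg_Tb g31; rewrite gd; have -> : (k + 2)%N%:Z - 2 = k%:Z by lia.
exists x => //.
have degT (a : 'I_7) : rdeg (-1) (Tb a.+1).
  have a31 : (a.+1 < 31)%N by have := ltn_ord a; lia.
  have := rdeg_Tb a31.
  by have -> : nth 0%N degn a.+1 = 1%N by case: a {a31} => [[|[|[|[|[|[|[|]]]]]]]].
have subB (l : int) (u v : M) : rdeg l u -> rdeg l v -> rdeg l (u - v).
  move=> hu hv; have sl := @red_deg_sub K 31 qT dT cT l.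
  by apply: (subspaceD sl) => //; apply: (subspaceN sl).
have [] := @F2_gauged k (fun b => Y b - br (Tb b.+1) x) (w - br (Tb 0%N) x) k3.
- move=> b; apply: subB => //; have := red_deg_br table_struct (degT b) xk.
  by have -> : -1 + k%:Z = k%:Z - 1 by lia.
- apply: subB => //; have := red_deg_br table_struct (@rdeg_Tb 0 isT) xk.
  by have -> : (nth 0%N degn 0)%:Z - 2 + k%:Z = k%:Z - 2 by rewrite -[nth _ _ 0%N]/(0%N); lia.
- by move=> a b; rewrite !brMB scalerBr -YY -T_jac opprD !addrA; congr (_ - _); rewrite addrAC.
- by move=> a; rewrite !brMB Yw T_comm.
- move=> g gk; rewrite crdB.
  have /and5P[/Nat.ltb_lt/ssrnat.ltP g31 /Nat.ltb_lt/ssrnat.ltP j31 b8 _ /andP[gc /allP gg]] := allP gwf g gk.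
  have bE : (inord g.2.1.-1 : 'I_7).+1 = g.2.1 by rewrite inordK; move: b8; case: (g.2.1 : nat) => // b; lia.
  rewrite bE /x (klin_sum _ _ _ _ (klin_brr _)).
  have crd_sum (F : nat * (nat * (nat * Z)) -> M) : crd (\sum_(g <- gauge k) F g) g.2.2.1 =
      \sum_(g' <- gauge k) crd (F g') g.2.2.1 by rewrite /crd summxE.
  rewrite crd_sum; apply/eqP; rewrite subr_eq0 eq_sym; apply/eqP.
  have b31 : (g.2.1 < 31)%N by case/andP: b8 => _; move: (g.2.1 : nat); lia.
  have E g' : g' \in gauge k -> crd ((crd (Y (inord g'.2.1.-1)) g'.2.2.1 / zK g'.2.2.2) *: br (Tb g.2.1) (Tb g'.1)) g.2.2.1 =
      (crd (Y (inord g'.2.1.-1)) g'.2.2.1 / zK g'.2.2.2) * (if g' == g then zK g.2.2.2 else 0).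
    move=> g'k; have -> (c : K) (v : M) n : crd (c *: v) n = c * crd v n by rewrite /crd mxE.
    congr (_ * _); have /and5P[/Nat.ltb_lt/ssrnat.ltP g31' _ _ _ _] := allP gwf g' g'k.
    have /Z.eqb_spec cE := gg g' g'k.
    rewrite (br_dl_crd _ b31 j31) adrowP (bigD1 (Ordinal g31')) //= big1 ?addr0 => [|i ig].
      rewrite /crd mxE !eqxx mulr1 cE; case: Nat.eqb_spec => [E|E].
        by rewrite (uniq_map_inj guniq g'k gk E) eqxx.
      by rewrite zK0; case: eqP => // g'g; case: E; rewrite g'g.
    rewrite /crd mxE /= (_ : (inord i == inord g'.1 :> 'I_31) = false) ?mulr0 //.
    by apply: contraNF ig => /eqP; rewrite inord_val => ->; rewrite -val_eqE /= inordK.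
  rewrite big_seq (eq_bigr _ E) -big_seq (bigD1_seq g gk (map_uniq guniq)) /= eqxx divfK ?good6_neq0 //.
  by rewrite big1 ?addr0 // => g' /negPf->; rewrite mulr0.
move=> Y0 _ b; apply/eqP; rewrite -subr_eq0; apply/eqP; exact: Y0.
Qed.

End TableAlgebra.

(** * Triangular decomposition *)

Section Triangular.
Variables (F : fieldType) (G : superAlg F) (n : nat) (A : 'M[int]_n) (odd_node : 'I_n -> bool).
Variables (Ep Em H : 'I_n -> G).
Hypothesis linl : forall (a : F) (x y w : G), br (a *: x + y) w = a *: br x w + br y w.
Hypothesis linr : forall (a : F) (x y w : G), br w (a *: x + y) = a *: br w x + br w y.
Hypothesis skew : forall s t (x y : G), par s x -> par t y -> br x y = - ((-1) ^+ (s && t) *: br y x).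
Hypothesis jac : forall s t (x y w : G), par s x -> par t y ->
  br x (br y w) = br (br x y) w + (-1) ^+ (s && t) *: br y (br x w).
Hypothesis par_sub : forall s, subspace (par (s := G) s).
Hypothesis par_br : forall s t (x y : G), par s x -> par t y -> par (s (+) t) (br x y).
Hypothesis pEp : forall i, par (odd_node i) (Ep i).
Hypothesis pEm : forall i, par (odd_node i) (Em i).
Hypothesis pH : forall i, par false (H i).
Hypothesis rEE : forall i j, br (Ep i) (Em j) = if i == j then H i else 0.
Hypothesis rHH : forall i j, br (H i) (H j) = 0.
Hypothesis rHEp : forall i j, br (H i) (Ep j) = (A i j)%:~R *: Ep j.
Hypothesis rHEm : forall i j, br (H i) (Em j) = - ((A i j)%:~R *: Em j).

(* Homogeneous elements of the subalgebra generated by the Chevalley generators,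
   with their parity and principal height. *)
Inductive chev : bool -> int -> G -> Prop :=
| chev_Ep i : chev (odd_node i) 1 (Ep i)
| chev_Em i : chev (odd_node i) (-1) (Em i)
| chev_H i : chev false 0 (H i)
| chev_0 s h : chev s h 0
| chev_lin s h (a : F) x y : chev s h x -> chev s h y -> chev s h (a *: x + y)
| chev_br s t h k x y : chev s h x -> chev t k y -> chev (s (+) t) (h + k) (br x y).

(* The sum of the span of iterated brackets of the Em, of the span of the H, and
   of the span of iterated brackets of the Ep. *)
Inductive tri : int -> G -> Prop :=
| tri_Ep i : tri 1 (Ep i)
| tri_Em i : tri (-1) (Em i)
| tri_H i : tri 0 (H i)
| tri_0 h : tri h 0
| tri_lin h (a : F) x y : tri h x -> tri h y -> tri h (a *: x + y)
| tri_brp h i x : 0 < h -> tri h x -> tri (h + 1) (br (Ep i) x)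
| tri_brm h i x : h < 0 -> tri h x -> tri (h - 1) (br (Em i) x).

Let br0 (w : G) : br 0 w = 0.
Proof. by have /eqP := linl 1 0 0 w; rewrite !scale1r addr0 -subr_eq0 opprD addNKr oppr_eq0 => /eqP. Qed.
Let br0r (w : G) : br w 0 = 0.
Proof. by have /eqP := linr 1 0 0 w; rewrite !scale1r addr0 -subr_eq0 opprD addNKr oppr_eq0 => /eqP. Qed.
Let brZ (a : F) (x w : G) : br (a *: x) w = a *: br x w.
Proof. by rewrite -[a *: x]addr0 linl br0 addr0. Qed.

Lemma chev_par s h x : chev s h x -> par s x.
Proof.
by elim=> {s h x} // [s|s h a x y _ IHx _ IHy|s t h k x y _ IHx _ IHy];
  [case: (par_sub s)|case: (par_sub s) => _; apply|apply: par_br].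
Qed.

Lemma triZ h (a : F) x : tri h x -> tri h (a *: x).
Proof. by move=> hx; rewrite -[_ *: _]addr0; apply: tri_lin => //; apply: tri_0. Qed.

Lemma triD h x y : tri h x -> tri h y -> tri h (x + y).
Proof. by move=> hx; rewrite -[x]scale1r; apply: tri_lin. Qed.

Lemma tri_span x : tri 0 x -> span_of H x.
Proof.
suff h h' y : tri h' y -> h' = 0 -> span_of H y by move/h; apply.
have s0 i (a : 'I_n -> F) : a = (fun j => (j == i)%:R) -> \sum_j a j *: H j = H i.
  move=> ->; rewrite (bigD1 i) //= eqxx scale1r big1 ?addr0 // => j /negPf->; exact: scale0r.
elim=> {h' y x} [i|i|i|h'|h' a x y _ IHx _ IHy|h' i x h0 _ _|h' i x h0 _ _] // E; try by lia.
- by exists (fun j => (j == i)%:R); rewrite (s0 i).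
- by exists (fun=> 0); rewrite big1 // => j _; rewrite scale0r.
have [[u ->] [v ->]] := (IHx E, IHy E); exists (fun j => a * u j + v j).
by rewrite scaler_sumr -big_split; apply: eq_bigr => j _ /=; rewrite scalerDl scalerA.
Qed.

Lemma tri_adH i h x : tri h x -> tri h (br (H i) x).
Proof.
elim=> {h x} [j|j|j|h|h a x y _ IHx _ IHy|h j x h0 hx IH|h j x h0 hx IH].
- by rewrite rHEp; apply: triZ; apply: tri_Ep.
- by rewrite rHEm -scaleNr; apply: triZ; apply: tri_Em.
- by rewrite rHH; apply: tri_0.
- by rewrite br0r; apply: tri_0.
- by rewrite linr; apply: tri_lin.
- rewrite (jac x (pH i) (pEp j)) rHEp brZ expr0 scale1r.
  by apply: tri_lin; apply: tri_brp.
rewrite (jac x (pH i) (pEm j)) rHEm -scaleNr brZ expr0 scale1r.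
by apply: tri_lin; apply: tri_brm.
Qed.

Lemma tri_adEp i h x : tri h x -> tri (h + 1) (br (Ep i) x).
Proof.
elim=> {h x} [j|j|j|h|h a x y _ IHx _ IHy|h j x h0 hx IH|h j x h0 hx IH].
- by apply: tri_brp => //; apply: tri_Ep.
- by rewrite rEE; case: eqP => _; [apply: tri_H|apply: tri_0].
- rewrite (skew (pEp i) (pH j)) rHEp andbF expr0 scale1r -scaleNr; apply: triZ; exact: tri_Ep.
- by rewrite br0r; apply: tri_0.
- by rewrite linr; apply: tri_lin.
- by apply: tri_brp; [lia|apply: tri_brp].
rewrite (jac x (pEp i) (pEm j)) rEE -addrA [-1 + 1]addrC; apply: triD.
  by rewrite subrr addr0; case: eqP => _; [apply: tri_adH|rewrite br0; apply: tri_0].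
apply: triZ; rewrite addrA; case: (ltrP (h + 1) 0) => h1; first exact: tri_brm.
have hE : h + 1 = 0 by lia.
rewrite hE in IH *; have [a ->] := tri_span IH.
apply: (big_ind (fun y => tri (0 - 1) (br (Em j) y))) => [|u v hu hv|k _].
- by rewrite br0r; apply: tri_0.
- by rewrite -[u]scale1r linr; apply: tri_lin.
rewrite -[_ *: H k]addr0 linr br0r addr0; apply: triZ.
rewrite (skew (pEm j) (pH k)) rHEm andbF expr0 scale1r opprK; apply: triZ; exact: tri_Em.
Qed.

Lemma tri_adEm i h x : tri h x -> tri (h - 1) (br (Em i) x).
Proof.
have EmEp j : br (Em i) (Ep j) = if j == i then - ((-1) ^+ (odd_node i && odd_node j) *: H i) else 0.
  by rewrite (skew (pEm i) (pEp j)) rEE; case: eqP => [->|_] //; rewrite scaler0 oppr0.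
elim=> {h x} [j|j|j|h|h a x y _ IHx _ IHy|h j x h0 hx IH|h j x h0 hx IH].
- rewrite EmEp subrr; case: eqP => _; last exact: tri_0.
  by rewrite -scaleNr; apply: triZ; apply: tri_H.
- by apply: tri_brm => //; apply: tri_Em.
- rewrite (skew (pEm i) (pH j)) rHEm andbF expr0 scale1r opprK; apply: triZ; exact: tri_Em.
- by rewrite br0r; apply: tri_0.
- by rewrite linr; apply: tri_lin.
- rewrite (jac x (pEm i) (pEp j)) EmEp -addrA; apply: triD.
    rewrite subrr addr0; case: eqP => _; last by rewrite br0; apply: tri_0.
    by rewrite -scaleNr brZ; apply: triZ; apply: tri_adH.
  apply: triZ; rewrite [1 - 1]addrC addrA; case: (ltrP 0 (h - 1)) => h1; first exact: tri_brp.
  have hE : h - 1 = 0 by lia.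
  rewrite hE in IH *; have [a ->] := tri_span IH.
  apply: (big_ind (fun y => tri (0 + 1) (br (Ep j) y))) => [|u v hu hv|k _].
  - by rewrite br0r; apply: tri_0.
  - by rewrite -[u]scale1r linr; apply: tri_lin.
  rewrite -[_ *: H k]addr0 linr br0r addr0; apply: triZ.
  rewrite (skew (pEp j) (pH k)) rHEp andbF expr0 scale1r -scaleNr; apply: triZ; exact: tri_Ep.
by apply: tri_brm; [lia|apply: tri_brm].
Qed.

Lemma chev_tri s h x : chev s h x -> tri h x.
Proof.
have ad s' h' x' : chev s' h' x' -> forall k y, tri k y -> tri (h' + k) (br x' y).
  elim=> {s' h' x'} [i|i|i|s' h'|s' h' a x' y' _ IHx _ IHy|s' t h' k' x' y' cx IHx cy IHy] k y hy.
  - by rewrite addrC; apply: tri_adEp.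
  - by rewrite addrC; apply: tri_adEm.
  - by rewrite add0r; apply: tri_adH.
  - by rewrite br0; apply: tri_0.
  - by rewrite linl; apply: tri_lin; [apply: IHx|apply: IHy].
  have -> : br (br x' y') y = br x' (br y' y) - (-1) ^+ (s' && t) *: br y' (br x' y).
    by rewrite (jac y (chev_par cx) (chev_par cy)) addrK.
  apply: triD; first by rewrite -addrA; apply: IHx; apply: IHy.
  by rewrite -scaleNr; apply: triZ; rewrite [h' + k']addrC -addrA; apply: IHy; apply: IHx.
elim=> {s h x} [i|i|i|s h|s h a x y _ IHx _ IHy|s t h k x y cx _ _ IHy].
- exact: tri_Ep. - exact: tri_Em. - exact: tri_H. - exact: tri_0. - exact: tri_lin.
exact: ad cx _ _ IHy.
Qed.

Lemma chev_sub s h : subspace (chev s h).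
Proof. by split; [apply: chev_0|move=> a x y; apply: chev_lin]. Qed.

End Triangular.

Lemma eigen_sum (F : numFieldType) (V : lmodType F) (f : V -> V) (mu : int) :
  (forall (a : F) x y, f (a *: x + y) = a *: f x + f y) ->
  forall (I : Type) (P : pred I) (lam : I -> int) (r : seq I) (X : I -> V),
  (forall i, P i -> f (X i) = (lam i)%:~R *: X i) -> (forall i, P i -> lam i != mu) ->
  f (\sum_(i <- r | P i) X i) = mu%:~R *: \sum_(i <- r | P i) X i ->
  \sum_(i <- r | P i) X i = 0.
Proof.
move=> fl I P lam.
have f0 : f 0 = 0 by have /eqP := fl 1 0 0; rewrite !scale1r addr0 -subr_eq0 opprD addNKr oppr_eq0 => /eqP.
have fZ a x : f (a *: x) = a *: f x by rewrite -[a *: x]addr0 fl f0 addr0.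
have fD x y : f (x + y) = f x + f y by rewrite -[x]scale1r fl !scale1r.
elim=> [|i r IH] X HX HP; first by rewrite !big_nil.
rewrite !big_cons; case Pi: (P i); last exact: IH.
set w' := \sum_(_ <- r | _) _; set w := X i + w' => fw.
have fs : f w' = \sum_(j <- r | P j) (lam j)%:~R *: X j.
  by rewrite /w' (big_morph f fD f0); apply: eq_bigr => j; apply: HX.
have E : \sum_(j <- r | P j) ((lam j - lam i)%:~R : F) *: X j = (mu - lam i)%:~R *: w.
  under eq_bigr => j _ do rewrite intrB scalerBl.
  rewrite sumrB -scaler_sumr -fs intrB scalerBl -fw /w fD HX // scalerDr opprD.
  by rewrite addrACA subrr add0r.
have /eqP : (mu - lam i)%:~R *: w = 0 :> V.
  rewrite -E; apply: IH => // [j Pj|]; last by rewrite E fZ fw !scalerA mulrC.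
  by rewrite fZ HX // !scalerA mulrC.
by rewrite scaler_eq0 intr_eq0 subr_eq0 eq_sym (negPf (HP i Pi)) => /eqP.
Qed.

Lemma keys_ltP r x : keys_lt r -> x \in r -> (x.1 < 31)%N.
Proof. by move=> /allP h /h /Nat.ltb_lt/ssrnat.ltP. Qed.

Lemma brow_lt i j : (i < 31)%N -> (j < 31)%N -> keys_lt (brow i j).
Proof. by move=> i31 j31; apply: (I31_all (I31_all brow_keys (Ordinal i31)) (Ordinal j31)). Qed.

Lemma bind_lt g r : (g < 31)%N -> keys_lt r -> keys_lt (bind r (brow g)).
Proof.
move=> g31 kr; apply/allP => y /flattenP[s /mapP[x xr ->]] /mapP[y' y'r ->] /=.
have := keys_ltP kr xr; move=> /(brow_lt g31) kb.
by apply/Nat.ltb_lt/ssrnat.ltP; apply: keys_ltP kb y'r.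
Qed.

Section Family.
Variables (K : fieldType) (G : superAlg K) (t : nat -> G).
Hypothesis linr : forall (a : K) (x y w : G), br w (a *: x + y) = a *: br w x + br w y.
Definition el (r : lrow) : G := \sum_(x <- r) zK K x.2 *: t x.1.
Hypothesis tbr : forall a b, (a < 31)%N -> (b < 31)%N -> br (t a) (t b) = el (brow a b).

Lemma elE r : keys_lt r -> el r = \sum_(n < 31) zK K (rcoef n r) *: t n.
Proof.
elim: r => [_|x r IH]; first by rewrite /el big_nil big1 // => i _; rewrite scale0r.
rewrite /el big_cons => /andP[/Nat.ltb_lt/ssrnat.ltP x31 /IH E].
rewrite -/(el r) E (bigD1 (Ordinal x31)) //= [in RHS](bigD1 (Ordinal x31)) //= Nat.eqb_refl zKD scalerDl addrA.
congr (_ + _); apply: eq_bigr => i ix; case: Nat.eqb_spec => // xi.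
by case/negP: ix; rewrite -val_eqE /= xi.
Qed.

Lemma el_coef r n : keys_lt r -> (n < 31)%N -> all (fun l => Z.eqb (rcoef l r) 0 || Nat.eqb l n) I31 ->
  el r = zK K (rcoef n r) *: t n.
Proof.
move=> kr n31 rn; rewrite elE // (bigD1 (Ordinal n31)) //= big1 ?addr0 // => i ni.
have /orP[/Z.eqb_spec ->|/Nat.eqb_spec E] := I31_all rn i; first exact: scale0r.
by case/negP: ni; rewrite -val_eqE /= E.
Qed.

Lemma el_bind g r : (g < 31)%N -> keys_lt r -> br (t g) (el r) = el (bind r (brow g)).
Proof.
move=> g31; have br0 : br (t g) 0 = 0.
  by have /eqP := linr 1 0 0 (t g); rewrite !scale1r addr0 -subr_eq0 opprD addNKr oppr_eq0 => /eqP.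
elim: r => [_|x r IH]; first by rewrite /el !big_nil.
move=> /andP[/Nat.ltb_lt/ssrnat.ltP x31 /IH E].
rewrite [in LHS]/el big_cons linr tbr // -/(el r) E.
have -> : bind (x :: r) (brow g) = [seq (y.1, (x.2 * y.2)%Z) | y <- brow g x.1] ++ bind r (brow g) by [].
rewrite [in RHS]/el big_cat -/(el _); congr (_ + _); rewrite /el scaler_sumr big_map.
by apply: eq_bigr => y _; rewrite scalerA -zKM.
Qed.

End Family.

Section TableFamily.
Variable K : fieldType.
Notation Tb := (fun n : nat => dl K qT cT (inord n)).

Lemma Tb_br a b : (a < 31)%N -> (b < 31)%N -> br (Tb a) (Tb b) = el Tb (brow a b).
Proof.
move=> a31 b31; rewrite (elE _ (brow_lt a31 b31)) (red_dl K qT cT); apply: eq_bigr => i _.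
by rewrite /cT !inordK // inord_val.
Qed.

End TableFamily.

Definition gE (i : 'I_3) : nat := nth 0%N [:: 23; 18; 17]%N i.
Definition gF (i : 'I_3) : nat := nth 0%N [:: 7; 12; 13]%N i.
Definition gH (i : 'I_3) : nat := nth 0%N [:: 14; 15; 16]%N i.
Definition Az (i j : 'I_3) : Z :=
  nth 0%Z (nth [::] [:: [:: 0; 1; 0]; [:: -1; 2; -3]; [:: 0; -1; 2]]%Z i) j.

Lemma AzE (i j : 'I_3) : ag2_cartan i j = int_of_Z (Az i j).
Proof. by rewrite mxE; case: i => [[|[|[|//]]] i3]; case: j => [[|[|[|//]]] j3]. Qed.

Lemma g31 (i : 'I_3) : [/\ gE i < 31, gF i < 31 & gH i < 31]%N.
Proof. by case: i => [[|[|[|//]]] i3]. Qed.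

Definition row_one (n : nat) (c : Z) : lrow := if Z.eqb c 0 then [::] else [:: (n, c)].

Lemma brow_chev (i j : 'I_3) : [/\ brow (gE i) (gF j) = if i == j then [:: (gH i, 1%Z)] else [::],
  brow (gH i) (gH j) = [::], brow (gH i) (gE j) = row_one (gE j) (Az i j) &
  brow (gH i) (gF j) = row_one (gF j) (- Az i j)].
Proof. by case: i => [[|[|[|//]]] i3]; case: j => [[|[|[|//]]] j3]. Qed.

Lemma el_one (K : fieldType) (G : superAlg K) (t : nat -> G) n c : el t (row_one n c) = zK K c *: t n.
Proof.
rewrite /row_one /el; case: Z.eqb_spec => [->|_]; first by rewrite big_nil scale0r.
exact: big_seq1.
Qed.

Definition hT (i : 'I_31) : int := (nth 0%N htn i)%:Z - 10.

Lemma height_check : all (fun i => all (fun j => all (fun x =>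
  Nat.eqb (nth 0%N htn x.1 + 10) (nth 0%N htn i + nth 0%N htn j)) (brow i j)) I31) I31.
Proof. by vm_compute. Qed.

Lemma hT_br (i j k : 'I_31) : cT i j k != 0 -> hT k = hT i + hT j.
Proof.
rewrite /cT /cTz => cn; have kin : (k : nat) \in [seq x.1 | x <- brow i j].
  by apply/negPn/negP => /rcoef_notin E; rewrite E eqxx in cn.
have [x xr xk] := mapP kin; have /allP/(_ x xr)/Nat.eqb_spec := I31_all (I31_all height_check i) j.
rewrite /hT -xk; move: (nth _ _ _) (nth _ _ _) (nth _ _ _) => u v w; lia.
Qed.

Definition recipes : seq (nat * (nat * (nat * nat))) :=
  [:: (24,(1,(23,18))); (19,(1,(18,17))); (20,(2,(18,17))); (21,(3,(18,17))); (25,(1,(17,24)));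
      (22,(1,(17,21))); (6,(1,(7,12))); (11,(1,(12,13))); (10,(2,(12,13))); (9,(3,(12,13)));
      (5,(1,(13,6))); (8,(1,(13,9))); (26,(1,(23,20))); (27,(1,(23,21))); (28,(1,(23,22)));
      (29,(1,(18,28))); (4,(1,(7,10))); (3,(1,(7,9))); (2,(1,(7,8))); (1,(1,(12,2)));
      (30,(1,(23,29))); (0,(1,(7,1)))]%N.

Definition itrow (k g p : nat) : lrow := ssrnat.iter k (fun r => bind r (brow g)) [:: (p, 1%Z)].
Definition factz (k : nat) : Z := nth 0%Z [:: 1; 1; 2; 6]%Z k.

Lemma factzE (K : fieldType) k : (k <= 3)%N -> zK K (factz k) = k`!%:R.
Proof. by case: k => [|[|[|[|]]]]. Qed.

Lemma recipes_check : all (fun x => let: (l, (k, (g, p))) := x in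
  [&& Nat.ltb l 31, (0 < k <= 3)%N, Nat.ltb g 31, Nat.ltb p 31,
      Z.eqb (rcoef l (itrow k g p)) (factz k),
      all (fun n => Z.eqb (rcoef n (itrow k g p)) 0 || Nat.eqb n l) I31,
      Nat.eqb (nth 0%N htn l + k * 10) (k * nth 0%N htn g + nth 0%N htn p),
      Nat.eqb (nth 0%N degn l + k * 2) (k * nth 0%N degn g + nth 0%N degn p) &
      (k == 1) || (g \in [:: 12; 13; 17; 18])]) recipes%N.
Proof. by vm_compute. Qed.

Definition gens31 : seq nat := [:: 7; 12; 13; 14; 15; 16; 17; 18; 23]%N.

Fixpoint derivable_from (kn : seq nat) (rs : seq (nat * (nat * (nat * nat)))) : bool :=
  if rs is (l, (_, (g, p))) :: rs' then [&& g \in kn, p \in kn & derivable_from (l :: kn) rs'] else true.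

Lemma recipes_ind (Q : nat -> Prop) : (forall g, g \in gens31 -> Q g) ->
  (forall l k g p, (l, (k, (g, p))) \in recipes -> Q g -> Q p -> Q l) ->
  forall l, (l < 31)%N -> Q l.
Proof.
move=> Qg Qr.
suff h rs : {subset rs <= recipes} -> forall kn : seq nat, (forall g, g \in kn -> Q g) ->
    derivable_from kn rs -> forall l, l \in kn ++ [seq x.1 | x <- rs] -> Q l.
  move=> l l31; apply: (h recipes _ gens31 Qg) => //.
  by have c : all (fun l => l \in gens31 ++ [seq x.1 | x <- recipes]) I31 by []; apply: (I31_all c (Ordinal l31)).
elim: rs => [|[l [k [g p]]] rs IH] sub kn Qk /=; first by move=> _ l; rewrite cats0; apply: Qk.
move=> /and3P[gk pk ok] l' l'in; apply: (IH _ (l :: kn) _ ok) => [x xr|x|].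
- by apply: sub; rewrite inE xr orbT.
- rewrite inE => /predU1P[->|/Qk//]; apply: (Qr l k g p (sub _ _) (Qk g gk) (Qk p pk)).
  exact: mem_head.
by move: l'in; rewrite -cat_rcons !mem_cat mem_rcons.
Qed.

Definition good0 (c : Z) : bool := ~~ Z.eqb c 0.

Lemma raise_solve : solves idz good0 (iota 0 30) [seq adrow x.1 x.2 | x <- [seq (b, n) | b <- [:: 23; 18; 17], n <- I31]]%N.
Proof. by vm_compute. Qed.

Definition lowering : seq 'I_3 := [seq inord i | i <- [:: 0; 1; 0; 2; 1; 1; 1; 2]%N].
Definition lowrow : lrow := foldl (fun r i => bind r (brow (nth 0%N [:: 7; 12; 13]%N i))) [:: (30%N, 1%Z)]
  [:: 0; 1; 0; 2; 1; 1; 1; 2]%N.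

Lemma lowrow_check : all (fun n => Z.eqb (rcoef n lowrow) 0 || Nat.eqb n 16) I31 && good0 (rcoef 16 lowrow).
Proof. by vm_compute. Qed.

Lemma divided_check : all (fun g => all (fun l =>
  all (fun k => all (fun n => Z.eqb (Z.modulo (rcoef n (itrow k g l)) (factz k)) 0) I31) [:: 0; 1; 2; 3] &&
  all (fun n => Z.eqb (rcoef n (itrow 4 g l)) 0) I31) I31) [:: 12; 13; 17; 18]%N.
Proof. by vm_compute. Qed.

Section ProductAlgebra.
Variables (F : numFieldType) (L : superAlg F) (Ep Em H : 'I_3 -> L).
Hypothesis hL : is_gA ag2_cartan ag2_odd Ep Em H.
Let LL := gA_lie hL.
Notation M := (reduction F qT cT).
Notation Tb := (fun n : nat => dl F qT cT (inord n) : M).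
Notation rht := (@red_deg F 31 qT hT cT).

Definition PA : superAlg F := @SuperAlg F (L * M)%type
  (fun s p => par s p.1 /\ par s p.2) (fun p p' => (br p.1 p'.1, br p.2 p'.2)).

Definition pEp (i : 'I_3) : PA := (Ep i, Tb (gE i)).
Definition pEm (i : 'I_3) : PA := (Em i, Tb (gF i)).
Definition pH (i : 'I_3) : PA := (H i, Tb (gH i)).

Lemma P_linl (a : F) (x y w : PA) : br (a *: x + y) w = a *: br x w + br y w.
Proof. by congr pair; [apply: (lie_linl LL)|apply: red_linl]. Qed.

Lemma P_linr (a : F) (x y w : PA) : br w (a *: x + y) = a *: br w x + br w y.
Proof. by congr pair; [apply: (lie_linr LL)|apply: red_linr]. Qed.

Lemma P_skew s t (x y : PA) : par s x -> par t y -> br x y = - ((-1) ^+ (s && t) *: br y x).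
Proof.
move=> [x1 x2] [y1 y2].
by congr pair; [apply: (lie_skew LL)|apply: (red_skew table_struct)].
Qed.

Lemma P_jac s t (x y w : PA) : par s x -> par t y ->
  br x (br y w) = br (br x y) w + (-1) ^+ (s && t) *: br y (br x w).
Proof.
move=> [x1 x2] [y1 y2].
by congr pair; [apply: (lie_jacobi LL)|apply: (red_jacobi table_struct)].
Qed.

Lemma redT_par_sub s : subspace (par (s := M) s).
Proof.
split=> [i|a x y xs ys i]; first by rewrite mxE eqxx.
rewrite !mxE => n0; case: (eqVneq ((x : 'rV[F]_31) 0 i) 0) => [x0|/xs//].
by apply: ys; apply: contraNneq n0 => ->; rewrite x0 mulr0 addr0.
Qed.

Lemma redT_par_br s t (x y : M) : par s x -> par t y -> par (s (+) t) (br x y).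
Proof.
move=> xs yt k; rewrite mxE; apply: contraNeq => qk; apply/eqP; rewrite big1 // => i _.
rewrite big1 // => j _; case: (eqVneq ((x : 'rV[F]_31) 0 i) 0) => [->|/xs qi]; first by rewrite mulr0 mul0r.
case: (eqVneq ((y : 'rV[F]_31) 0 j) 0) => [->|/yt qj]; first by rewrite mulr0.
case: (eqVneq (cT i j k) 0) => [->|/(sl_deg table_struct) dE]; first by rewrite !mul0r.
by case/eqP: qk; rewrite -qi -qj !(sl_par table_struct) dE odd_absD.
Qed.

Lemma P_par_sub s : subspace (par (s := PA) s).
Proof.
have [l0 ll] := lie_par LL s; have [m0 ml] := redT_par_sub s.
by split=> [|a x y [x1 x2] [y1 y2]]; split=> //; [apply: ll|apply: ml].
Qed.

Lemma P_par_br s t (x y : PA) : par s x -> par t y -> par (s (+) t) (br x y).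
Proof. by move=> [x1 x2] [y1 y2]; split; [apply: (lie_br_par LL)|apply: redT_par_br]. Qed.

Lemma Tb_par n : (n < 31)%N -> par (oddT n) (Tb n).
Proof. move=> n31 i; rewrite /dl mxE eqxx andTb; case: (i =P inord n) => [->|_]; last by rewrite eqxx.
by rewrite /qT inordK. Qed.

Lemma P_pEp i : par (ag2_odd i) (pEp i).
Proof.
split; first exact: (gA_parEp hL).
have [e31 _ _] := g31 i; have := Tb_par e31.
by case: i {e31} => [[|[|[|//]]] i3].
Qed.

Lemma P_pEm i : par (ag2_odd i) (pEm i).
Proof.
split; first exact: (gA_parEm hL).
have [_ f31 _] := g31 i; have := Tb_par f31.
by case: i {f31} => [[|[|[|//]]] i3].
Qed.

Lemma P_pH i : par false (pH i).
Proof.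
split; first exact: (gA_parH hL).
have [_ _ h31] := g31 i; have := Tb_par h31.
by case: i {h31} => [[|[|[|//]]] i3].
Qed.

Lemma P_EE i j : br (pEp i) (pEm j) = if i == j then pH i else 0.
Proof.
have -> : br (pEp i) (pEm j) = (br (Ep i) (Em j), br (Tb (gE i)) (Tb (gF j))) by [].
have [[ei _ _] [_ fj _]] := (g31 i, g31 j); have [E _ _ _] := brow_chev i j.
rewrite (gA_EE hL) Tb_br // E; case: eqP => _; last by rewrite /el big_nil.
by rewrite /el big_seq1 scale1r.
Qed.

Lemma P_HH i j : br (pH i) (pH j) = 0.
Proof.
have -> : br (pH i) (pH j) = (br (H i) (H j), br (Tb (gH i)) (Tb (gH j))) by [].
have [[_ _ hi] [_ _ hj]] := (g31 i, g31 j); have [_ E _ _] := brow_chev i j.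
by rewrite (gA_HH hL) Tb_br // E /el big_nil.
Qed.

Lemma P_HEp i j : br (pH i) (pEp j) = (ag2_cartan i j)%:~R *: pEp j.
Proof.
have -> : br (pH i) (pEp j) = (br (H i) (Ep j), br (Tb (gH i)) (Tb (gE j))) by [].
have [[_ _ hi] [ej _ _]] := (g31 i, g31 j); have [_ _ E _] := brow_chev i j.
by rewrite (gA_HEp hL) Tb_br // E el_one AzE.
Qed.

Lemma P_HEm i j : br (pH i) (pEm j) = - ((ag2_cartan i j)%:~R *: pEm j).
Proof.
have -> : br (pH i) (pEm j) = (br (H i) (Em j), br (Tb (gH i)) (Tb (gF j))) by [].
have [[_ _ hi] [_ fj _]] := (g31 i, g31 j); have [_ _ _ E] := brow_chev i j.
by rewrite (gA_HEm hL) Tb_br // E el_one zKN scaleNr AzE.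
Qed.

Notation DD := (@chev F PA 3 ag2_odd pEp pEm pH).

Lemma DD_par s h p : DD s h p -> par s p.
Proof. exact: (chev_par P_par_sub P_par_br P_pEp P_pEm P_pH). Qed.

Lemma DD_span s (p : PA) : DD s 0 p -> span_of pH p.
Proof.
move=> /(chev_tri P_linl P_linr P_skew P_jac P_par_sub P_par_br P_pEp P_pEm P_pH P_EE P_HH P_HEp P_HEm).
exact: tri_span.
Qed.

Lemma fst_sum (I : Type) (r : seq I) (P : pred I) (X : I -> PA) :
  (\sum_(i <- r | P i) X i).1 = \sum_(i <- r | P i) (X i).1.
Proof. by apply: (big_morph (fun p : PA => p.1)). Qed.

Lemma snd_sum (I : Type) (r : seq I) (P : pred I) (X : I -> PA) :
  (\sum_(i <- r | P i) X i).2 = \sum_(i <- r | P i) (X i).2.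
Proof. by apply: (big_morph (fun p : PA => p.2)). Qed.

Lemma crd_Tb n l : (n < 31)%N -> (l < 31)%N -> crd (Tb n) l = (l == n)%:R.
Proof. by move=> n31 l31; rewrite /crd /dl mxE eqxx andTb -val_eqE /= !inordK. Qed.

Lemma DD0_fst s (p : PA) : DD s 0 p -> p.2 = 0 -> p = 0.
Proof.
move=> /DD_span[a ->]; rewrite snd_sum => E; rewrite big1 // => i _.
suff -> : a i = 0 by rewrite scale0r.
have [_ _ h31] := g31 i; have := congr1 (fun x => crd x (gH i)) E.
rewrite /crd summxE mxE (bigD1 i) //= big1 ?addr0 => [|j ji]; rewrite mxE -!/(crd _ _).
  by rewrite (crd_Tb h31 h31) eqxx mulr1.
have [_ _ hj] := g31 j; rewrite (crd_Tb hj h31).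
have -> : (gH i == gH j) = false; last by rewrite mulr0.
by apply: contraNF ji; case: i {h31 E} => [[|[|[|//]]] i3]; case: j {hj} => [[|[|[|//]]] j3].
Qed.

Lemma DD0_snd s (p : PA) : DD s 0 p -> p.1 = 0 -> p = 0.
Proof.
move=> /DD_span[a ->]; rewrite fst_sum => E; rewrite big1 // => i _.
by rewrite (gA_indep hL E) scale0r.
Qed.

Definition hht : L := 2%:R *: H (inord 0) - H (inord 1) - H (inord 2).

Lemma hht_br x : br hht x = 2%:R *: br (H (inord 0)) x - br (H (inord 1)) x - br (H (inord 2)) x.
Proof. by rewrite /hht -!scaleN1r !(lbrD LL) !(lbrZ LL). Qed.

Lemma par_hht : par false hht.
Proof.
have sp := lie_par LL false; have hH := gA_parH hL.
apply: (subspaceD sp); last by apply: (subspaceN sp).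
by apply: (subspaceD sp); [apply: (subspaceZ sp)|apply: (subspaceN sp)].
Qed.

Lemma DD_hht s h (p : PA) : DD s h p -> br hht p.1 = h%:~R *: p.1.
Proof.
have key i : 2 * ag2_cartan (inord 0) i - ag2_cartan (inord 1) i - ag2_cartan (inord 2) i = 1.
  by rewrite !mxE !inordK //; case: i => [[|[|[|//]]] i3].
elim=> {s h p} [i|i|i|s h|s h a x y _ IHx _ IHy|s t h k x y hx IHx hy IHy].
- by rewrite hht_br !(gA_HEp hL) scalerA -!scalerBl -[2%:R]/(2%:~R) -intrM -!intrB key.
- rewrite hht_br !(gA_HEm hL) scalerN -!opprD scalerA -!scalerBl -[2%:R]/(2%:~R) -intrM -!intrB key.
  by rewrite -scaleNr.
- by rewrite hht_br !(gA_HH hL) scaler0 !subr0 scale0r.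
- by rewrite (lbr0r LL) scaler0.
- by rewrite /= (lbrDr LL) (lbrZr LL) IHx IHy scalerDr !scalerA [a * _]mulrC.
have [px _] := DD_par hx.
rewrite -[(br x y).1]/(br x.1 y.1) (lie_jacobi LL I I I par_hht px) expr0 scale1r IHx IHy.
by rewrite (lbrZ LL) (lbrZr LL) -scalerDl -intrD.
Qed.

Lemma DD_rht s h (p : PA) : DD s h p -> rht h p.2.
Proof.
have gen n k : (n < 31)%N -> (nth 0%N htn n)%:Z - 10 = k -> rht k (Tb n).
  move=> n31 nk i; rewrite /dl mxE eqxx andTb; case: (i =P inord n) => [->|_]; last by rewrite eqxx.
  by rewrite /hT inordK.
have sub k : subspace (rht k) := @red_deg_sub F 31 qT hT cT k.
elim=> {s h p} [i|i|i|s h|s h a x y _ IHx _ IHy|s t h k x y hx IHx hy IHy].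
- by have [e31 _ _] := g31 i; apply: gen => //; case: i {e31} => [[|[|[|//]]] i3].
- by have [_ f31 _] := g31 i; apply: gen => //; case: i {f31} => [[|[|[|//]]] i3].
- by have [_ _ h31] := g31 i; apply: gen => //; case: i {h31} => [[|[|[|//]]] i3].
- by case: (sub h).
- by case: (sub h) => _; apply.
move=> n; rewrite mxE; apply: contraNeq => dn; apply/eqP; rewrite big1 // => i _.
rewrite big1 // => j _; case: (eqVneq ((x.2 : 'rV[F]_31) 0 i) 0) => [->|/IHx di]; first by rewrite mulr0 mul0r.
case: (eqVneq ((y.2 : 'rV[F]_31) 0 j) 0) => [->|/IHy dj]; first by rewrite mulr0.
case: (eqVneq (cT i j n) 0) => [->|/hT_br dE]; first by rewrite !mul0r.
by rewrite dE di dj eqxx in dn.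
Qed.

Inductive dsum (Q : M -> Prop) : L -> Prop :=
| dsum0 : dsum Q 0
| dsumS s h p x : DD s h p -> Q p.2 -> dsum Q x -> dsum Q (p.1 + x).

Lemma dsum_subspace Q : (forall (a : F) y, Q y -> Q (a *: y)) -> subspace (dsum Q).
Proof.
move=> QZ; split=> [|a x y hx hy]; first exact: dsum0.
elim: hx => {x} [|s h p x hp qp _ IH]; first by rewrite scaler0 add0r.
rewrite scalerDr -addrA; apply: (@dsumS Q s h (a *: p)) => //; last exact: QZ.
by rewrite -[_ *: p]addr0; apply: chev_lin => //; apply: chev_0.
Qed.

Lemma dsum_br Q x y : (forall (a : F) y, Q y -> Q (a *: y)) -> (forall u y, Q y -> Q (br u y)) ->
  dsum (fun=> True) x -> dsum Q y -> dsum Q (br x y).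
Proof.
move=> QZ Qb hx hy; have sub := dsum_subspace QZ.
elim: hx => {x} [|s h p x hp _ _ IHx]; first by rewrite (lbr0 LL); apply: dsum0.
rewrite (lbrD LL); apply: (subspaceD sub) => {x IHx} //.
elim: hy => {y} [|t k p' y hp' qp' _ IHy]; first by rewrite (lbr0r LL); apply: dsum0.
rewrite (lbrDr LL); apply: (dsumS (p := br p p') (chev_br hp hp')) => //; exact: Qb.
Qed.

Lemma dsum_full x : dsum (fun=> True) x.
Proof.
apply: (gA_gen hL) x.
- exact: dsum_subspace.
- by move=> x y; apply: dsum_br.
have one s h p : DD s h p -> dsum (fun=> True) p.1.
  by move=> hp; rewrite -[p.1]addr0; apply: dsumS hp _ _ => //; apply: dsum0.
move=> i; split; first exact: (one _ _ (pEp i) (chev_Ep _ _ _ _ i)).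
  exact: (one _ _ (pEm i) (chev_Em _ _ _ _ i)).
exact: (one _ _ (pH i) (chev_H _ _ _ _ i)).
Qed.

Lemma DD_snd0 s h (p : PA) : DD s h p -> p.2 = 0 -> p.1 = 0.
Proof.
pose Q := fun y : M => y = 0.
have QZ (a : F) y : Q y -> Q (a *: y) by move=> ->; apply: scaler0.
have Qb u y : Q y -> Q (br u y).
  by move=> ->; rewrite -[0 as X in br u X](scale0r 0) -[_ *: _]addr0 red_linr scale0r add0r; exact: (klin0 (f := fun v => br u v) (fun a x y => red_linr a x y u)).
have sub := dsum_subspace QZ.
suff D0 x : dsum Q x -> x = 0.
  by move=> hp p2; apply: D0; rewrite -[p.1]addr0; apply: dsumS hp p2 _; apply: dsum0.
apply: (gA_max hL) x.
  split=> //; split; last by move=> x y _; apply: dsum_br => //; apply: dsum_full.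
  split=> // x; elim=> {x} [|s' h' p' x hp' qp' hx [x0 [x1 [hx0 hx1 p0 p1 ->]]]].
    exists 0, 0; rewrite addr0; split=> //; try exact: dsum0.
      by case: (lie_par LL false).
    by case: (lie_par LL true).
  have [pp _] := DD_par hp'; have one : dsum Q p'.1.
    by rewrite -[p'.1]addr0; apply: dsumS hp' qp' _; apply: dsum0.
  case: s' hp' pp => hp' pp.
    exists x0, (p'.1 + x1); split=> //; [exact: (subspaceD sub)| |by rewrite addrCA].
    exact: (subspaceD (lie_par LL true)).
  exists (p'.1 + x0), x1; split=> //; [exact: (subspaceD sub)| |by rewrite addrA].
  exact: (subspaceD (lie_par LL false)).
move=> x hx [a xE].
have fx : br hht x = (0 : int)%:~R *: x.
  rewrite xE scale0r (lbr_sumr LL) big1 // => i _.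
  by rewrite (lbrZr LL) hht_br !(gA_HH hL) scaler0 !subr0 scaler0.
have {a xE} [r xE] : exists r : seq (int * L),
    x = \sum_(y <- r | (y.1 != 0) && (br hht y.2 == y.1%:~R *: y.2)) y.2.
  elim: hx {a xE fx} => {x} [|s' h' p' x hp' qp' _ [r ->]]; first by exists [::]; rewrite big_nil.
  case: (eqVneq h' 0) hp' => [->|h0] hp'.
    by exists r; rewrite (DD0_fst hp' qp') add0r.
  by exists ((h', p'.1) :: r); rewrite big_cons /= h0 (DD_hht hp') eqxx.
rewrite {1}xE; apply: (@eigen_sum F L (fun x => br hht x) 0 _ _ _ (fun y => y.1) r (fun y => y.2)).
- by move=> c u v; rewrite (lbrDr LL) (lbrZr LL).
- by move=> y /andP[_ /eqP].
- by move=> y /andP[].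
by rewrite -xE.
Qed.

Lemma lower_word (w : seq 'I_3) s h (p : PA) (a : F) r : DD s h p -> p.1 = 0 -> p.2 = a *: el Tb r ->
  keys_lt r -> exists s' p', [/\ DD s' (h - (size w)%:Z) p', p'.1 = 0 &
    p'.2 = a *: el Tb (foldl (fun r i => bind r (brow (gF i))) r w)].
Proof.
elim: w s h p r => [|i w IH] s h p r hp p1 p2 kr; first by exists s, p; rewrite subr0.
have [_ f31 _] := g31 i.
have hp' := chev_br (chev_Em ag2_odd pEp pEm pH i) hp.
have p1' : (br (pEm i) p).1 = 0 by rewrite -[LHS]/(br (Em i) p.1) p1 (lbr0r LL).
have p2' : (br (pEm i) p).2 = a *: el Tb (bind r (brow (gF i))).
  rewrite -[LHS]/(br (Tb (gF i)) p.2) p2.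
  rewrite -(el_bind (@red_linr F 31 qT cT) (@Tb_br F) f31 kr) -[a *: el Tb r]addr0 red_linr.
  by rewrite (klin0 (f := fun v => br _ v) (fun a x y => red_linr a x y _)) addr0.
have [s' [p'' [h1 h2 h3]]] := IH _ _ _ _ hp' p1' p2' (bind_lt f31 kr).
exists s', p''; split=> //; congr (DD _ _ _): h1.
by rewrite /= -[(size w).+1]addn1 PoszD opprD addrA addrAC [-1 + h]addrC.
Qed.

Lemma DD_fst0 s h (p : PA) : DD s h p -> p.1 = 0 -> p.2 = 0.
Proof.
have [n] : exists n : nat, 9 - h <= n%:Z by exists `|9 - h|%N; lia.
elim: n s h p => [|n IH] s h p hn hp p1.
  apply: crd_eq0 => l l31; apply/eqP/negPn/negP => /(DD_rht hp).
  have c : all (fun l => nth 0%N htn l < 19)%N I31 by [].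
  by have := I31_all c (Ordinal l31); rewrite /hT inordK // => /= ? ?; lia.
have sing i : br (Tb (gE i)) p.2 = 0.
  have hp' := chev_br (chev_Ep ag2_odd pEp pEm pH i) hp.
  apply: (IH _ _ _ _ hp'); first by lia.
  by rewrite -[LHS]/(br (Ep i) p.1) p1 (lbr0r LL).
have good c : good0 c -> zK F c != 0.
  by move=> /Z.eqb_spec c0; rewrite /zK intr_eq0; apply/eqP => E; apply: c0; lia.
have p2E : p.2 = crd p.2 30 *: el Tb [:: (30%N, 1%Z)].
  apply/eqP; rewrite -subr_eq0 /el big_seq1 scale1r; apply/eqP; apply: crd_eq0 => l l31.
  rewrite crdB crdZ crd_Tb //; case: (eqVneq l 30%N) => [->|l30]; first by rewrite mulr1 subrr.
  rewrite mulr0 subr0; apply: (solvesP (@idz_zK F) good raise_solve); last by rewrite mem_iota; lia.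
  move=> r /mapP[[b n'] /allpairsP[[b1 n1] [bI nI [-> ->]]] ->].
  move: nI; rewrite mem_iota => nI.
  have [i iE] : exists i, b1 = gE i.
    by move: bI; rewrite !inE /= => /or3P[]/eqP->; [exists (inord 0)|exists (inord 1)|exists (inord 2)];
      rewrite /gE inordK.
  have [e31 _ _] := g31 i.
  by rewrite -br_dl_crd // iE ?sing // /crd mxE.
case: (eqVneq (crd p.2 30) 0) => [E|c0]; first by rewrite p2E E scale0r.
have h8 : h = 8 by have := DD_rht hp c0; rewrite /hT inordK // => <-.
have [s' [p' [hp' p1' p2']]] := lower_word lowering hp p1 p2E isT.
rewrite h8 size_map subrr in hp'.
have E0 := DD0_snd hp' p1'; have : p'.2 = 0 by rewrite E0.
rewrite p2' => /eqP; rewrite scaler_eq0 (negPf c0) orFb.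
have -> : foldl (fun r i => bind r (brow (gF i))) [:: (30%N, 1%Z)] lowering = lowrow.
  by rewrite /lowering /= /gF !inordK.
have /andP[lc lg] := lowrow_check.
have kl : keys_lt lowrow by vm_compute.
rewrite (el_coef _ kl _ lc) // scaler_eq0 (negPf (good _ lg)) /= => /eqP/(congr1 (fun x => crd x 16)).
by rewrite crd_Tb // /crd mxE => /eqP; rewrite oner_eq0.
Qed.

End ProductAlgebra.

Section Lift.
Variables (F : numFieldType) (L : superAlg F) (Ep Em H : 'I_3 -> L).
Hypothesis hL : is_gA ag2_cartan ag2_odd Ep Em H.
Let LL := gA_lie hL.
Notation M := (reduction F qT cT).
Notation Tb := (fun n : nat => dl F qT cT (inord n) : M).
Notation G := (PA L).
Notation pE := (@pEp F L Ep).
Notation pF := (@pEm F L Em).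
Notation pK := (@pH F L H).
Notation DD := (@chev F G 3 ag2_odd pE pF pK).
Notation zfm := (zform ag2_odd Ep Em H).
Notation deg := (rgrade Ep Em H ag2_r).

Lemma DD_uniq s h (u u' : L) (y : M) : DD s h ((u, y) : G) -> DD s h ((u', y) : G) -> u = u'.
Proof.
move=> hu hu'; apply/eqP; rewrite -subr_eq0; apply/eqP.
have hd : DD s h ((-1) *: ((u', y) : G) + (u, y)) by apply: chev_lin.
have := DD_snd0 hL hd; rewrite /= scaleN1r addNr => /(_ erefl) <-.
by rewrite scaleN1r addrC.
Qed.

Lemma DD_iter k s t h j (x y : G) : DD s h x -> DD t j y ->
  DD ((odd k && s) (+) t) (h * k%:Z + j) (ssrnat.iter k (br x) y).
Proof.
move=> hx hy; elim: k => [|k IH]; first by rewrite mulr0 add0r.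
rewrite iterS; have := chev_br hx IH.
have -> : h + (h * k%:Z + j) = h * k.+1%:Z + j by rewrite -addn1 PoszD mulrDr mulr1 addrA [h + _]addrC.
by have -> : s (+) ((odd k && s) (+) t) = (odd k.+1 && s) (+) t by rewrite /=; case: (odd k); case: (s); case: (t).
Qed.

Lemma iter_fst k (x y : G) : (ssrnat.iter k (br x) y).1 = ssrnat.iter k (br x.1) y.1.
Proof. by elim: k => //= k ->. Qed.

Lemma iter_snd k (x y : G) : (ssrnat.iter k (br x) y).2 = ssrnat.iter k (br x.2) y.2.
Proof. by elim: k => //= k ->. Qed.

Lemma rgrade_iter k (i j : int) x y : deg i x -> deg j y -> deg (i * k%:Z + j) (ssrnat.iter k (br x) y).
Proof.
move=> hx hy; elim: k => [|k IH]; first by rewrite mulr0 add0r.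
have -> : i * k.+1%:Z + j = i + (i * k%:Z + j) by rewrite -addn1 PoszD mulrDr mulr1 addrA [i + _]addrC.
exact: rgrade_br.
Qed.

Section IterRow.
Variables (K : fieldType) (V : superAlg K) (t : nat -> V).
Hypothesis linr : forall (a : K) (x y w : V), br w (a *: x + y) = a *: br w x + br w y.
Hypothesis tbr : forall a b, (a < 31)%N -> (b < 31)%N -> br (t a) (t b) = el t (brow a b).

Lemma iter_row k g p : (g < 31)%N -> (p < 31)%N ->
  keys_lt (itrow k g p) /\ ssrnat.iter k (br (t g)) (t p) = el t (itrow k g p).
Proof.
move=> g31' p31; elim: k => [|k [kk IH]].
  by split; [rewrite /keys_lt /= andbT; apply/Nat.ltb_lt/ssrnat.ltP|rewrite /el big_seq1 scale1r].
have -> : itrow k.+1 g p = bind (itrow k g p) (brow g) by [].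
split; first exact: bind_lt.
by rewrite iterS IH (el_bind linr tbr).
Qed.

End IterRow.

Definition lift_of (l : nat) (u : L) : Prop :=
  [/\ DD (oddT l) ((nth 0%N htn l)%:Z - 10) ((u, Tb l) : G), zfm u & deg ((nth 0%N degn l)%:Z - 2) u].

Lemma factz_neq0 k : (k`!%:R : F) != 0.
Proof. by rewrite pnatr_eq0 -lt0n fact_gt0. Qed.

Lemma table_lift l : (l < 31)%N -> exists u, lift_of l u.
Proof.
move: l; apply: recipes_ind => [g gI|l k g p lI [ug [hg zg dg]] [up [hp zp dp]]].
  have [i E] : exists i : 'I_3, [\/ g = gE i, g = gF i | g = gH i].
    have c : all (fun g => has (fun i => [|| g == nth 0%N [:: 23; 18; 17]%N i, g == nth 0%N [:: 7; 12; 13]%N i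
       | g == nth 0%N [:: 14; 15; 16]%N i]) [:: 0; 1; 2]%N) gens31 by [].
    have /hasP[i iI gi] := allP c g gI; have i3 : (i < 3)%N by move: iI; rewrite !inE => /or3P[]/eqP->.
    by exists (Ordinal i3); rewrite /gE /gF /gH; case/or3P: gi => /eqP; [constructor 1|constructor 2|constructor 3].
  case: E => ->; [exists (Ep i)|exists (Em i)|exists (H i)]; split; try by constructor.
  - have := chev_Ep ag2_odd pE pF pK i; by case: i => [[|[|[|//]]] i3].
  - have := rgrade_Ep Ep Em H ag2_r i; by case: i => [[|[|[|//]]] i3].
  - have := chev_Em ag2_odd pE pF pK i; by case: i => [[|[|[|//]]] i3].
  - have := rgrade_Em Ep Em H ag2_r i; by case: i => [[|[|[|//]]] i3].
  - have := chev_H ag2_odd pE pF pK i; by case: i => [[|[|[|//]]] i3].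
  have := rgrade_H Ep Em H ag2_r i; by case: i => [[|[|[|//]]] i3].
have := allP recipes_check _ lI; case/and5P=> /Nat.ltb_lt/ssrnat.ltP l31 k3 /Nat.ltb_lt/ssrnat.ltP g31'.
move=> /Nat.ltb_lt/ssrnat.ltP p31 /and5P[/Z.eqb_spec rl rn /Nat.eqb_spec hE /Nat.eqb_spec dE kg].
have k0 := factz_neq0 k.
have [kk it] := iter_row (@red_linr F 31 qT cT) (@Tb_br F) k g31' p31.
rewrite (el_coef _ kk l31 rn) rl factzE in it; last by case/andP: k3.
exists (k`!%:R^-1 *: ssrnat.iter k (br ug) up); split.
- have := DD_iter k hg hp; set s := (_ (+) _); set h := (_ + _) => hh.
  have -> : oddT l = s.
    by rewrite /s /oddT; move: (congr1 odd dE); rewrite !oddD !oddM andbF addbF.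
  have -> : (nth 0%N htn l)%:Z - 10 = h by rewrite /h; clear -hE; nia.
  have := chev_lin k`!%:R^-1 hh (chev_0 ag2_odd pE pF pK s h); rewrite addr0.
  move: (iter_fst k ((ug, Tb g) : G) (up, Tb p)) (iter_snd k ((ug, Tb g) : G) (up, Tb p)).
  move: (ssrnat.iter k (br ((ug, Tb g) : G)) (up, Tb p)) => [w1 w2] /= -> ->.
  congr (chev _ _ _ _ _ _ _).
  have -> : (k`!%:R^-1 *: ((ssrnat.iter k (br ug) up, ssrnat.iter k (br (Tb g)) (Tb p)) : G)) =
    (k`!%:R^-1 *: ssrnat.iter k (br ug) up, k`!%:R^-1 *: ssrnat.iter k (br (Tb g)) (Tb p)) by [].
  by rewrite it scalerA mulVf // scale1r.
- case/orP: kg => [/eqP k1|gI]; first by rewrite k1 invr1 scale1r; apply: zform_br.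
  have scK : k`!%:R *: (k`!%:R^-1 *: ssrnat.iter k (br ug) up) = ssrnat.iter k (br ug) up.
    by rewrite scalerA divff // scale1r.
  have [i [i0 E]] : exists i : 'I_3, i != ord0 /\ (g = gE i \/ g = gF i).
    by move: gI; rewrite !inE => /or4P[]/eqP->; [exists (inord 1)|exists (inord 2)|exists (inord 2)|exists (inord 1)];
     rewrite -val_eqE /= inordK //; split=> //; rewrite /gE /gF inordK //; [right|right|left|left].
  case: E => E; rewrite E in hg.
    have uE : ug = Ep i.
      apply: (DD_uniq hg); have := chev_Ep ag2_odd pE pF pK i; by case: (i) => [[|[|[|//]]] i3].
    by rewrite uE in scK *; apply: zform_divp scK.
  have uE : ug = Em i.
    apply: (DD_uniq hg); have := chev_Em ag2_odd pE pF pK i; by case: (i) => [[|[|[|//]]] i3].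
  by rewrite uE in scK *; apply: zform_divm scK.
rewrite -[_ *: _]addr0; apply: rgrade_lin; last exact: rgrade_0.
have := rgrade_iter k dg dp; congr (rgrade _ _ _ _ _ _); clear -dE; nia.
Qed.

Variable t : nat -> L.
Hypothesis ht : forall l, (l < 31)%N -> lift_of l (t l).

Lemma DD_el s h r : keys_lt r ->
  (forall x, x \in r -> oddT x.1 = s /\ (nth 0%N htn x.1)%:Z - 10 = h) -> DD s h ((el t r, el Tb r) : G).
Proof.
elim: r => [_ _|x r IH /andP[/Nat.ltb_lt/ssrnat.ltP x31 kr] hr].
  by rewrite /el !big_nil; apply: chev_0.
have [xs xh] := hr x (mem_head _ _); have [hx _ _] := ht x31.
rewrite xs xh in hx; have hr' := IH kr (fun y yr => hr y (mem_behead (s := x :: r) yr)).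
have := chev_lin (zK F x.2) hx hr'; congr (chev _ _ _ _ _ _ _).
by rewrite /el !big_cons.
Qed.

Lemma t_br a b : (a < 31)%N -> (b < 31)%N -> br (t a) (t b) = el t (brow a b).
Proof.
move=> a31 b31; have [[ha _ _] [hb _ _]] := (ht a31, ht b31).
have hab : DD (oddT a (+) oddT b) ((nth 0%N htn a)%:Z - 10 + ((nth 0%N htn b)%:Z - 10))
    ((br (t a) (t b), el Tb (brow a b)) : G).
  by rewrite -Tb_br //; apply: chev_br ha hb.
apply: (DD_uniq hab); apply: DD_el (brow_lt a31 b31) _ => x xr.
have /Nat.eqb_spec dE : Nat.eqb (nth 0%N degn x.1 + 2) (nth 0%N degn a + nth 0%N degn b) :=
  allP (I31_all (I31_all deg_check (Ordinal a31)) (Ordinal b31)) x xr.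
have /Nat.eqb_spec hE : Nat.eqb (nth 0%N htn x.1 + 10) (nth 0%N htn a + nth 0%N htn b) :=
  allP (I31_all (I31_all height_check (Ordinal a31)) (Ordinal b31)) x xr.
split; last by lia.
by rewrite /oddT; move: (congr1 odd dE); rewrite !oddD addbF.
Qed.

Notation tt := (fun l : 'I_31 => t l).

Lemma tL_linr (a : F) (x y w : L) : br w (a *: x + y) = a *: br w x + br w y.
Proof. exact: (lie_linr LL). Qed.

Lemma DD_comb s h (a : 'I_31 -> F) (P : pred 'I_31) : (forall l, P l -> a l != 0 -> qT l = s /\ hT l = h) ->
  DD s h ((\sum_(l | P l) a l *: tt l, \sum_(l | P l) a l *: dl F qT cT l) : G).
Proof.
move=> hP; have -> : ((\sum_(l | P l) a l *: tt l, \sum_(l | P l) a l *: dl F qT cT l) : G) =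
    \sum_(l | P l) a l *: ((t l, dl F qT cT l) : G).
  by rewrite [RHS]surjective_pairing fst_sum snd_sum.
apply: (subspace_sum (chev_sub _ _ _ _ s h)) => l Pl; case: (eqVneq (a l) 0) => [->|al].
  by rewrite scale0r; apply: chev_0.
have [<- <-] := hP l Pl al; apply: (subspaceZ (chev_sub _ _ _ _ _ _)).
by have [hl _ _] := ht (ltn_ord l); rewrite inord_val in hl.
Qed.

Lemma t_indep (a : 'I_31 -> F) : \sum_l a l *: tt l = 0 -> forall l, a l = 0.
Proof.
move=> a0 l; pose f := br (hht H).
have ft l' : f (tt l') = (hT l')%:~R *: tt l' by have [hl _ _] := ht (ltn_ord l'); apply: (DD_hht hL hl).
have fa l' : f (a l' *: tt l') = (hT l')%:~R *: (a l' *: tt l').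
  have -> : f (a l' *: tt l') = a l' *: f (tt l') by apply: (lbrZr LL).
  by rewrite ft !scalerA mulrC.
have E := a0; rewrite (bigID (fun l' => hT l' == hT l)) /= in E.
have hE : \sum_(i | hT i == hT l) a i *: tt i = 0.
  have /eqP := E; rewrite addr_eq0 => /eqP E'.
  have N0 : \sum_(i | hT i != hT l) a i *: tt i = 0.
    apply: (@eigen_sum F L f (hT l) _ _ _ hT) => [c x y|i _|i //|].
    - by rewrite /f (lbrDr LL) (lbrZr LL).
    - exact: fa.
    have -> : \sum_(i | hT i != hT l) a i *: tt i = - \sum_(i | hT i == hT l) a i *: tt i by rewrite E' opprK.
    have fN v : f (- v) = - f v by rewrite -scaleN1r /f (lbrZr LL) scaleN1r.
    rewrite fN scalerN; congr (- _); rewrite /f (lbr_sumr LL) scaler_sumr.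
    by apply: eq_bigr => i /eqP <-; apply: fa.
  by rewrite E' N0 oppr0.
have pp s : par s (\sum_(i | (hT i == hT l) && (qT i == s)) a i *: tt i).
  apply: (subspace_sum (lie_par LL s)) => i /andP[_ /eqP <-]; apply: (subspaceZ (lie_par LL _)).
  by have [hl _ _] := ht (ltn_ord i); have [] := DD_par hL hl.
have s0 : \sum_(i | (hT i == hT l) && (qT i == qT l)) a i *: tt i = 0.
  have P1 := pp (qT l); have P2 := pp (~~ qT l).
  move: hE; rewrite (bigID (fun i => qT i == qT l)) /= => /eqP; rewrite addr_eq0 => /eqP E1.
  have E2 : \sum_(i | (hT i == hT l) && (qT i != qT l)) a i *: tt i =
      \sum_(i | (hT i == hT l) && (qT i == ~~ qT l)) a i *: tt i.
    by apply: eq_bigl => i; case: (qT i); case: (qT l).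
  have P3 : par (~~ qT l) (\sum_(i | (hT i == hT l) && (qT i == qT l)) a i *: tt i).
    by rewrite E1 E2; apply: (subspaceN (lie_par LL _)).
  by move: P1 P3; case: (qT l) => P1 P3; apply: (lie_par_disj LL).
have hc := @DD_comb (qT l) (hT l) a (fun i => (hT i == hT l) && (qT i == qT l)).
have {hc}hc := hc (fun i Pi _ => let: conj h1 h2 := andP Pi in conj (eqP h2) (eqP h1)).
have := DD_fst0 hL hc s0 => /= /rowP/(_ l).
rewrite summxE mxE (bigD1 l) ?eqxx //= big1 ?addr0 => [|i /andP[_ /negPf il]].
  by rewrite !mxE !eqxx mulr1.
by rewrite !mxE [l == i]eq_sym il andbF mulr0.
Qed.

Definition zspan (x : L) : Prop := exists a : 'I_31 -> int, x = \sum_l (a l)%:~R *: tt l.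

Lemma zspan_comb (I : Type) (r : seq I) (P : pred I) (a : I -> int) (X : I -> L) :
  (forall i, P i -> zspan (X i)) -> zspan (\sum_(i <- r | P i) (a i)%:~R *: X i).
Proof.
move=> hX; apply: (big_ind zspan) => [|x y [u ->] [v ->]|i /hX[u ->]].
- by exists (fun=> 0); rewrite big1 // => l _; rewrite scale0r.
- by exists (fun l => u l + v l); rewrite -big_split /=; apply: eq_bigr => l _; rewrite intrD scalerDl.
by exists (fun l => a i * u l); rewrite scaler_sumr; apply: eq_bigr => l _; rewrite intrM scalerA.
Qed.

Lemma zspan_t l : (l < 31)%N -> zspan (t l).
Proof.
move=> l31; exists (fun l' => (l' == Ordinal l31)%:R).
by rewrite (bigD1 (Ordinal l31)) //= eqxx scale1r big1 ?addr0 // => i /negPf->; rewrite scale0r.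
Qed.

Lemma zspan_el r : keys_lt r -> zspan (el t r).
Proof.
move=> kr; rewrite (elE _ kr); apply: (zspan_comb _ (fun n : 'I_31 => int_of_Z (rcoef n r)) (X := tt)) => i _.
exact: zspan_t (ltn_ord i).
Qed.

Lemma zspan_br x y : zspan x -> zspan y -> zspan (br x y).
Proof.
move=> [a ->] [b ->]; rewrite (lbr_sum LL).
under eq_bigr => i _ do rewrite (lbrZ LL); apply: zspan_comb => i _.
rewrite (lbr_sumr LL); under eq_bigr => j _ do rewrite (lbrZr LL); apply: zspan_comb => j _.
rewrite t_br //; apply: zspan_el; exact: brow_lt.
Qed.

Lemma zspan_div g k x y : g \in [:: 12; 13; 17; 18]%N -> zspan x ->
  k`!%:R *: y = ssrnat.iter k (br (t g)) x -> zspan y.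
Proof.
move=> gI [a ->]; have k0 := factz_neq0 k.
have g31' : (g < 31)%N by move: gI; rewrite !inE => /or4P[]/eqP->.
have itE k' : ssrnat.iter k' (br (t g)) (\sum_l (a l)%:~R *: tt l) = \sum_l (a l)%:~R *: el t (itrow k' g l).
  transitivity (\sum_l (a l)%:~R *: ssrnat.iter k' (br (t g)) (tt l)).
    elim: k' => //= k' ->; rewrite (lbr_sumr LL); apply: eq_bigr => l _; exact: (lbrZr LL).
  by apply: eq_bigr => l _; have [_ ->] := iter_row tL_linr t_br k' g31' (ltn_ord l).
have dl0 l := I31_all (allP divided_check g gI) l.
case: (ltnP k 4) => [k4|k4]; last first.
  have -> : ssrnat.iter k (br (t g)) (\sum_l (a l)%:~R *: tt l) = 0.
    rewrite -(subnK k4) iterD itE big1 => [|l _].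
      by elim: (k - 4)%N => //= j ->; rewrite (lbr0r LL).
    have /andP[_ c4] := dl0 l; have [kk _] := iter_row tL_linr t_br 4 g31' (ltn_ord l).
    rewrite (elE _ kk) big1 ?scaler0 // => n _; have /Z.eqb_spec -> := I31_all c4 n; exact: scale0r.
  move=> /eqP; rewrite scaler_eq0 (negPf k0) => /eqP ->.
  by exists (fun=> 0); rewrite big1 // => l _; rewrite scale0r.
rewrite itE => /(congr1 (fun v => k`!%:R^-1 *: v)); rewrite scalerA mulVf // scale1r => ->.
rewrite scaler_sumr; under eq_bigr => l _ do rewrite scalerA mulrC -scalerA.
apply: zspan_comb => l _; have /andP[c _] := dl0 l.
have [kk _] := iter_row tL_linr t_br k g31' (ltn_ord l).
rewrite (elE _ kk) scaler_sumr.
have kI : k \in [:: 0; 1; 2; 3]%N by case: (k) k4 => [|[|[|[|]]]].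
have hc n := I31_all (allP c k kI) n.
under eq_bigr => n _.
  have -> : k`!%:R^-1 *: (zK F (rcoef n (itrow k g l)) *: tt n) =
      (int_of_Z (Z.div (rcoef n (itrow k g l)) (factz k)))%:~R *: tt n; last over.
  have fz : factz k <> 0%Z by case: (k) k4 => [|[|[|[|]]]].
  have /Z.eqb_spec m0 := hc n; rewrite [X in zK F X](Z.div_mod _ _ fz) m0 Z.add_0_r zKM factzE //.
  by rewrite !scalerA mulrA mulVf // mul1r.
apply: (zspan_comb _ (fun n : 'I_31 => int_of_Z (Z.div (rcoef n (itrow k g l)) (factz k))) (X := tt)) => n _.
exact: zspan_t (ltn_ord n).
Qed.

Lemma t_gen (i : 'I_3) : [/\ t (gE i) = Ep i, t (gF i) = Em i & t (gH i) = H i].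
Proof.
have [e31 f31 h31] := g31 i.
have [[he _ _] [hf _ _] [hh _ _]] := And3 (ht e31) (ht f31) (ht h31).
split; [apply: (DD_uniq he)|apply: (DD_uniq hf)|apply: (DD_uniq hh)].
- have := chev_Ep ag2_odd pE pF pK i; by case: (i) => [[|[|[|//]]] i3].
- have := chev_Em ag2_odd pE pF pK i; by case: (i) => [[|[|[|//]]] i3].
have := chev_H ag2_odd pE pF pK i; by case: (i) => [[|[|[|//]]] i3].
Qed.

Lemma zform_zspan x : zfm x -> zspan x.
Proof.
elim=> {x} [i|i|i||x y _ IHx _ IHy|x y _ IHx _ IHy|i k x y i0 _ IHx E|i k x y i0 _ IHx E].
- by have [<- _ _] := t_gen i; have [e31 _ _] := g31 i; apply: zspan_t.
- by have [_ <- _] := t_gen i; have [_ f31 _] := g31 i; apply: zspan_t.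
- by have [_ _ <-] := t_gen i; have [_ _ h31] := g31 i; apply: zspan_t.
- by exists (fun=> 0); rewrite big1 // => l _; rewrite scale0r.
- case: IHx IHy => u -> [v ->]; exists (fun l => u l - v l); rewrite -sumrB.
  by apply: eq_bigr => l _; rewrite intrB scalerBl.
- exact: zspan_br.
- have [tE _ _] := t_gen i; rewrite -tE in E; apply: (zspan_div _ IHx E).
  by move: i0; rewrite /ag2_odd -val_eqE; case: (i) => [[|[|[|//]]] i3].
have [_ tE _] := t_gen i; rewrite -tE in E; apply: (zspan_div _ IHx E).
by move: i0; rewrite /ag2_odd -val_eqE; case: (i) => [[|[|[|//]]] i3].
Qed.

Lemma t_int_indep (a : 'I_31 -> int) : \sum_l (a l)%:~R *: tt l = 0 -> forall l, a l = 0.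
Proof. by move=> /t_indep h l; apply/eqP; rewrite -(@intr_eq0 F) h. Qed.

End Lift.

Lemma int_coef_eq (F : numFieldType) (L : lmodType F) (m : nat) (b : 'I_m -> L) :
  (forall a : 'I_m -> int, \sum_l (a l)%:~R *: b l = 0 -> forall l, a l = 0) ->
  forall u v : 'I_m -> int, \sum_l (u l)%:~R *: b l = \sum_l (v l)%:~R *: b l -> forall l, u l = v l.
Proof.
move=> ind u v /eqP; rewrite -subr_eq0 -sumrB => /eqP E l; apply/eqP; rewrite -subr_eq0; apply/eqP.
apply: (ind (fun l => u l - v l)); rewrite -[RHS]E; apply: eq_bigr => i _; by rewrite intrB scalerBl.
Qed.

Theorem integral_basis_table (F : numFieldType) (L : superAlg F) (Ep Em H : 'I_3 -> L)
  (hL : is_gA ag2_cartan ag2_odd Ep Em H) (m : nat) (b : 'I_m -> L) (q : 'I_m -> bool) (d : 'I_m -> int)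
  (c : 'I_m -> 'I_m -> 'I_m -> int) (hb : is_integral_basis ag2_odd Ep Em H ag2_r b q d c) :
  exists (P : 'I_m -> 'I_31 -> int) (Q : 'I_31 -> 'I_m -> int),
  [/\ forall i j, \sum_l P i l * Q l j = (i == j)%:R,
      forall l n, \sum_i Q l i * P i n = (l == n)%:R,
      forall i j l, \sum_k c i j k * P k l = \sum_x \sum_y P i x * P j y * cT x y l,
      forall i l, P i l != 0 -> d i = dT l &
      forall l i, Q l i != 0 -> d i = dT l].
Proof.
have LL := gA_lie hL.
have /choice[t0 ht0] : forall l : 'I_31, exists u, lift_of Ep Em H l u.
  by move=> l; apply: (table_lift hL); apply: ltn_ord.
pose t (l : nat) := t0 (inord l).
have ht l : (l < 31)%N -> lift_of Ep Em H l (t l) by move=> l31; have := ht0 (inord l); rewrite inordK.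
have tind := t_int_indep hL ht; have bind := int_indep hb.
have /choice[P hP] : forall i, exists p : 'I_31 -> int, b i = \sum_l (p l)%:~R *: t l.
  move=> i; apply: (zform_zspan hL ht); apply/(ib_zform hb).
  exists (fun j => (j == i)%:R); rewrite (bigD1 i) //= eqxx scale1r big1 ?addr0 // => j /negPf->.
  by rewrite scale0r.
have /choice[Q hQ] : forall l : 'I_31, exists p : 'I_m -> int, t l = \sum_i (p i)%:~R *: b i.
  by move=> l; apply/(ib_zform hb); have [] := ht l (ltn_ord l).
have one (n : nat) (V : lmodType F) (X : 'I_n -> V) i : X i = \sum_j ((i == j)%:R : int)%:~R *: X j.
  by rewrite (bigD1 i) //= eqxx scale1r big1 ?addr0 // => j /negPf ji; rewrite eq_sym ji scale0r.
exists P, Q; split.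
- move=> i; apply: (int_coef_eq bind); rewrite -one hP.
  under [RHS]eq_bigr => l _ do rewrite hQ scaler_sumr.
  rewrite exchange_big /=; apply: eq_bigr => j _; rewrite rmorph_sum /= scaler_suml.
  by apply: eq_bigr => l _; rewrite intrM scalerA.
- move=> l; apply: (int_coef_eq tind); rewrite -(one _ _ (fun l : 'I_31 => t l)) hQ.
  under [RHS]eq_bigr => i _ do rewrite hP scaler_sumr.
  rewrite exchange_big /=; apply: eq_bigr => j _; rewrite rmorph_sum /= scaler_suml.
  by apply: eq_bigr => i _; rewrite intrM scalerA.
- move=> i j; apply: (int_coef_eq tind).
  transitivity (br (b i) (b j)).
    rewrite (ib_br hb); under [RHS]eq_bigr => k _ do rewrite hP scaler_sumr.
    rewrite exchange_big /=; apply: eq_bigr => l _; rewrite rmorph_sum /= scaler_suml.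
    by apply: eq_bigr => k _; rewrite intrM scalerA.
  rewrite !hP (lbr_sum LL).
  under eq_bigr => x _ do rewrite (lbrZ LL) (lbr_sumr LL) scaler_sumr.
  under eq_bigr => x _ do under eq_bigr => y _ do
    rewrite (lbrZr LL) (t_br hL ht (ltn_ord x) (ltn_ord y)) (elE _ (brow_lt (ltn_ord x) (ltn_ord y))) !scaler_sumr.
  under eq_bigr => x _ do rewrite exchange_big /=.
  rewrite exchange_big /=; apply: eq_bigr => l _; rewrite rmorph_sum /= scaler_suml; apply: eq_bigr => x _.
  rewrite rmorph_sum /= scaler_suml; apply: eq_bigr => y _.
  by rewrite !intrM !scalerA /cT /cTz /zK.
- move=> i l Pil; have := rgrade_hdeg hL (ib_deg hb i); rewrite hP (lbr_sumr LL) scaler_sumr => E.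
  suff : P i l * (2 * dT l) = 2 * d i * P i l by move=> /eqP; rewrite mulrC -subr_eq0 -mulrBl mulf_eq0 (negPf Pil) orbF; lia.
  apply: (int_coef_eq tind (u := fun l => P i l * (2 * dT l)) (v := fun l => 2 * d i * P i l)).
  transitivity (\sum_(l < 31) br (hdeg H) ((P i l)%:~R *: t l)).
    apply: eq_bigr => l' _; have [_ _ dl'] := ht l' (ltn_ord l').
    by rewrite (lbrZr LL) (rgrade_hdeg hL dl') intrM scalerA.
  by rewrite E; apply: eq_bigr => l' _; rewrite !intrM !scalerA.
move=> l i Qli; have [_ _ dl'] := ht l (ltn_ord l); have := rgrade_hdeg hL dl'.
rewrite hQ (lbr_sumr LL) scaler_sumr => E.
suff : Q l i * (2 * d i) = 2 * dT l * Q l i by move=> /eqP; rewrite mulrC -subr_eq0 -mulrBl mulf_eq0 (negPf Qli) orbF; lia.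
apply: (int_coef_eq bind (u := fun i => Q l i * (2 * d i)) (v := fun i => 2 * dT l * Q l i)).
transitivity (\sum_i br (hdeg H) ((Q l i)%:~R *: b i)).
  by apply: eq_bigr => i' _; rewrite (lbrZr LL) (rgrade_hdeg hL (ib_deg hb i')) intrM scalerA.
by rewrite E; apply: eq_bigr => i' _; rewrite !intrM !scalerA.
Qed.

(** * Transport along integral bases *)

Section PartOne.
Variables (K : fieldType) (m : nat) (q : 'I_m -> bool) (d : 'I_m -> int).
Variable (c : 'I_m -> 'I_m -> 'I_m -> int).
Hypothesis sl : struct_laws q d c.
Hypothesis two : (2%:R : K) != 0.
Hypothesis three : (3%:R : K) != 0.
Variables (P : 'I_m -> 'I_31 -> int) (Q : 'I_31 -> 'I_m -> int).
Hypothesis PQ : forall i j, \sum_l P i l * Q l j = (i == j)%:R.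
Hypothesis QP : forall l n, \sum_i Q l i * P i n = (l == n)%:R.
Hypothesis Pc : forall i j l, \sum_k c i j k * P k l = \sum_x \sum_y P i x * P j y * cT x y l.
Hypothesis Pd : forall i l, P i l != 0 -> d i = dT l.
Hypothesis Qd : forall l i, Q l i != 0 -> d i = dT l.
Notation MR := (reduction K q c).
Notation MK := (reduction K qT cT).
Notation rd := (@red_deg K m q d c).
Notation rdT := (@red_deg K 31 qT dT cT).
Notation Tb := (fun n : nat => dl K qT cT (inord n)).
Notation linlR := (@red_linl K m q c).
Notation linrR := (@red_linr K m q c).
Notation linrT := (@red_linr K 31 qT cT).

Definition to_table (x : MR) : MK := \row_l \sum_i (x : 'rV[K]_m) 0 i * (P i l)%:~R.
Definition of_table (y : MK) : MR := \row_i \sum_l (y : 'rV[K]_31) 0 l * (Q l i)%:~R.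
Notation psi := to_table.
Notation phi := of_table.

Lemma psi_lin (a : K) x y : psi (a *: x + y) = a *: psi x + psi y.
Proof.
apply/rowP => l; rewrite !mxE mulr_sumr -big_split; apply: eq_bigr => i _ /=.
by rewrite !mxE mulrDl mulrA.
Qed.

Lemma psiK x : phi (psi x) = x.
Proof.
apply/rowP => i; rewrite mxE; under eq_bigr => l _ do rewrite mxE mulr_suml.
rewrite exchange_big /= (bigD1 i) //= [X in _ + X]big1 ?addr0 => [|j /negPf ji].
  under eq_bigr => l _ do rewrite -mulrA -intrM.
  by rewrite -mulr_sumr -rmorph_sum /= PQ eqxx mulr1.
under eq_bigr => l _ do rewrite -mulrA -intrM.
by rewrite -mulr_sumr -rmorph_sum /= PQ ji mulr0.
Qed.

Lemma phiK y : psi (phi y) = y.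
Proof.
apply/rowP => i; rewrite mxE; under eq_bigr => l _ do rewrite mxE mulr_suml.
rewrite exchange_big /= (bigD1 i) //= [X in _ + X]big1 ?addr0 => [|j /negPf ji].
  under eq_bigr => l _ do rewrite -mulrA -intrM.
  by rewrite -mulr_sumr -rmorph_sum /= QP eqxx mulr1.
under eq_bigr => l _ do rewrite -mulrA -intrM.
by rewrite -mulr_sumr -rmorph_sum /= QP ji mulr0.
Qed.

Lemma psi_br x y : psi (br x y) = br (psi x) (psi y).
Proof.
apply/rowP => l; rewrite !mxE.
under eq_bigr => k _ do rewrite mxE mulr_suml.
rewrite exchange_big /=.
under eq_bigr => i _ do under eq_bigr => k _ do rewrite mulr_suml.
under eq_bigr => i _ do rewrite exchange_big /=.
have E i j : \sum_k (c i j k)%:~R * (x : 'rV[K]_m) 0 i * (y : 'rV[K]_m) 0 j * (P k l)%:~R =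
   \sum_u \sum_v ((x : 'rV[K]_m) 0 i * (P i u)%:~R) * ((y : 'rV[K]_m) 0 j * (P j v)%:~R) * (cT u v l)%:~R.
  transitivity ((x : 'rV[K]_m) 0 i * (y : 'rV[K]_m) 0 j * (\sum_k c i j k * P k l)%:~R).
    rewrite rmorph_sum /= mulr_sumr; apply: eq_bigr => k _; rewrite intrM; ring.
  rewrite Pc rmorph_sum /= mulr_sumr; apply: eq_bigr => u _.
  rewrite rmorph_sum /= mulr_sumr; apply: eq_bigr => v _; rewrite !intrM; ring.
under eq_bigr => i _ do under eq_bigr => j _ do rewrite E.
under eq_bigr => i _ do rewrite exchange_big /=.
rewrite exchange_big /=; apply: eq_bigr => u _.
under eq_bigr => i _ do rewrite exchange_big /=.
rewrite exchange_big /=; apply: eq_bigr => v _.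
rewrite !mxE -mulrA mulr_suml mulr_sumr; apply: eq_bigr => i _.
rewrite mulr_sumr mulr_sumr; apply: eq_bigr => j _; ring.
Qed.

Lemma psi_deg k x : rd k x -> rdT k (psi x).
Proof.
move=> xk l; rewrite mxE; apply: contraNeq => lk; apply/eqP; rewrite big1 // => i _.
case: (eqVneq ((x : 'rV[K]_m) 0 i) 0) => [->|/xk di]; first by rewrite mul0r.
by case: (eqVneq (P i l) 0) => [->|/Pd E]; [rewrite mulr0|rewrite -E di eqxx in lk].
Qed.

Lemma phi_deg k y : rdT k y -> rd k (phi y).
Proof.
move=> yk i; rewrite mxE; apply: contraNeq => ik; apply/eqP; rewrite big1 // => l _.
case: (eqVneq ((y : 'rV[K]_31) 0 l) 0) => [->|/yk di]; first by rewrite mul0r.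
by case: (eqVneq (Q l i) 0) => [->|/Qd E]; [rewrite mulr0|rewrite E di eqxx in ik].
Qed.

Lemma d_bounds i : exists2 n : nat, (n < 5)%N & d i = n%:Z - 2.
Proof.
have [l Pil] : exists l, P i l != 0.
  case: (boolP [exists l, P i l != 0]) => [/existsP //|]; rewrite negb_exists => /forallP h.
  have := PQ i i; rewrite eqxx big1 // => l _.
  by have := h l; rewrite negbK => /eqP ->; rewrite mul0r.
exists (nth 0%N degn l); last by rewrite (Pd Pil).
have hh : all (fun i => nth 0%N degn i < 5)%N I31 by [].
exact: (I31_all hh).
Qed.

Lemma psi0 : psi 0 = 0.
Proof. by apply/rowP => l; rewrite !mxE big1 // => i _; rewrite mxE mul0r. Qed.

Lemma psi_sum (I : finType) (a : I -> K) (X : I -> MR) : psi (\sum_i a i *: X i) = \sum_i a i *: psi (X i).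
Proof.
apply: (big_ind2 (fun x y => psi x = y)); first exact: psi0.
  by move=> x1 y1 x2 y2 <- <-; rewrite -[x1]scale1r psi_lin !scale1r.
by move=> i _; rewrite -[a i *: X i]addr0 psi_lin psi0 addr0.
Qed.

Definition comp_of (n : nat) (x : MR) : MR :=
  \row_i (if d i == n%:Z - 2 then (x : 'rV[K]_m) 0 i else 0).

Variables (z : MR) (e : 'I_7 -> MR) (B : 'M[K]_7).
Hypothesis hf : is_frame d z e B.

Let z_ind : lin_indep (fun _ : 'I_1 => z) := proj2 (frame_z hf).
Let e_ind : lin_indep e := proj2 (frame_e hf).
Let gz x : rd (-2) x <-> span_of (fun _ : 'I_1 => z) x := proj1 (frame_z hf) x.
Let ge x : rd (-1) x <-> span_of e x := proj1 (frame_e hf) x.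
Let gB := frame_B hf.

Let e_deg a : rd (-1) (e a).
Proof.
apply/ge; exists (fun b => (b == a)%:R); rewrite (bigD1 a) //= eqxx scale1r big1 ?addr0 // => b /negPf->.
by rewrite scale0r.
Qed.

Lemma frame_sym : B^T = B.
Proof.
apply/matrixP => a b; rewrite mxE; apply/eqP; rewrite -subr_eq0; apply/eqP.
have h : (B b a - B a b) *: z = 0.
  rewrite scalerBl -!gB; apply/eqP; rewrite subr_eq0; apply/eqP.
  rewrite (red_skew sl (red_deg_par sl (@e_deg b)) (red_deg_par sl (@e_deg a))).
  by rewrite -[odd _ && _]/true expr1 scaleN1r opprK.
have := z_ind (a := fun=> B b a - B a b); rewrite big_ord1 => /(_ h ord0); exact.
Qed.

Let deg1 (a : 'I_7) : nth 0%N degn a.+1 = 1%N.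
Proof. by case: a => [[|[|[|[|[|[|[|]]]]]]]]. Qed.
Let lt31 (a : 'I_7) : (a.+1 < 31)%N.
Proof. by have := ltn_ord a; lia. Qed.

Let Tb_deg (a : 'I_7) : rdT (-1) (Tb a.+1).
Proof. by have := @rdeg_Tb K _ (lt31 a); rewrite deg1. Qed.

Let Tb0_deg : rdT (-2) (Tb 0).
Proof. exact: (@rdeg_Tb K 0 isT). Qed.

Lemma T1_expand (y : MK) : rdT (-1) y -> y = \sum_(b < 7) crd y b.+1 *: Tb b.+1.
Proof.
move=> yd; apply/rowP => l; rewrite summxE.
have E (b : 'I_7) : (crd y b.+1 *: (Tb b.+1 : 'rV[K]_31)) 0 l = if l == b.+1 :> nat then crd y b.+1 else 0.
  rewrite !mxE eqxx /= -val_eqE /= inordK //.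
  by case: eqP => _; rewrite ?mulr1 ?mulr0.
under eq_bigr => b _ do rewrite E.
case: (boolP (0 < l < 8)%N) => [l8|l8].
  have l7 : (l.-1 < 7)%N by lia.
  have lE : l = (Ordinal l7).+1 :> nat by rewrite /= prednK //; lia.
  rewrite (bigD1 (Ordinal l7)) //= [X in _ + X]big1 ?addr0 => [|b bl].
    by rewrite -lE eqxx /crd inord_val.
  by rewrite ifF //; apply: contraNF bl => /eqP lb; rewrite -val_eqE /= lb.
rewrite big1 => [|b _]; last by rewrite ifF //; apply: contraNF l8 => /eqP->; have := ltn_ord b; lia.
apply/eqP/negPn/negP => /yd; rewrite /dT.
have c1 : all (fun l => (nth 0%N degn l == 1%N) ==> (0 < l < 8)%N) I31 by [].
have /implyP := I31_all c1 l; move: (nth _ _ _) l8 => u /negP l8 h uE; apply: l8; apply: h; lia.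
Qed.

Let Smx : exists S : 'M[K]_7, forall b : 'I_7, phi (Tb b.+1) = \sum_a S b a *: e a.
Proof.
have /choice[S hS] : forall b : 'I_7, exists s : 'I_7 -> K, phi (Tb b.+1) = \sum_a s a *: e a.
  by move=> b; apply/ge; apply: phi_deg; apply: Tb_deg.
by exists (\matrix_(b, a) S b a) => b; rewrite hS; apply: eq_bigr => a _; rewrite mxE.
Qed.

Let lamK : exists2 lam : K, lam != 0 & Tb 0%N = lam *: psi z.
Proof.
have /gz[s E] := phi_deg Tb0_deg; rewrite big_ord1 in E.
have T0E : Tb 0%N = s ord0 *: psi z by rewrite -[LHS]phiK E -[_ *: z]addr0 psi_lin psi0 addr0.
exists (s ord0) => //; apply/eqP => s0; rewrite s0 scale0r in T0E.
have := congr1 (fun x => crd x 0) T0E; rewrite /crd /dl !mxE !eqxx => /eqP; by rewrite oner_eq0.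
Qed.

Definition BTinv : 'M[K]_7 := \matrix_(a, b) (if (a + b == 6)%N then (BT K a b)^-1 else 0).

Lemma BT_anti (a b : 'I_7) : (a + b != 6)%N -> BT K a b = 0.
Proof.
have h : all (fun a => all (fun b => (a + b == 6)%N || Z.eqb (cTz a.+1 b.+1 0) 0) (iota 0 7)) (iota 0 7) by [].
have ai : (a : nat) \in iota 0 7 by rewrite mem_iota ltn_ord.
have bi : (b : nat) \in iota 0 7 by rewrite mem_iota ltn_ord.
move=> /negPf ab; have := allP (allP h _ ai) _ bi; rewrite ab /= => /Z.eqb_spec; by rewrite /BT => ->.
Qed.

Lemma BT_neq0 (a : 'I_7) : BT K a (6 - a) != 0.
Proof.
by case: a => [[|[|[|[|[|[|[|//]]]]]]] a7]; rewrite /BT /zK /= ?oppr_eq0 ?oner_eq0 // oppr_eq0.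
Qed.

Lemma BT_inv (BM : 'M[K]_7) : (forall a b, BM a b = BT K a b) -> BM *m BTinv = 1%:M.
Proof.
move=> BE; apply/matrixP => a b; rewrite !mxE.
rewrite (bigD1 (rev_ord a)) //= big1 ?addr0 => [|j ja]; last first.
  rewrite BE BT_anti ?mul0r //; apply: contraNneq ja => aj; rewrite -val_eqE /=; lia.
rewrite BE mxE /=; case: (eqVneq a b) => [<-|ab].
  have -> : (7 - a.+1 + a == 6)%N by have := ltn_ord a; lia.
  have -> : (7 - a.+1 = 6 - a)%N by lia.
  have sy : BT K (6 - a) a = BT K a (6 - a) by case: a => [[|[|[|[|[|[|[|//]]]]]]] a7].
  by rewrite sy mulfV // BT_neq0.
rewrite ifF ?mulr0 //; apply: contraNF ab => E; rewrite -val_eqE /=.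
by have := ltn_ord a; have := ltn_ord b; lia.
Qed.

Lemma part_one_iso (T : tAlg K) (ok : pred nat) (tau : nat -> T) : tlaws ok tau ->
  isomorphic (cts_prolong (T := T) z e B (rd 0)) (full (V := MR)).
Proof.
move=> tl; have [S hS] := Smx; have [lam l0 T0E] := lamK.
have TS (b : 'I_7) : Tb b.+1 = \sum_a S b a *: psi (e a) by rewrite -[LHS]phiK hS psi_sum.
pose S' : 'M[K]_7 := \matrix_(a, b) crd (psi (e a)) b.+1.
have eS' a : psi (e a) = \sum_b S' a b *: Tb b.+1.
  by rewrite {1}(T1_expand (psi_deg (@e_deg a))); apply: eq_bigr => b _; rewrite mxE.
have S'S : S' *m S = 1%:M.
  apply/matrixP => a b; rewrite !mxE.
  have E : \sum_b0 (\sum_j S' a j * S j b0 - (b0 == a)%:R) *: e b0 = 0.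
    transitivity (phi (psi (\sum_b0 (\sum_j S' a j * S j b0 - (b0 == a)%:R) *: e b0))); first by rewrite psiK.
    have -> : psi (\sum_b0 (\sum_j S' a j * S j b0 - (b0 == a)%:R) *: e b0) = 0; last first.
      by apply/rowP => i; rewrite !mxE big1 // => l _; rewrite mxE mul0r.
    rewrite psi_sum; under eq_bigr => b0 _ do rewrite scalerBl.
    rewrite sumrB; apply/eqP; rewrite subr_eq0; apply/eqP.
    rewrite [RHS](bigD1 a) //= eqxx scale1r [X in _ = _ + X]big1 ?addr0 => [|j /negPf->]; last exact: scale0r.
    rewrite eS'; under [RHS]eq_bigr => j _ do rewrite TS scaler_sumr.
    rewrite exchange_big /=; apply: eq_bigr => b0 _; rewrite scaler_suml.
    by apply: eq_bigr => j _; rewrite scalerA.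
  by have /eqP := e_ind E b; rewrite subr_eq0 => /eqP ->; rewrite eq_sym.
have SS' : S *m S' = 1%:M := mulmx1C S'S.
have brS (X Y : 'I_7 -> MK) (u v : 'I_7 -> K) :
    br (\sum_i u i *: X i) (\sum_j v j *: Y j) = \sum_i \sum_j (u i * v j) *: br (X i) (Y j).
  rewrite (klin_sum _ _ _ _ (klin_brl _)); apply: eq_bigr => i _.
  rewrite (klin_sum _ _ _ _ (klin_brr _)) scaler_sumr.
  by apply: eq_bigr => j _; rewrite scalerA.
have sumD (f g : 'I_7 -> 'I_7 -> MK) :
    \sum_i \sum_j f i j + \sum_i \sum_j g i j = \sum_i \sum_j (f i j + g i j).
  by rewrite -big_split; apply: eq_bigr => i _ /=; rewrite -big_split.
pose BM : 'M[K]_7 := \matrix_(a, b) BT K a b.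
have BME a b : BM a b = BT K a b by rewrite mxE.
have SBE (a b : 'I_7) : lam * BT K a b = \sum_i \sum_j S a i * S b j * B i j.
  have E : (lam * BT K a b - \sum_i \sum_j S a i * S b j * B i j) *: z = 0.
    rewrite -[LHS]psiK -[_ *: z]addr0 psi_lin psi0 addr0 scalerBl.
    have -> : (lam * BT K a b) *: psi z = br (Tb a.+1) (Tb b.+1).
      by rewrite mulrC -scalerA -T0E; exact: esym (brTT two three a b).
    cbv beta; rewrite !TS brS; have -> : \sum_i \sum_j (S a i * S b j) *: br (psi (e i)) (psi (e j)) =
      (\sum_i \sum_j S a i * S b j * B i j) *: psi z.
      rewrite scaler_suml; apply: eq_bigr => i _; rewrite scaler_suml; apply: eq_bigr => j _.
      by rewrite -psi_br gB -[_ *: z]addr0 psi_lin psi0 addr0 scalerA.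
    by rewrite subrr; apply/rowP => i; rewrite !mxE big1 // => l _; rewrite mxE mul0r.
  have := z_ind (a := fun=> lam * BT K a b - \sum_i \sum_j S a i * S b j * B i j); rewrite big_ord1.
  by move=> /(_ E ord0)/eqP; rewrite subr_eq0 => /eqP.
have SBS : S *m B *m S^T = lam *: BM.
  apply/matrixP => a b; rewrite !mxE SBE; under eq_bigr => j _ do rewrite !mxE mulr_suml.
  rewrite exchange_big /=; apply: eq_bigr => i _; apply: eq_bigr => j _; ring.
pose Bi := lam^-1 *: (S^T *m BTinv *m S).
have BBi : B *m Bi = 1%:M.
  have BE : B = S' *m (lam *: BM) *m S'^T.
    by rewrite -SBS !mulmxA S'S mul1mx -mulmxA -trmx_mul S'S trmx1 mulmx1.
  rewrite /Bi {1}BE -!scalemxAr -!scalemxAl scalerA mulVf // scale1r.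
  rewrite !mulmxA -[S' *m BM *m S'^T *m S^T]mulmxA -trmx_mul SS' trmx1 mulmx1.
  by rewrite -[S' *m BM *m BTinv]mulmxA (BT_inv BME) mulmx1.
have psi_inj x : psi x = 0 -> x = 0.
  by move=> E; rewrite -[x]psiK E; apply/rowP => i; rewrite !mxE big1 // => l _; rewrite mxE mul0r.
have dn i n : (n < 5)%N \/ (4 < n)%N -> d i == n%:Z - 2 -> (n < 5)%N.
  by have [n' n5 ->] := d_bounds i; move=> _; lia.
have big_deg k (x : MR) : (k < -2) || (2 < k) -> rd k x -> x = 0.
  move=> hk xk; apply/rowP => i; rewrite mxE; apply/eqP/negPn/negP => /xk.
  by have [n n5 ->] := d_bounds i; lia.
apply: (@cts_isomorphic K T ok tau tl B Bi frame_sym BBi two MR rd z e _ linlR linrR _ _ _ _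
  gz z_ind ge e_ind gB _ _ _ _ comp_of).
- exact: red_deg_sub.
- exact: (red_deg_br sl).
- exact: (red_deg_par sl).
- exact: (red_skew sl).
- exact: (red_jacobi sl).
- by move=> k x k3; apply: big_deg; lia.
- by move=> k x k3; apply: big_deg; lia.
- move=> k x xk xe; apply: psi_inj; apply: (F1_table two three (psi_deg xk)) => b.
  rewrite TS (klin_sum _ _ _ _ (klin_brl _)) big1 // => a _.
  by rewrite -psi_br xe psi0 scaler0.
- move=> k Y w k3 Yd wd YY Yw.
  pose Y' (b : 'I_7) : MK := \sum_a S b a *: psi (Y a).
  have subT l := @red_deg_sub K 31 qT dT cT l.
  have [] := @F2_table K two three k Y' (lam *: psi w) k3.
  + move=> b; apply: (subspace_sum (subT _)) => a _; apply: (subspaceZ (subT _)).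
    exact: psi_deg (Yd a).
  + by apply: (subspaceZ (subT _)); apply: psi_deg.
  + move=> a b; cbv beta; rewrite !TS /Y' !brS.
    rewrite [X in _ + X]exchange_big sumD scalerA [_ * lam]mulrC SBE scaler_suml.
    apply: eq_bigr => i _; rewrite scaler_suml; apply: eq_bigr => j _.
    rewrite [S b j * _]mulrC -scalerDr -!psi_br -scalerA; congr (_ *: _).
    rewrite -[psi (br (e i) (Y j))]scale1r -psi_lin scale1r YY.
    by rewrite -[_ *: w]addr0 psi_lin psi0 addr0.
  + move=> a; rewrite (_ : br (Tb 0%N) (Y' a) = br (lam *: psi z) (Y' a)); last by rewrite -T0E.
    cbv beta; rewrite TS (klin_sum _ _ _ _ (klin_brl _)) (klin_sum _ _ _ _ (klin_brr _)).
    apply: eq_bigr => i _; congr (_ *: _); rewrite brMZl -psi_br -Yw psi_br.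
    by rewrite -[lam *: _]addr0 linrT (klin0 (klin_brr _)) addr0.
  move=> x xk xY; exists (phi x); first exact: phi_deg.
  move=> b; rewrite -[LHS]psiK -[RHS]psiK; congr phi; rewrite psi_br phiK eS'.
  rewrite (klin_sum _ _ _ _ (klin_brl _)); under [RHS]eq_bigr => j _ do rewrite -xY /Y' scaler_sumr.
  rewrite exchange_big /= (bigD1 b) //= [X in _ + X]big1 => [|a ab].
    under eq_bigr => j _ do rewrite scalerA.
    rewrite -scaler_suml addr0; move/matrixP: S'S => /(_ b b); rewrite !mxE eqxx => ->.
    by rewrite scale1r.
  under eq_bigr => j _ do rewrite scalerA.
  by rewrite -scaler_suml; move/matrixP: S'S => /(_ b a); rewrite !mxE eq_sym (negPf ab) => ->; rewrite scale0r.
- move=> n a x y; apply/rowP => i; rewrite !mxE; case: eqP => _ //; by rewrite mulr0 addr0.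
- by move=> n x i; rewrite mxE; case: (d i =P n%:Z - 2) => [//|_]; rewrite eqxx.
- move=> x; apply/rowP => i; rewrite summxE; have [n n5 dE] := d_bounds i.
  rewrite (bigD1 (Ordinal n5)) //= mxE dE eqxx big1 ?addr0 // => j jn.
  rewrite mxE dE ifF //; apply: contraNF jn => /eqP E; rewrite -val_eqE /=; lia.
- move=> n n' x xn; apply/rowP => i; rewrite mxE.
  case: (eqVneq ((x : 'rV[K]_m) 0 i) 0) => [x0|/xn di].
    by rewrite x0; case: eqP => _; case: eqP => _; rewrite ?mxE ?x0.
  rewrite di; case: (eqVneq n' n) => [->|nn]; first by rewrite eqxx.
  by rewrite ifF ?mxE //; apply: contraNF nn => /eqP E; apply/eqP; lia.
- move=> s n x xs i; rewrite mxE; case: (d i =P n%:Z - 2) => _; first exact: xs.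
  by rewrite eqxx.
- move=> x x0 x1; apply/rowP => i; rewrite mxE; apply/eqP/negPn/negP => xi.
  by have := x0 i xi; rewrite (x1 i xi).
move=> x; exists (\row_i (if q i then 0 else (x : 'rV[K]_m) 0 i)), (\row_i (if q i then (x : 'rV[K]_m) 0 i else 0)).
split.
- by move=> i; rewrite mxE; case: (q i); rewrite ?eqxx.
- by move=> i; rewrite mxE; case: (q i); rewrite ?eqxx.
by apply/rowP => i; rewrite !mxE; case: (q i); rewrite ?addr0 ?add0r.
Qed.

End PartOne.

Theorem theorem4p2
  (R : realType) (L : superAlg R[i]) (Ep Em H : 'I_3 -> L)
  (hL : is_gA ag2_cartan ag2_odd Ep Em H)
  (m : nat) (b : 'I_m -> L) (q : 'I_m -> bool) (d : 'I_m -> int)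
  (c : 'I_m -> 'I_m -> 'I_m -> int)
  (hb : is_integral_basis ag2_odd Ep Em H ag2_r b q d c)
  (K : closedFieldType) (hK : 2%N \notin [pchar K]) :
  (forall (z : reduction K q c) (e : 'I_7 -> reduction K q c) (B : 'M[K]_7),
    is_frame d z e B ->
    ([pchar K] =i pred0 ->
      isomorphic (cts_prolong (T := poly_tAlg K) z e B (red_deg d 0))
                 (full (V := reduction K q c))) /\
    (forall p N : nat, p \in [pchar K] -> (3 < p)%N -> (1 <= N)%N ->
      isomorphic (cts_prolong (T := dp_tAlg K (p ^ N)) z e B (red_deg d 0))
                 (full (V := reduction K q c)))) /\
  (3%N \in [pchar K] ->
    forall (z : reduction K q c) (e : 'I_7 -> reduction K q c)
           (X1p X2p X1m X2m Z : reduction K q c),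
    is_frame d z e (gram3 K) ->
    is_g0_tilde z e (red_deg d 0) X1p X2p X1m X2m Z ->
    let s := g0_tilde X1p X2p X1m X2m Z in
    (forall N : nat, (1 <= N)%N ->
      is_simple (cts_prolong (T := dp_tAlg K (3 ^ N)) z e (gram3 K) s)) /\
    (forall N : nat, (1 <= N)%N ->
      (exists m' m'' : vect_alg (dp_tAlg K (3 ^ N)) -> Prop,
        degree1_splits z e (gram3 K) s m' m'') /\
      (forall m' m'' : vect_alg (dp_tAlg K (3 ^ N)) -> Prop,
        degree1_splits z e (gram3 K) s m' m'' ->
        is_simple (partial_prolong z e (gram3 K) s m''))) /\
    (forall N N' : nat, (1 <= N)%N -> (N <= N')%N ->
      forall (m' m'' : vect_alg (dp_tAlg K (3 ^ N)) -> Prop)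
             (n' n'' : vect_alg (dp_tAlg K (3 ^ N')) -> Prop),
      degree1_splits z e (gram3 K) s m' m'' ->
      degree1_splits z e (gram3 K) s n' n'' ->
      is_iso (partial_prolong z e (gram3 K) s m'')
             (partial_prolong z e (gram3 K) s n'')
             (@v_incl K (3 ^ N) (3 ^ N')))).
Proof.
have sl := integral_basis_struct hL hb.
have [P [Q [PQ QP Pc Pd Qd]]] := integral_basis_table hL hb.
have two : (2%:R : K) != 0 by apply: contraNneq hK => E; rewrite inE /= E eqxx.
split=> [z e B hf|K3 z e X1p X2p X1m X2m Z hf hX]; last exact: (part_two sl K3 hf hX).
have iso three := @part_one_iso K m q d c sl two three P Q PQ QP Pc Pd Qd z e B hf.
split=> [K0|p N pK p3 N1].
  have three : (3%:R : K) != 0 by apply: contraFneq (K0 3%N) => E; rewrite inE /= E eqxx.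
  exact: iso three _ _ _ (poly_tlaws K0).
have three : (3%:R : K) != 0.
  by rewrite -(dvdn_pcharf pK); apply/negP => /dvdn_leq -/(_ isT); rewrite leqNgt p3.
by apply: iso three _ _ _ (dp_tlaws_pchar pK _ N1); apply: ltnW.
Qed.
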